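(* Let $\nu>0$, $s>1/2$ and $\Omega\in\mathbb{R}$. Assume that $u\in C([0,\infty);H^s(\mathbb{R}^3))$ is a global solution to the Navier-Stokes equations with the Coriolis force $$\partial_t u-\nu\Delta u+\Omega e_3\times u+(u,\nabla)u+\nabla p=0,\qquad \operatorname{div}u=0\quad\text{in }(0,\infty)\times\mathbb{R}^3,\qquad u|_{t=0}=u_0,$$ satisfying $$u\in AC([0,\infty);H^{s-1}(\mathbb{R}^3))\cap L^1_{\mathrm{loc}}(0,\infty;H^{s+1}(\mathbb{R}^3)).$$ Then $\lim_{t\to\infty}\|u(t)\|_{\chi^{-1}}=0$.
   Context: The Fourier transform is $\widehat f(\xi)=\mathcal F[f](\xi)=\int_{\mathbb{R}^3}e^{-ix\cdot\xi}f(x)\,dx$. For $m\in\mathbb{R}$, $$\chi^m(\mathbb{R}^3)=\Bigl\{f\in\mathcal S'\;\Big|\;\widehat f\in L^1_{\mathrm{loc}},\ \|f\|_{\chi^m}:=\int_{\mathbb{R}^3}|\xi|^m|\widehat f(\xi)|\,d\xi<\infty\Bigr\};$$ for vector fields, $|\widehat f(\xi)|$ is the Euclidean norm in $\mathbb{C}^3$. For $s>1/2$ one has $H^s(\mathbb{R}^3)\hookrightarrow\chi^{-1}(\mathbb{R}^3)$. The unknowns are the velocity field $u=u(t,x)=(u_1,u_2,u_3)$ ($\mathbb{R}^3$-valued) and the scalar pressure $p=p(t,x)$; $u_0=u(0)\in H^s$ is the (divergence-free) initial velocity field, $\nu$ is the viscosity, $e_3=(0,0,1)$, $\Omega$ is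 the Coriolis parameter, and $(u,\nabla)u=\sum_{k=1}^3u_k\partial_k u$. In this class of functions, being a solution means that $\operatorname{div}u=0$, $u(0)=u_0$ and $$\partial_t u=\nu\Delta u-\Omega\,\mathbb{P}(e_3\times u)-\mathbb{P}\bigl[(u,\nabla)u\bigr]\quad\text{in }H^{s-1}\text{ for a.e. }t>0,$$ where $\mathbb{P}=(\delta_{ij}+R_iR_j)_{i,j}$ is the Helmholtz projection onto divergence-free fields ($R_j$ the Riesz transforms; $\mathbb{P}$ has Fourier symbol $\delta_{ij}-\xi_i\xi_j/|\xi|^2$). $AC(I;X)$ denotes the space of absolutely continuous functions on the interval $I$ with values in the Banach space $X$; for $I=[0,\infty)$ this means absolute continuity on each compact interval $[0,T]$. $L^1_{\mathrm{loc}}(0,\infty;X)$ means membership in $L^1(0,T;X)$ for every finite $T>0$. *)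

(* Defs.v *)
(* Built on MathComp and MathComp-Analysis. *)
From HB Require Import structures.
From mathcomp Require Import all_boot all_order all_algebra.
From mathcomp Require Import all_classical all_reals all_analysis.
From mathcomp Require Import complex.

Set Implicit Arguments.
Unset Strict Implicit.
Unset Printing Implicit Defensive.

Import Order.TTheory GRing.Theory Num.Theory.
Import numFieldNormedType.Exports.

Local Open Scope classical_set_scope.
Local Open Scope ring_scope.
Local Open Scope complex_scope.

Notation R3 R := (R * R * R)%type.

Section Euclidean.
Context {R : realType}.

Definition lebesgue3 : {measure set (measurableTypeR R * measurableTypeR R
    * measurableTypeR R) -> \bar R} :=
  ((lebesgue_measure \x lebesgue_measure) \x lebesgue_measure)%E.

Definition coord3 (x : R3 R) (i : 'I_3) : R := [:: x.1.1; x.1.2; x.2]`_i.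

Definition unit_vec (i : 'I_3) : R3 R :=
  ((i == 0)%:R, (i == 1)%:R, (i == 2)%:R).

Definition dot (x y : R3 R) : R := \sum_(i < 3) coord3 x i * coord3 y i.

(* The library norm on a product is the sup norm. *)
Definition enorm (x : R3 R) : R := Num.sqrt (dot x x).

Definition expi (theta : R) : R[i] := cos theta +i* sin theta.

Definition cintegral (f : R3 R -> R[i]) : R[i] :=
  (\int[lebesgue3]_x complex.Re (f x)) +i* (\int[lebesgue3]_x complex.Im (f x)).

Definition L1loc (f : R3 R -> R[i]) : Prop :=
  [/\ measurable_fun [set: R3 R] (fun x => complex.Re (f x)),
      measurable_fun [set: R3 R] (fun x => complex.Im (f x)) &
      forall r : R, lebesgue3.-integrable [set x | enorm x <= r]
        (fun x => (Normc.normc (f x))%:E)].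

End Euclidean.

Section Schwartz.
Context {R : realType}.

(* R[i] carries no normed-module structure over R, hence the componentwise
   derivative. *)
Definition pderiv (j : 'I_3) (f : R3 R -> R[i]) (x : R3 R) : R[i] :=
  ('D_(unit_vec j) (fun y => complex.Re (f y)) x)
  +i* ('D_(unit_vec j) (fun y => complex.Im (f y)) x).

(* The multi-index derivative d^alpha, alpha being listed as a sequence of
   directions, the head of which is differentiated last. *)
Definition pderivs (a : seq 'I_3) (f : R3 R -> R[i]) : R3 R -> R[i] :=
  foldr pderiv f a.

Definition is_schwartz (f : R3 R -> R[i]) : Prop :=
  forall a : seq 'I_3,
    (forall x, differentiable (fun y => complex.Re (pderivs a f y)) x /\
               differentiable (fun y => complex.Im (pderivs a f y)) x) /\
    (forall N : nat, exists C : R, forall x,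
       (1 + enorm x) ^+ N * Normc.normc (pderivs a f x) <= C).

Lemma is_schwartz_pderiv j f : is_schwartz f -> is_schwartz (pderiv j f).
Proof.
move=> hf a.
have -> : pderivs a (pderiv j f) = pderivs (rcons a j) f.
  by rewrite /pderivs foldr_rcons.
exact: hf.
Qed.

End Schwartz.

Record schwartz (R : realType) := Schwartz {
  schwartz_fun :> R3 R -> R[i];
  schwartzP : is_schwartz schwartz_fun }.

Definition schwartz_pderiv {R : realType} (j : 'I_3) (f : schwartz R) :
    schwartz R :=
  Schwartz (is_schwartz_pderiv j (schwartzP f)).

(* Arbitrary functionals on the Schwartz space; those in S' are singled out
   by [tempered]. *)
Definition dist (R : realType) := schwartz R -> R[i].
Definition vdist (R : realType) := 'I_3 -> schwartz R -> R[i].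

Section Distributions.
Context {R : realType}.

Definition seminorm (N : nat) (f : schwartz R) : R :=
  sup [set r | exists (a : seq 'I_3) (x : R3 R), (size a <= N)%N /\
    r = (1 + enorm x) ^+ N * Normc.normc (pderivs a f x)].

Definition tempered (T : dist R) : Prop :=
  (forall (c : R[i]) (f g h : schwartz R),
     (forall x, h x = c * f x + g x) -> T h = c * T f + T g) /\
  (exists (N : nat) (C : R), forall f, Normc.normc (T f) <= C * seminorm N f).

Definition real_valued (T : dist R) : Prop :=
  forall f : schwartz R,
    (forall x, complex.Im (f x) = 0) -> complex.Im (T f) = 0.

Definition dderiv (j : 'I_3) (T : dist R) : dist R :=
  fun f => - T (schwartz_pderiv j f).

Definition laplacian (T : dist R) : dist R :=
  \sum_(j < 3) dderiv j (dderiv j T).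

Definition divergence (U : vdist R) : dist R := \sum_(j < 3) dderiv j (U j).

Definition dist_of (g : R3 R -> R[i]) : dist R :=
  fun f => cintegral (fun x => g x * f x).

Definition compactly_supported (f : R3 R -> R[i]) : Prop :=
  exists r : R, forall x, r < enorm x -> f x = 0.

(* T coincides with the locally integrable function g. Only compactly supported
   test functions are used, as g may grow too fast to be integrated against
   every Schwartz function. *)
Definition represents (T : dist R) (g : R3 R -> R[i]) : Prop :=
  L1loc g /\ forall f : schwartz R, compactly_supported f -> T f = dist_of g f.

(* The function with which T coincides (determined up to a null set), or 0 if
   there is none. *)
Definition fun_of (T : dist R) : R3 R -> R[i] :=
  xget (fun=> 0) [set g | represents T g].

Definition fourier (f : R3 R -> R[i]) (xi : R3 R) : R[i] :=
  cintegral (fun x => expi (- dot x xi) * f x).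

Definition inv_fourier (f : R3 R -> R[i]) (x : R3 R) : R[i] :=
  ((2 * pi) ^- 3)%:C * cintegral (fun xi => expi (dot x xi) * f xi).

(* The Fourier transform of T, defined by <F T, f> = <T, F f>, is the locally
   integrable function g. *)
Definition has_fourier (T : dist R) (g : R3 R -> R[i]) : Prop :=
  L1loc g /\
  forall f h : schwartz R, compactly_supported f ->
    (forall xi, h xi = fourier f xi) -> T h = dist_of g f.

Definition hat (T : dist R) : R3 R -> R[i] :=
  xget (fun=> 0) [set g | has_fourier T g].

(* The inverse Fourier transform of g: <F^-1 g, f> = <g, F^-1 f>. *)
Definition inv_fourier_dist (g : R3 R -> R[i]) : dist R :=
  fun f => cintegral (fun xi => g xi * inv_fourier f xi).

Definition has_L1loc_fourier (U : vdist R) : Prop :=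
  forall j, tempered (U j) /\ exists g, has_fourier (U j) g.

(* Euclidean norm in C^3 of the Fourier transform. *)
Definition hat_norm (U : vdist R) (xi : R3 R) : R :=
  Num.sqrt (\sum_(j < 3) Normc.normc (hat (U j) xi) ^+ 2).

(* Function space norms are +oo outside of the space. *)
Definition chi_norm (m : R) (U : vdist R) : \bar R :=
  if `[< has_L1loc_fourier U >] then
    (\int[lebesgue3]_xi (enorm xi `^ m * hat_norm U xi)%:E)%E
  else +oo%E.

Definition sobolev_norm (sigma : R) (U : vdist R) : \bar R :=
  if `[< has_L1loc_fourier U >] then
    ((\int[lebesgue3]_xi
       ((1 + enorm xi ^+ 2) `^ sigma * hat_norm U xi ^+ 2)%:E) `^ 2^-1)%E
  else +oo%E.

End Distributions.

(* Functions of time with values in X = {v | N v < +oo}, where N is an extended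
   norm on V. *)
Section VectorValued.
Context {R : realType} {V : lmodType R[i]}.
Variable N : V -> \bar R.
Implicit Types u : R -> V.

Definition continuous_into u : Prop :=
  forall t0 : R, 0 <= t0 -> (N (u t0) < +oo)%E /\
    N (u t - u t0) @[t --> within [set t | 0 <= t] (nbhs t0)] --> 0%E.

(* AC([0, oo); X). *)
Definition AC_into u : Prop :=
  (forall t : R, 0 <= t -> (N (u t) < +oo)%E) /\
  forall T : R, 0 < T -> forall e : R, 0 < e -> exists2 d : R, 0 < d &
    forall (n : nat) (a b : 'I_n -> R),
      (forall i, [/\ 0 <= a i, a i <= b i & b i <= T]) ->
      (forall i j, i != j -> b i <= a j \/ b j <= a i) ->
      \sum_(i < n) (b i - a i) < d ->
      (\sum_(i < n) N (u (b i) - u (a i)) < e%:E)%E.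

Definition simple_into (w : R -> V) : Prop :=
  [/\ finite_set (range w),
      forall v, measurable (w @^-1` [set v] : set (measurableTypeR R)) &
      forall t, (N (w t) < +oo)%E].

Definition strongly_measurable (I : set R) u : Prop :=
  exists2 w : nat -> R -> V, (forall n, simple_into (w n)) &
    {ae lebesgue_measure, forall t : R, I t ->
       N (w n t - u t) @[n --> \oo] --> 0%E}.

(* L^1_loc(0, oo; X), Bochner integrability on each ]0, T[. *)
Definition L1loc_into u : Prop :=
  forall T : R, 0 < T -> strongly_measurable `]0, T[ u /\
    lebesgue_measure.-integrable `]0, T[ (fun t : R => N (u t)).

Definition has_time_deriv u (t : R) (v : V) : Prop :=
  (N v < +oo)%E /\
  N ((h^-1)%:C *: (u (t + h) - u t) - v) @[h --> 0^'] --> 0%E.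

End VectorValued.

Section NavierStokesCoriolis.
Context {R : realType}.

(* Index arithmetic is modulo 3. *)
Definition cross (a : 'I_3 -> R) (U : vdist R) : vdist R :=
  fun i => (a (i + 1))%:C *: U (i + 2) - (a (i + 2))%:C *: U (i + 1).

Definition e3 : 'I_3 -> R := fun i => (i == 2)%:R.

(* (u, nabla) u, as a pointwise product of functions. *)
Definition advection (U : vdist R) : vdist R :=
  fun j => dist_of (fun x =>
    \sum_(k < 3) fun_of (U k) x * fun_of (dderiv k (U j)) x).

Definition leray_symbol (xi : R3 R) (i j : 'I_3) : R :=
  (i == j)%:R - coord3 xi i * coord3 xi j / enorm xi ^+ 2.

Definition leray (U : vdist R) : vdist R :=
  fun i => inv_fourier_dist (fun xi =>
    \sum_(j < 3) (leray_symbol xi i j)%:C * hat (U j) xi).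

Definition nsc_rhs (nu Om : R) (U : vdist R) : vdist R :=
  fun i => nu%:C *: laplacian (U i) - Om%:C *: leray (cross e3 U) i
           - leray (advection U) i.

(* The pressure is eliminated by the Helmholtz projection. *)
Record nsc_solution (nu s Om : R) (u0 : vdist R) (u : R -> vdist R) : Prop := {
  nsc_real : forall t : R, 0 <= t -> forall j, real_valued (u t j);
  nsc_init : u 0 = u0;
  nsc_div : forall t : R, 0 < t -> divergence (u t) = 0;
  nsc_eq : {ae lebesgue_measure, forall t : R, 0 < t ->
    has_time_deriv (sobolev_norm (s - 1)) u t (nsc_rhs nu Om (u t))} }.

End NavierStokesCoriolis.

(* Main.v *)
(* For a weight w let E_w(t) be the integral of w |u^(t)|^2 over frequency
   space. As u is continuous into H^s and absolutely continuous into H^(s-1),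
   and 1 - s < s, E_w is absolutely continuous for bounded w, with derivative
   2 Re <u^, (d_t u)^>_w almost everywhere. For w = 1 the Coriolis and the
   nonlinear terms drop out and E_1' = - 2 nu ||grad u||^2, so that
   ||grad u(t0)|| is as small as we wish for some t0.
   Put sigma = min(s, 1), m(xi) = (kappa + |xi|^sigma)^2 and
   K = int |eta|^-2 / m(eta), which is finite because sigma > 1/2; by
   Cauchy-Schwarz ||u||_{chi^-1}^2 <= K E_m. Let w = min(m, rho^2). Moving the
   derivative to the outer frequency xi = eta + zeta, a weighted Young
   inequality and
   |eta|^-2 / m(zeta) <= |eta|^-2 / m(eta) + |zeta|^-2 / m(zeta)
   bound the nonlinear part of E_w' by C (K E_m)^(1/2) int w |xi|^2 |u^|^2.
   Hence K E_m cannot leave a small interval [0, e] once it is there: each E_w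
   decreases, and rho goes to infinity. Finally K E_m is small at t0, because
   kappa^2 K -> 0 as kappa -> 0 and int |xi|^(2 sigma) |u^|^2 is controlled by
   the energy and the gradient. *)
Require Import Defs.
From HB Require Import structures.
From mathcomp Require Import all_boot all_order all_algebra.
From mathcomp Require Import all_classical all_reals all_analysis.
From mathcomp Require Import measurable_realfun complex.
From mathcomp Require Import ring lra.
Import Order.TTheory GRing.Theory Num.Theory.
Import numFieldNormedType.Exports.
Set Implicit Arguments.
Unset Strict Implicit.
Unset Printing Implicit Defensive.
Local Open Scope classical_set_scope.
Local Open Scope ring_scope.
Local Open Scope complex_scope.

(** The estimate is short; the passage from distributions to frequency space shapes the proof.
    [advection] multiplies almost-everywhere representatives, so its Fourier transform has to be
    identified as a convolution. At almost every time u(t) lies in H^(s+1): then u^ is integrable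
    and u is bounded, while the transform of the gradient is only square integrable with the extra
    weight 1 + |xi|. This half derivative makes the dyadic pieces of its inverse transform summable
    almost everywhere, with a locally integrable majorant, and the convolution theorem survives the
    limit. The weight m is cut off because the pairing of H^s with H^(s-1) does not tolerate m in
    general. The cut-off is a minimum, which keeps the subadditivity of the symbol up to a factor 2.
    The choice sigma <= s makes E_m finite, and sigma <= 1 places |xi|^(2 sigma) between the energy
    and the gradient. The transforms are replaced by representatives with everywhere valid
    symmetries, on which the cancellation of the nonlinear term is a pointwise identity. *)

Notation Re := complex.Re.
Notation Im := complex.Im.
Notation normc := Normc.normc.

(** * Complex-valued integrals *)

Section NormC.
Context {R : realType}.
Implicit Types z w : R[i].

Lemma normcE' z : normc z = Num.sqrt (Re z ^+ 2 + Im z ^+ 2).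
Proof. by case: z. Qed.

Lemma normc_ge0 z : 0 <= normc z :> R.
Proof. by rewrite normcE' sqrtr_ge0. Qed.

Lemma sqr_normc' z : normc z ^+ 2 = Re z ^+ 2 + Im z ^+ 2.
Proof. by rewrite normcE' sqr_sqrtr// addr_ge0// sqr_ge0. Qed.

Lemma Re_le_normc z : `|Re z| <= normc z.
Proof.
by rewrite -(@ler_pXn2r _ 2) ?nnegrE ?normc_ge0// sqr_normc' real_normK ?num_real// lerDl sqr_ge0.
Qed.

Lemma Im_le_normc z : `|Im z| <= normc z.
Proof.
by rewrite -(@ler_pXn2r _ 2) ?nnegrE ?normc_ge0// sqr_normc' real_normK ?num_real// lerDr sqr_ge0.
Qed.

Lemma normc_le z : normc z <= `|Re z| + `|Im z|.
Proof.
rewrite -(@ler_pXn2r _ 2) ?nnegrE ?normc_ge0 ?addr_ge0// sqr_normc' sqrrD.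
rewrite !real_normK ?num_real// lerD2r lerDl.
by rewrite mulrn_wge0// mulr_ge0.
Qed.

Lemma normc_conj z : normc (conjc z) = normc z.
Proof. by case: z => a b; rewrite /= sqrrN. Qed.

Lemma normcR (x : R) : normc x%:C = `|x|.
Proof. by rewrite /= expr0n addr0 sqrtr_sqr. Qed.

Lemma normc_i : normc ('i : R[i]) = 1.
Proof. by rewrite /= expr0n add0r expr1n sqrtr1. Qed.

Lemma ReD z w : Re (z + w) = Re z + Re w. Proof. by case: z; case: w. Qed.
Lemma ImD z w : Im (z + w) = Im z + Im w. Proof. by case: z; case: w. Qed.
Lemma ReN z : Re (- z) = - Re z. Proof. by case: z. Qed.
Lemma ImN z : Im (- z) = - Im z. Proof. by case: z. Qed.
Lemma ReM z w : Re (z * w) = Re z * Re w - Im z * Im w.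
Proof. by case: z; case: w. Qed.
Lemma ImM z w : Im (z * w) = Re z * Im w + Im z * Re w.
Proof. by case: z; case: w. Qed.
Lemma Re_conj z : Re (conjc z) = Re z. Proof. by case: z. Qed.
Lemma Im_conj z : Im (conjc z) = - Im z. Proof. by case: z. Qed.
Lemma ReMr (c : R) w : Re (c%:C * w) = c * Re w.
Proof. by case: w => a b /=; rewrite mul0r subr0. Qed.
Lemma ImMr (c : R) w : Im (c%:C * w) = c * Im w.
Proof. by case: w => a b /=; rewrite mul0r addr0. Qed.
Lemma complex_eq z w : Re z = Re w -> Im z = Im w -> z = w.
Proof. by case: z => a b; case: w => c e /= -> ->. Qed.

Lemma conjcM z w : conjc (z * w) = conjc z * conjc w.
Proof. by apply: complex_eq; rewrite ?Re_conj ?Im_conj ?ReM ?ImM ?Re_conj ?Im_conj; ring. Qed.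

Lemma normc_sum (I : Type) (r : seq I) (P : pred I) (F : I -> R[i]) :
  normc (\sum_(i <- r | P i) F i) <= \sum_(i <- r | P i) normc (F i).
Proof.
elim/big_ind2 : _ => //; first by rewrite Normc.normc0.
by move=> x1 x2 y1 y2 h1 h2; apply: le_trans (le_normcD _ _) (lerD h1 h2).
Qed.

Lemma le_normcB z w : normc (z - w) <= normc z + normc w.
Proof. by apply: le_trans (le_normcD _ _) _; rewrite normcN. Qed.

Lemma Re_sum (I : Type) (r : seq I) (P : pred I) (F : I -> R[i]) :
  Re (\sum_(i <- r | P i) F i) = \sum_(i <- r | P i) Re (F i).
Proof. by elim/big_rec2 : _ => // i x y _ <-; rewrite ReD. Qed.

End NormC.

Section ComplexIntegral.
Context {d} {T : measurableType d} {R : realType} (mu : {measure set T -> \bar R}).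
Implicit Types f g : T -> R[i].

Definition cmeas f := measurable_fun [set: T] (fun x => Re (f x)) /\
  measurable_fun [set: T] (fun x => Im (f x)).

Definition cintegrable f := mu.-integrable [set: T] (fun x => (Re (f x))%:E) /\
  mu.-integrable [set: T] (fun x => (Im (f x))%:E).

(** Generalises [cintegral] to any measure, so that it also applies to products of spaces; for [mu3]
    the two are convertible. *)
Definition cint f : R[i] := (\int[mu]_x Re (f x)) +i* (\int[mu]_x Im (f x)).

Lemma cmeas_cst z : cmeas (fun=> z).
Proof. by split; exact: measurable_cst. Qed.

Lemma cmeasD f g : cmeas f -> cmeas g -> cmeas (fun x => f x + g x).
Proof.
move=> [f1 f2] [g1 g2]; split.
  by under eq_fun do rewrite ReD; exact: measurable_funD.
by under eq_fun do rewrite ImD; exact: measurable_funD.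
Qed.

Lemma cmeasN f : cmeas f -> cmeas (fun x => - f x).
Proof.
move=> [f1 f2]; split.
  by under eq_fun do rewrite ReN; exact: measurableT_comp.
by under eq_fun do rewrite ImN; exact: measurableT_comp.
Qed.

Lemma cmeasB f g : cmeas f -> cmeas g -> cmeas (fun x => f x - g x).
Proof. by move=> hf hg; apply: cmeasD => //; exact: cmeasN. Qed.

Lemma cmeasM f g : cmeas f -> cmeas g -> cmeas (fun x => f x * g x).
Proof.
move=> [f1 f2] [g1 g2]; split.
  by under eq_fun do rewrite ReM; apply: measurable_funB; exact: measurable_funM.
by under eq_fun do rewrite ImM; apply: measurable_funD; exact: measurable_funM.
Qed.

Lemma cmeas_conj f : cmeas f -> cmeas (fun x => conjc (f x)).
Proof.
move=> [f1 f2]; split.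
  by under eq_fun do rewrite Re_conj.
by under eq_fun do rewrite Im_conj; exact: measurableT_comp.
Qed.

Lemma cmeasR (h : T -> R) : measurable_fun [set: T] h -> cmeas (fun x => (h x)%:C).
Proof. by move=> mh; split => //=; exact: measurable_cst. Qed.

Lemma cmeas_sum (I : Type) (r : seq I) (P : pred I) (F : I -> T -> R[i]) :
  (forall i, cmeas (F i)) -> cmeas (fun x => \sum_(i <- r | P i) F i x).
Proof.
move=> mF; elim: r => [|i r ih].
  by under eq_fun do rewrite big_nil; exact: cmeas_cst.
under eq_fun do rewrite big_cons; case: (P i) => //.
exact: cmeasD.
Qed.

Lemma measurable_normc f : cmeas f -> measurable_fun [set: T] (fun x => normc (f x)).
Proof.
move=> [f1 f2]; under eq_fun do rewrite normcE'.
apply: (measurableT_comp (continuous_measurable_fun (@sqrt_continuous R))).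
by apply: measurable_funD; exact: measurable_funX.
Qed.

Lemma cintegrable_cmeas f : cintegrable f -> cmeas f.
Proof.
by move=> [/measurable_int f1 /measurable_int f2]; split; apply/measurable_EFinP.
Qed.

Lemma le_cintegrable f (h : T -> R) : cmeas f -> (forall x, normc (f x) <= h x) ->
  mu.-integrable [set: T] (EFin \o h) -> cintegrable f.
Proof.
move=> [f1 f2] fh ih; split; apply: (le_integrable _ _ _ ih) => //.
- exact/measurable_EFinP.
- move=> x _ /=; rewrite lee_fin.
  by apply: le_trans (Re_le_normc _) _; apply: le_trans (fh x) (ler_norm _).
- exact/measurable_EFinP.
- move=> x _ /=; rewrite lee_fin.
  by apply: le_trans (Im_le_normc _) _; apply: le_trans (fh x) (ler_norm _).
Qed.

Lemma cintegrable_normc f : cintegrable f ->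
  mu.-integrable [set: T] (EFin \o (fun x => normc (f x))).
Proof.
move=> if_; have mf := cintegrable_cmeas if_; case: if_ => /integrable_norm i1 /integrable_norm i2.
have := integrableD measurableT i1 i2.
apply: le_integrable => //; first exact/measurable_EFinP/measurable_normc.
move=> x _ /=; rewrite lee_fin ger0_norm ?normc_ge0//.
by apply: le_trans (normc_le _) _; rewrite ler_norm.
Qed.

Lemma cintegrableP f : cintegrable f <->
  cmeas f /\ (\int[mu]_x (normc (f x))%:E < +oo)%E.
Proof.
split=> [h|[mf fi]].
  split; first exact: cintegrable_cmeas.
  have /integrableP[_] := cintegrable_normc h.
  by under eq_integral do rewrite /= ger0_norm ?normc_ge0//.
apply: (@le_cintegrable _ (fun x => normc (f x))) => //.
apply/integrableP; split; first exact/measurable_EFinP/measurable_normc.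
by under eq_integral do rewrite /= ger0_norm ?normc_ge0//.
Qed.

Lemma cintegrableD f g : cintegrable f -> cintegrable g -> cintegrable (fun x => f x + g x).
Proof.
move=> [f1 f2] [g1 g2]; split.
  by under eq_fun do rewrite ReD EFinD; exact: integrableD.
by under eq_fun do rewrite ImD EFinD; exact: integrableD.
Qed.

Lemma cintegrableN f : cintegrable f -> cintegrable (fun x => - f x).
Proof.
move=> [f1 f2]; split.
  by under eq_fun do rewrite ReN EFinN; exact: integrableN.
by under eq_fun do rewrite ImN EFinN; exact: integrableN.
Qed.

Lemma cintegrableZl z f : cintegrable f -> cintegrable (fun x => z * f x).
Proof.
move=> if_; apply: (@le_cintegrable _ (fun x => normc z * normc (f x))).
- by apply: cmeasM; [exact: cmeas_cst|exact: cintegrable_cmeas].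
- by move=> x; rewrite Normc.normcM.
- have := integrableZl measurableT (normc z) (cintegrable_normc if_).
  by apply: eq_integrable => // x _ /=; rewrite EFinM.
Qed.

Lemma cintegrable_conj f : cintegrable f -> cintegrable (fun x => conjc (f x)).
Proof.
move=> [f1 f2]; split.
  by under eq_fun do rewrite Re_conj.
by under eq_fun do rewrite Im_conj EFinN; exact: integrableN.
Qed.

Lemma cintegrable0 : cintegrable (fun=> 0).
Proof. by split; exact: integrable0. Qed.

Lemma cintegrable_sum (I : Type) (r : seq I) (P : pred I) (F : I -> T -> R[i]) :
  (forall i, cintegrable (F i)) -> cintegrable (fun x => \sum_(i <- r | P i) F i x).
Proof.
move=> mF; elim: r => [|i r ih].
  by under eq_fun do rewrite big_nil; exact: cintegrable0.
under eq_fun do rewrite big_cons; case: (P i) => //.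
exact: cintegrableD.
Qed.

Lemma eq_cint f g : f =1 g -> cint f = cint g.
Proof. by move=> fg; congr (cint _); apply/funext. Qed.

Lemma cint0 : cint (fun=> 0) = 0.
Proof. by rewrite /cint /Rintegral /= integral0. Qed.

Lemma cintD f g : cintegrable f -> cintegrable g ->
  cint (fun x => f x + g x) = cint f + cint g.
Proof.
move=> [f1 f2] [g1 g2]; rewrite /cint.
under eq_Rintegral do rewrite ReD; rewrite RintegralD//.
by under [X in _ +i* X]eq_Rintegral do rewrite ImD; rewrite RintegralD.
Qed.

Lemma cintZl z f : cintegrable f -> cint (fun x => z * f x) = z * cint f.
Proof.
move=> [f1 f2]; rewrite /cint.
under eq_Rintegral do rewrite ReM.
under [X in _ +i* X]eq_Rintegral do rewrite ImM.
have h r (h : T -> R) : mu.-integrable [set: T] (EFin \o h) ->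
    mu.-integrable [set: T] (EFin \o (fun x => r * h x)).
  move=> ih; have := integrableZl measurableT r ih.
  by apply: eq_integrable => // x _ /=.
rewrite RintegralB ?RintegralD ?RintegralZl//; try exact: h.
by case: z.
Qed.

Lemma cintN f : cintegrable f -> cint (fun x => - f x) = - cint f.
Proof.
move=> hf; rewrite -mulN1r -cintZl//; apply: eq_cint => x; by rewrite mulN1r.
Qed.

Lemma cintB f g : cintegrable f -> cintegrable g ->
  cint (fun x => f x - g x) = cint f - cint g.
Proof. by move=> hf hg; rewrite cintD ?cintN//; exact: cintegrableN. Qed.

Lemma cint_sum (I : Type) (r : seq I) (P : pred I) (F : I -> T -> R[i]) :
  (forall i, cintegrable (F i)) ->
  cint (fun x => \sum_(i <- r | P i) F i x) = \sum_(i <- r | P i) cint (F i).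
Proof.
move=> mF; elim: r => [|i r ih].
  by rewrite big_nil; under eq_cint do rewrite big_nil; rewrite cint0.
rewrite big_cons -ih; under eq_cint do rewrite big_cons.
by case: (P i) => //; rewrite cintD//; exact: cintegrable_sum.
Qed.

Lemma cint_conj f : cintegrable f -> cint (fun x => conjc (f x)) = conjc (cint f).
Proof.
move=> [f1 f2]; rewrite /cint /=.
under eq_Rintegral do rewrite Re_conj.
under [X in _ +i* X]eq_Rintegral do rewrite Im_conj -mulN1r.
by rewrite RintegralZl// mulN1r.
Qed.

Lemma ae_eq_cint f g : cmeas f -> cmeas g -> {ae mu, forall x, f x = g x} ->
  cint f = cint g.
Proof.
move=> [f1 f2] [g1 g2] fg; rewrite /cint /Rintegral; congr (fine _ +i* fine _).
  apply: ae_eq_integral => //; try exact/measurable_EFinP.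
  by apply: filterS fg => x /= -> _.
apply: ae_eq_integral => //; try exact/measurable_EFinP.
by apply: filterS fg => x /= -> _.
Qed.

Lemma ae_cintegrable f g : cmeas g -> {ae mu, forall x, f x = g x} ->
  cintegrable f -> cintegrable g.
Proof.
move=> mg fg if_; have mf := cintegrable_cmeas if_.
move/cintegrableP : if_ => [_ fi]; apply/cintegrableP; split => //.
rewrite -(@ae_eq_integral _ _ _ mu setT _ (fun x => (normc (f x))%:E))//.
- exact/measurable_EFinP/measurable_normc.
- exact/measurable_EFinP/measurable_normc.
- by apply: filterS fg => x /= -> _.
Qed.

(** Rotation: if z is the integral, |z|^2 is the integral of Re (conj z f), hence at most |z| times
    the integral of |f|. *)
Lemma le_normc_cint f : cintegrable f ->
  normc (cint f) <= \int[mu]_x normc (f x).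
Proof.
move=> if_; set z := cint f.
have [z0|z0] := eqVneq (normc z) 0.
  by rewrite z0; apply: Rintegral_ge0 => x _; exact: normc_ge0.
have zp : 0 < normc z by rewrite lt_neqAle eq_sym z0 normc_ge0.
rewrite -(ler_pM2l zp).
have -> : normc z * normc z = Re (conjc z * z).
  by rewrite -expr2 sqr_normc' ReM Re_conj Im_conj !expr2; ring.
rewrite -RintegralZl//; last exact: cintegrable_normc.
rewrite -cintZl//= /cint /=; apply: le_Rintegral => //.
- by case: (cintegrableZl (conjc z) if_).
- have := integrableZl measurableT (normc z) (cintegrable_normc if_).
  by apply: eq_integrable => // x _ /=.
- move=> x _; apply: le_trans (ler_norm _) _; apply: le_trans (Re_le_normc _) _.
  by rewrite Normc.normcM [X in X * _ <= _](normc_conj z).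
Qed.

Lemma Rintegral_le (h k : T -> R) : mu.-integrable [set: T] (EFin \o h) ->
  mu.-integrable [set: T] (EFin \o k) -> (forall x, h x <= k x) ->
  \int[mu]_x h x <= \int[mu]_x k x.
Proof. by move=> ih ik hk; apply: le_Rintegral. Qed.

Lemma EFin_Rintegral (h : T -> R) : mu.-integrable [set: T] (EFin \o h) ->
  (\int[mu]_x h x)%:E = (\int[mu]_x (h x)%:E)%E.
Proof. by move=> ih; rewrite /Rintegral fineK//; exact: integrable_fin_num. Qed.

Lemma le_normc_cintE f : cintegrable f ->
  ((normc (cint f))%:E <= \int[mu]_x (normc (f x))%:E)%E.
Proof.
move=> if_; rewrite -EFin_Rintegral ?lee_fin ?le_normc_cint//.
exact: cintegrable_normc.
Qed.

Lemma cint_le f (h : T -> R) : cintegrable f -> mu.-integrable [set: T] (EFin \o h) ->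
  (forall x, normc (f x) <= h x) -> normc (cint f) <= \int[mu]_x h x.
Proof.
move=> if_ ih fh; apply: le_trans (le_normc_cint if_) _.
by apply: Rintegral_le => //; exact: cintegrable_normc.
Qed.

Lemma ae_le_cintegrable f (h : T -> R) : cmeas f ->
  {ae mu, forall x, normc (f x) <= h x} ->
  mu.-integrable [set: T] (EFin \o h) -> cintegrable f.
Proof.
move=> mf fh ih; apply/cintegrableP; split => //.
have /integrableP[mh] := ih; apply: le_lt_trans; apply: ae_ge0_le_integral => //.
- by move=> x _; rewrite lee_fin normc_ge0.
- exact/measurable_EFinP/measurable_normc.
- exact: measurableT_comp.
- by apply: filterS fh => x hx _; rewrite lee_fin; apply: le_trans hx (ler_norm _).
Qed.

Lemma Rintegral_dct_ae (f_ : nat -> T -> R) (f h : T -> R) :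
  (forall n, measurable_fun [set: T] (f_ n)) -> measurable_fun [set: T] f ->
  {ae mu, forall x, f_ n x @[n --> \oo] --> f x} ->
  mu.-integrable [set: T] (EFin \o h) ->
  {ae mu, forall x, forall n, `|f_ n x| <= h x} ->
  \int[mu]_x f_ n x @[n --> \oo] --> \int[mu]_x f x.
Proof.
move=> mf_ mf cf ih fh.
have [] := @dominated_convergence _ _ _ mu setT measurableT
  (fun n => EFin \o f_ n) (EFin \o f) (EFin \o h).
- by move=> n; exact/measurable_EFinP.
- exact/measurable_EFinP.
- by apply: filterS cf => x cx _; apply: cvg_EFin => //; exact: nearW.
- exact: ih.
- by apply: filterS fh => x hx n _ /=; rewrite lee_fin.
move=> if_ _; rewrite /Rintegral => cv.
apply: fine_cvg; rewrite fineK; last exact: integrable_fin_num.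
exact: cv.
Qed.

Lemma Rintegral_dct (f_ : nat -> T -> R) (f h : T -> R) :
  (forall n, measurable_fun [set: T] (f_ n)) -> measurable_fun [set: T] f ->
  {ae mu, forall x, f_ n x @[n --> \oo] --> f x} ->
  mu.-integrable [set: T] (EFin \o h) ->
  (forall n x, `|f_ n x| <= h x) ->
  \int[mu]_x f_ n x @[n --> \oo] --> \int[mu]_x f x.
Proof. by move=> mf_ mf cf ih fh; apply: (Rintegral_dct_ae mf_ mf cf ih); exact: nearW. Qed.

Lemma cint_dct (f_ : nat -> T -> R[i]) f (h : T -> R) :
  (forall n, cmeas (f_ n)) -> cmeas f ->
  {ae mu, forall x, Re (f_ n x) @[n --> \oo] --> Re (f x) /\
    Im (f_ n x) @[n --> \oo] --> Im (f x)} ->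
  mu.-integrable [set: T] (EFin \o h) ->
  {ae mu, forall x, forall n, normc (f_ n x) <= h x} ->
  Re (cint (f_ n)) @[n --> \oo] --> Re (cint f) /\
  Im (cint (f_ n)) @[n --> \oo] --> Im (cint f).
Proof.
move=> mf_ [mf1 mf2] cf ih fh; split; rewrite /cint /=.
  apply: (@Rintegral_dct_ae _ _ h) => //; first by move=> n; case: (mf_ n).
    by apply: filterS cf => x [].
  by apply: filterS fh => x hx n; apply: le_trans (Re_le_normc _) (hx n).
apply: (@Rintegral_dct_ae _ _ h) => //; first by move=> n; case: (mf_ n).
  by apply: filterS cf => x [].
by apply: filterS fh => x hx n; apply: le_trans (Im_le_normc _) (hx n).
Qed.

End ComplexIntegral.

Lemma cmeas_comp {d d'} {T : measurableType d} {T' : measurableType d'}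
    {R : realType} (f : T' -> R[i]) (h : T -> T') :
  cmeas f -> measurable_fun [set: T] h -> cmeas (fun x => f (h x)).
Proof. by move=> [f1 f2] mh; split; [exact: (measurableT_comp f1 mh)|exact: (measurableT_comp f2 mh)]. Qed.

Section ComplexFubini.
Context {d1 d2} {T1 : measurableType d1} {T2 : measurableType d2} {R : realType}.
Variables (m1 : {sigma_finite_measure set T1 -> \bar R})
          (m2 : {sigma_finite_measure set T2 -> \bar R}).
Variable f : T1 * T2 -> R[i].

Lemma measurable_pair1' (x : T1) : measurable_fun [set: T2] (fun y : T2 => (x, y)).
Proof. exact: measurable_pair1. Qed.

(** No integrability is assumed: Tonelli gives the measurability of the integrals of the positive
    and negative parts, and their difference in the extended reals is measurable. *)
Lemma measurable_integral2 (g : T1 * T2 -> \bar R) : measurable_fun [set: T1 * T2] g ->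
  measurable_fun [set: T1] (fun x => \int[m2]_y g (x, y))%E.
Proof.
move=> mg; under eq_fun do rewrite integralE.
have hp := @measurable_fun_fubini_tonelli_F _ _ _ _ _ m2 (g^\+)%E (measurable_funepos mg)
  (fun x => funepos_ge0 _ x).
have hn := @measurable_fun_fubini_tonelli_F _ _ _ _ _ m2 (g^\-)%E (measurable_funeneg mg)
  (fun x => funeneg_ge0 _ x).
rewrite (_ : (fun x => _) = (fubini_F m2 g^\+ \- fubini_F m2 g^\-)%E); first exact: emeasurable_funB.
by rewrite funeqE => x /=; congr (_ - _)%E; apply: eq_integral => y _; rewrite unlock.
Qed.

Lemma measurable_integral1 (g : T1 * T2 -> \bar R) : measurable_fun [set: T1 * T2] g ->
  measurable_fun [set: T2] (fun y => \int[m1]_x g (x, y))%E.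
Proof.
move=> mg; under eq_fun do rewrite integralE.
have hp := @measurable_fun_fubini_tonelli_G _ _ _ _ _ m1 (g^\+)%E (measurable_funepos mg)
  (fun x => funepos_ge0 _ x).
have hn := @measurable_fun_fubini_tonelli_G _ _ _ _ _ m1 (g^\-)%E (measurable_funeneg mg)
  (fun x => funeneg_ge0 _ x).
rewrite (_ : (fun x => _) = (fubini_G m1 g^\+ \- fubini_G m1 g^\-)%E); first exact: emeasurable_funB.
by rewrite funeqE => x /=; congr (_ - _)%E; apply: eq_integral => y _; rewrite unlock.
Qed.

Lemma cmeas_cint2 : cmeas f -> cmeas (fun x => cint m2 (fun y => f (x, y))).
Proof.
have key (g : T1 * T2 -> R) : measurable_fun setT g ->
    measurable_fun setT (fun x => \int[m2]_y g (x, y)).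
  move=> mg; rewrite /Rintegral.
  apply: (measurableT_comp (fine_measurable measurableT)).
  by apply: (measurable_integral2 (g := EFin \o g)); exact/measurable_EFinP.
by move=> [f1 f2]; split; rewrite /cint /=; exact: (key (fun z => _ (f z))).
Qed.

Hypothesis if_ : cintegrable (m1 \x m2)%E f.

Lemma ae_cintegrable1 : {ae m1, forall x, cintegrable m2 (fun y => f (x, y))}.
Proof.
case: if_ => i1 i2; have := ae_integrable1 i1; have := ae_integrable1 i2.
by apply: filterS2 => x /= h2 h1; split.
Qed.

Lemma cint_fubini1 : cint (m1 \x m2)%E f = cint m1 (fun x => cint m2 (fun y => f (x, y))).
Proof.
have key (g : T1 * T2 -> R) : (m1 \x m2)%E.-integrable setT (EFin \o g) ->
    \int[(m1 \x m2)%E]_z g z = \int[m1]_x (\int[m2]_y g (x, y)).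
  move=> ig; rewrite /Rintegral.
  rewrite -[X in fine X = _]integral12_prod_meas1//; congr fine.
  (* Almost every section has a finite integral, so that passing through [fine] changes the inner
     integral on a null set only. *)
  apply: ae_eq_integral => //.
  - exact: (measurable_int _ (integrable_fubini_F ig)).
  - apply/measurable_EFinP.
    apply: (measurableT_comp (fine_measurable measurableT)).
    exact: (measurable_int _ (integrable_fubini_F ig)).
  - have := integrable_ae measurableT (integrable_fubini_F ig).
    by apply: filterS => x /= h _; rewrite fineK//; exact: h.
by case: if_ => i1 i2; rewrite /cint /=; congr (_ +i* _); exact: key.
Qed.

Lemma cint_fubini2 : cint (m1 \x m2)%E f = cint m2 (fun y => cint m1 (fun x => f (x, y))).
Proof.
have key (g : T1 * T2 -> R) : (m1 \x m2)%E.-integrable setT (EFin \o g) ->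
    \int[(m1 \x m2)%E]_z g z = \int[m2]_y (\int[m1]_x g (x, y)).
  move=> ig; rewrite /Rintegral.
  rewrite -[X in fine X = _]integral21_prod_meas1//; congr fine.
  apply: ae_eq_integral => //.
  - by apply: (measurable_integral1 (g := EFin \o g)); exact: (measurable_int _ ig).
  - apply/measurable_EFinP.
    apply: (measurableT_comp (fine_measurable measurableT)).
    by apply: (measurable_integral1 (g := EFin \o g)); exact: (measurable_int _ ig).
  - have := ae_integrable2 ig.
    by apply: filterS => x /= h _; rewrite fineK//; exact: integrable_fin_num.
by case: if_ => i1 i2; rewrite /cint /=; congr (_ +i* _); exact: key.
Qed.

(** The modulus of the inner integral is at most the inner integral of the modulus, whose total
    Tonelli identifies with the integral over the product. *)
Lemma cintegrable_fubini1 : cintegrable m1 (fun x => cint m2 (fun y => f (x, y))).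
Proof.
have mf := cintegrable_cmeas if_.
move/cintegrableP : (if_) => [_ fi]; apply/cintegrableP; split; first exact: cmeas_cint2.
apply: le_lt_trans fi; rewrite fubini_tonelli1//; last 2 first.
- exact/measurable_EFinP/measurable_normc.
- by move=> x; rewrite lee_fin normc_ge0.
apply: ae_ge0_le_integral => //.
- by move=> x _; rewrite lee_fin normc_ge0.
- exact/measurable_EFinP/measurable_normc/cmeas_cint2.
- by move=> x _; apply: integral_ge0 => y _; rewrite lee_fin normc_ge0.
- apply: measurable_fun_fubini_tonelli_F.
    exact/measurable_EFinP/measurable_normc.
  by move=> z; rewrite lee_fin normc_ge0.
- have := ae_cintegrable1; apply: filterS => x ix _.
  exact: le_normc_cintE.
Qed.

Lemma cint_fubini : cint m1 (fun x => cint m2 (fun y => f (x, y))) =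
  cint m2 (fun y => cint m1 (fun x => f (x, y))).
Proof. by rewrite -cint_fubini1 cint_fubini2. Qed.

End ComplexFubini.

(** * Lebesgue measure on the space *)

Section SigmaFiniteProduct.
Context {d1 d2} {T1 : measurableType d1} {T2 : measurableType d2} {R : realType}.
Variables (m1 : {sigma_finite_measure set T1 -> \bar R})
          (m2 : {sigma_finite_measure set T2 -> \bar R}).

(* The canonical sigma-finite structure of the library on [m1 \x m2] is only
   found for finite measures. *)
Definition sfprod : set (T1 * T2) -> \bar R := (m1 \x m2)%E.

HB.instance Definition _ := Measure.on sfprod.

Lemma sfprod_sigma_finite : sigma_finite setT sfprod.
Proof.
have /sigma_finiteP[F [TF ndF Foo]] := sigma_finiteT m1.
have /sigma_finiteP[G [TG ndG Goo]] := sigma_finiteT m2.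
exists (fun n => F n `*` G n).
  apply/seteqP; split => -[x y] //= _.
  have [n _ Fn] : (\bigcup_n F n) x by rewrite -TF.
  have [k _ Gk] : (\bigcup_n G n) y by rewrite -TG.
  (* Both exhausting families increase, so a common index is available. *)
  exists (maxn n k) => //; split => /=.
    by move: x Fn; exact/subsetPset/ndF/leq_maxl.
  by move: y Gk; exact/subsetPset/ndG/leq_maxr.
move=> k; have [mF Fk] := Foo k; have [mG Gk] := Goo k.
split; first exact: measurableX.
by rewrite /sfprod product_measure1E// lte_mul_pinfty// ge0_fin_numE.
Qed.

HB.instance Definition _ := Measure_isSigmaFinite.Build _ _ _ sfprod
  sfprod_sigma_finite.

Definition sfproduct : {sigma_finite_measure set (T1 * T2)%type -> \bar R} :=
  [the {sigma_finite_measure set _ -> \bar R} of sfprod].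

End SigmaFiniteProduct.

Section R3measure.
Context {R : realType}.
Notation T1 := (measurableTypeR R).

Definition mu1 : {sigma_finite_measure set T1 -> \bar R} :=
  [the {sigma_finite_measure set _ -> \bar R} of @lebesgue_measure R].

Notation mu := mu1.

Definition mu2 : {sigma_finite_measure set (T1 * T1)%type -> \bar R} := sfproduct mu1 mu1.
Definition mu3 : {sigma_finite_measure set (T1 * T1 * T1)%type -> \bar R} := sfproduct mu2 mu1.

Lemma cintegralE (f : R3 R -> R[i]) : cintegral f = cint mu3 f.
Proof. by []. Qed.

(** The change of variables formula; [c] is the inverse Jacobian of [phi]. Requiring it for
    nonnegative functions suffices: the integrable case follows by positive and negative parts. *)
Definition rescales {d} {T : measurableType d} (m : {measure set T -> \bar R})
    (c : R) (phi : T -> T) : Prop :=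
  [/\ 0 <= c, measurable_fun [set: T] phi & forall f : T -> \bar R,
    measurable_fun [set: T] f -> (forall x, 0 <= f x)%E ->
    (\int[m]_x f (phi x) = c%:E * \int[m]_x f x)%E].

Lemma rescales_opp : rescales mu 1 (-%R : T1 -> T1).
Proof.
have mo : measurable_fun setT (-%R : T1 -> T1) by exact: oppr_measurable.
split => // f mf f0; rewrite mul1e.
rewrite -(setTI setT) -(preimage_setT (-%R : T1 -> T1)) setIT.
rewrite -ge0_integral_pushforward//.
by apply: eq_measure_integral => A mA _; exact: lebesgue_measureN.
Qed.

(** The image of Lebesgue measure, multiplied by [a], gives half-open intervals their length; by
    uniqueness it is Lebesgue measure itself. *)
Lemma rescales_affine (a b : R) : 0 < a ->
  rescales mu a^-1 (fun x : T1 => (a * x + b : T1)).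
Proof.
move=> a0.
have mo : measurable_fun setT (fun x : T1 => (a * x + b : T1)).
  by apply: measurable_funD => //; exact: mulrl_measurable.
split => //; first by rewrite invr_ge0 ltW.
move=> f mf f0.
rewrite -(setTI setT) -(preimage_setT (fun x : T1 => (a * x + b : T1))) setIT.
rewrite -ge0_integral_pushforward//.
have a1 : 0 <= a by exact: ltW.
have h A : measurable A -> pushforward mu (fun x : T1 => (a * x + b : T1)) A =
    (a^-1%:E * mu A)%E.
  move=> mA.
  have /(_ mo) -> : mu A = mscale (NngNum a1) (pushforward mu (fun x : T1 => (a * x + b : T1))) A.
    move=> m; apply: lebesgue_measure_unique => // _ [[l r] _ <-] /=.
    rewrite /mscale /= /pushforward.
    rewrite (_ : _ @^-1` _ = `](l - b) / a, (r - b) / a]%classic); last first.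
      apply/seteqP; split => x /=; rewrite !in_itv/= ltr_pdivrMr// ler_pdivlMr//;
        by rewrite ltrBlDr lerBrDr (mulrC x).
    rewrite !lebesgue_measure_itv/= !lte_fin ltr_pM2r ?invr_gt0// ltrD2r.
    case: ifP => _; last by rewrite mule0.
    by rewrite -!EFinD -EFinM; congr (_%:E); field; rewrite gt_eqF.
  by rewrite /mscale /= muleA -EFinM mulVf ?gt_eqF// mul1e.
have a'0 : 0 <= a^-1 by rewrite invr_ge0.
transitivity (\int[mscale (NngNum a'0) mu]_y f y)%E.
  by apply: eq_measure_integral => A mA _; exact: h.
by rewrite preimage_setT ge0_integral_mscale.
Qed.

Lemma tonelli3 (f : R3 R -> \bar R) : measurable_fun [set: R3 R] f ->
  (forall x, 0 <= f x)%E ->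
  (\int[mu3]_x f x = \int[mu]_x \int[mu]_y \int[mu]_z f (x, y, z))%E.
Proof.
move=> mf f0; transitivity (\int[mu2]_z (\int[mu]_y f (z, y)))%E.
  exact: (@fubini_tonelli1 _ _ _ _ _ mu2 mu1 f).
rewrite -(@fubini_tonelli1 _ _ _ _ _ mu1 mu1 (fun z => \int[mu]_y f (z, y))%E)//.
- exact: (@measurable_fun_fubini_tonelli_F _ _ _ _ _ mu1 f).
- by move=> x; exact: integral_ge0.
Qed.

(** By Tonelli the three one-dimensional changes of variables are made one at a time, from the
    innermost integral outwards. *)
Lemma rescales3 (c1 c2 c3 : R) (p1 p2 p3 : T1 -> T1) :
  rescales mu c1 p1 -> rescales mu c2 p2 -> rescales mu c3 p3 ->
  rescales mu3 (c1 * c2 * c3) (fun x : R3 R => (p1 x.1.1, p2 x.1.2, p3 x.2)).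
Proof.
move=> [c10 mp1 h1] [c20 mp2 h2] [c30 mp3 h3].
have mp : measurable_fun [set: R3 R] (fun x : R3 R => (p1 x.1.1, p2 x.1.2, p3 x.2)).
  apply/measurable_fun_pairP; split.
    apply/measurable_fun_pairP; split.
      by apply: (measurableT_comp mp1); apply: measurableT_comp.
    by apply: (measurableT_comp mp2); apply: measurableT_comp.
  exact: (measurableT_comp mp3).
split => //; first by rewrite !mulr_ge0.
move=> f mf f0; rewrite tonelli3//; last exact: (measurableT_comp mf).
rewrite tonelli3//.
have m3 (g : R3 R -> \bar R) : measurable_fun setT g -> (forall x, 0 <= g x)%E ->
   measurable_fun setT (fun z : R * R => \int[mu]_y g (z, y))%E.
  by move=> mg g0; exact: measurable_fun_fubini_tonelli_F.
have m2 (g : R * R -> \bar R) : measurable_fun setT g -> (forall x, 0 <= g x)%E ->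
   measurable_fun setT (fun z : R => \int[mu]_y g (z, y))%E.
  by move=> mg g0; exact: measurable_fun_fubini_tonelli_F.
have F0 z : (0 <= \int[mu]_y f (z, y))%E by exact: integral_ge0.
transitivity (\int[mu]_x \int[mu]_y (c3%:E * \int[mu]_z f (p1 x, p2 y, z)))%E.
  apply: eq_integral => x _; apply: eq_integral => y _ /=.
  rewrite (h3 (fun z => f (p1 x, p2 y, z)))//.
  exact: (measurableT_comp mf (measurable_pair1 _)).
transitivity (\int[mu]_x (c3%:E * (c2%:E * \int[mu]_y \int[mu]_z f (p1 x, y, z))))%E.
  apply: eq_integral => x _; rewrite ge0_integralZl//.
  - congr (_ * _)%E; apply: (h2 (fun y => \int[mu]_z f (p1 x, y, z))%E) => //.
    exact: (measurableT_comp (m3 _ mf f0) (measurable_pair1 _)).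
  - apply: (measurableT_comp (measurableT_comp (m3 _ mf f0) (measurable_pair1 (p1 x))) mp2).
have key (G : T1 -> \bar R) (k : R) : measurable_fun setT G -> (forall x, 0 <= G x)%E ->
    0 <= k -> (\int[mu]_x (k%:E * G (p1 x)) = (k * c1)%:E * \int[mu]_x G x)%E.
  move=> mG G0 k0; rewrite ge0_integralZl//; last exact: (measurableT_comp mG mp1).
  by rewrite h1// EFinM muleA.
pose G x := (\int[mu]_y \int[mu]_z f (x, y, z))%E.
transitivity (\int[mu]_x ((c3 * c2)%:E * G (p1 x)))%E.
  by apply: eq_integral => x _; rewrite EFinM muleA.
rewrite (key G) ?mulr_ge0//.
- by congr (_%:E * _)%E; ring.
- exact: (m2 (fun z => \int[mu]_y f (z, y))%E (m3 _ mf f0) F0).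
- by move=> x; apply: integral_ge0 => y _; exact: F0.
Qed.

Section rescaled_integrals.
Context {d} {T : measurableType d} (m : {measure set T -> \bar R}) (c : R) (phi : T -> T).
Hypothesis hphi : rescales m c phi.

Lemma rescales_integrable (f : T -> \bar R) : m.-integrable setT f ->
  m.-integrable setT (fun x => f (phi x)).
Proof.
case: hphi => c0 mp h /integrableP[mf fi]; apply/integrableP; split.
  exact: (measurableT_comp mf).
rewrite (h (fun x => `|f x|)%E)//; last exact: measurableT_comp.
exact: lte_mul_pinfty.
Qed.

Lemma rescales_Rintegral (f : T -> R) : m.-integrable setT (EFin \o f) ->
  \int[m]_x f (phi x) = c * \int[m]_x f x.
Proof.
move=> if_; have mf := measurable_int _ if_; case: hphi => c0 mp h.
apply/EFin_inj; rewrite EFinM EFin_Rintegral//; last exact: (rescales_integrable if_).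
rewrite EFin_Rintegral// integralE [in RHS]integralE.
have hp := h ((EFin \o f)^\+)%E (measurable_funepos mf) (fun x => funepos_ge0 _ x).
have hn := h ((EFin \o f)^\-)%E (measurable_funeneg mf) (fun x => funeneg_ge0 _ x).
rewrite muleBr//; last first.
  by apply: fin_num_adde_defl; rewrite fin_numN; exact: integrable_neg_fin_num.
by rewrite -hp -hn; congr (_ - _)%E; apply: eq_integral => x _; rewrite ?funeposE ?funenegE.
Qed.

Lemma rescales_cintegrable (f : T -> R[i]) : cintegrable m f ->
  cintegrable m (fun x => f (phi x)).
Proof.
by move=> [f1 f2]; split; [exact: (rescales_integrable f1)|exact: (rescales_integrable f2)].
Qed.

Lemma rescales_cint (f : T -> R[i]) : cintegrable m f ->
  cint m (fun x => f (phi x)) = c%:C * cint m f.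
Proof.
move=> [f1 f2]; rewrite /cint (rescales_Rintegral f1) (rescales_Rintegral f2).
by apply: complex_eq; rewrite ?ReM ?ImM/=; ring.
Qed.

End rescaled_integrals.

Lemma rescales3_opp : rescales mu3 1 (fun x : R3 R => - x).
Proof.
by have := rescales3 rescales_opp rescales_opp rescales_opp; rewrite !mul1r.
Qed.

Lemma rescales3_affine (a : R) (b : R3 R) : 0 < a ->
  rescales mu3 (a ^- 3) (fun x : R3 R => a *: x + b).
Proof.
move=> a0; have := rescales3 (rescales_affine b.1.1 a0) (rescales_affine b.1.2 a0) (rescales_affine b.2 a0).
rewrite (_ : a^-1 / a / a = a ^- 3)//; by rewrite -!invfM; congr _^-1; ring.
Qed.

Lemma rescales3_shift (b : R3 R) : rescales mu3 1 (fun x : R3 R => x + b).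
Proof.
have := rescales3_affine b ltr01; rewrite expr1n invr1.
by rewrite (_ : (fun x : R3 R => 1 *: x + b) = (fun x => x + b))//; apply/funext => x; rewrite scale1r.
Qed.

End R3measure.

(** * Euclidean geometry of the space *)

Section Geometry.
Context {R : realType}.
Implicit Types x y z : R3 R.

Lemma I3P (i : 'I_3) : [\/ i = 0, i = 1 | i = 2].
Proof.
case: i => [[|[|[|//]]]] hi; [apply: Or31|apply: Or32|apply: Or33]; exact/val_inj.
Qed.

Lemma sum3 (V : nmodType) (F : 'I_3 -> V) : \sum_(i < 3) F i = F 0 + F 1 + F 2.
Proof.
rewrite !big_ord_recl big_ord0 addr0 addrA.
by congr (F _ + F _ + F _); exact/val_inj.
Qed.

Lemma coord0E x : coord3 x 0 = x.1.1. Proof. by []. Qed.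
Lemma coord1E x : coord3 x 1 = x.1.2. Proof. by []. Qed.
Lemma coord2E x : coord3 x 2 = x.2. Proof. by []. Qed.

Lemma coord3D x y i : coord3 (x + y) i = coord3 x i + coord3 y i.
Proof. by case: (I3P i) => ->. Qed.
Lemma coord3N x i : coord3 (- x) i = - coord3 x i.
Proof. by case: (I3P i) => ->. Qed.
Lemma coord3B x y i : coord3 (x - y) i = coord3 x i - coord3 y i.
Proof. by rewrite coord3D coord3N. Qed.
Lemma coord3Z (a : R) x i : coord3 (a *: x) i = a * coord3 x i.
Proof. by case: (I3P i) => ->. Qed.
Lemma coord3_0 i : coord3 (0 : R3 R) i = 0.
Proof. by case: (I3P i) => ->. Qed.

Lemma coord3_unit_vec i j : coord3 (unit_vec j : R3 R) i = (i == j)%:R.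
Proof. by case: (I3P i) => ->; case: (I3P j) => ->. Qed.

Lemma coord3P x y : (forall i, coord3 x i = coord3 y i) -> x = y.
Proof.
move=> h; have h0 := h 0; have h1 := h 1; have h2 := h 2.
move: h0 h1 h2; rewrite !coord0E !coord1E !coord2E.
by case: x h => [[a b] c] _; case: y => [[a' b'] c'] /= -> -> ->.
Qed.

Lemma dotE x y : dot x y = x.1.1 * y.1.1 + x.1.2 * y.1.2 + x.2 * y.2.
Proof. by rewrite /dot sum3. Qed.

Lemma dotC x y : dot x y = dot y x.
Proof. by rewrite !dotE; ring. Qed.
Lemma dotDl x y z : dot (x + y) z = dot x z + dot y z.
Proof. by rewrite !dotE /=; ring. Qed.
Lemma dotDr x y z : dot z (x + y) = dot z x + dot z y.
Proof. by rewrite !dotE /=; ring. Qed.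
Lemma dotNl x y : dot (- x) y = - dot x y.
Proof. by rewrite !dotE /=; ring. Qed.
Lemma dotNr x y : dot x (- y) = - dot x y.
Proof. by rewrite !dotE /=; ring. Qed.
Lemma dotZl (a : R) x y : dot (a *: x) y = a * dot x y.
Proof. by rewrite /dot mulr_sumr; apply: eq_bigr => i _; rewrite coord3Z mulrA. Qed.
Lemma dotZr (a : R) x y : dot x (a *: y) = a * dot x y.
Proof. by rewrite dotC dotZl dotC. Qed.
Lemma dot_unit_vec j x : dot (unit_vec j) x = coord3 x j.
Proof.
rewrite /dot (bigD1 j)//= big1 ?addr0.
  by rewrite coord3_unit_vec eqxx mul1r.
by move=> i /negbTE ij; rewrite coord3_unit_vec ij mul0r.
Qed.

Lemma dotxx_ge0 x : 0 <= dot x x.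
Proof. by rewrite dotE !addr_ge0// -expr2 sqr_ge0. Qed.

Lemma enorm_ge0 x : 0 <= enorm x. Proof. exact: sqrtr_ge0. Qed.

Lemma sqr_enorm x : enorm x ^+ 2 = dot x x.
Proof. by rewrite sqr_sqrtr// dotxx_ge0. Qed.

Lemma coord3_le_enorm x i : `|coord3 x i| <= enorm x.
Proof.
rewrite -(@ler_pXn2r _ 2) ?nnegrE ?enorm_ge0// sqr_enorm real_normK ?num_real//.
rewrite dotE -!expr2; have := sqr_ge0 x.1.1; have := sqr_ge0 x.1.2; have := sqr_ge0 x.2.
by case: (I3P i) => ->; rewrite ?coord0E ?coord1E ?coord2E; lra.
Qed.

Lemma enorm_le_sum x : enorm x <= \sum_(i < 3) `|coord3 x i|.
Proof.
rewrite -(@ler_pXn2r _ 2) ?nnegrE ?enorm_ge0 ?sumr_ge0// sqr_enorm dotE sum3.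
rewrite !coord0E !coord1E !coord2E -!expr2 -[x.1.1 ^+ 2]real_normK ?num_real//.
rewrite -[x.1.2 ^+ 2]real_normK ?num_real// -[x.2 ^+ 2]real_normK ?num_real//.
have := normr_ge0 x.1.1; have := normr_ge0 x.1.2; have := normr_ge0 x.2; nra.
Qed.

Lemma enormN x : enorm (- x) = enorm x.
Proof. by rewrite /enorm dotNl dotNr opprK. Qed.

Lemma enormZ (a : R) x : enorm (a *: x) = `|a| * enorm x.
Proof.
by rewrite /enorm dotZl dotZr mulrA -expr2 sqrtrM ?sqr_ge0// sqrtr_sqr.
Qed.

Lemma dot_le_enorm x y : `|dot x y| <= enorm x * enorm y.
Proof.
rewrite -(@ler_pXn2r _ 2) ?nnegrE ?mulr_ge0 ?enorm_ge0//.
rewrite real_normK ?num_real// exprMn !sqr_enorm !dotE.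
move: x y => [[a b] c] [[a' b'] c'] /=; rewrite -subr_ge0.
rewrite (_ : _ - _ = (a * b' - b * a') ^+ 2 + (a * c' - c * a') ^+ 2 + (b * c' - c * b') ^+ 2).
  by rewrite !addr_ge0// sqr_ge0.
by rewrite !expr2; ring.
Qed.

Lemma enormD x y : enorm (x + y) <= enorm x + enorm y.
Proof.
rewrite -(@ler_pXn2r _ 2) ?nnegrE ?addr_ge0 ?enorm_ge0// sqrrD !sqr_enorm.
rewrite dotDl !dotDr (dotC y x); have := dot_le_enorm x y.
by have := ler_norm (dot x y); lra.
Qed.

Lemma enormB x y : enorm (x - y) <= enorm x + enorm y.
Proof. by rewrite -(enormN y); exact: enormD. Qed.

Lemma enorm_eq0 x : (enorm x == 0) = (x == 0).
Proof.
apply/eqP/eqP => [h|->]; last first.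
  by rewrite /enorm -(scale0r (0 : R3 R)) dotZl mul0r sqrtr0.
apply: coord3P => i; apply/eqP; rewrite coord3_0 -normr_le0 -h.
exact: coord3_le_enorm.
Qed.

Lemma normr_coord3 x i : `|coord3 x i| <= `|x|.
Proof.
case: (I3P i) => ->; rewrite ?coord0E ?coord1E ?coord2E.
- by rewrite !prod_normE/= !le_max lexx.
- by rewrite !prod_normE/= !le_max lexx orbT.
- by rewrite !prod_normE/= !le_max lexx orbT.
Qed.

(** Here [|x|] is the sup norm, hence one unit of the constant for each coordinate. *)
Lemma enorm_le_norm x : enorm x <= 3 * `|x|.
Proof.
apply: le_trans (enorm_le_sum x) _; rewrite sum3.
have := normr_coord3 x 0; have := normr_coord3 x 1; have := normr_coord3 x 2; lra.
Qed.

Lemma measurable_coord3 i : measurable_fun [set: R3 R] (fun x : R3 R => coord3 x i).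
Proof.
case: (I3P i) => ->.
- rewrite (_ : (fun x => _) = (fst \o fst))//; exact: measurableT_comp.
- rewrite (_ : (fun x => _) = (snd \o fst))//; exact: measurableT_comp.
- by rewrite (_ : (fun x => _) = snd).
Qed.

Lemma measurable_fun_R3 {d} {T : measurableType d} (f : T -> R3 R) :
  (forall i, measurable_fun [set: T] (fun t => coord3 (f t) i)) ->
  measurable_fun [set: T] f.
Proof.
move=> h; apply/measurable_fun_pairP; split; last exact: (h 2).
by apply/measurable_fun_pairP; split; [exact: (h 0)|exact: (h 1)].
Qed.

Lemma measurable_coord3_comp {d} {T : measurableType d} (f : T -> R3 R) i :
  measurable_fun [set: T] f -> measurable_fun [set: T] (fun t => coord3 (f t) i).
Proof. by move=> mf; exact: (measurableT_comp (measurable_coord3 i) mf). Qed.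

Lemma measurable_R3D {d} {T : measurableType d} (f g : T -> R3 R) :
  measurable_fun [set: T] f -> measurable_fun [set: T] g ->
  measurable_fun [set: T] (fun t => f t + g t).
Proof.
move=> mf mg; apply: measurable_fun_R3 => i; under eq_fun do rewrite coord3D.
by apply: measurable_funD; exact: measurable_coord3_comp.
Qed.

Lemma measurable_R3N {d} {T : measurableType d} (f : T -> R3 R) :
  measurable_fun [set: T] f -> measurable_fun [set: T] (fun t => - f t).
Proof.
move=> mf; apply: measurable_fun_R3 => i; under eq_fun do rewrite coord3N.
by apply: measurable_funN; exact: measurable_coord3_comp.
Qed.

Lemma measurable_R3B {d} {T : measurableType d} (f g : T -> R3 R) :
  measurable_fun [set: T] f -> measurable_fun [set: T] g ->
  measurable_fun [set: T] (fun t => f t - g t).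
Proof. by move=> mf mg; apply: measurable_R3D => //; exact: measurable_R3N. Qed.

Lemma measurable_R3Z {d} {T : measurableType d} (a : R) (f : T -> R3 R) :
  measurable_fun [set: T] f -> measurable_fun [set: T] (fun t => a *: f t).
Proof.
move=> mf; apply: measurable_fun_R3 => i; under eq_fun do rewrite coord3Z.
by apply: measurable_funM => //; exact: measurable_coord3_comp.
Qed.

Lemma measurable_dot {d} {T : measurableType d} (f g : T -> R3 R) :
  measurable_fun [set: T] f -> measurable_fun [set: T] g ->
  measurable_fun [set: T] (fun t => dot (f t) (g t)).
Proof.
move=> mf mg; rewrite /dot.
by apply: measurable_sum => i; apply: measurable_funM; exact: measurable_coord3_comp.
Qed.

Lemma measurable_enorm {d} {T : measurableType d} (f : T -> R3 R) :
  measurable_fun [set: T] f -> measurable_fun [set: T] (fun t => enorm (f t)).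
Proof.
move=> mf; apply: (measurableT_comp (continuous_measurable_fun (@sqrt_continuous R))).
exact: measurable_dot.
Qed.

Lemma measurable_id3 : measurable_fun [set: R3 R] (fun x : R3 R => x).
Proof. exact: measurable_id. Qed.

Lemma lipschitz_enorm x y : `|enorm x - enorm y| <= enorm (x - y).
Proof.
have h1 : enorm x <= enorm (x - y) + enorm y by have := enormD (x - y) y; rewrite subrK.
have h2 : enorm y <= enorm (x - y) + enorm x.
  by have := enormD (y - x) x; rewrite subrK -(enormN (y - x)) opprB.
by rewrite ler_norml; apply/andP; split; lra.
Qed.

Lemma continuous_enorm : continuous (@enorm R).
Proof.
move=> x; apply/cvgrPdist_lt => e e0.
near=> y; apply: le_lt_trans (lipschitz_enorm _ _) _.
apply: le_lt_trans (enorm_le_norm _) _; rewrite -ltr_pdivlMl//.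
near: y; apply: cvgr_dist_lt; last by rewrite mulr_gt0.
exact: cvg_id.
Unshelve. all: by end_near. Qed.

End Geometry.

(** * The complex exponential on the imaginary axis *)

Section Expi.
Context {R : realType}.
Implicit Types t : R.

Lemma expiD (a b : R) : expi (a + b) = expi a * expi b.
Proof. by apply: complex_eq; rewrite ?ReM ?ImM /= ?cosD ?sinD; ring. Qed.

Lemma expi0 : expi (0 : R) = 1.
Proof. by apply: complex_eq => /=; rewrite ?cos0 ?sin0. Qed.

Lemma expiN t : expi (- t) = conjc (expi t).
Proof. by apply: complex_eq => /=; rewrite ?cosN ?sinN. Qed.

Lemma normc_expi t : normc (expi t) = 1.
Proof. by rewrite /= cos2Dsin2 sqrtr1. Qed.

Lemma expi_mulN t : expi t * expi (- t) = 1.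
Proof. by rewrite -expiD subrr expi0. Qed.

Lemma abs_sin_le t : `|sin t| <= `|t|.
Proof.
wlog t0 : t / 0 <= t => [h|].
  by case: (leP 0 t) => [/h//|/ltW t0]; rewrite -normrN -sinN -[X in _ <= X]normrN h// oppr_ge0.
move: t0; rewrite le_eqVlt => /predU1P[<-|t0]; first by rewrite sin0 normr0.
have [|c _] := @MVT R sin cos 0 t t0.
  by apply: continuous_subspaceT => x; exact: continuous_sin.
rewrite sin0 !subr0 => ->; rewrite normrM ler_piMl//.
by rewrite ler_norml cos_geN1 cos_le1.
Qed.

Lemma sqr_le_norm (a b : R) : `|a| <= `|b| -> a ^+ 2 <= b ^+ 2.
Proof.
move=> ab; rewrite -(real_normK (num_real a)) -(real_normK (num_real b)).
by rewrite ler_pXn2r ?nnegrE.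
Qed.

Lemma one_minus_cos t : 1 - cos t = 2 * sin (t / 2) ^+ 2.
Proof.
have := cosD (t / 2) (t / 2); rewrite -splitr => ->.
by have := cos2Dsin2 (t / 2); rewrite !expr2; lra.
Qed.

Lemma cos_lower t : `|1 - cos t| <= t ^+ 2.
Proof.
rewrite one_minus_cos ger0_norm; last by apply: mulr_ge0 => //; exact: sqr_ge0.
have := sqr_le_norm (abs_sin_le (t / 2)); rewrite exprMn exprVn.
by have := sqr_ge0 t; lra.
Qed.

Lemma cos_lower1 t : `|1 - cos t| <= `|t|.
Proof.
rewrite one_minus_cos ger0_norm; last by apply: mulr_ge0 => //; exact: sqr_ge0.
rewrite -(real_normK (num_real (sin _))).
have := abs_sin_le (t / 2); rewrite normrM (ger0_norm (_ : 0 <= 2^-1))//.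
have : `|sin (t / 2)| <= 1 by rewrite ler_norml sin_geN1 sin_le1.
have := normr_ge0 (sin (t / 2)); rewrite expr2; nra.
Qed.

Lemma sin_lower t : `|sin t - t| <= t ^+ 2.
Proof.
wlog t0 : t / 0 <= t => [h|].
  case: (leP 0 t) => [/h//|/ltW t0].
  by have := h (- t); rewrite oppr_ge0 sqrrN sinN -opprD normrN; apply.
move: t0; rewrite le_eqVlt => /predU1P[<-|t0].
  by rewrite sin0 subrr normr0 sqr_ge0.
have [|c] := @MVT R (fun x => sin x - x) (fun x => cos x - 1) 0 t t0.
  apply: continuous_subspaceT => x; apply: cvgB; [exact: continuous_sin|exact: cvg_id].
rewrite in_itv/= => /andP[c0 ct]; rewrite sin0 !subr0 => ->.
rewrite normrM (ger0_norm (ltW t0)) expr2 ler_pM2r//.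
by rewrite distrC (le_trans (cos_lower1 c))// ger0_norm ltW.
Qed.

(** A quadratic remainder is all that is needed to differentiate a Fourier integral and to compute
    the limit of a difference quotient. *)
Lemma expi_taylor2 t : normc (expi t - 1 - 'i * t%:C) <= 2 * t ^+ 2.
Proof.
apply: le_trans (normc_le _) _.
rewrite !(ReD, ImD, ReN, ImN, ReM, ImM)/=.
rewrite !(mul0r, mulr0, mul1r, oppr0, subr0, addr0, sub0r, add0r, opprK).
have := cos_lower t; have := sin_lower t; rewrite (distrC 1) => h1 h2.
by rewrite mulr_natl mulr2n lerD.
Qed.

Lemma cmeas_expi {d} {T : measurableType d} (h : T -> R) :
  measurable_fun [set: T] h -> cmeas (fun x => expi (h x)).
Proof.
move=> mh; split => /=.
  by apply: (measurableT_comp (continuous_measurable_fun (@continuous_cos R))).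
by apply: (measurableT_comp (continuous_measurable_fun (@continuous_sin R))).
Qed.

End Expi.

(** * Decay and integrability *)

Section LineIntegrals.
Context {R : realType}.
Notation mu := (@mu1 R).

Lemma even_integral (q : R -> \bar R) : measurable_fun [set: R] q ->
  (forall x, 0 <= q x)%E -> (forall x, q (- x) = q x) ->
  (\int[mu]_x q x = 2%:E * \int[mu]_(x in `[0%R, +oo[) q x)%E.
Proof.
move=> mq q0 qe.
have mI : measurable [set x : R | 0 <= x] by rewrite -set_itvcy.
have -> : [set: R] = `]-oo, 0%R[%classic `|` `[0%R, +oo[%classic.
  apply/seteqP; split => x //= _; rewrite !in_itv/= andbT.
  by case: (ltP x 0) => h; [left|right].
rewrite ge0_integral_setU//=; last 2 first.
- exact: measurable_funTS.
- apply/disj_setPLR => x /=; rewrite !in_itv/= andbT => h /=; rewrite leNgt h //.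
rewrite mule_natl mule2n; congr (_ + _)%E.
rewrite integral_itv_bndo_bndc; last exact: measurable_funTS.
rewrite [RHS](@ge0_integration_by_substitution0 R q)//.
by apply: eq_integral => x _; rewrite qe.
Qed.

Lemma integral_oneDsqrV : (\int[mu]_x ((1 + x ^+ 2)^-1)%:E = pi%:E)%E.
Proof.
have := @integral0y_oneDsqr R; rewrite /oneDsqr => h.
rewrite even_integral.
- by rewrite [X in (_ * X)%E]h -EFinM; congr _%:E; rewrite mulrC divfK.
- apply/measurable_EFinP; apply: continuous_measurable_fun.
  exact: (@continuous_oneDsqrV R).
- by move=> x; rewrite lee_fin invr_ge0 addr_ge0// sqr_ge0.
- by move=> x; rewrite sqrrN.
Qed.

Lemma integrable_oneDsqrV : mu.-integrable [set: R] (EFin \o (fun x : R => (1 + x ^+ 2)^-1)).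
Proof.
apply/integrableP; split.
  apply/measurable_EFinP; apply: continuous_measurable_fun.
  exact: (@continuous_oneDsqrV R).
under eq_integral do rewrite /= ger0_norm ?invr_ge0 ?addr_ge0 ?sqr_ge0//.
by rewrite integral_oneDsqrV ltry.
Qed.

Definition expabs (t : R) : R := expR (- `|t|).

Lemma continuous_expabs : continuous expabs.
Proof.
move=> t; apply: continuous_comp; last exact: continuous_expR.
by apply: continuousN; exact: norm_continuous.
Qed.

(** Adding 1 to the cosine makes the integrand nonnegative, so that the fundamental theorem of
    calculus on the half-line applies. The transform of [expabs] is recovered by subtracting the
    integral of [expabs]. *)
Lemma integral_expabs_cos (x : R) :
  (\int[mu]_t (expabs t * (1 + cos (x * t)))%:E = (2 * (1 + (1 + x ^+ 2)^-1))%:E)%E.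
Proof.
have x20 : 1 + x ^+ 2 != 0 by rewrite gt_eqF// ltr_pwDl// sqr_ge0.
have c1 t : 0 <= 1 + cos (x * t) by have := cos_geN1 (x * t); lra.
have cc : continuous (fun t => cos (x * t)).
  by move=> t; apply: continuous_comp; [exact: mulrl_continuous|exact: continuous_cos].
have cg : continuous (fun t => expabs t * (1 + cos (x * t))).
  move=> t; apply: cvgM; first exact: continuous_expabs.
  by apply: cvgD; [exact: cvg_cst|exact: cc].
rewrite even_integral; last 3 first.
- by apply/measurable_EFinP; exact: continuous_measurable_fun.
- by move=> t; rewrite lee_fin mulr_ge0// expR_ge0.
- by move=> t; rewrite /expabs normrN mulrN cosN.
rewrite EFinM; congr (_ * _)%E.
(* A primitive of e^(-t) (1 + cos (x t)), found by integrating by parts twice. It vanishes at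
   infinity. *)
pose F (t : R) := - expR (- t) + expR (- t) * ((1 + x ^+ 2)^-1 * (x * sin (x * t) - cos (x * t))).
pose g (t : R) := expR (- t) * (1 + cos (x * t)).
have dF (t : R) : is_derive t 1 F (g t).
  have d1 : is_derive t (1 : R) (fun t : R => expR (- t)) (- expR (- t)).
    have := @is_derive1_comp R expR -%R t (expR (- t)) (-1).
    by rewrite mulrN1; apply.
  have dx : is_derive t (1 : R) ( *%R x : R -> R) x.
    by have := is_deriveZ x (is_derive_id t (1 : R)); rewrite /GRing.scale/= mulr1.
  have d2 : is_derive t (1 : R) (fun t : R => sin (x * t)) (cos (x * t) * x).
    exact: (@is_derive1_comp R sin ( *%R x) t _ _ (is_derive_sin _) dx).
  have d3 : is_derive t (1 : R) (fun t : R => cos (x * t)) (- sin (x * t) * x).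
    exact: (@is_derive1_comp R cos ( *%R x) t _ _ (is_derive_cos _) dx).
  have d4 := is_deriveB (is_deriveZ x d2) d3.
  have d5 := is_deriveZ (1 + x ^+ 2)^-1 d4.
  have d6 := is_deriveD (is_deriveN d1) (is_deriveM d1 d5).
  have d7 : is_derive t (1 : R) F (- - expR (- t) + (expR (- t) *
      ((1 + x ^+ 2)^-1 * (x * (cos (x * t) * x) - - sin (x * t) * x)) +
      ((1 + x ^+ 2)^-1 * (x * sin (x * t) - cos (x * t))) * - expR (- t))) := d6.
  apply: is_derive_eq d7 _; rewrite /g; field.
  exact: x20.
have Fy : F t @[t --> +oo%R] --> (0 : R).
  have e0 : expR (- t) @[t --> +oo%R] --> (0 : R) by exact: cvgr_expR.
  apply/cvgrPdist_le => e e0'.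
  have [M Mp] : exists2 M : R, 0 < M & forall t, `|F t| <= M * expR (- t).
    exists (1 + (`|x| + 1) / (1 + x ^+ 2)).
      by rewrite ltr_pwDl// divr_ge0// ?addr_ge0// sqr_ge0.
    move=> t; rewrite /F; apply: le_trans (ler_normD _ _) _.
    rewrite normrN (ger0_norm (expR_ge0 _)) mulrDl mul1r lerD2l.
    rewrite normrM (ger0_norm (expR_ge0 _)) [leRHS]mulrC ler_wpM2l ?expR_ge0//.
    rewrite normrM [`|_^-1|]ger0_norm ?invr_ge0 ?addr_ge0 ?sqr_ge0// mulrC.
    rewrite ler_wpM2r ?invr_ge0 ?addr_ge0 ?sqr_ge0//.
    apply: le_trans (ler_normB _ _) _; rewrite normrM lerD//.
      by rewrite ler_piMr// ler_norml sin_geN1 sin_le1.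
    by rewrite ler_norml cos_geN1 cos_le1.
  move/cvgrPdist_le : e0 => /(_ (e / M) (divr_gt0 e0' Mp)) eM b.
  apply: filterS eM => t; rewrite !sub0r !normrN (ger0_norm (expR_ge0 _)) => h.
  by apply: le_trans (b t) _; rewrite -ler_pdivlMl// mulrC.
have cF : continuous F.
  by move=> t; apply: differentiable_continuous; apply/derivable1_diffP; case: (dF t).
have F0 : F 0 = - (1 + (1 + x ^+ 2)^-1).
  by rewrite /F mulr0 oppr0 expR0 sin0 cos0 mulr0 sub0r mul1r mulrN1 opprD.
transitivity (\int[mu]_(t in `[0%R, +oo[) (g t)%:E)%E.
  apply: eq_integral => t; rewrite inE/= in_itv/= andbT => t0.
  by rewrite /g /expabs ger0_norm.
rewrite (@ge0_continuous_FTC2y R g F 0 0)//.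
- by rewrite F0 sub0e -EFinN opprK.
- by move=> t _; rewrite mulr_ge0// expR_ge0.
- apply: continuous_subspaceT => t; apply: cvgM.
    by apply: continuous_comp; [exact: oppr_continuous|exact: continuous_expR].
  by apply: cvgD; [exact: cvg_cst|exact: cc].
- by apply: cvg_at_right_filter; exact: cF.
- by move=> t _; rewrite derive1E; apply: derive_val.
Qed.

(** The case x = 0 of the preceding integral, where 1 + cos is constantly 2. *)
Lemma integral_expabs : (\int[mu]_t (expabs t)%:E = 2%:E)%E.
Proof.
have := integral_expabs_cos 0.
under eq_integral do rewrite mul0r cos0 -[1 + 1]/2 mulrC EFinM.
rewrite expr0n addr0 invr1 ge0_integralZl//; first last.
- by move=> t _; rewrite lee_fin expR_ge0.
- by apply/measurable_EFinP; apply: continuous_measurable_fun; exact: continuous_expabs.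
move=> h; have : ((2^-1)%:E * (2%:E * \int[mu]_t (expabs t)%:E) = (2^-1)%:E * (2 * (1 + 1))%:E)%E.
  by rewrite h.
by rewrite muleA -!EFinM mulVf// mul1e => ->; congr _%:E; rewrite mulKf.
Qed.

Lemma measurable_expabs : measurable_fun [set: R] expabs.
Proof. by apply: continuous_measurable_fun; exact: continuous_expabs. Qed.

Lemma integrable_expabs : mu.-integrable [set: R] (EFin \o expabs).
Proof.
apply/integrableP; split; first by apply/measurable_EFinP; exact: measurable_expabs.
under eq_integral do rewrite /= ger0_norm ?expR_ge0//.
by rewrite integral_expabs ltry.
Qed.

Lemma cintegrable_expabs (x : R) :
  cintegrable mu (fun t => expi (- (t * x)) * (expabs t)%:C).
Proof.
apply: (le_cintegrable _ _ integrable_expabs).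
  apply: cmeasM; last exact: cmeasR measurable_expabs.
  apply: cmeas_expi; apply: measurable_funN; exact: mulrr_measurable.
by move=> t; rewrite Normc.normcM normc_expi mul1r normcR ger0_norm ?expR_ge0.
Qed.

(** The real part is the previous integral minus that of [expabs]; the imaginary part is the
    integral of an odd function. *)
Lemma fourier_expabs (x : R) :
  cint mu (fun t => expi (- (t * x)) * (expabs t)%:C) = (2 / (1 + x ^+ 2))%:C.
Proof.
have [i1 i2] := cintegrable_expabs x.
have e1 t : Re (expi (- (t * x)) * (expabs t)%:C) = expabs t * cos (x * t).
  by rewrite ReM /= cosN mulr0 subr0 mulrC (mulrC t).
have e2 t : Im (expi (- (t * x)) * (expabs t)%:C) = - (expabs t * sin (x * t)).
  by rewrite ImM /= sinN mulr0 add0r mulrC (mulrC t) mulrN.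
transitivity ((2 / (1 + x ^+ 2)) +i* 0 : R[i]); last by [].
rewrite /cint; congr (_ +i* _).
- under eq_Rintegral do rewrite e1.
  have i3 : mu.-integrable [set: R] (EFin \o (fun t => expabs t * cos (x * t))).
    by apply: eq_integrable i1 => // t _ /=; rewrite -e1.
  have i4 : mu.-integrable [set: R] (EFin \o (fun t => expabs t * (1 + cos (x * t)))).
    have := integrableD measurableT integrable_expabs i3.
    by apply: eq_integrable => // t _ /=; rewrite -EFinD mulrDr mulr1.
  apply/EFin_inj; rewrite (_ : \int[mu]_t (expabs t * cos (x * t)) =
    \int[mu]_t (expabs t * (1 + cos (x * t))) - \int[mu]_t expabs t).
    rewrite EFinB !EFin_Rintegral//; last exact: integrable_expabs.
    rewrite integral_expabs_cos integral_expabs -EFinB; congr _%:E; ring.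
  rewrite -RintegralB//; last exact: integrable_expabs.
  by apply: eq_Rintegral => t _; ring.
- under eq_Rintegral do rewrite e2.
  have i3 : mu.-integrable [set: R] (EFin \o (fun t => - (expabs t * sin (x * t)))).
    by apply: eq_integrable i2 => // t _ /=; rewrite -e2.
  have := rescales_Rintegral rescales_opp i3.
  rewrite mul1r (_ : \int[mu]_t _ = - \int[mu]_t - (expabs t * sin (x * t))) => [|]; last first.
    rewrite -mulN1r -RintegralZl//; apply: eq_Rintegral => t _.
    by rewrite /expabs normrN mulrN sinN; ring.
  by move=> h; lra.
Qed.

Lemma integral_powR (r a b : R) : 0 < a -> a < b -> r != 1 ->
  (\int[mu]_(x in `[a, b]) (x `^ (- r))%:E = ((b `^ (1 - r) - a `^ (1 - r)) / (1 - r))%:E)%E.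
Proof.
move=> a0 ab r1; have r10 : 1 - r != 0 by rewrite subr_eq0 eq_sym.
pose F (x : R) := (1 - r)^-1 * x `^ (1 - r).
have dF (x : R) : 0 < x -> is_derive x 1 F (x `^ (- r)).
  move=> x0; have d := is_derive1_powR (1 - r) x0.
  have := is_deriveZ (1 - r)^-1 d.
  move=> h; have {}h : is_derive x (1 : R) F _ := h; apply: is_derive_eq h _; rewrite /GRing.scale /= mulrA mulVf// mul1r.
  by congr (_ `^ _); ring.
have cF (x : R) : 0 < x -> {for x, continuous F}.
  move=> x0; apply: differentiable_continuous; apply/derivable1_diffP.
  by case: (dF x x0).
rewrite (@continuous_FTC2 R _ F)//.
- by rewrite -EFinB -mulrBr mulrC.
- apply: continuous_in_subspaceT => x; rewrite inE/= in_itv/= => /andP[ax _].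
  have x0 := lt_le_trans a0 ax.
  apply: differentiable_continuous; apply/derivable1_diffP.
  by case: (is_derive1_powR (- r) x0).
- split.
  + by move=> x; rewrite in_itv/= => /andP[ax _]; case: (dF x (lt_trans a0 ax)).
  + by apply: cvg_at_right_filter; exact: cF.
  + by apply: cvg_at_left_filter; apply: cF; exact: lt_trans ab.
- move=> x; rewrite in_itv/= => /andP[ax _]; rewrite derive1E.
  by have := dF x (lt_trans a0 ax) => ?; exact: derive_val.
Qed.

End LineIntegrals.

Section ProductIntegrals.
Context {R : realType}.
Notation mu := (@mu1 R).

#[global] Instance ae_filter_mu3 : Filter (almost_everywhere (@mu3 R)) :=
  ae_filter_ringOfSetsType _.

Lemma integral_prod3 (q1 q2 q3 : R -> R) :
  measurable_fun [set: R] q1 -> measurable_fun [set: R] q2 -> measurable_fun [set: R] q3 ->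
  (forall x, 0 <= q1 x) -> (forall x, 0 <= q2 x) -> (forall x, 0 <= q3 x) ->
  (\int[mu3]_x (q1 x.1.1 * q2 x.1.2 * q3 x.2)%:E =
   \int[mu]_x (q1 x)%:E * \int[mu]_x (q2 x)%:E * \int[mu]_x (q3 x)%:E)%E.
Proof.
move=> m1 m2 m3 p1 p2 p3.
have I0 q : (forall x, 0 <= q x) -> (0 <= \int[mu]_x (q x)%:E)%E.
  by move=> q0; apply: integral_ge0 => x _; rewrite lee_fin.
rewrite tonelli3; last first.
- by move=> x; rewrite lee_fin !mulr_ge0.
- apply/measurable_EFinP; apply: measurable_funM; first apply: measurable_funM.
  + exact: (measurableT_comp m1 (measurable_coord3 0)).
  + exact: (measurableT_comp m2 (measurable_coord3 1)).
  + exact: (measurableT_comp m3 (measurable_coord3 2)).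
transitivity (\int[mu]_x (\int[mu]_y ((q2 y)%:E * ((q1 x)%:E * \int[mu]_z (q3 z)%:E))))%E.
  apply: eq_integral => x _; apply: eq_integral => y _ /=.
  under eq_integral do rewrite EFinM.
  rewrite ge0_integralZl//; last 3 first.
  - exact/measurable_EFinP.
  - by move=> z _; rewrite lee_fin.
  - by rewrite lee_fin mulr_ge0.
  by rewrite EFinM muleA [((q2 y)%:E * _)%E]muleC.
transitivity (\int[mu]_x ((\int[mu]_y (q2 y)%:E * \int[mu]_z (q3 z)%:E) * (q1 x)%:E))%E.
  apply: eq_integral => x _.
  rewrite ge0_integralZr//; last 3 first.
  - exact/measurable_EFinP.
  - by move=> z _; rewrite lee_fin.
  - by rewrite mule_ge0// ?lee_fin// I0.
  by rewrite [((q1 x)%:E * _)%E]muleC muleA.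
rewrite ge0_integralZl//; last 3 first.
- exact/measurable_EFinP.
- by move=> z _; rewrite lee_fin.
- by rewrite mule_ge0// I0.
by rewrite muleC muleA.
Qed.

Lemma integrable_prod3 (q1 q2 q3 : R -> R) :
  mu.-integrable [set: R] (EFin \o q1) -> mu.-integrable [set: R] (EFin \o q2) ->
  mu.-integrable [set: R] (EFin \o q3) ->
  (forall x, 0 <= q1 x) -> (forall x, 0 <= q2 x) -> (forall x, 0 <= q3 x) ->
  mu3.-integrable [set: R3 R] (EFin \o (fun x : R3 R => q1 x.1.1 * q2 x.1.2 * q3 x.2)).
Proof.
move=> i1 i2 i3 p1 p2 p3.
have m1 : measurable_fun setT q1 by apply/measurable_EFinP; exact: measurable_int i1.
have m2 : measurable_fun setT q2 by apply/measurable_EFinP; exact: measurable_int i2.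
have m3 : measurable_fun setT q3 by apply/measurable_EFinP; exact: measurable_int i3.
apply/integrableP; split.
  apply/measurable_EFinP; apply: measurable_funM; first apply: measurable_funM.
  - exact: (measurableT_comp m1 (measurable_coord3 0)).
  - exact: (measurableT_comp m2 (measurable_coord3 1)).
  - exact: (measurableT_comp m3 (measurable_coord3 2)).
have e x : `|q1 x.1.1 * q2 x.1.2 * q3 x.2| = q1 x.1.1 * q2 x.1.2 * q3 x.2.
  by rewrite ger0_norm// !mulr_ge0.
under eq_integral do rewrite /= e.
rewrite integral_prod3// -!EFin_Rintegral// -!EFinM ltry//.
Qed.

Lemma cintegrable_prod3 (f1 f2 f3 : R -> R[i]) :
  cintegrable mu f1 -> cintegrable mu f2 -> cintegrable mu f3 ->
  cintegrable mu3 (fun x : R3 R => f1 x.1.1 * f2 x.1.2 * f3 x.2).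
Proof.
move=> i1 i2 i3.
apply: (le_cintegrable _ _ (integrable_prod3 (cintegrable_normc i1)
  (cintegrable_normc i2) (cintegrable_normc i3) _ _ _)) => [|x|x|x|x]; try exact: normc_ge0.
  apply: cmeasM; first apply: cmeasM.
  - exact: (cmeas_comp (cintegrable_cmeas i1) (measurable_coord3 0)).
  - exact: (cmeas_comp (cintegrable_cmeas i2) (measurable_coord3 1)).
  - exact: (cmeas_comp (cintegrable_cmeas i3) (measurable_coord3 2)).
by rewrite !Normc.normcM.
Qed.

Lemma cint_prod3 (f1 f2 f3 : R -> R[i]) :
  cintegrable mu f1 -> cintegrable mu f2 -> cintegrable mu f3 ->
  cint mu3 (fun x : R3 R => f1 x.1.1 * f2 x.1.2 * f3 x.2) =
  cint mu f1 * cint mu f2 * cint mu f3.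
Proof.
move=> i1 i2 i3; have i123 := cintegrable_prod3 i1 i2 i3.
have i12 : cintegrable mu2 (fun x : R * R => f1 x.1 * f2 x.2).
  apply/cintegrableP; split.
    apply: cmeasM.
    - exact: (cmeas_comp (cintegrable_cmeas i1) measurable_fst).
    - exact: (cmeas_comp (cintegrable_cmeas i2) measurable_snd).
  under eq_integral do rewrite Normc.normcM EFinM.
  have [m1 m2] := (measurable_normc (cintegrable_cmeas i1), measurable_normc (cintegrable_cmeas i2)).
  rewrite (@fubini_tonelli1 _ _ _ _ _ mu mu (fun z => (normc (f1 z.1))%:E * (normc (f2 z.2))%:E)%E); last 2 first.
  - apply: emeasurable_funM; apply/measurable_EFinP.
      exact: (measurableT_comp m1 measurable_fst).
    exact: (measurableT_comp m2 measurable_snd).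
  - by move=> x; rewrite mule_ge0// lee_fin normc_ge0.
  rewrite /fubini_F/=.
  under eq_integral => x _.
    rewrite ge0_integralZl//; last 3 first.
    - exact/measurable_EFinP.
    - by move=> z _; rewrite lee_fin normc_ge0.
    - by rewrite lee_fin normc_ge0.
    rewrite -(EFin_Rintegral (cintegrable_normc i2)).
    over.
  rewrite ge0_integralZr//; last 3 first.
  - exact/measurable_EFinP.
  - by move=> z _; rewrite lee_fin normc_ge0.
  - by rewrite lee_fin; apply: Rintegral_ge0 => x _; exact: normc_ge0.
  by rewrite -(EFin_Rintegral (cintegrable_normc i1)) -EFinM ltry.
transitivity (cint mu2 (fun z : R * R => cint mu (fun y => f1 z.1 * f2 z.2 * f3 y))).
  exact: (@cint_fubini1 _ _ _ _ _ mu2 mu (fun x : R3 R => f1 x.1.1 * f2 x.1.2 * f3 x.2)).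
under eq_cint do rewrite cintZl//.
under eq_cint do rewrite mulrC.
rewrite cintZl// mulrC; congr (_ * _).
transitivity (cint mu (fun x => cint mu (fun y => f1 x * f2 y))).
  exact: (@cint_fubini1 _ _ _ _ _ mu mu (fun x : R * R => f1 x.1 * f2 x.2)).
under eq_cint do rewrite cintZl//.
under eq_cint do rewrite mulrC.
by rewrite cintZl// mulrC.
Qed.

(** The exponent is two per coordinate: (1 + |x|)^6 dominates the product of the three factors 1 +
    x_i^2, whose inverses are integrable on the line. *)
Lemma integrable_decay : mu3.-integrable [set: R3 R] (EFin \o (fun x : R3 R => (1 + enorm x) ^- 6)).
Proof.
have i1 := @integrable_oneDsqrV R.
have p x : 0 <= (1 + x ^+ 2)^-1 :> R by rewrite invr_ge0 addr_ge0// sqr_ge0.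
apply: (le_integrable _ _ _ (integrable_prod3 i1 i1 i1 p p p)) => //.
  apply/measurable_EFinP.
  rewrite (_ : (fun _ => _) = (fun x => ((1 + x) ^+ 6)^-1) \o @enorm R)//.
  apply: measurableT_comp; last exact: (measurable_enorm measurable_id3).
  have mm : measurable_fun [set: R] (fun x : R => `|(1 + x) ^+ 6|^-1).
    have := @measurable_powR R (-1).
    move=> h; rewrite (_ : (fun _ => _) = (fun y => y `^ (-1)) \o (fun x : R => `|(1 + x) ^+ 6|)).
      apply: measurableT_comp => //; apply: measurableT_comp => //.
      by apply: measurable_funX; exact: measurable_funD.
    by apply/funext => x /=; rewrite powR_inv1.
  rewrite (_ : (fun _ => _) = (fun x : R => `|(1 + x) ^+ 6|^-1))//.
  by apply/funext => x; rewrite ger0_norm// exprn_even_ge0.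
move=> x _ /=; rewrite lee_fin ger0_norm ?invr_ge0 ?exprn_ge0 ?addr_ge0 ?enorm_ge0//.
rewrite ger0_norm ?mulr_ge0// -!invfM lef_pV2 ?posrE; last 2 first.
- by rewrite exprn_gt0// ltr_pwDl// enorm_ge0.
- by rewrite !mulr_gt0// ltr_pwDl// sqr_ge0.
have h i : 1 + coord3 x i ^+ 2 <= (1 + enorm x) ^+ 2.
  have h : coord3 x i ^+ 2 <= enorm x ^+ 2.
    by apply: sqr_le_norm; rewrite [leRHS]ger0_norm ?enorm_ge0// coord3_le_enorm.
  have := enorm_ge0 x; rewrite sqrrD; lra.
have -> : (1 + enorm x) ^+ 6 = (1 + enorm x) ^+ 2 * (1 + enorm x) ^+ 2 * (1 + enorm x) ^+ 2 by ring.
have p' i : 0 <= 1 + coord3 x i ^+ 2 by rewrite addr_ge0// sqr_ge0.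
apply: ler_pM; [exact: (mulr_ge0 (p' 0) (p' 1))|exact: (p' 2)| |exact: (h 2)].
by apply: ler_pM; [exact: (p' 0)|exact: (p' 1)|exact: (h 0)|exact: (h 1)].
Qed.

(** The indicator of the coordinate plane is a product of functions of one variable, one of them the
    indicator of a point, so its integral has a vanishing factor. *)
Lemma ae_coord3_neq0 i : {ae (@mu3 R), forall x : R3 R, coord3 x i != 0}.
Proof.
pose A := [set x : R3 R | coord3 x i = 0].
have mA : measurable A.
  have := @measurable_coord3 R i measurableT [set 0] (measurable_set1 0).
  by rewrite setTI.
exists A; split => //; last by move=> x /= /negP; rewrite negbK => /eqP.
pose Q (j : 'I_3) : R -> R := if j == i then \1_[set 0] else cst 1.
have mQ j : measurable_fun [set: R] (Q j).
  by rewrite /Q; case: ifP => _; [exact: measurable_indic|exact: measurable_cst].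
have Q0 j x : 0 <= Q j x by rewrite /Q; case: ifP.
have Qi : (\int[mu]_x (Q i x)%:E = 0)%E.
  by rewrite /Q eqxx integral_indic// setIT; exact: lebesgue_measure_set1.
rewrite -[A]setIT -integral_indic//.
transitivity (\int[mu3]_x (Q 0 x.1.1 * Q 1 x.1.2 * Q 2 x.2)%:E)%E.
  apply: eq_integral => x _; congr _%:E; rewrite indicE /A.
  have -> : (x \in [set x | coord3 x i = 0]) = (coord3 x i \in [set 0 : R]) by apply/idP/idP; rewrite !in_setE.
  by rewrite /Q; case: (I3P i) => -> /=; rewrite indicE ?mulr1 ?mul1r.
rewrite integral_prod3//.
by case: (I3P i) Qi => ->; move=> ->; rewrite ?mul0e ?mule0 ?mul0e.
Qed.

Lemma ae_enorm_gt0 : {ae (@mu3 R), forall x : R3 R, 0 < enorm x}.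
Proof.
apply: filterS (ae_coord3_neq0 0) => x h.
rewrite lt_neqAle enorm_ge0 andbT eq_sym enorm_eq0.
by apply: contra_neq h => ->; exact: coord3_0.
Qed.

End ProductIntegrals.

(** * Schwartz functions and their Fourier transforms *)

Section Differentiability.
Context {R : realType}.
Implicit Types x y : R3 R.

(** Fréchet differentiability from an explicit quadratic remainder. It serves for coordinates, for
    the flat point of [bump1] and for Fourier transforms, where such a bound is what the integral
    provides. *)
Lemma quadratic_is_diff (V : normedModType R) (f : V -> R) (L : {linear V -> R}) (x : V) (C : R) :
  continuous L -> (forall h, `|f (h + x) - f x - L h| <= C * `|h| ^+ 2) -> is_diff x f L.
Proof.
move=> cL hC.
have ho : f \o shift x = cst (f x) + L +o_ (0 : V) id.
  apply/eqaddoP => e e0; have [C0|C0] := leP C 0.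
    near=> h; rewrite /= !fctE /= opprD addrA.
    apply: le_trans (hC h) _; rewrite expr2 mulrA ler_wpM2r//.
    by apply: le_trans (ltW e0); rewrite mulr_le0_ge0.
  have Ce : 0 < C^-1 * e by rewrite mulr_gt0// invr_gt0.
  have := @nbhs0_le R V _ Ce; apply: filterS => h hh.
  rewrite /= !fctE /= opprD addrA.
  apply: le_trans (hC h) _; rewrite expr2 mulrA ler_wpM2r//.
  by rewrite -ler_pdivlMl.
have E := diff_unique cL ho.
apply: DiffDef => //; apply/diff_locallyP; rewrite E; split => //.
Unshelve. all: by end_near. Qed.

Section linear_dot.
Variable l : R3 R.
Lemma dot_is_linear : linear (dot l : R3 R -> R).
Proof. by move=> a x y; rewrite dotDr dotZr. Qed.
HB.instance Definition _ := GRing.isLinear.Build R (R3 R) R _ (dot l) dot_is_linear.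
Definition linear_dot : {linear R3 R -> R} := dot l.
Lemma continuous_dot : continuous (dot l : R3 R -> R).
Proof.
move=> x; apply/cvgrPdist_lt => e e0.
have M0 : 0 < 3 * (enorm l + 1) by rewrite mulr_gt0// ltr_wpDl// enorm_ge0.
near=> y; rewrite -dotNr -dotDr -/(x - y); apply: le_lt_trans (dot_le_enorm _ _) _.
apply: (@le_lt_trans _ _ ((enorm l + 1) * (3 * `|x - y|))).
  by apply: ler_pM; rewrite ?enorm_ge0 ?lerDl ?enorm_le_norm.
rewrite mulrA (mulrC _ 3) -ltr_pdivlMl//.
near: y; apply: cvgr_dist_lt; last by rewrite mulr_gt0// invr_gt0.
exact: cvg_id.
Unshelve. all: by end_near. Qed.
End linear_dot.

Lemma quadratic_diff3 (f : R3 R -> R) (l x : R3 R) (C : R) :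
  (forall h, `|f (h + x) - f x - dot l h| <= C * `|h| ^+ 2) -> is_diff x f (dot l).
Proof. move=> h; have hh := @quadratic_is_diff _ f (linear_dot l) x C (@continuous_dot l) h.
exact: hh. Qed.

Lemma is_diff_derive (f : R3 R -> R) (df : R3 R -> R) x v :
  is_diff x f df -> is_derive x v f (df v).
Proof.
move=> [dfx E]; apply: DeriveDef; first exact: diff_derivable.
by rewrite deriveE// E.
Qed.

Lemma quadratic_derive1 (f : R -> R) (l x : R) (C : R) :
  (forall h, `|f (h + x) - f x - l * h| <= C * `|h| ^+ 2) -> is_derive x 1 f l.
Proof.
move=> h.
have cl : continuous ( *%R l : R -> R) by exact: mulrl_continuous.
have [d E] := @quadratic_is_diff R^o f ( *:%R l : {linear R^o -> R^o}) x C cl h.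
apply: DeriveDef; first exact: diff_derivable.
rewrite deriveE//; have -> : 'd f x = *%R l :> (R -> R) := E.
by rewrite mulr1.
Qed.

Lemma is_diff_comp1 (g : R -> R) (phi : R3 R -> R) (x : R3 R) (g' : R) (dphi : R3 R -> R) :
  is_derive (phi x) 1 g g' -> is_diff x phi dphi ->
  is_diff x (g \o phi) (fun v => g' * dphi v).
Proof.
move=> [dg Eg] dp.
have dg' : differentiable g (phi x) by apply/derivable1_diffP.
have h := is_diff_comp dp (differentiableP dg').
apply: is_diff_eq h _; apply/funext => v /=.
by rewrite deriv1E// derive1E Eg /GRing.scale /= mulrC.
Qed.

Definition cdiff (f : R3 R -> R[i]) x := differentiable (fun y => Re (f y)) x /\
  differentiable (fun y => Im (f y)) x.

Definition is_pd (j : 'I_3) (f : R3 R -> R[i]) x (d : R[i]) :=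
  is_derive x (unit_vec j) (fun y => Re (f y)) (Re d) /\
  is_derive x (unit_vec j) (fun y => Im (f y)) (Im d).

Lemma is_pd_val j f x d : is_pd j f x d -> pderiv j f x = d.
Proof.
move=> [h1 h2]; apply: complex_eq; rewrite /pderiv /=; exact: derive_val.
Qed.

Lemma cdiff_is_pd j f x : cdiff f x -> is_pd j f x (pderiv j f x).
Proof.
by move=> [h1 h2]; split; apply: DeriveDef => //; exact: diff_derivable.
Qed.

Lemma pderiv_val j f g : (forall x, is_pd j f x (g x)) -> pderiv j f = g.
Proof. by move=> h; apply/funext => x; exact: is_pd_val. Qed.

Lemma cdiffD f g x : cdiff f x -> cdiff g x -> cdiff (fun y => f y + g y) x.
Proof.
move=> [f1 f2] [g1 g2]; split.
  by under eq_fun do rewrite ReD; exact: differentiableD.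
by under eq_fun do rewrite ImD; exact: differentiableD.
Qed.

Lemma is_pdD j f g x df dg : is_pd j f x df -> is_pd j g x dg ->
  is_pd j (fun y => f y + g y) x (df + dg).
Proof.
move=> [f1 f2] [g1 g2]; split.
  by under eq_fun do rewrite ReD; rewrite ReD; exact: is_deriveD.
by under eq_fun do rewrite ImD; rewrite ImD; exact: is_deriveD.
Qed.

Lemma cdiffM f g x : cdiff f x -> cdiff g x -> cdiff (fun y => f y * g y) x.
Proof.
move=> [f1 f2] [g1 g2]; split.
  under eq_fun do rewrite ReM.
  by apply: (@differentiableB _ _ _ (fun y => Re (f y) * Re (g y)) (fun y => Im (f y) * Im (g y)));
    exact: differentiableM.
under eq_fun do rewrite ImM.
by apply: (@differentiableD _ _ _ (fun y => Re (f y) * Im (g y)) (fun y => Im (f y) * Re (g y)));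
    exact: differentiableM.
Qed.

Lemma is_pdM j f g x df dg : is_pd j f x df -> is_pd j g x dg ->
  is_pd j (fun y => f y * g y) x (df * g x + f x * dg).
Proof.
move=> [f1 f2] [g1 g2]; split.
  under eq_fun do rewrite ReM.
  have h : is_derive x (unit_vec j) (fun y => Re (f y) * Re (g y) - Im (f y) * Im (g y)) _ :=
    is_deriveB (is_deriveM f1 g1) (is_deriveM f2 g2).
  by apply: is_derive_eq h _; rewrite ReD !ReM /GRing.scale /=; ring.
under eq_fun do rewrite ImM.
have h : is_derive x (unit_vec j) (fun y => Re (f y) * Im (g y) + Im (f y) * Re (g y)) _ :=
  is_deriveD (is_deriveM f1 g2) (is_deriveM f2 g1).
by apply: is_derive_eq h _; rewrite ImD !ImM /GRing.scale /=; ring.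
Qed.

Lemma cdiff_cst (c : R[i]) x : cdiff (fun=> c) x.
Proof. by split; exact: differentiable_cst. Qed.

Lemma is_pd_cst j (c : R[i]) x : is_pd j (fun=> c) x 0.
Proof. by split => /=; exact: is_derive_cst. Qed.

Lemma cdiff_conj f x : cdiff f x -> cdiff (fun y => conjc (f y)) x.
Proof.
move=> [f1 f2]; split; first by under eq_fun do rewrite Re_conj.
by under eq_fun do rewrite Im_conj; exact: differentiableN.
Qed.

Lemma is_pd_conj j f x df : is_pd j f x df -> is_pd j (fun y => conjc (f y)) x (conjc df).
Proof.
move=> [f1 f2]; split; first by under eq_fun do rewrite Re_conj; rewrite Re_conj.
by under eq_fun do rewrite Im_conj; rewrite Im_conj; exact: is_deriveN.
Qed.

Lemma cdiffR (h : R3 R -> R) x : differentiable h x -> cdiff (fun y => (h y)%:C) x.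
Proof. by move=> dh; split => //=; exact: differentiable_cst. Qed.

Lemma is_pdR j (h : R3 R -> R) x (d : R) : is_derive x (unit_vec j) h d ->
  is_pd j (fun y => (h y)%:C) x d%:C.
Proof. by move=> dh; split => //=; exact: is_derive_cst. Qed.

Lemma is_diff_affine_coord (s c : R) i x :
  is_diff x (fun y => s * coord3 y i + c) (dot (s *: unit_vec i)).
Proof.
apply: (@quadratic_diff3 _ _ _ 0) => h.
rewrite mul0r coord3D dotZl dot_unit_vec.
by rewrite (_ : _ - _ - _ = 0) ?normr0//; ring.
Qed.

Lemma is_diff_coord i x : is_diff x (fun y => coord3 y i) (dot (unit_vec i)).
Proof.
apply: (@quadratic_diff3 _ _ _ 0) => h.
rewrite mul0r coord3D dot_unit_vec.
by rewrite (_ : _ - _ - _ = 0) ?normr0//; ring.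
Qed.

Lemma is_diff_affine_map (f df : R3 R -> R) (a : R) (b x : R3 R) :
  is_diff (a *: x + b) f df -> is_diff x (fun y => f (a *: y + b)) (fun v => df (a *: v)).
Proof.
move=> h.
have hA : is_diff x (fun y : R3 R => a *: y + b) (fun v => a *: v).
  have h' : is_diff x (fun y : R3 R => a *: y + b) _ :=
    is_diffD (is_diffZ a (is_diff_id x)) (is_diff_cst b x).
  by apply: is_diff_eq h' _; apply/funext => v; rewrite /= addr0.
exact: (is_diff_comp hA h).
Qed.

Lemma cdiff_affine f (a : R) (b x : R3 R) : cdiff f (a *: x + b) ->
  cdiff (fun y => f (a *: y + b)) x.
Proof.
move=> [f1 f2]; split.
  by have [] := @is_diff_affine_map (fun y => Re (f y)) _ a b x (differentiableP f1).
by have [] := @is_diff_affine_map (fun y => Im (f y)) _ a b x (differentiableP f2).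
Qed.

Lemma is_pd_affine j f (a : R) (b x : R3 R) : cdiff f (a *: x + b) ->
  is_pd j (fun y => f (a *: y + b)) x (a%:C * pderiv j f (a *: x + b)).
Proof.
move=> [f1 f2]; split.
  have h := is_diff_derive (unit_vec j) (@is_diff_affine_map (fun y => Re (f y)) _ a b x (differentiableP f1)).
  apply: is_derive_eq h _; rewrite linearZ ReM /= mul0r subr0.
  by rewrite deriveE.
have h := is_diff_derive (unit_vec j) (@is_diff_affine_map (fun y => Im (f y)) _ a b x (differentiableP f2)).
apply: is_derive_eq h _; rewrite linearZ ImM /= mul0r addr0.
by rewrite deriveE.
Qed.

End Differentiability.

(** * Stability of the Schwartz space *)

Section SchwartzClosure.
Context {R : realType}.
Implicit Types f g : R3 R -> R[i].

Definition decays f := forall N : nat, exists C : R, forall x,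
  (1 + enorm x) ^+ N * normc (f x) <= C.

(** Coinduction: a class of differentiable, rapidly decaying functions that is stable under [pderiv]
    contains all iterated derivatives of its members. No Leibniz formula over multi-indices is
    needed. *)
Lemma schwartz_coind (P : (R3 R -> R[i]) -> Prop) :
  (forall f, P f -> [/\ forall x, cdiff f x, decays f & forall j, P (pderiv j f)]) ->
  forall f, P f -> is_schwartz f.
Proof.
move=> hP f Pf a.
have Pa : P (pderivs a f) by elim: a => //= j a ih; have [_ _] := hP _ ih; apply.
by have [h1 h2 _] := hP _ Pa; split.
Qed.

Lemma schwartz_cdiff f x : is_schwartz f -> cdiff f x.
Proof. by move=> /(_ [::]) [h _]; exact: h. Qed.

Lemma schwartz_decays f : is_schwartz f -> decays f.
Proof. by move=> /(_ [::]) []. Qed.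

Lemma base_gt0 (x : R3 R) : 0 < 1 + enorm x.
Proof. by rewrite ltr_pwDl// enorm_ge0. Qed.

Lemma baseX_ge0 N (x : R3 R) : 0 <= (1 + enorm x) ^+ N.
Proof. by rewrite exprn_ge0// ltW// base_gt0. Qed.

Lemma decays_ge0 f N : decays f -> exists2 C : R, 0 <= C &
  forall x, (1 + enorm x) ^+ N * normc (f x) <= C.
Proof.
move=> /(_ N)[C hC]; exists C => //.
apply: le_trans (hC 0); rewrite mulr_ge0 ?normc_ge0// exprn_ge0//.
by rewrite ltW// base_gt0.
Qed.

Lemma decaysD f g : decays f -> decays g -> decays (fun x => f x + g x).
Proof.
move=> df dg N; have [C hC] := df N; have [D hD] := dg N; exists (C + D) => x.
apply: le_trans (lerD (hC x) (hD x)); rewrite -mulrDr ler_wpM2l ?baseX_ge0//.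
exact: le_normcD.
Qed.

Lemma decaysM f g : decays f -> (exists C, forall x, normc (g x) <= C) ->
  decays (fun x => f x * g x).
Proof.
move=> df [D hD] N; have [C C0 hC] := decays_ge0 N df; exists (C * D) => x.
rewrite Normc.normcM mulrA; apply: ler_pM => //; last exact: normc_ge0.
by rewrite mulr_ge0 ?normc_ge0// exprn_ge0// ltW// base_gt0.
Qed.

Lemma decays_bounded f : decays f -> exists C, forall x, normc (f x) <= C.
Proof. by move=> /(_ 0)[C hC]; exists C => x; have := hC x; rewrite expr0 mul1r. Qed.

Lemma decays_coord f j : decays f -> decays (fun x => (coord3 x j)%:C * f x).
Proof.
move=> df N; have [C hC] := df N.+1; exists C => x; apply: le_trans (hC x).
rewrite Normc.normcM normcR exprSr -mulrA ler_wpM2l ?baseX_ge0//.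
rewrite ler_wpM2r ?normc_ge0//.
apply: le_trans (coord3_le_enorm _ _) _.
by rewrite lerDr.
Qed.

Lemma decays_affine f (a : R) (b : R3 R) : a != 0 -> decays f ->
  decays (fun x => f (a *: x + b)).
Proof.
move=> a0 df N; have [C C0 hC] := decays_ge0 N df.
(* Chosen so that 1 + |x| <= M (1 + |a x + b|). *)
pose M := 1 + (1 + enorm b) / `|a|.
have M0 : 0 <= M by rewrite addr_ge0// divr_ge0// addr_ge0// enorm_ge0.
exists (M ^+ N * C) => x; set y := a *: x + b.
have h : 1 + enorm x <= M * (1 + enorm y).
  have : enorm x <= (1 + enorm b) / `|a| * (1 + enorm y).
    rewrite mulrAC ler_pdivlMr ?normr_gt0// mulrC -enormZ.
    have -> : a *: x = y - b by rewrite /y addrK.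
    apply: le_trans (enormB _ _) _.
    by have := enorm_ge0 y; have := enorm_ge0 b; nra.
  by rewrite /M mulrDl mul1r; have := enorm_ge0 y; lra.
apply: (@le_trans _ _ ((M * (1 + enorm y)) ^+ N * normc (f y))).
  by rewrite ler_wpM2r ?normc_ge0// lerXn2r ?nnegrE ?mulr_ge0// ltW// base_gt0.
by rewrite exprMn -mulrA ler_wpM2l ?exprn_ge0.
Qed.

(** The derivative of a product mixes sums and products, that of a dilation brings a scalar; taken
    together, these forms are stable under [pderiv], so that one coinduction settles all the closure
    properties. *)
Inductive schwartz_closure : (R3 R -> R[i]) -> Prop :=
| SC_base f of is_schwartz f : schwartz_closure f
| SC_add f g of schwartz_closure f & schwartz_closure g :
    schwartz_closure (fun x => f x + g x)
| SC_mul f g of schwartz_closure f & schwartz_closure g :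
    schwartz_closure (fun x => f x * g x)
| SC_scale c f of schwartz_closure f : schwartz_closure (fun x => c * f x)
| SC_coord j f of schwartz_closure f :
    schwartz_closure (fun x => (coord3 x j)%:C * f x)
| SC_conj f of schwartz_closure f : schwartz_closure (fun x => conjc (f x))
| SC_affine f a b of a != 0 & schwartz_closure f :
    schwartz_closure (fun x => f (a *: x + b)).

Lemma schwartz_closureP f : schwartz_closure f -> is_schwartz f.
Proof.
apply: schwartz_coind => {}f; elim.
- move=> {}f hf; split; [by move=> x; exact: schwartz_cdiff|exact: schwartz_decays|].
  by move=> j; apply: SC_base; exact: is_schwartz_pderiv.
- move=> {}f g sf [df ef pf] sg [dg eg pg]; split.
  + by move=> x; exact: cdiffD.
  + exact: decaysD.
  + move=> j; rewrite (@pderiv_val _ j _ (fun x => pderiv j f x + pderiv j g x)); first exact: SC_add.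
    by move=> x; apply: is_pdD; exact: cdiff_is_pd.
- move=> {}f g sf [df ef pf] sg [dg eg pg]; split.
  + by move=> x; exact: cdiffM.
  + by apply: decaysM => //; exact: decays_bounded.
  + move=> j; rewrite (@pderiv_val _ j _ (fun x => pderiv j f x * g x + f x * pderiv j g x)).
      by apply: SC_add; exact: SC_mul.
    by move=> x; apply: is_pdM; exact: cdiff_is_pd.
- move=> c {}f sf [df ef pf]; split.
  + by move=> x; apply: cdiffM => //; exact: cdiff_cst.
  + under [X in decays X]eq_fun do rewrite mulrC.
    by apply: decaysM => //; exists (normc c).
  + move=> j; rewrite (@pderiv_val _ j _ (fun x => c * pderiv j f x)); first exact: SC_scale.
    move=> x; have := is_pdM (is_pd_cst j c x) (cdiff_is_pd j (df x)).
    by rewrite mul0r add0r.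
- move=> i {}f sf [df ef pf]; split.
  + move=> x; apply: cdiffM => //; apply: cdiffR.
    by have [] := is_diff_coord i x.
  + exact: decays_coord.
  + move=> j.
    rewrite (@pderiv_val _ j _ (fun x => (i == j)%:R * f x + (coord3 x i)%:C * pderiv j f x)).
      by apply: SC_add; [exact: SC_scale|exact: SC_coord].
    move=> x; have h := is_pdR (is_diff_derive (unit_vec j) (is_diff_coord i x)).
    have := is_pdM h (cdiff_is_pd j (df x)).
    by rewrite dot_unit_vec coord3_unit_vec (rmorph_nat (real_complex R)).
- move=> {}f sf [df ef pf]; split.
  + by move=> x; exact: cdiff_conj.
  + by move=> N; have [C hC] := ef N; exists C => x; rewrite normc_conj.
  + move=> j; rewrite (@pderiv_val _ j _ (fun x => conjc (pderiv j f x))); first exact: SC_conj.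
    by move=> x; apply: is_pd_conj; exact: cdiff_is_pd.
- move=> {}f a b a0 sf [df ef pf]; split.
  + by move=> x; exact: cdiff_affine.
  + exact: decays_affine.
  + move=> j; rewrite (@pderiv_val _ j _ (fun x => a%:C * pderiv j f (a *: x + b))).
      by apply: SC_scale; exact: SC_affine.
    by move=> x; exact: is_pd_affine.
Qed.

Lemma schwartzD f g : is_schwartz f -> is_schwartz g -> is_schwartz (fun x => f x + g x).
Proof. by move=> hf hg; apply: schwartz_closureP; apply: SC_add; exact: SC_base. Qed.
Lemma schwartzM f g : is_schwartz f -> is_schwartz g -> is_schwartz (fun x => f x * g x).
Proof. by move=> hf hg; apply: schwartz_closureP; apply: SC_mul; exact: SC_base. Qed.
Lemma schwartzZ c f : is_schwartz f -> is_schwartz (fun x => c * f x).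
Proof. by move=> hf; apply: schwartz_closureP; apply: SC_scale; exact: SC_base. Qed.
Lemma schwartz_coord j f : is_schwartz f -> is_schwartz (fun x => (coord3 x j)%:C * f x).
Proof. by move=> hf; apply: schwartz_closureP; apply: SC_coord; exact: SC_base. Qed.
Lemma schwartz_conj f : is_schwartz f -> is_schwartz (fun x => conjc (f x)).
Proof. by move=> hf; apply: schwartz_closureP; apply: SC_conj; exact: SC_base. Qed.
Lemma schwartz_affine f a b : a != 0 -> is_schwartz f -> is_schwartz (fun x => f (a *: x + b)).
Proof. by move=> a0 hf; apply: schwartz_closureP; apply: SC_affine => //; exact: SC_base. Qed.

Lemma schwartz_shift f b : is_schwartz f -> is_schwartz (fun x => f (x + b)).
Proof.
move=> /(schwartz_affine b (oner_neq0 R)).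
by under eq_fun do rewrite scale1r.
Qed.

Lemma schwartz_opp f : is_schwartz f -> is_schwartz (fun x => f (- x)).
Proof.
have h : -1 != 0 :> R by rewrite oppr_eq0 oner_neq0.
move=> /(schwartz_affine 0 h).
by under eq_fun do rewrite scaleN1r addr0.
Qed.

Lemma cdiff_continuous f : (forall x, cdiff f x) ->
  continuous (fun x => Re (f x)) /\ continuous (fun x => Im (f x)).
Proof.
by move=> df; split=> x; apply: differentiable_continuous; have [] := df x.
Qed.

End SchwartzClosure.

(** * Smooth compactly supported functions *)

Section Bumps.
Context {R : realType}.

(* The iterated derivatives of [t |-> exp (- 1 / t)], extended by zero, are
   linear combinations of these functions. *)
Definition bump1 (k : nat) (t : R) : R := if 0 < t then t ^- k * expR (- t^-1) else 0.

(** The m-th power of e^(y/m) >= 1 + y/m. With y = 1/t it beats the negative powers of t in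
    [bump1]. *)
Lemma expR_ge_pow (m : nat) (y : R) : (0 < m)%N -> 0 <= y -> (y / m%:R) ^+ m <= expR y.
Proof.
move=> m0 y0; have m0' : 0 < m%:R :> R by rewrite ltr0n.
have -> : expR y = expR (y / m%:R) ^+ m.
  by rewrite -expRM_natl -mulr_natl mulrCA divff ?mulr1// gt_eqF.
rewrite lerXn2r ?nnegrE ?expR_ge0 ?divr_ge0 ?(ltW m0')//.
by apply: le_trans (expR_ge1Dx _); rewrite lerDr.
Qed.

Lemma bump1_ge0 k t : 0 <= bump1 k t.
Proof.
rewrite /bump1; case: ifP => // t0; rewrite mulr_ge0 ?expR_ge0//.
by rewrite invr_ge0 exprn_ge0// ltW.
Qed.

Lemma bump1_neg k t : t <= 0 -> bump1 k t = 0.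
Proof. by rewrite /bump1 ltNge => ->. Qed.

Lemma bump1_bounded k : exists C, forall t, bump1 k t <= C.
Proof.
exists (k.+1%:R ^+ k.+1 + 1) => t; rewrite /bump1.
have c0 : 0 <= k.+1%:R ^+ k.+1 + 1 :> R by rewrite addr_ge0// exprn_ge0.
case: ifP => // t0.
have ti : 0 < t^-1 by rewrite invr_gt0.
have e1 : expR (- t^-1) <= 1 by rewrite -expR0 ler_expR oppr_le0 ltW.
have [t1|t1] := leP 1 t.
  apply: (@le_trans _ _ 1); last by rewrite lerDr exprn_ge0.
  rewrite -[leRHS]mulr1; apply: ler_pM; rewrite ?expR_ge0// ?invr_ge0 ?exprn_ge0 ?(ltW t0)//.
  by rewrite invf_le1 ?exprn_gt0// exprn_ege1.
apply: (@le_trans _ _ (k.+1%:R ^+ k.+1)); last by rewrite lerDl.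
have h := @expR_ge_pow k.+1 t^-1 (ltn0Sn k) (ltW ti).
rewrite expRN ler_pdivrMr ?expR_gt0//.
have k0 : 0 < k.+1%:R ^+ k.+1 :> R by rewrite exprn_gt0.
rewrite mulrC -ler_pdivrMr//; apply: le_trans h.
rewrite expr_div_n exprVn ler_pM2r ?invr_gt0//.
rewrite -!exprVn exprS ler_peMl ?exprn_ge0 ?(ltW ti)//.
by rewrite invf_ge1// ltW.
Qed.

(** Quadratic vanishing at 0, which gives the derivative 0 there. It is the boundedness of the
    member of the family with two more powers of 1/t. *)
Lemma bump1_le k : exists2 C, 0 <= C & forall t, bump1 k t <= C * t ^+ 2.
Proof.
have [C hC] := bump1_bounded k.+2; exists (Num.max C 0); first by rewrite le_max lexx orbT.
move=> t; have c0 : 0 <= Num.max C 0 by rewrite le_max lexx orbT.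
have := hC t; rewrite /bump1; case: ifP => t0 h; last by rewrite mulr_ge0// sqr_ge0.
rewrite -ler_pdivrMr ?exprn_gt0//; apply: (@le_trans _ _ C); last by rewrite le_max lexx.
apply: le_trans h.
by rewrite (_ : t ^- k.+2 = t ^- k / t ^+ 2) 1?mulrAC// -invfM -exprD addn2.
Qed.

Lemma is_derive_bump1 k (t : R) :
  is_derive t 1 (bump1 k) (bump1 k.+2 t - k%:R * bump1 k.+1 t).
Proof.
have [t0|t0|t0] := ltgtP t 0.
- rewrite !bump1_neg ?(ltW t0)// mulr0 subr0.
  apply: (@near_eq_is_derive _ _ _ (cst 0)) => //.
  near=> y; rewrite bump1_neg// ltW//; near: y.
  by apply: lt_nbhsl.
- have tn0 : t != 0 by rewrite gt_eqF.
  have d1 : is_derive t (1 : R) (fun t : R => t^-1) (- t ^- 2).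
    have := @is_deriveV R id t 1 1 tn0 (is_derive_id t (1 : R)).
    by rewrite /GRing.scale /= mulr1.
  have d2 : is_derive t (1 : R) (fun t : R => expR (- t^-1)) (expR (- t^-1) * t ^- 2).
    have := @is_derive1_comp R expR (fun t => - t^-1) t _ _ (is_derive_expR _) (is_deriveN d1).
    by rewrite opprK.
  have d3 : is_derive t (1 : R) (fun t : R => t ^- k) (- k%:R * t ^- k.+1).
    have h := is_deriveX k d1.
    rewrite exprfctE in h.
    under eq_fun do rewrite -exprVn.
    apply: is_derive_eq h _; rewrite /GRing.scale /= -!exprVn.
    by case: k => [|k]; rewrite ?oppr0 ?mul0r// succnK !exprS expr0; ring.
  have d4 : is_derive t (1 : R) (fun t : R => t ^- k * expR (- t^-1)) _ := is_deriveM d3 d2.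
  apply: (@near_eq_is_derive _ _ _ (fun t : R => t ^- k * expR (- t^-1))) => //.
    near=> y; rewrite /bump1 ifT//; near: y.
    by apply: lt_nbhsr.
  apply: is_derive_eq d4 _; rewrite /bump1 t0 /GRing.scale /= !exprS !invfM expr0 invr1.
  by ring.
- subst t; rewrite !bump1_neg// mulr0 subr0.
  have [C C0 hC] := bump1_le k.
  apply: (@quadratic_derive1 _ _ _ _ C) => h.
  rewrite addr0 [bump1 k 0]bump1_neg// subr0 mul0r subr0 ger0_norm ?bump1_ge0//.
  by rewrite real_normK ?num_real.
Unshelve. all: by end_near. Qed.

(** Stable under [pderiv], because the derivative of a [bump1] is a combination of [bump1]s. Its
    members are bounded but need not decay; decay will come from compact support. *)
Inductive bump_class : (R3 R -> R[i]) -> Prop :=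
| BC_bump k s c j : bump_class (fun x => (bump1 k (s * coord3 x j + c))%:C)
| BC_add f g of bump_class f & bump_class g : bump_class (fun x => f x + g x)
| BC_mul f g of bump_class f & bump_class g : bump_class (fun x => f x * g x)
| BC_scale c f of bump_class f : bump_class (fun x => c * f x).

Lemma bump_classP f : bump_class f ->
  [/\ forall x, cdiff f x, exists C, forall x, normc (f x) <= C & forall j, bump_class (pderiv j f)].
Proof.
elim.
- move=> k s c i.
  have h x : is_diff x (bump1 k \o (fun y : R3 R => s * coord3 y i + c)) _ :=
    is_diff_comp1 (is_derive_bump1 k _) (is_diff_affine_coord s c i x).
  split.
  + by move=> x; apply: cdiffR; case: (h x).
  + by have [C hC] := bump1_bounded k; exists C => x; rewrite normcR ger0_norm ?bump1_ge0.
  + move=> j; pose r := s * (i == j)%:R : R.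
    rewrite (@pderiv_val _ j _ (fun x => r%:C * ((bump1 k.+2 (s * coord3 x i + c))%:C +
       (- k%:R) * (bump1 k.+1 (s * coord3 x i + c))%:C))).
      by apply: BC_scale; apply: BC_add; [|apply: BC_scale]; exact: BC_bump.
    move=> x; have := is_pdR (is_diff_derive (unit_vec j) (h x)).
    rewrite dotZl dot_unit_vec coord3_unit_vec -/r.
    have -> // : ((bump1 k.+2 (s * coord3 x i + c) - k%:R * bump1 k.+1 (s * coord3 x i + c)) * r)%:C
      = r%:C * ((bump1 k.+2 (s * coord3 x i + c))%:C - k%:R * (bump1 k.+1 (s * coord3 x i + c))%:C).
      by rewrite rmorphM rmorphB rmorphM rmorph_nat mulrC.
    by rewrite mulNr.
- move=> {}f g sf [df [C hC] pf] sg [dg [D hD] pg]; split.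
  + by move=> x; exact: cdiffD.
  + by exists (C + D) => x; apply: le_trans (le_normcD _ _) (lerD (hC x) (hD x)).
  + move=> j; rewrite (@pderiv_val _ j _ (fun x => pderiv j f x + pderiv j g x)); first exact: BC_add.
    by move=> x; apply: is_pdD; exact: cdiff_is_pd.
- move=> {}f g sf [df [C hC] pf] sg [dg [D hD] pg]; split.
  + by move=> x; exact: cdiffM.
  + by exists (C * D) => x; rewrite Normc.normcM; apply: ler_pM; rewrite ?normc_ge0.
  + move=> j; rewrite (@pderiv_val _ j _ (fun x => pderiv j f x * g x + f x * pderiv j g x)).
      by apply: BC_add; exact: BC_mul.
    by move=> x; apply: is_pdM; exact: cdiff_is_pd.
- move=> c {}f sf [df [C hC] pf]; split.
  + by move=> x; apply: cdiffM => //; exact: cdiff_cst.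
  + by exists (normc c * C) => x; rewrite Normc.normcM ler_wpM2l ?normc_ge0.
  + move=> j; rewrite (@pderiv_val _ j _ (fun x => c * pderiv j f x)); first exact: BC_scale.
    move=> x; have := is_pdM (is_pd_cst j c x) (cdiff_is_pd j (df x)).
    by rewrite mul0r add0r.
Qed.

Lemma compactly_supported_pderiv j (f : R3 R -> R[i]) :
  compactly_supported f -> compactly_supported (pderiv j f).
Proof.
move=> [r hr]; exists r => x rx.
have nx : \forall y \near x, f y = 0.
  have := @continuous_enorm R x; move=> /cvgrPdist_lt /(_ (enorm x - r)).
  rewrite subr_gt0 => /(_ rx); apply: filterS => y; rewrite ltr_norml => /andP[_ h].
  by apply: hr; lra.
apply: is_pd_val; split.
- apply: (@near_eq_is_derive _ _ _ (cst 0)) => //.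
  by apply: filterS nx => y ->.
- apply: (@near_eq_is_derive _ _ _ (cst 0)) => //.
  by apply: filterS nx => y ->.
Qed.

(** On the support any power of 1 + |x| is bounded, so that boundedness of all derivatives, supplied
    by [bump_class], is already rapid decay. *)
Lemma compactly_supported_schwartz (f : R3 R -> R[i]) :
  bump_class f -> compactly_supported f -> is_schwartz f.
Proof.
move=> bf cf; apply: (@schwartz_coind _ (fun f => bump_class f /\ compactly_supported f)) => //.
move=> {bf cf} {}f [bf cf]; have [df [C hC] pf] := bump_classP bf; split => //.
- move=> N; have [r hr] := cf; exists ((1 + `|r|) ^+ N * `|C|) => x.
  have [rx|rx] := ltP r (enorm x).
    by rewrite hr// Normc.normc0 mulr0 mulr_ge0// exprn_ge0// addr_ge0.
  apply: ler_pM; rewrite ?baseX_ge0 ?normc_ge0//.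
    rewrite lerXn2r ?nnegrE ?addr_ge0 ?enorm_ge0// lerD2l.
    by apply: le_trans rx (ler_norm _).
  by apply: le_trans (hC x) (ler_norm _).
- by move=> j; split; [exact: pf|exact: compactly_supported_pderiv].
Qed.

(* Smooth, supported in the box [l, r], and tending to its indicator function
   as [n] grows. *)
Definition box_bump (n : R) (l r : 'I_3 -> R) (x : R3 R) : R[i] :=
  (bump1 0 (n * coord3 x 0 + - (n * l 0)) * bump1 0 (- n * coord3 x 0 + n * r 0) *
   (bump1 0 (n * coord3 x 1 + - (n * l 1)) * bump1 0 (- n * coord3 x 1 + n * r 1)) *
   (bump1 0 (n * coord3 x 2 + - (n * l 2)) * bump1 0 (- n * coord3 x 2 + n * r 2)))%:C.

Lemma bump_class_box n l r : bump_class (box_bump n l r).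
Proof.
rewrite /box_bump; under eq_fun do rewrite !rmorphM /=.
by repeat first [exact: BC_bump|apply: BC_mul].
Qed.

Lemma box_bump_support n l r x : 0 < n ->
  (exists i, coord3 x i <= l i \/ r i <= coord3 x i) -> box_bump n l r x = 0.
Proof.
move=> n0 [i h].
have : bump1 0 (n * coord3 x i + - (n * l i)) * bump1 0 (- n * coord3 x i + n * r i) = 0.
  case: h => h.
    by rewrite bump1_neg ?mul0r// -mulrBr pmulr_rle0// subr_le0.
  by rewrite [X in _ * X]bump1_neg ?mulr0// addrC mulNr -mulrBr pmulr_rle0// subr_le0.
by rewrite /box_bump; case: (I3P i) => -> ->; rewrite ?mul0r ?mulr0 ?mul0r.
Qed.

Lemma box_bump_compact n l r : 0 < n -> compactly_supported (box_bump n l r).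
Proof.
move=> n0; exists (\sum_(i < 3) (`|l i| + `|r i|)) => x hx.
apply: box_bump_support => //.
have [i hi] : exists i, `|l i| + `|r i| < `|coord3 x i|.
  apply/not_existsP => h; move: hx; apply/negP; rewrite -leNgt.
  apply: le_trans (enorm_le_sum x) _; apply: ler_sum => i _.
  by rewrite leNgt; apply/negP; exact: h.
exists i; have := ler_norm (r i); have := ler_norm (- l i); rewrite normrN.
have [c0|c0] := leP 0 (coord3 x i) => h1 h2.
  by right; move: hi; rewrite (ger0_norm c0) => h; have := normr_ge0 (l i); lra.
by left; move: hi; rewrite (ltr0_norm c0) => h; have := normr_ge0 (r i); lra.
Qed.

Lemma box_bump_schwartz n l r : 0 < n -> is_schwartz (box_bump n l r).
Proof.
move=> n0; apply: compactly_supported_schwartz; first exact: bump_class_box.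
exact: box_bump_compact.
Qed.

Lemma bump10_le1 t : bump1 0 t <= 1.
Proof.
rewrite /bump1; case: ifP => // t0; rewrite expr0 invr1 mul1r -expR0 ler_expR.
by rewrite oppr_le0 invr_ge0 ltW.
Qed.

Lemma normc_box_bump n l r x : normc (box_bump n l r x) <= 1.
Proof.
have h a b : 0 <= bump1 0 a * bump1 0 b <= 1.
  by rewrite mulr_ge0 ?bump1_ge0//= mulr_ile1 ?bump1_ge0 ?bump10_le1.
rewrite normcR ger0_norm; last by rewrite !mulr_ge0 ?bump1_ge0.
have h1 a b : bump1 0 a * bump1 0 b <= 1 by have /andP[] := h a b.
have h0 a b : 0 <= bump1 0 a * bump1 0 b by have /andP[] := h a b.
set a := _ * bump1 0 _; set b := bump1 0 _ * bump1 0 _; set c := bump1 0 _ * bump1 0 _.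
have [a0 a1] : 0 <= a /\ a <= 1 by split; [exact: h0|exact: h1].
have [b0 b1] : 0 <= b /\ b <= 1 by split; [exact: h0|exact: h1].
have [c0 c1] : 0 <= c /\ c <= 1 by split; [exact: h0|exact: h1].
by apply: mulr_ile1 => //; [exact: mulr_ge0|exact: mulr_ile1].
Qed.

Lemma bump10_cvg (t : R) : 0 < t -> bump1 0 (n.+1%:R * t) @[n --> \oo] --> (1 : R).
Proof.
move=> t0.
have -> : (fun n : nat => bump1 0 (n.+1%:R * t)) = (fun n : nat => expR (- (t^-1 * harmonic n))).
  apply/funext => n; rewrite /bump1 mulr_gt0// expr0 invr1 mul1r.
  by rewrite /harmonic invfM mulrC.
rewrite -expR0; apply: continuous_cvg; first exact: continuous_expR.
rewrite -oppr0 -[X in - X](mulr0 t^-1); apply: cvgN; apply: cvgMr; exact: cvg_harmonic.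
Qed.

Lemma box_bump_cvg l r x : (forall i, l i < coord3 x i < r i) ->
  Re (box_bump n.+1%:R l r x) @[n --> \oo] --> (1 : R).
Proof.
move=> h.
have c i : bump1 0 (n.+1%:R * coord3 x i + - (n.+1%:R * l i)) *
    bump1 0 (- n.+1%:R * coord3 x i + n.+1%:R * r i) @[n --> \oo] --> (1 : R).
  have /andP[h1 h2] := h i; rewrite -[X in _ --> X](mulr1 1); apply: cvgM.
    under eq_cvg do rewrite -mulrBr.
    by apply: bump10_cvg; rewrite subr_gt0.
  under eq_cvg do rewrite addrC mulNr -mulrBr.
  by apply: bump10_cvg; rewrite subr_gt0.
rewrite /box_bump /= -[X in _ --> X](mulr1 1).
apply: cvgM; last exact: (c 2).
by rewrite -[X in _ --> X](mulr1 1); apply: cvgM; [exact: (c 0)|exact: (c 1)].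
Qed.

End Bumps.

(** * Limits of complex sequences *)

Section ComplexLimits.
Context {R : realType}.
Implicit Types u v : nat -> R[i].

Definition ccvg u (l : R[i]) : Prop := normc (u n - l) @[n --> \oo] --> (0 : R).

Lemma ccvgP u l : ccvg u l <-> Re (u n) @[n --> \oo] --> Re l /\ Im (u n) @[n --> \oo] --> Im l.
Proof.
split=> [h|[h1 h2]].
  split; apply/cvgrPdist_le => e e0; move/cvgrPdist_le: h => /(_ _ e0);
    apply: filterS => n; rewrite sub0r normrN ger0_norm ?normc_ge0// => h.
    by apply: le_trans h; rewrite distrC -ReN -ReD; exact: Re_le_normc.
  by apply: le_trans h; rewrite distrC -ImN -ImD; exact: Im_le_normc.
have h3 : `|Re (u n) - Re l| + `|Im (u n) - Im l| @[n --> \oo] --> (0 : R).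
  rewrite -[X in _ --> X](addr0 0); apply: cvgD.
    by apply/norm_cvg0P; apply/subr_cvg0.
  by apply/norm_cvg0P; apply/subr_cvg0.
apply: (squeeze_cvgr _ (cvg_cst 0) h3); apply: nearW => n.
rewrite normc_ge0/=; apply: le_trans (normc_le _) _.
by rewrite ReD ReN ImD ImN.
Qed.

Lemma ccvg_cst l : ccvg (fun=> l) l.
Proof. by rewrite /ccvg; under eq_fun do rewrite subrr Normc.normc0; exact: cvg_cst. Qed.

Lemma ccvg_unique u l m : ccvg u l -> ccvg u m -> l = m.
Proof.
move=> /ccvgP[h1 h2] /ccvgP[h3 h4]; apply: complex_eq.
  exact: (cvg_unique _ h1 h3).
exact: (cvg_unique _ h2 h4).
Qed.

Lemma ccvgD u v l m : ccvg u l -> ccvg v m -> ccvg (fun n => u n + v n) (l + m).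
Proof.
move=> /ccvgP[h1 h2] /ccvgP[h3 h4]; apply/ccvgP; split.
  by under eq_cvg do rewrite ReD; rewrite ReD; exact: cvgD.
by under eq_cvg do rewrite ImD; rewrite ImD; exact: cvgD.
Qed.

Lemma ccvgM u v l m : ccvg u l -> ccvg v m -> ccvg (fun n => u n * v n) (l * m).
Proof.
move=> /ccvgP[h1 h2] /ccvgP[h3 h4]; apply/ccvgP; split.
  by under eq_cvg do rewrite ReM; rewrite ReM; apply: cvgB; exact: cvgM.
by under eq_cvg do rewrite ImM; rewrite ImM; apply: cvgD; exact: cvgM.
Qed.

Lemma ccvgR (u : nat -> R) (l : R) : u n @[n --> \oo] --> l ->
  ccvg (fun n => (u n)%:C) l%:C.
Proof. by move=> h; apply/ccvgP; split => //=; exact: cvg_cst. Qed.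

Lemma ccvg_le u l (v : nat -> R) : (forall n, normc (u n - l) <= v n) ->
  v n @[n --> \oo] --> (0 : R) -> ccvg u l.
Proof.
move=> h cv; apply: (squeeze_cvgr _ (cvg_cst 0) cv); apply: nearW => n.
by rewrite normc_ge0 h.
Qed.

Lemma ccvg_eq u v l : u =1 v -> ccvg u l -> ccvg v l.
Proof. by move=> /funext ->. Qed.

Lemma cint_dctc_ae {d} {T : measurableType d} (mu : {measure set T -> \bar R})
  (f_ : nat -> T -> R[i]) (f : T -> R[i]) (h : T -> R) :
  (forall n, cmeas (f_ n)) -> cmeas f ->
  {ae mu, forall x, ccvg (f_^~ x) (f x)} ->
  mu.-integrable [set: T] (EFin \o h) ->
  {ae mu, forall x, forall n, normc (f_ n x) <= h x} ->
  ccvg (fun n => cint mu (f_ n)) (cint mu f).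
Proof.
move=> mf_ mf cf ih fh; apply/ccvgP; apply: (cint_dct mf_ mf _ ih fh).
have F := ae_filter_ringOfSetsType mu.
by apply: filterS cf => x /ccvgP.
Qed.

Lemma cint_dctc {d} {T : measurableType d} (mu : {measure set T -> \bar R})
  (f_ : nat -> T -> R[i]) (f : T -> R[i]) (h : T -> R) :
  (forall n, cmeas (f_ n)) -> cmeas f ->
  {ae mu, forall x, ccvg (f_^~ x) (f x)} ->
  mu.-integrable [set: T] (EFin \o h) ->
  (forall n x, normc (f_ n x) <= h x) ->
  ccvg (fun n => cint mu (f_ n)) (cint mu f).
Proof.
move=> mf_ mf cf ih fh; apply: (cint_dctc_ae mf_ mf cf ih).
have F := ae_filter_ringOfSetsType mu.
exact: nearW.
Qed.

(** Lets a derivative, a limit along a punctured neighbourhood, be evaluated along a sequence, as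
    dominated convergence requires. *)
Lemma cvg_harmonic_dnbhs : (harmonic : nat -> R) @ \oo --> (0 : R)^'.
Proof.
move=> A A0; have h : nbhs (0 : R) [set x | x != 0 -> A x] := A0.
have h2 : \forall n \near \oo, harmonic n != 0 :> R -> A (harmonic n) := @cvg_harmonic R _ h.
rewrite /nbhs /=; apply: filterS h2 => n; apply.
by rewrite /harmonic gt_eqF// invr_gt0.
Qed.

Lemma cvgM_harmonic (C : R) : C * harmonic n @[n --> \oo] --> (0 : R).
Proof. by rewrite -[X in _ --> X](mulr0 C); apply: cvgMr; exact: cvg_harmonic. Qed.

End ComplexLimits.

(** * Measurability of continuous functions *)

Section ContinuousMeasurable.
Context {R : realType}.

(** Balls of the sup norm are cubes, hence measurable; those with rational centre and radius that
    lie in [U] cover it. If the ball of radius e around x is in [U], a centre within e/8 of x and a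
    radius between e/4 and 3e/4 do. *)
Lemma open_measurable3 (U : set (R3 R)) : open U -> measurable U.
Proof.
move=> oU.
pose q3 (q : rat * rat * rat) : R3 R := (ratr q.1.1, ratr q.1.2, ratr q.2).
pose B (i : rat * rat * rat * rat) : set (R3 R) :=
  if `[< ball (q3 i.1) (ratr i.2 : R) `<=` U >] then ball (q3 i.1) (ratr i.2 : R) else set0.
have -> : U = \bigcup_i B i.
  apply/seteqP; split => x; last first.
    by move=> [i _]; rewrite /B; case: asboolP => // h hx; exact: h.
  move=> Ux; have /nbhs_ballP[e /= e0 be] : nbhs x U by exact: open_nbhs_nbhs.
  have [r [rb [r' _ rE]]] : (ball (e / 2) (e / 4) `&` (@ratr R @` setT)) !=set0.
    by apply: dense_rat; [exists (e / 2); apply: ballxx; rewrite divr_gt0|exact: ball_open].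
  have hq (a : R) : exists q : rat, `|a - ratr q| < e / 8.
    have [q [qb [q' _ qE]]] : (ball a (e / 8) `&` (@ratr R @` setT)) !=set0.
      by apply: dense_rat; [exists a; apply: ballxx; rewrite divr_gt0|exact: ball_open].
    by exists q'; move: qb; rewrite /ball /= qE.
  have [q1 h1] := hq x.1.1; have [q2 h2] := hq x.1.2; have [q4 h4] := hq x.2.
  move: rb; rewrite /ball /= -rE ltr_norml => /andP[r1 r2].
  exists ((q1, q2, q4), r') => //; rewrite /B /=.
  have xb : ball (q3 (q1, q2, q4)) (ratr r' : R) x.
    by split; [split|]; rewrite /ball /= distrC; lra.
  rewrite ifT//; apply/asboolP => y [[y1 y2] y3]; apply: be.
  move: y1 y2 y3; rewrite /ball /= => y1 y2 y3.
  split; [split|]; rewrite /ball /=.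
  - by rewrite (_ : x.1.1 - y.1.1 = (x.1.1 - ratr q1) + (ratr q1 - y.1.1)); [apply: le_lt_trans (ler_normD _ _) _; lra|ring].
  - by rewrite (_ : x.1.2 - y.1.2 = (x.1.2 - ratr q2) + (ratr q2 - y.1.2)); [apply: le_lt_trans (ler_normD _ _) _; lra|ring].
  - by rewrite (_ : x.2 - y.2 = (x.2 - ratr q4) + (ratr q4 - y.2)); [apply: le_lt_trans (ler_normD _ _) _; lra|ring].
apply: (countable_bigcupT_measurable (countableP _)) => i; rewrite /B; case: ifP => // _.
have -> : ball (q3 i.1) (ratr i.2 : R) = (ball (q3 i.1).1.1 (ratr i.2 : R) `*` ball (q3 i.1).1.2 (ratr i.2 : R))
     `*` ball (q3 i.1).2 (ratr i.2 : R).
  by apply/seteqP; split.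
by apply: measurableX; [apply: measurableX|]; exact: measurable_ball.
Qed.

Lemma continuous_measurable3 (f : R3 R -> R) : continuous f -> measurable_fun [set: R3 R] f.
Proof.
move=> /continuousP cf; apply: (measurability _ (RGenOpens.measurableE R)).
move=> _ [_ [a [b ->] <-]]; rewrite setTI; apply: open_measurable3.
exact/cf/interval_open.
Qed.

Lemma schwartz_cmeas (f : R3 R -> R[i]) : is_schwartz f -> cmeas f.
Proof.
move=> sf; have [c1 c2] := cdiff_continuous (fun x => schwartz_cdiff x sf).
by split; exact: continuous_measurable3.
Qed.

Lemma decays_integrable (f : R3 R -> R[i]) N : cmeas f -> decays f ->
  mu3.-integrable [set: R3 R] (EFin \o (fun x => (1 + enorm x) ^+ N * normc (f x))).
Proof.
move=> mf df; have [C C0 hC] := decays_ge0 (N + 6) df.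
have i1 := integrableZl measurableT C (@integrable_decay R).
apply: (le_integrable _ _ _ i1) => //.
  apply/measurable_EFinP; apply: measurable_funM; last exact: measurable_normc.
  by apply: measurable_funX; apply: measurable_funD => //; exact: (measurable_enorm measurable_id3).
move=> x _ /=; rewrite lee_fin !ger0_norm ?mulr_ge0 ?baseX_ge0 ?normc_ge0 ?invr_ge0 ?baseX_ge0//.
by rewrite ler_pdivlMr ?exprn_gt0 ?base_gt0// mulrAC -exprD.
Qed.

Lemma decays_cintegrable (f : R3 R -> R[i]) : cmeas f -> decays f -> cintegrable mu3 f.
Proof.
move=> mf df; apply: (le_cintegrable _ _ (decays_integrable 0 mf df)) => [|x]; first exact: mf.
by rewrite expr0 mul1r.
Qed.

Lemma schwartz_cintegrable (f : R3 R -> R[i]) : is_schwartz f -> cintegrable mu3 f.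
Proof.
by move=> sf; apply: decays_cintegrable; [exact: schwartz_cmeas|exact: schwartz_decays].
Qed.

End ContinuousMeasurable.

(** * The Fourier transform of Schwartz functions *)

Section FourierSchwartz.
Context {R : realType}.
Implicit Types (f g : R3 R -> R[i]) (x xi : R3 R).

Lemma fourierE f xi : fourier f xi = cint mu3 (fun x => expi (- dot x xi) * f x).
Proof. by []. Qed.

Lemma cmeas_char (xi : R3 R) (s : R) : cmeas (fun x : R3 R => expi (s * dot x xi)).
Proof.
apply: cmeas_expi; apply: measurable_funM => //.
by apply: measurable_dot; [exact: measurable_id3|exact: measurable_cst].
Qed.

Lemma cmeas_charN (xi : R3 R) : cmeas (fun x : R3 R => expi (- dot x xi)).
Proof.
apply: cmeas_expi; apply: measurable_funN.
by apply: measurable_dot; [exact: measurable_id3|exact: measurable_cst].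
Qed.

Lemma cintegrable_char f (h : R3 R -> R[i]) : cmeas h -> (forall x, normc (h x) <= 1) ->
  cintegrable mu3 f -> cintegrable mu3 (fun x => h x * f x).
Proof.
move=> mh h1 if_; apply: (le_cintegrable _ _ (cintegrable_normc if_)).
  by apply: cmeasM => //; exact: (cintegrable_cmeas if_).
by move=> x; rewrite Normc.normcM ler_piMl ?normc_ge0.
Qed.

Lemma fourier_integrand f xi : cintegrable mu3 f ->
  cintegrable mu3 (fun x => expi (- dot x xi) * f x).
Proof.
apply: cintegrable_char; first exact: cmeas_charN.
by move=> x; rewrite normc_expi.
Qed.

Lemma fourierD f g xi : cintegrable mu3 f -> cintegrable mu3 g ->
  fourier (fun x => f x + g x) xi = fourier f xi + fourier g xi.
Proof.
move=> if_ ig; rewrite !fourierE -cintD; [|exact: fourier_integrand|exact: fourier_integrand].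
by apply: eq_cint => x; rewrite mulrDr.
Qed.

Lemma fourierZ c f xi : cintegrable mu3 f ->
  fourier (fun x => c * f x) xi = c * fourier f xi.
Proof.
move=> if_; rewrite !fourierE -cintZl; last exact: fourier_integrand.
by apply: eq_cint => x; rewrite mulrCA.
Qed.

Lemma fourier_conj f xi : cintegrable mu3 f ->
  fourier (fun x => conjc (f x)) xi = conjc (fourier f (- xi)).
Proof.
move=> if_; rewrite !fourierE -cint_conj; last exact: fourier_integrand.
by apply: eq_cint => x; rewrite conjcM -expiN dotNr opprK.
Qed.

Lemma fourier_opp f xi : cintegrable mu3 f ->
  fourier (fun x => f (- x)) xi = fourier f (- xi).
Proof.
move=> if_; rewrite !fourierE.
rewrite -[RHS]mul1r -(rescales_cint rescales3_opp (fourier_integrand (- xi) if_)).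
by apply: eq_cint => x; rewrite dotNl dotNr opprK.
Qed.

Lemma fourier_shift f b xi : cintegrable mu3 f ->
  fourier (fun x => f (x + b)) xi = expi (dot b xi) * fourier f xi.
Proof.
move=> if_; rewrite !fourierE.
have h := rescales_cint (rescales3_shift b) (fourier_integrand xi if_).
rewrite mul1r in h; rewrite -h -cintZl.
  by apply: eq_cint => x; rewrite dotDl opprD expiD !mulrA [_ * expi (- dot x xi)]mulrC -!mulrA
     (mulrA (expi (dot b xi))) expi_mulN mul1r.
exact: (rescales_cintegrable (rescales3_shift b) (fourier_integrand xi if_)).
Qed.

Lemma normc_fourier f xi : cintegrable mu3 f -> normc (fourier f xi) <= \int[mu3]_x normc (f x).
Proof.
move=> if_; rewrite fourierE; apply: cint_le; [exact: fourier_integrand|exact: cintegrable_normc|].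
by move=> x; rewrite Normc.normcM normc_expi mul1r.
Qed.

Lemma cmeas_fourier f : cmeas f -> cmeas (fourier f).
Proof.
move=> mf; apply: (@cmeas_cint2 _ _ _ _ _ mu3 (fun z : R3 R * R3 R => expi (- dot z.2 z.1) * f z.2)).
apply: cmeasM; last exact: (cmeas_comp mf measurable_snd).
apply: cmeas_expi; apply: measurable_funN; apply: measurable_dot.
  exact: measurable_snd.
exact: measurable_fst.
Qed.

(** Multiplication by -i x_j, which the Fourier transform turns into the derivative in the direction
    j. *)
Definition mulix (j : 'I_3) f (x : R3 R) : R[i] := - 'i * ((coord3 x j)%:C * f x).

Lemma schwartz_mulix j f : is_schwartz f -> is_schwartz (mulix j f).
Proof. by move=> sf; apply: schwartzZ; exact: schwartz_coord. Qed.

(** Second-order expansion of the character under the integral sign. The constant is 2 from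
    [expi_taylor2] times the square of the 3 that compares the Euclidean norm of h with its sup
    norm. *)
Lemma fourier_quadratic f xi : is_schwartz f -> exists C : R, forall h,
  normc (fourier f (h + xi) - fourier f xi -
    \sum_(j < 3) (coord3 h j)%:C * fourier (mulix j f) xi) <= C * `|h| ^+ 2.
Proof.
move=> sf; have if_ := schwartz_cintegrable sf.
have i2 := decays_integrable 2 (schwartz_cmeas sf) (schwartz_decays sf).
exists (18 * \int[mu3]_x ((1 + enorm x) ^+ 2 * normc (f x))) => h.
pose E x := expi (- dot x h) - 1 - 'i * (- dot x h)%:C.
have mE : cmeas E.
  apply: cmeasB; first by apply: cmeasB; [exact: cmeas_charN|exact: cmeas_cst].
  apply: cmeasM; first exact: cmeas_cst.
  apply: cmeasR; apply: measurable_funN.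
  by apply: measurable_dot; [exact: measurable_id3|exact: measurable_cst].
have bE x : normc (E x * (expi (- dot x xi) * f x)) <=
    18 * `|h| ^+ 2 * ((1 + enorm x) ^+ 2 * normc (f x)).
  rewrite !Normc.normcM normc_expi mul1r mulrA ler_wpM2r ?normc_ge0//.
  apply: le_trans (expi_taylor2 _) _; rewrite sqrrN.
  have d1 : dot x h ^+ 2 <= (enorm x * (3 * `|h|)) ^+ 2.
    apply: sqr_le_norm; rewrite [leRHS]ger0_norm ?mulr_ge0 ?enorm_ge0//.
    apply: le_trans (dot_le_enorm _ _) _.
    by rewrite ler_wpM2l ?enorm_ge0 ?enorm_le_norm.
  have d2 : enorm x ^+ 2 <= (1 + enorm x) ^+ 2.
    by rewrite lerXn2r ?nnegrE ?addr_ge0 ?enorm_ge0// lerDr.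
  rewrite !exprMn in d1.
  have h2 : 0 <= `|h| ^+ 2 by rewrite exprn_ge0.
  by nra.
have iE : cintegrable mu3 (fun x => E x * (expi (- dot x xi) * f x)).
  apply: (@le_cintegrable _ _ _ mu3 _ (fun x => 18 * `|h| ^+ 2 * ((1 + enorm x) ^+ 2 * normc (f x)))).
  - by apply: cmeasM; [exact: mE|exact: (cintegrable_cmeas (fourier_integrand xi if_))].
  - exact: bE.
  have := integrableZl measurableT (18 * `|h| ^+ 2) i2.
  by apply: eq_integrable => // x _ /=; rewrite EFinM.
have -> : fourier f (h + xi) - fourier f xi -
    \sum_(j < 3) (coord3 h j)%:C * fourier (mulix j f) xi =
    cint mu3 (fun x => E x * (expi (- dot x xi) * f x)).
  have ij j := schwartz_cintegrable (schwartz_mulix j sf).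
  under eq_bigr => j _ do rewrite fourierE -(cintZl _ (fourier_integrand xi (ij j))).
  rewrite -cint_sum; last by move=> j; apply: cintegrableZl; exact: fourier_integrand.
  rewrite !fourierE -cintB; [|exact: fourier_integrand|exact: fourier_integrand].
  rewrite -cintB; last 2 first.
  - by apply: cintegrableD; [|apply: cintegrableN]; exact: fourier_integrand.
  - by apply: cintegrable_sum => j; apply: cintegrableZl; exact: fourier_integrand.
  apply: eq_cint => x; rewrite dotDr opprD expiD /E.
  have -> : \sum_(j < 3) (coord3 h j)%:C * (expi (- dot x xi) * mulix j f x) =
     - 'i * (dot x h)%:C * (expi (- dot x xi) * f x).
    rewrite /dot rmorph_sum mulr_sumr mulr_suml; apply: eq_bigr => j _.
    by rewrite /mulix rmorphM /=; ring.
  by rewrite rmorphN /=; ring.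
apply: le_trans (cint_le iE _ bE) _.
  have := integrableZl measurableT (18 * `|h| ^+ 2) i2.
  by apply: eq_integrable => // x _ /=; rewrite EFinM.
by rewrite RintegralZl// mulrAC.
Qed.

Lemma cquadratic_cdiff (F : R3 R -> R[i]) xi (a : 'I_3 -> R[i]) (C : R) :
  (forall h, normc (F (h + xi) - F xi - \sum_(j < 3) (coord3 h j)%:C * a j) <= C * `|h| ^+ 2) ->
  cdiff F xi /\ forall j, is_pd j F xi (a j).
Proof.
move=> hC.
pose l1 : R3 R := (Re (a 0), Re (a 1), Re (a 2)).
pose l2 : R3 R := (Im (a 0), Im (a 1), Im (a 2)).
have d1 : is_diff xi (fun y => Re (F y)) (dot l1).
  apply: (@quadratic_diff3 _ _ _ _ C) => h; apply: le_trans (hC h).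
  apply: le_trans (Re_le_normc _); rewrite !ReD !ReN sum3 !ReD !ReMr dotE /l1 /=.
  by rewrite !coord0E !coord1E !coord2E !(mulrC (Re _)).
have d2 : is_diff xi (fun y => Im (F y)) (dot l2).
  apply: (@quadratic_diff3 _ _ _ _ C) => h; apply: le_trans (hC h).
  apply: le_trans (Im_le_normc _); rewrite !ImD !ImN sum3 !ImD !ImMr dotE /l2 /=.
  by rewrite !coord0E !coord1E !coord2E !(mulrC (Im _)).
split; first by split; [case: d1|case: d2].
move=> j; split.
  have := is_diff_derive (unit_vec j) d1; rewrite dotC dot_unit_vec.
  by case: (I3P j) => ->.
have := is_diff_derive (unit_vec j) d2; rewrite dotC dot_unit_vec.
by case: (I3P j) => ->.
Qed.

Lemma fourier_cdiff f xi : is_schwartz f -> cdiff (fourier f) xi /\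
  forall j, is_pd j (fourier f) xi (fourier (mulix j f) xi).
Proof.
by move=> sf; have [C hC] := fourier_quadratic xi sf; exact: cquadratic_cdiff hC.
Qed.

Lemma pderiv_fourier j f : is_schwartz f -> pderiv j (fourier f) = fourier (mulix j f).
Proof. by move=> sf; apply: pderiv_val => xi; have [_] := fourier_cdiff xi sf. Qed.

Lemma is_derive_line (f : R3 R -> R) (x v : R3 R) (t : R) : differentiable f (x + t *: v) ->
  is_derive t 1 (fun s : R => f (x + s *: v)) ('D_v f (x + t *: v)).
Proof.
move=> df.
have hA : is_diff t (fun s : R => x + s *: v) (fun s => s *: v).
  have hs : is_diff t (fun s : R => s *: v) (fun s => s *: v).
    have di : differentiable (id : R -> R) t by [].
    apply: DiffDef; first exact: differentiableZl.
    by rewrite diffZl// diff_val.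
  have h : is_diff t (fun s : R => x + s *: v) _ := is_diffD (is_diff_cst x t) hs.
  by apply: is_diff_eq h _; apply/funext => s; rewrite !fctE /= add0r.
have [h1 h2] := is_diff_comp hA (differentiableP df).
apply: DeriveDef; first exact: diff_derivable.
rewrite deriveE//.
have -> : 'd (fun s : R => f (x + s *: v)) t = ('d f (x + t *: v) \o (fun s : R => s *: v)) :> (R -> R) := h2.
by rewrite /= scale1r deriveE.
Qed.

Lemma MVT_line (f : R3 R -> R) (x v : R3 R) (a : R) : 0 < a -> (forall y, differentiable f y) ->
  exists2 c, 0 < c < a & f (x + a *: v) - f x = a * 'D_v f (x + c *: v).
Proof.
move=> a0 df; have [||c] := @MVT R (fun s => f (x + s *: v)) (fun s => 'D_v f (x + s *: v)) 0 a a0.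
- by move=> s _; exact: is_derive_line.
- apply: derivable_within_continuous => s _; by have [] := is_derive_line (df (x + s *: v)).
rewrite in_itv/= => h; rewrite subr0 scale0r addr0 => ->.
by exists c => //; rewrite mulrC.
Qed.

Definition diffquot j f (n : nat) x : R[i] :=
  (harmonic n)^-1%:C * (f (x + harmonic n *: unit_vec j) - f x).

Lemma diffquot_cvg j f x : is_schwartz f -> ccvg (fun n => diffquot j f n x) (pderiv j f x).
Proof.
move=> sf; have [d1 d2] := schwartz_cdiff x sf.
have e1 : derivable (fun y => Re (f y)) x (unit_vec j) by exact: diff_derivable.
have e2 : derivable (fun y => Im (f y)) x (unit_vec j) by exact: diff_derivable.
apply/ccvgP; split; rewrite /pderiv /=.
  have /cvg_ex[l hl] := e1.
  rewrite /derive (cvg_lim _ hl)//.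
  have := cvg_comp _ _ (@cvg_harmonic_dnbhs R) hl; apply: cvg_trans.
  apply: near_eq_cvg; apply: nearW => n; rewrite /diffquot ReMr ReD ReN.
  by rewrite /= [_ + x]addrC invrK.
have /cvg_ex[l hl] := e2.
rewrite /derive (cvg_lim _ hl)//.
have := cvg_comp _ _ (@cvg_harmonic_dnbhs R) hl; apply: cvg_trans.
apply: near_eq_cvg; apply: nearW => n; rewrite /diffquot ImMr ImD ImN.
by rewrite /= [_ + x]addrC invrK.
Qed.

(** By the mean value theorem, applied to the real and the imaginary part (hence the factor 2). The
    intermediate point y is at distance at most 1 from x, so that 1 + |x| <= 2 (1 + |y|), which
    costs 2^6. *)
Lemma diffquot_bound j f : is_schwartz f -> exists C, forall n x,
  normc (diffquot j f n x) <= C * (1 + enorm x) ^- 6.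
Proof.
move=> sf; have [C C0 hC] := decays_ge0 6 (schwartz_decays (is_schwartz_pderiv j sf)).
exists (2 * (2 ^+ 6 * C)) => n x; set a : R := harmonic n.
have a0 : 0 < a by rewrite /a /harmonic invr_gt0.
have a1 : a <= 1 by rewrite /a /harmonic invf_le1// ler1n.
have key c : 0 < c < a -> normc (pderiv j f (x + c *: unit_vec j)) <= 2 ^+ 6 * C * (1 + enorm x) ^- 6.
  move=> /andP[c0 ca]; set y := x + _.
  have h : 1 + enorm x <= 2 * (1 + enorm y).
    have -> : x = y - c *: unit_vec j by rewrite /y addrK.
    have := enormB y (c *: unit_vec j); rewrite enormZ (gtr0_norm c0).
    have -> : enorm (unit_vec j : R3 R) = 1.
      by rewrite /enorm dot_unit_vec coord3_unit_vec eqxx sqrtr1.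
    by have := enorm_ge0 y; lra.
  rewrite ler_pdivlMr ?exprn_gt0 ?base_gt0// mulrC.
  apply: (@le_trans _ _ ((2 * (1 + enorm y)) ^+ 6 * normc (pderiv j f y))).
    by rewrite ler_wpM2r ?normc_ge0// lerXn2r ?nnegrE ?mulr_ge0 ?addr_ge0 ?enorm_ge0.
  by rewrite exprMn -mulrA ler_wpM2l ?exprn_ge0.
rewrite /diffquot Normc.normcM normcR ger0_norm ?invr_ge0 ?(ltW a0)// -/a.
rewrite ler_pdivrMl//; apply: le_trans (normc_le _) _; rewrite ReD ImD ReN ImN.
have [c1 h1 ->] := @MVT_line (fun y => Re (f y)) x (unit_vec j) a a0 (fun y => (schwartz_cdiff y sf).1).
have [c2 h2 ->] := @MVT_line (fun y => Im (f y)) x (unit_vec j) a a0 (fun y => (schwartz_cdiff y sf).2).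
rewrite !normrM (gtr0_norm a0) -mulrDr ler_pM2l//.
rewrite -mulrA mulr_natl mulr2n; apply: lerD.
  by apply: le_trans (key _ h1); exact: (Re_le_normc (pderiv j f (x + c1 *: unit_vec j))).
by apply: le_trans (key _ h2); exact: (Im_le_normc (pderiv j f (x + c2 *: unit_vec j))).
Qed.

(** Difference quotients in place of integration by parts: a translation becomes multiplication by a
    character, so the transform of [diffquot] is explicit, and it also converges to the transform of
    the derivative by dominated convergence. *)
Lemma fourier_pderiv j f xi : is_schwartz f ->
  fourier (pderiv j f) xi = 'i * (coord3 xi j)%:C * fourier f xi.
Proof.
move=> sf; have if_ := schwartz_cintegrable sf.
have [C hC] := diffquot_bound j sf.
have iq n : cintegrable mu3 (diffquot j f n).
  apply: cintegrableZl; apply: cintegrableD; last exact: cintegrableN.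
  by apply: schwartz_cintegrable; exact: schwartz_shift.
have h1 : ccvg (fun n => fourier (diffquot j f n) xi) (fourier (pderiv j f) xi).
  apply: (@cint_dctc _ _ _ mu3 _ _ (fun x => C * (1 + enorm x) ^- 6)).
  - by move=> n; exact: cintegrable_cmeas (fourier_integrand xi (iq n)).
  - apply: cmeasM; first exact: cmeas_charN.
    by apply: schwartz_cmeas; exact: is_schwartz_pderiv.
  - apply: nearW => x; apply: ccvgM; first exact: ccvg_cst.
    exact: diffquot_cvg.
  - have := integrableZl measurableT C (@integrable_decay R).
    by apply: eq_integrable => // x _ /=; rewrite EFinM.
  - by move=> n x; rewrite Normc.normcM normc_expi mul1r.
apply: (ccvg_unique h1).
apply: (@ccvg_le _ _ _ (fun n => (2 * coord3 xi j ^+ 2 * normc (fourier f xi)) * harmonic n)); last first.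
  exact: cvgM_harmonic.
move=> n; set a : R := harmonic n.
have a0 : 0 < a by rewrite /a /harmonic invr_gt0.
have -> : fourier (diffquot j f n) xi = a^-1%:C * ((expi (a * coord3 xi j) - 1) * fourier f xi).
  have is_ := schwartz_cintegrable (schwartz_shift (a *: unit_vec j) sf).
  rewrite /diffquot -/a fourierZ; last by apply: cintegrableD => //; exact: cintegrableN.
  congr (_ * _); under [X in fourier X]eq_fun do rewrite -[- f _]mulN1r.
  rewrite fourierD//; last exact: cintegrableZl.
  by rewrite fourierZ// fourier_shift// dotZl dot_unit_vec mulrBl mul1r mulN1r.
have -> : a^-1%:C * ((expi (a * coord3 xi j) - 1) * fourier f xi) - 'i * (coord3 xi j)%:C * fourier f xi
   = a^-1%:C * ((expi (a * coord3 xi j) - 1 - 'i * (a * coord3 xi j)%:C) * fourier f xi).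
  have aK : a^-1%:C * a%:C = 1 by rewrite -rmorphM /= mulVf// gt_eqF.
  rewrite [in RHS]rmorphM /= [in RHS]mulrBl [in RHS]mulrBr; congr (_ - _).
  rewrite (_ : (a^-1)%:C * ('i * (a%:C * (coord3 xi j)%:C) * fourier f xi) =
    (a^-1)%:C * a%:C * ('i * (coord3 xi j)%:C * fourier f xi)); last by ring.
  by rewrite aK mul1r.
rewrite !Normc.normcM normcR ger0_norm ?invr_ge0 ?(ltW a0)//.
rewrite ler_pdivrMl//; have := expi_taylor2 (a * coord3 xi j).
have := normc_ge0 (fourier f xi); rewrite exprMn => h0 h.
by apply: le_trans (ler_wpM2r h0 h) _; rewrite le_eqVlt; apply/orP; left; apply/eqP; ring.
Qed.

Lemma pow_sum4 (N : nat) (a b c d : R) : 0 <= a -> 0 <= b -> 0 <= c -> 0 <= d ->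
  (a + b + c + d) ^+ N <= 4 ^+ N * (a ^+ N + b ^+ N + c ^+ N + d ^+ N).
Proof.
move=> a0 b0 c0 d0.
have h2 (x y : R) : 0 <= x -> 0 <= y -> (x + y) ^+ N <= 2 ^+ N * (x ^+ N + y ^+ N).
  move=> x0 y0; wlog xy : x y x0 y0 / x <= y => [h|].
    by have [/h|/ltW/h] := leP x y; [apply|rewrite addrC [X in _ * X]addrC; apply].
  apply: (@le_trans _ _ ((2 * y) ^+ N)).
    by rewrite lerXn2r ?nnegrE ?addr_ge0 ?mulr_ge0//; lra.
  by rewrite exprMn ler_wpM2l ?exprn_ge0// lerDr exprn_ge0.
rewrite -addrA; apply: le_trans (h2 _ _ (addr_ge0 a0 b0) (addr_ge0 c0 d0)) _.
rewrite (_ : 4 = 2 * 2 :> R) ?exprMn -?mulrA; last by ring.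
rewrite ler_wpM2l ?exprn_ge0// -addrA mulrDr.
by apply: lerD; exact: h2.
Qed.

Lemma schwartz_pderiv_iter j f N : is_schwartz f -> is_schwartz (iter N (pderiv j) f).
Proof. by move=> sf; elim: N => //= N ih; exact: is_schwartz_pderiv. Qed.

Lemma fourier_pderiv_iter j f N xi : is_schwartz f ->
  fourier (iter N (pderiv j) f) xi = ('i * (coord3 xi j)%:C) ^+ N * fourier f xi.
Proof.
move=> sf; elim: N => [|N ih]; first by rewrite mul1r.
by rewrite iterS fourier_pderiv ?ih ?exprS ?mulrA//; exact: schwartz_pderiv_iter.
Qed.

Lemma normcX (z : R[i]) n : normc (z ^+ n) = normc z ^+ n.
Proof. by elim: n => [|n ih]; rewrite ?Normc.normc1// !exprS Normc.normcM ih. Qed.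

(** Pure derivatives along the axes suffice, since (1 + |xi|)^N is at most 4^N (1 + the sum of the
    |xi_j|^N). The bound is kept explicit because it has to tend to 0 along sequences of functions
    later. *)
Lemma fourier_decay_bound f N xi : is_schwartz f ->
  (1 + enorm xi) ^+ N * normc (fourier f xi) <= 4 ^+ N * (\int[mu3]_x normc (f x) +
    \int[mu3]_x normc (iter N (pderiv 0) f x) + \int[mu3]_x normc (iter N (pderiv 1) f x) +
    \int[mu3]_x normc (iter N (pderiv 2) f x)).
Proof.
move=> sf.
have b j : `|coord3 xi j| ^+ N * normc (fourier f xi) <= \int[mu3]_x normc (iter N (pderiv j) f x).
  have := normc_fourier xi (schwartz_cintegrable (schwartz_pderiv_iter j N sf)).
  by rewrite fourier_pderiv_iter// Normc.normcM normcX Normc.normcM normc_i mul1r normcR.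
have b0 := normc_fourier xi (schwartz_cintegrable sf).
have h : (1 + enorm xi) ^+ N <= 4 ^+ N * (1 + `|coord3 xi 0| ^+ N + `|coord3 xi 1| ^+ N + `|coord3 xi 2| ^+ N).
  apply: le_trans (_ : (1 + `|coord3 xi 0| + `|coord3 xi 1| + `|coord3 xi 2|) ^+ N <= _).
    rewrite lerXn2r ?nnegrE ?addr_ge0 ?enorm_ge0//.
    by have := enorm_le_sum xi; rewrite sum3; lra.
  by apply: le_trans (pow_sum4 _ _ _ _ _) _ => //; rewrite expr1n.
apply: le_trans (ler_wpM2r (normc_ge0 _) h) _.
rewrite -mulrA ler_wpM2l ?exprn_ge0// !mulrDl mul1r.
by apply: lerD (b 2); apply: lerD (b 1); apply: lerD (b 0).
Qed.

Lemma fourier_decays f : is_schwartz f -> decays (fourier f).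
Proof. by move=> sf N; eexists => xi; exact: fourier_decay_bound. Qed.

Lemma fourier_schwartz f : is_schwartz f -> is_schwartz (fourier f).
Proof.
move=> sf; apply: (@schwartz_coind _ (fun h => exists2 f, is_schwartz f & h = fourier f)); last by exists f.
move=> _ [g sg ->]; split.
- by move=> x; have [] := fourier_cdiff x sg.
- exact: fourier_decays.
- by move=> j; rewrite pderiv_fourier//; exists (mulix j g) => //; exact: schwartz_mulix.
Qed.

End FourierSchwartz.

(** * Fourier inversion *)

Section TensorFubini.
Context {d1 d2} {T1 : measurableType d1} {T2 : measurableType d2} {R : realType}.
Variables (m1 : {sigma_finite_measure set T1 -> \bar R})
          (m2 : {sigma_finite_measure set T2 -> \bar R}).

Lemma cintegrable_tonelli (f : T1 * T2 -> R[i]) : cmeas f ->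
  (\int[m1]_x \int[m2]_y (normc (f (x, y)))%:E < +oo)%E -> cintegrable (m1 \x m2)%E f.
Proof.
move=> mf fi; apply/cintegrableP; split => //; rewrite fubini_tonelli1//.
  exact/measurable_EFinP/measurable_normc.
by move=> x; rewrite lee_fin normc_ge0.
Qed.

Lemma cintegrable_tensor (f : T1 -> R[i]) (g : T2 -> R[i]) :
  cintegrable m1 f -> cintegrable m2 g ->
  cintegrable (m1 \x m2)%E (fun z => f z.1 * g z.2).
Proof.
move=> if_ ig; have [/measurable_normc nf /measurable_normc ng] := (cintegrable_cmeas if_, cintegrable_cmeas ig).
apply: cintegrable_tonelli.
  apply: cmeasM.
    exact: (cmeas_comp (cintegrable_cmeas if_) measurable_fst).
  exact: (cmeas_comp (cintegrable_cmeas ig) measurable_snd).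
under eq_integral => x _.
  under eq_integral do rewrite /= Normc.normcM EFinM.
  rewrite ge0_integralZl//; last 3 first.
  - exact/measurable_EFinP.
  - by move=> z _; rewrite lee_fin normc_ge0.
  - by rewrite lee_fin normc_ge0.
  rewrite -(EFin_Rintegral (cintegrable_normc ig)).
  over.
rewrite ge0_integralZr//; last 3 first.
- exact/measurable_EFinP.
- by move=> z _; rewrite lee_fin normc_ge0.
- by rewrite lee_fin; apply: Rintegral_ge0 => x _; exact: normc_ge0.
by rewrite -(EFin_Rintegral (cintegrable_normc if_)) -EFinM ltry.
Qed.

End TensorFubini.

Section FourierInversion.
Context {R : realType}.
Implicit Types (f g : R3 R -> R[i]) (x y xi : R3 R).
Notation T3 := (measurableTypeR R * measurableTypeR R * measurableTypeR R)%type.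

Lemma fourier_mult f g : cintegrable mu3 f -> cintegrable mu3 g ->
  cint mu3 (fun xi => fourier f xi * g xi) = cint mu3 (fun y => f y * fourier g y).
Proof.
move=> if_ ig.
pose F (z : R3 R * R3 R) := expi (- dot z.2 z.1) * (g z.1 * f z.2).
have iF : cintegrable (mu3 \x mu3)%E F.
  have it := cintegrable_tensor ig if_.
  apply: (le_cintegrable _ _ (cintegrable_normc it)).
    apply: cmeasM; last exact: (cintegrable_cmeas it).
    apply: cmeas_expi; apply: measurable_funN; apply: measurable_dot.
      exact: measurable_snd.
    exact: measurable_fst.
  by move=> z; rewrite /F Normc.normcM normc_expi mul1r.
transitivity (cint mu3 (fun xi => cint mu3 (fun y => F (xi, y)))).
  apply: eq_cint => xi; rewrite fourierE mulrC -cintZl; last exact: fourier_integrand.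
  by apply: eq_cint => y; rewrite /F mulrCA.
transitivity (cint mu3 (fun y => cint mu3 (fun xi => F (xi, y)))).
  exact: (@cint_fubini _ _ _ _ _ mu3 mu3 F iF).
apply: eq_cint => y; rewrite fourierE -cintZl; last exact: fourier_integrand.
by apply: eq_cint => xi; rewrite /F /= (dotC y xi); ring.
Qed.

(* The summability kernel of the inversion formula. *)
Definition kexp (x : R3 R) : R := expabs x.1.1 * expabs x.1.2 * expabs x.2.
Definition kcauchy (x : R3 R) : R :=
  2 / (1 + x.1.1 ^+ 2) * (2 / (1 + x.1.2 ^+ 2)) * (2 / (1 + x.2 ^+ 2)).

Lemma kexp_ge0 x : 0 <= kexp x.
Proof. by rewrite /kexp !mulr_ge0// expR_ge0. Qed.

Lemma expabs_le1 (t : R) : expabs t <= 1.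
Proof. by rewrite /expabs -expR0 ler_expR oppr_le0. Qed.

Lemma kexp_le1 x : kexp x <= 1.
Proof.
rewrite /kexp; apply: mulr_ile1; rewrite ?mulr_ge0 ?expR_ge0 ?expabs_le1//.
by apply: mulr_ile1; rewrite ?expR_ge0 ?expabs_le1.
Qed.

Lemma kcauchy_ge0 x : 0 <= kcauchy x.
Proof. by rewrite /kcauchy !mulr_ge0// ?invr_ge0 addr_ge0// sqr_ge0. Qed.

Lemma integrable_kexp : mu3.-integrable [set: R3 R] (EFin \o kexp).
Proof. by apply: integrable_prod3; try exact: integrable_expabs; move=> x; exact: expR_ge0. Qed.

Lemma cintegrable_kexp : cintegrable mu3 (fun x => (kexp x)%:C).
Proof.
have mk := measurable_int _ (integrable_kexp).
apply: (le_cintegrable _ _ integrable_kexp).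
  by apply: cmeasR; exact/measurable_EFinP.
by move=> x; rewrite normcR ger0_norm ?kexp_ge0.
Qed.

Lemma integrable_cauchy1 : (@mu1 R).-integrable [set: R] (EFin \o (fun t : R => 2 / (1 + t ^+ 2))).
Proof. by have := integrableZl measurableT 2 (@integrable_oneDsqrV R); apply: eq_integrable. Qed.

Lemma integrable_kcauchy : mu3.-integrable [set: R3 R] (EFin \o kcauchy).
Proof.
apply: (integrable_prod3 integrable_cauchy1 integrable_cauchy1 integrable_cauchy1);
  by move=> x; rewrite mulr_ge0// invr_ge0 addr_ge0// sqr_ge0.
Qed.

Lemma integral_kcauchy : (\int[mu3]_x (kcauchy x)%:E = ((2 * pi) ^+ 3)%:E)%E.
Proof.
have m1 : measurable_fun [set: R] (fun t : R => 2 / (1 + t ^+ 2)).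
  by apply/measurable_EFinP; exact: (measurable_int _ integrable_cauchy1).
have e1 : (\int[@mu1 R]_t (2 / (1 + t ^+ 2))%:E = (2 * pi)%:E)%E.
  rewrite EFinM -integral_oneDsqrV -ge0_integralZl//.
  - by apply/measurable_EFinP; apply/measurable_EFinP; exact: (measurable_int _ (@integrable_oneDsqrV R)).
  - by move=> t _; rewrite lee_fin invr_ge0 addr_ge0// sqr_ge0.
have p t : 0 <= 2 / (1 + t ^+ 2) :> R by rewrite mulr_ge0// invr_ge0 addr_ge0// sqr_ge0.
have := integral_prod3 m1 m1 m1 p p p; rewrite e1 => ->.
by rewrite -!EFinM; congr _%:E; ring.
Qed.

Lemma fourier_kexp xi : fourier (fun x => (kexp x)%:C) xi = (kcauchy xi)%:C.
Proof.
transitivity (cint mu3 (fun x : R3 R => (expi (- (x.1.1 * xi.1.1)) * (expabs x.1.1)%:C) *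
  (expi (- (x.1.2 * xi.1.2)) * (expabs x.1.2)%:C) * (expi (- (x.2 * xi.2)) * (expabs x.2)%:C))).
  apply: eq_cint => x; rewrite dotE !opprD !expiD /kexp !rmorphM /=; ring.
have h := @cint_prod3 R (fun t => expi (- (t * xi.1.1)) * (expabs t)%:C)
  (fun t => expi (- (t * xi.1.2)) * (expabs t)%:C) (fun t => expi (- (t * xi.2)) * (expabs t)%:C)
  (cintegrable_expabs _) (cintegrable_expabs _) (cintegrable_expabs _).
by rewrite [LHS]h !fourier_expabs /kcauchy !rmorphM.
Qed.

(** A damped character. Its transform is an approximate identity around x, of total mass (2 pi)^3,
    as e tends to 0. *)
Definition kmod (e : R) x xi : R[i] := expi (dot x xi) * (kexp (e *: xi))%:C.

Lemma cintegrable_kmod e x : 0 < e -> cintegrable mu3 (kmod e x).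
Proof.
move=> e0; apply: cintegrable_char.
- by have := cmeas_char x 1; under eq_fun do rewrite mul1r dotC.
- by move=> y; rewrite normc_expi.
- have := rescales_cintegrable (rescales3_affine 0 e0) cintegrable_kexp.
  by under eq_fun do rewrite addr0.
Qed.

Lemma fourier_kmod e x y : 0 < e ->
  fourier (kmod e x) y = (e ^- 3 * kcauchy (e^-1 *: (y - x)))%:C.
Proof.
move=> e0; rewrite rmorphM /= -fourier_kexp !fourierE.
rewrite -(rescales_cint (rescales3_affine 0 e0) (fourier_integrand _ cintegrable_kexp)).
apply: eq_cint => xi; rewrite /kmod addr0 mulrA -expiD; congr (expi _ * _).
rewrite dotZl dotZr mulrA divff ?gt_eqF// mul1r dotDr dotNr (dotC x); ring.
Qed.

Lemma harmonic_gt0' n : 0 < harmonic n :> R.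
Proof. by rewrite /harmonic invr_gt0. Qed.

Lemma kexp_cvg xi : kexp (harmonic n *: xi) @[n --> \oo] --> (1 : R).
Proof.
have h (t : R) : expabs (harmonic n * t) @[n --> \oo] --> (1 : R).
  have -> : (1 : R) = expabs 0 by rewrite /expabs normr0 oppr0 expR0.
  apply: continuous_cvg; first exact: continuous_expabs.
  by under eq_cvg do rewrite mulrC; exact: cvgM_harmonic.
by rewrite -[X in _ --> X](mulr1 1); apply: cvgM; [rewrite -[X in _ --> X](mulr1 1); apply: cvgM|]; exact: h.
Qed.

Lemma cmeas_kmod e x : cmeas (kmod e x).
Proof.
apply: cmeasM; first by have := cmeas_char x 1; under eq_fun do rewrite mul1r dotC.
apply: cmeasR.
have mk : measurable_fun [set: R3 R] kexp by apply/measurable_EFinP; exact: (measurable_int _ integrable_kexp).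
by apply: (measurableT_comp mk); apply: measurable_R3Z; exact: measurable_id3.
Qed.

Lemma normc_kmod e x xi : normc (kmod e x xi) <= 1.
Proof. by rewrite Normc.normcM normc_expi mul1r normcR ger0_norm ?kexp_ge0// kexp_le1. Qed.

Lemma schwartz_ccvg_line f x z : is_schwartz f -> ccvg (fun n => f (harmonic n *: z + x)) (f x).
Proof.
move=> sf; have [c1 c2] := cdiff_continuous (fun y => schwartz_cdiff y sf).
have h : harmonic n *: z + x @[n --> \oo] --> (0 : R) *: z + x.
  by apply: cvgD; [apply: cvgZr_tmp; exact: cvg_harmonic|exact: cvg_cst].
rewrite scale0r add0r in h.
by apply/ccvgP; split; [exact: (cvg_comp _ _ h (c1 x))|exact: (cvg_comp _ _ h (c2 x))].
Qed.

(** Two limits of one sequence. The damped inversion integrals converge to the undamped one; by the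
    multiplication formula they are also averages of f against rescaled Cauchy kernels concentrating
    at x. *)
Lemma fourier_inversion_cint f x : is_schwartz f ->
  cint mu3 (fun xi => expi (dot x xi) * fourier f xi) = ((2 * pi) ^+ 3)%:C * f x.
Proof.
move=> sf; have if_ := schwartz_cintegrable sf.
have sF := fourier_schwartz sf; have iF := schwartz_cintegrable sF.
have [Cf hf] := decays_bounded (schwartz_decays sf).
pose u n := cint mu3 (fun xi => fourier f xi * kmod (harmonic n) x xi).
have u1 : ccvg u (cint mu3 (fun xi => expi (dot x xi) * fourier f xi)).
  apply: (@cint_dctc _ _ _ mu3 _ _ (fun xi => normc (fourier f xi))).
  - by move=> n; apply: cmeasM; [exact: (cintegrable_cmeas iF)|exact: cmeas_kmod].
  - apply: cmeasM; last exact: (cintegrable_cmeas iF).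
    by have := cmeas_char x 1; under eq_fun do rewrite mul1r dotC.
  - apply: nearW => xi; rewrite mulrC; apply: ccvgM; first exact: ccvg_cst.
    rewrite -[X in ccvg _ X]mulr1; apply: ccvgM; first exact: ccvg_cst.
    by apply: ccvgR; exact: kexp_cvg.
  - exact: cintegrable_normc.
  - by move=> n xi; rewrite Normc.normcM ler_piMr ?normc_ge0// normc_kmod.
have u2 : ccvg u (cint mu3 (fun z => f x * (kcauchy z)%:C)).
  have -> : u = (fun n => cint mu3 (fun z => f (harmonic n *: z + x) * (kcauchy z)%:C)).
    apply/funext => n; have e0 := harmonic_gt0' n; set e := harmonic n in e0 *.
    rewrite /u fourier_mult//; last exact: cintegrable_kmod.
    have ig : cintegrable mu3 (fun y => f y * fourier (kmod e x) y).
      have [C hC] : exists C, forall y, normc (fourier (kmod e x) y) <= C.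
        by exists (\int[mu3]_y normc (kmod e x y)) => y; apply: normc_fourier; exact: cintegrable_kmod.
      have := integrableZl measurableT C (cintegrable_normc if_).
      apply: le_cintegrable.
        apply: cmeasM; first exact: (cintegrable_cmeas if_).
        by apply: cmeas_fourier; exact: cmeas_kmod.
      by move=> y; rewrite Normc.normcM mulrC; apply: ler_wpM2r; [exact: normc_ge0|exact: hC].
    have h := rescales_cint (rescales3_affine x e0) ig.
    have e3 : e ^+ 3 != 0 by rewrite expf_neq0// gt_eqF.
    have eE : (e ^+ 3)%:C * (e ^- 3)%:C = 1 by rewrite -rmorphM /= divff.
    rewrite -[LHS]mul1r -eE -mulrA -h -cintZl; last exact: (rescales_cintegrable (rescales3_affine x e0) ig).
    apply: eq_cint => z; rewrite fourier_kmod// addrK scalerA mulVf ?gt_eqF// scale1r.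
    by rewrite [(_ * kcauchy z)%:C]rmorphM /= mulrCA [X in _ * X = _]mulrA eE mul1r.
  apply: (@cint_dctc _ _ _ mu3 _ _ (fun z => Cf * kcauchy z)).
  - move=> n; apply: cmeasM; last first.
      by apply: cmeasR; apply/measurable_EFinP; exact: (measurable_int _ integrable_kcauchy).
    apply: (cmeas_comp (cintegrable_cmeas if_)).
    by apply: measurable_R3D => //; apply: measurable_R3Z; exact: measurable_id3.
  - apply: cmeasM; first exact: cmeas_cst.
    by apply: cmeasR; apply/measurable_EFinP; exact: (measurable_int _ integrable_kcauchy).
  - apply: nearW => z; apply: ccvgM; last exact: ccvg_cst.
    exact: schwartz_ccvg_line.
  - have := integrableZl measurableT Cf integrable_kcauchy.
    by apply: eq_integrable => // z _ /=; rewrite EFinM.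
  - move=> n z; rewrite Normc.normcM normcR ger0_norm ?kcauchy_ge0//.
    by apply: ler_wpM2r; [exact: kcauchy_ge0|exact: hf].
have iK : cintegrable mu3 (fun z => (kcauchy z)%:C).
  apply: (le_cintegrable _ _ integrable_kcauchy).
    by apply: cmeasR; apply/measurable_EFinP; exact: (measurable_int _ integrable_kcauchy).
  by move=> z; rewrite normcR ger0_norm ?kcauchy_ge0.
rewrite (ccvg_unique u1 u2) cintZl// mulrC; congr (_ * _).
apply: complex_eq; rewrite /cint /=; last by rewrite /Rintegral integral0.
by apply/EFin_inj; rewrite EFin_Rintegral ?integral_kcauchy//; exact: integrable_kcauchy.
Qed.

Lemma inv_fourierE f x : inv_fourier f x = ((2 * pi) ^- 3)%:C * fourier f (- x).
Proof.
rewrite /inv_fourier cintegralE fourierE; congr (_ * cint _ _); apply/funext => xi.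
by rewrite [dot xi (- x)]dotNr opprK (dotC xi).
Qed.

Lemma pi3K : ((2 * pi) ^- 3)%:C * ((2 * pi) ^+ 3)%:C = 1 :> R[i].
Proof. by rewrite -rmorphM /= mulVf// expf_neq0// mulf_neq0// gt_eqF// pi_gt0. Qed.

Lemma inv_fourierK f : is_schwartz f -> inv_fourier (fourier f) = f.
Proof.
by move=> sf; apply/funext => x; rewrite /inv_fourier cintegralE fourier_inversion_cint// mulrA pi3K mul1r.
Qed.

Lemma inv_fourier_schwartz f : is_schwartz f -> is_schwartz (inv_fourier f).
Proof.
move=> sf; rewrite (_ : inv_fourier f = fun x => ((2 * pi) ^- 3)%:C * fourier f (- x)).
  by apply: schwartzZ; apply: schwartz_opp; exact: fourier_schwartz.
by apply/funext => x; rewrite inv_fourierE.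
Qed.

Lemma fourierK f : is_schwartz f -> fourier (inv_fourier f) = f.
Proof.
move=> sf; have iF := schwartz_cintegrable (fourier_schwartz sf).
rewrite -[RHS]inv_fourierK//; apply/funext => x; rewrite [RHS]inv_fourierE.
rewrite (_ : inv_fourier f = fun x => ((2 * pi) ^- 3)%:C * fourier f (- x)); last first.
  by apply/funext => y; rewrite inv_fourierE.
rewrite fourierZ ?fourier_opp//.
exact: (rescales_cintegrable rescales3_opp iF).
Qed.

Lemma inv_fourier_mult f g : cintegrable mu3 f -> cintegrable mu3 g ->
  cint mu3 (fun x => inv_fourier f x * g x) = cint mu3 (fun x => f x * inv_fourier g x).
Proof.
move=> if_ ig; have ifo := rescales_cintegrable rescales3_opp if_.
have bF h x : cintegrable mu3 h -> normc (fourier h x) <= \int[mu3]_y normc (h y).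
  by move=> ih; exact: normc_fourier.
have i1 h k : cintegrable mu3 h -> cintegrable mu3 k -> cintegrable mu3 (fun x => fourier h x * k x).
  move=> ih ik; have := integrableZl measurableT (\int[mu3]_y normc (h y)) (cintegrable_normc ik).
  apply: le_cintegrable.
    by apply: cmeasM; [apply: cmeas_fourier; exact: (cintegrable_cmeas ih)|exact: (cintegrable_cmeas ik)].
  by move=> x; rewrite Normc.normcM ler_wpM2r ?normc_ge0// bF.
transitivity (((2 * pi) ^- 3)%:C * cint mu3 (fun x => fourier (fun y => f (- y)) x * g x)).
  rewrite -cintZl; last exact: i1.
  by apply: eq_cint => x; rewrite inv_fourierE fourier_opp// mulrA.
rewrite fourier_mult//.
have i2 : cintegrable mu3 (fun y => f (- y) * fourier g y).
  by have := i1 _ _ ig ifo; under eq_fun do rewrite mulrC.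
have := rescales_cint rescales3_opp i2; rewrite mul1r => <-.
rewrite -cintZl; last exact: (rescales_cintegrable rescales3_opp i2).
by apply: eq_cint => x; rewrite inv_fourierE opprK mulrCA.
Qed.

End FourierInversion.

(** * The fundamental lemma of the calculus of variations *)

Section DuBoisReymond.
Context {R : realType}.
Implicit Types (l r : 'I_3 -> R) (x : R3 R).
Notation T3 := (measurableTypeR R * measurableTypeR R * measurableTypeR R)%type.

Definition obox l r : set (R3 R) := [set x | forall i, l i < coord3 x i < r i].

Definition oboxes : set (set (R3 R)) := [set A | exists l r, A = obox l r].

Lemma oboxE l r : obox l r = (`]l 0, r 0[ `*` `]l 1, r 1[) `*` `]l 2, r 2[.
Proof.
apply/seteqP; split => x /=; rewrite !in_itv /=.
  by move=> h; split; [split|]; [exact: (h 0)|exact: (h 1)|exact: (h 2)].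
by move=> [[h0 h1] h2] i; case: (I3P i) => ->.
Qed.

Lemma measurable_obox l r : measurable (obox l r : set T3).
Proof. by rewrite oboxE; apply: measurableX; first apply: measurableX. Qed.

Lemma oboxI l r l' r' :
  obox l r `&` obox l' r' = obox (fun i => Num.max (l i) (l' i)) (fun i => Num.min (r i) (r' i)).
Proof.
apply/seteqP; split => x /=.
  move=> [h h'] i; rewrite gt_max lt_min.
  by have /andP[-> ->] := h i; have /andP[-> ->] := h' i.
by move=> h; split=> i; have := h i; rewrite gt_max lt_min => /andP[/andP[h1 h2] /andP[h3 h4]]; apply/andP.
Qed.

Lemma setI_closed_oboxes : setI_closed oboxes.
Proof. by move=> _ _ [l [r ->]] [l' [r' ->]]; rewrite oboxI; eexists; eexists; reflexivity. Qed.

Lemma open_sigma_oboxes (U : set (R3 R)) : open U -> <<s oboxes >> U.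
Proof.
move=> oU.
pose q3 (q : rat * rat * rat) (i : 'I_3) : R := coord3 (ratr q.1.1, ratr q.1.2, ratr q.2) i.
pose D (i : rat * rat * rat * rat) := obox (fun k => q3 i.1 k - ratr i.2) (fun k => q3 i.1 k + ratr i.2).
pose B (i : rat * rat * rat * rat) : set (R3 R) := if `[< D i `<=` U >] then D i else set0.
have -> : U = \bigcup_i B i.
  apply/seteqP; split => x; last first.
    by move=> [i _]; rewrite /B; case: asboolP => // h hx; exact: h.
  move=> Ux; have /nbhs_ballP[e /= e0 be] : nbhs x U by exact: open_nbhs_nbhs.
  have [r [rb [r' _ rE]]] : (ball (e / 2) (e / 4) `&` (@ratr R @` setT)) !=set0.
    by apply: dense_rat; [exists (e / 2); apply: ballxx; rewrite divr_gt0|exact: ball_open].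
  have hq (a : R) : exists q : rat, `|a - ratr q| < e / 8.
    have [q [qb [q' _ qE]]] : (ball a (e / 8) `&` (@ratr R @` setT)) !=set0.
      by apply: dense_rat; [exists a; apply: ballxx; rewrite divr_gt0|exact: ball_open].
    by exists q'; move: qb; rewrite /ball /= qE.
  have [q1 h1] := hq x.1.1; have [q2 h2] := hq x.1.2; have [q4 h4] := hq x.2.
  move: rb; rewrite /ball /= -rE ltr_norml => /andP[r1 r2].
  have hk k : `|coord3 x k - q3 (q1, q2, q4) k| < e / 8 by case: (I3P k) => ->.
  exists ((q1, q2, q4), r') => //; rewrite /B ifT; last first.
    apply/asboolP => y hy; apply: be.
    have hy' k : `|coord3 x k - coord3 y k| < e.
      have := hy k; have := hk k; rewrite /= !ltr_norml => /andP[a1 a2] /andP[a3 a4].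
      by apply/andP; split; lra.
    by split; [split|]; rewrite /ball /=; [exact: (hy' 0)|exact: (hy' 1)|exact: (hy' 2)].
  move=> k /=; have := hk k; rewrite ltr_norml => /andP[a1 a2].
  by apply/andP; split; lra.
(* The axioms of a sigma-algebra speak of sequences, so the rational boxes are enumerated; codes of
   nothing give the empty set. *)
have -> : \bigcup_i B i = \bigcup_n (if unpickle n is Some i then B i else set0).
  apply/seteqP; split => x [i _ Bi].
    by exists (pickle i); [exact: I|rewrite pickleK; exact: Bi].
  by move: Bi; case: (unpickle i) => [j Bj|[]]; exists j; [exact: I|exact: Bj].
apply: sigma_algebra_bigcup => n; case: (unpickle n) => [i|]; last exact: sigma_algebra0.
rewrite /B; case: ifP => _; last exact: sigma_algebra0.
by apply: sub_sigma_algebra; eexists; eexists; reflexivity.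
Qed.

(** The substantial inclusion says that the identity is measurable when its source carries the
    sigma-algebra generated by the boxes. This is checked on each coordinate, through preimages of
    open intervals. *)
Lemma measurable_oboxes : @measurable _ T3 = <<s oboxes >>.
Proof.
apply/seteqP; split; last first.
  by apply: smallest_sub; [exact: sigma_algebra_measurable|move=> _ [l [r ->]]; exact: measurable_obox].
pose Tb : measurableType _ := g_sigma_algebraType oboxes.
have mc i : measurable_fun [set: Tb] (fun x : Tb => coord3 x i : measurableTypeR R).
  apply: (measurability _ (RGenOpens.measurableE R)).
  move=> _ [_ [a [b ->] <-]]; rewrite setTI; apply: open_sigma_oboxes.
  have : continuous (fun x : R3 R => coord3 x i).
    by move=> x; apply: differentiable_continuous; have [] := is_diff_coord i x.
  by move/continuousP; apply; exact: interval_open.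
have mi : measurable_fun [set: Tb] (id : Tb -> T3).
  apply/measurable_fun_pairP; split; last exact: (mc 2).
  by apply/measurable_fun_pairP; split; [exact: (mc 0)|exact: (mc 1)].
by move=> A mA; have := mi measurableT A mA; rewrite setTI.
Qed.

Lemma oboxes_cover x : exists n : nat, forall k : nat, (n <= k)%N ->
  obox (fun=> - k%:R) (fun=> k%:R) x.
Proof.
exists (Num.truncn (enorm x)).+1 => k nk i.
rewrite -ltr_norml; apply: le_lt_trans (coord3_le_enorm _ _) _.
by apply: lt_le_trans (truncnS_gt _) _; rewrite ler_nat.
Qed.

Lemma Rintegral_indicE (h : R3 R -> R) A :
  (\int[mu3]_(x in A) (h x)%:E = \int[mu3]_x (\1_A x * h x)%:E)%E.
Proof.
rewrite integral_mkcond; apply: eq_integral => x _.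
by rewrite patchE indicE; case: ifP => _; rewrite ?mul1r ?mul0r.
Qed.

(** Sets over which h integrates to 0 form a Dynkin system containing the boxes, which are stable
    under intersection. The whole space belongs to it by exhaustion with boxes, and complements then
    follow. *)
Lemma oboxes_ae_eq0 (h : R3 R -> R) : mu3.-integrable [set: R3 R] (EFin \o h) ->
  (forall l r, \int[mu3]_(x in obox l r) (h x)%:E = 0)%E ->
  {ae mu3, forall x, h x = 0}.
Proof.
move=> ih h0.
have mh : measurable_fun setT h by apply/measurable_EFinP; exact: (measurable_int _ ih).
have iS A : measurable A -> mu3.-integrable A (EFin \o h).
  by move=> mA; apply: integrableS ih.
have hT : (\int[mu3]_(x in setT) (h x)%:E = 0)%E.
  pose u n := \int[mu3]_x (\1_(obox (fun=> - n%:R) (fun=> n%:R)) x * h x).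
  have u0 n : u n = 0.
    by rewrite /u /Rintegral -Rintegral_indicE h0.
  have cu : u n @[n --> \oo] --> \int[mu3]_x h x.
    apply: (@Rintegral_dct _ _ _ mu3 _ _ (fun x => `|h x|)).
    - by move=> n; apply: measurable_funM => //; apply: measurable_indic; exact: measurable_obox.
    - exact: mh.
    - apply: nearW => x; have [n hn] := oboxes_cover x.
      apply: cvg_near_cst; exists n => // k /= nk.
      by rewrite indicE mem_set ?mul1r//; exact: hn.
    - exact: (integrable_norm ih).
    - by move=> n x; rewrite normrM ler_piMl// indicE ger0_norm//; case: (_ \in _).
  have : 0 = \int[mu3]_x h x.
    apply: (cvg_unique _ _ cu) => //.
    by have -> : u = fun=> 0 by [apply/funext]; exact: cvg_cst.
  by rewrite -EFin_Rintegral// => <-.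
have key : forall S, <<s oboxes >> S -> (\int[mu3]_(x in S) (h x)%:E = 0)%E.
  apply: (@dynkin_induction _ T3) => //.
  - exact: measurable_oboxes.
  - exact: setI_closed_oboxes.
  - by move=> _ [l [r ->]].
  - move=> S mS S0.
    have : (\int[mu3]_(x in S `|` ~` S) (h x)%:E = 0)%E by rewrite setUv.
    rewrite integral_setU_EFin ?S0 ?add0e//.
    + exact: measurableC.
    + by rewrite setUv.
    + exact/disj_setPCl.
  - move=> F mF tF F0; rewrite integral_bigcup//; last first.
      by apply: iS; exact: bigcup_measurable.
    by apply: eseries0 => n _ _; exact: F0.
have := @integral_ae_eq _ _ _ mu3 setT measurableT (fun=> 0%E) (EFin \o h) ih (measurable_cst _).
have hE E : E `<=` [set: T3] -> measurable E -> (\int[mu3]_(x in E) (EFin \o h) x = \int[mu3]_(x in E) 0)%E.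
  by move=> _ mE; rewrite integral0 key// -measurable_oboxes.
by move=> /(_ hE); apply: filterS => x /(_ I) /= [].
Qed.

Lemma box_bump_cvg_indic l r x :
  Re (box_bump n.+1%:R l r x) @[n --> \oo] --> (\1_(obox l r) x : R).
Proof.
have [hx|hx] := pselect (obox l r x).
  by rewrite indicE mem_set//; exact: box_bump_cvg.
rewrite indicE memNset//; under eq_cvg => n.
  rewrite box_bump_support//; last first.
    apply: contrapT => /forallNP h; apply: hx => i; have /not_orP[/negP h1 /negP h2] := h i.
    by rewrite !ltNge h1 h2.
  over.
exact: cvg_cst.
Qed.

Lemma obox_enorm_le l r x : obox l r x -> enorm x <= \sum_(i < 3) (`|l i| + `|r i|).
Proof.
move=> h; apply: le_trans (enorm_le_sum x) _; apply: ler_sum => i _.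
have /andP[h1 h2] := h i.
have := ler_norm (r i); have := ler_norm (- l i); rewrite normrN => h3 h4.
by rewrite ler_norml; have := normr_ge0 (r i); have := normr_ge0 (l i); lra.
Qed.

Lemma measurable_ball3 (e : R) : measurable ([set x | enorm x <= e] : set T3).
Proof.
rewrite (_ : [set x | _] = (@enorm R) @^-1` `]-oo, e]).
  have := @measurable_enorm R _ T3 _ (@measurable_id3 R) measurableT `]-oo, e]%classic.
  by rewrite setTI; apply; exact: measurable_itv.
by apply/seteqP; split => x /=; rewrite in_itv.
Qed.

Lemma L1loc_bounded (g : R3 R -> R[i]) (A : set T3) (rho : R) : L1loc g -> measurable A ->
  (forall x, A x -> enorm x <= rho) ->
  mu3.-integrable [set: R3 R] (EFin \o (fun x => \1_A x * normc (g x))).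
Proof.
move=> [_ _ lg] mA Ar; have h := integrableS (measurable_ball3 rho) mA Ar (lg rho).
move/(integrable_mkcond _ mA) : h.
apply: eq_integrable => // x _; rewrite patchE /= indicE.
by case: ifP => _; rewrite ?mul1r ?mul0r.
Qed.

Lemma L1locP (g : R3 R -> R[i]) : cmeas g ->
  (forall rho, mu3.-integrable [set: R3 R] (EFin \o (fun x => \1_[set y | enorm y <= rho] x * normc (g x)))) ->
  L1loc g.
Proof.
move=> [mg1 mg2] h; split => // rho.
apply/(integrable_mkcond _ (measurable_ball3 rho)).
apply: eq_integrable (h rho) => // x _; rewrite patchE /= indicE.
by case: ifP => _; rewrite ?mul1r ?mul0r.
Qed.

(** Smooth bumps tending to the indicator of a box give a vanishing integral of g over every box.
    Since g need not be integrable, it is first restricted to a large box; an intersection of two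
    boxes is a box, so the restricted function still integrates to 0 over all of them. *)
Lemma du_bois_reymond (g : R3 R -> R[i]) : L1loc g ->
  (forall f : schwartz R, compactly_supported f -> cint mu3 (fun x => g x * f x) = 0) ->
  {ae mu3, forall x, g x = 0}.
Proof.
move=> lg g0; have mg : cmeas g by case: lg.
have ibox l r : mu3.-integrable [set: R3 R] (EFin \o (fun x => \1_(obox l r) x * normc (g x))).
  by apply: (L1loc_bounded _ (measurable_obox l r) (@obox_enorm_le l r)).
have cbox l r : cintegrable mu3 (fun x => (\1_(obox l r) x)%:C * g x).
  apply: (le_cintegrable _ _ (ibox l r)).
    by apply: cmeasM => //; apply: cmeasR; apply: measurable_indic; exact: measurable_obox.
  by move=> x; rewrite Normc.normcM normcR ger0_norm// indicE; case: (_ \in _).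
have key l r : cint mu3 (fun x => (\1_(obox l r) x)%:C * g x) = 0.
  have h n : cint mu3 (fun x => box_bump n.+1%:R l r x * g x) = 0.
    rewrite -(g0 (Schwartz (box_bump_schwartz l r (ltr0Sn R n)))).
      by apply: eq_cint => x; rewrite mulrC.
    exact: box_bump_compact.
  symmetry; apply: (@ccvg_unique _ (fun n => cint mu3 (fun x => box_bump n.+1%:R l r x * g x))).
    by under [X in ccvg X]eq_fun do rewrite h; exact: ccvg_cst.
  apply: (@cint_dctc _ _ _ mu3 _ _ (fun x => \1_(obox l r) x * normc (g x))).
  - move=> n; apply: cmeasM => //; apply: schwartz_cmeas; exact: box_bump_schwartz.
  - by apply: cmeasM => //; apply: cmeasR; apply: measurable_indic; exact: measurable_obox.
  - apply: nearW => x; apply: ccvgM; last exact: ccvg_cst.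
    by apply: ccvgR; exact: box_bump_cvg_indic.
  - exact: ibox.
  - move=> n x; rewrite Normc.normcM; have [hx|hx] := pselect (obox l r x).
      by rewrite ler_wpM2r ?normc_ge0// indicE mem_set// normc_box_bump.
    rewrite box_bump_support ?Normc.normc0 ?mul0r ?mulr_ge0 ?normc_ge0//; last first.
      apply: contrapT => /forallNP k; apply: hx => i; have /not_orP[/negP h1 /negP h2] := k i.
      by rewrite !ltNge h1 h2.
have keyN (n : nat) : {ae mu3, forall x, \1_(obox (fun=> - n%:R) (fun=> n%:R)) x * Re (g x) = 0 /\
   \1_(obox (fun=> - n%:R) (fun=> n%:R)) x * Im (g x) = 0}.
  set B := obox _ _; have [i1 i2] := cbox (fun=> - n%:R) (fun=> n%:R).
  have e1 : (EFin \o (fun x => \1_B x * Re (g x))) = (fun x => (Re ((\1_B x)%:C * g x))%:E).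
    by apply/funext => x; rewrite ReMr.
  have e2 : (EFin \o (fun x => \1_B x * Im (g x))) = (fun x => (Im ((\1_B x)%:C * g x))%:E).
    by apply/funext => x; rewrite ImMr.
  have z l r : \int[mu3]_x (\1_(obox l r) x * (\1_B x * Re (g x))) = 0 /\
               \int[mu3]_x (\1_(obox l r) x * (\1_B x * Im (g x))) = 0.
    have h := key (fun i => Num.max (l i) (- n%:R)) (fun i => Num.min (r i) n%:R).
    rewrite -oboxI -/B in h.
    have [h1 h2] := (f_equal (@Re R) h, f_equal (@Im R) h).
    by split; [rewrite -[RHS]h1|rewrite -[RHS]h2]; apply: eq_Rintegral => x _;
      rewrite ?ReMr ?ImMr indicI /= mulrA.
  have iI l r (q : R3 R -> R) : mu3.-integrable setT (EFin \o (fun x => \1_B x * q x)) ->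
      \int[mu3]_x (\1_(obox l r) x * (\1_B x * q x)) = 0 ->
      (\int[mu3]_(x in obox l r) (\1_B x * q x)%:E = 0)%E.
    move=> iq q0; rewrite Rintegral_indicE -EFin_Rintegral ?q0//.
    have := integrableS (@measurableT _ T3) (measurable_obox l r) (@subsetT _ _) iq.
    move/(integrable_mkcond _ (measurable_obox l r)); apply: eq_integrable => // x _; rewrite patchE /= [\1_(obox l r) x]indicE.
    by case: ifP => _; rewrite ?mul1r ?mul0r.
  have a1 : {ae mu3, forall x, \1_B x * Re (g x) = 0}.
    apply: oboxes_ae_eq0; first by rewrite e1.
    by move=> l r; apply: iI; [rewrite e1|have [] := z l r].
  have a2 : {ae mu3, forall x, \1_B x * Im (g x) = 0}.
    apply: oboxes_ae_eq0; first by rewrite e2.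
    by move=> l r; apply: iI; [rewrite e2|have [] := z l r].
  by apply: filterS2 a1 a2 => x h1 h2; split.
have := ae_foralln keyN; apply: filterS => x h.
have [n hn] := oboxes_cover x; have [] := h n.
rewrite indicE mem_set; last exact: hn.
by rewrite !mul1r => h1 h2; exact: complex_eq.
Qed.

End DuBoisReymond.

(** * Convolution and Plancherel inequality *)

Section NonnegativeMeasurable.
Context {R : realType}.

Definition nnm {d} {T : measurableType d} (F : T -> R) :=
  measurable_fun [set: T] F /\ forall x : T, 0 <= F x.

Lemma nnm_normc {d} {T : measurableType d} (f : T -> R[i]) : cmeas f -> nnm (fun x => normc (f x)).
Proof. by move=> mf; split; [exact: measurable_normc|move=> x; exact: normc_ge0]. Qed.

Lemma nnmM {d} {T : measurableType d} (F G : T -> R) : nnm F -> nnm G -> nnm (fun x => F x * G x).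
Proof. by move=> [m1 p1] [m2 p2]; split; [exact: measurable_funM|move=> x; exact: mulr_ge0]. Qed.

Lemma nnmD {d} {T : measurableType d} (F G : T -> R) : nnm F -> nnm G -> nnm (fun x => F x + G x).
Proof. by move=> [m1 p1] [m2 p2]; split; [exact: measurable_funD|move=> x; exact: addr_ge0]. Qed.

Lemma nnmX {d} {T : measurableType d} (F : T -> R) n : nnm F -> nnm (fun x => F x ^+ n).
Proof. by move=> [m1 p1]; split; [exact: measurable_funX|move=> x; exact: exprn_ge0]. Qed.

Lemma nnm_cst {d} {T : measurableType d} (c : R) : 0 <= c -> nnm (fun _ : T => c).
Proof. by move=> c0; split; [exact: measurable_cst|]. Qed.

Lemma nnm_comp {d d'} {T : measurableType d} {T' : measurableType d'} (F : T' -> R) (h : T -> T') :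
  nnm F -> measurable_fun [set: T] h -> nnm (fun x => F (h x)).
Proof. by move=> [m1 p1] mh; split; [exact: (measurableT_comp m1 mh)|move=> x; exact: p1]. Qed.

Lemma nnm_sum {d} {T : measurableType d} (I : Type) (r : seq I) (F : I -> T -> R) :
  (forall i, nnm (F i)) -> nnm (fun x => \sum_(i <- r) F i x).
Proof.
move=> h; elim: r => [|i r ih].
  by under [X in nnm X]eq_fun do rewrite big_nil; exact: nnm_cst.
by under [X in nnm X]eq_fun do rewrite big_cons; exact: nnmD.
Qed.

Lemma fatou_le {d} {T : measurableType d} (mu : {measure set T -> \bar R})
    (F : nat -> T -> R) (G : T -> R) (C : \bar R) :
  (forall n, nnm (F n)) -> (forall x, F n x @[n --> \oo] --> G x) ->
  (forall n, (\int[mu]_x (F n x)%:E <= C)%E) -> (\int[mu]_x (G x)%:E <= C)%E.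
Proof.
move=> nF cF hC.
have mF n : measurable_fun [set: T] (fun x => (F n x)%:E).
  by apply/measurable_EFinP; case: (nF n).
have F0 n (x : T) : [set: T] x -> (0 <= (F n x)%:E)%E by move=> _; rewrite lee_fin; case: (nF n).
have h := @fatou _ T _ mu setT measurableT (fun n x => (F n x)%:E) mF F0.
apply: le_trans (le_trans _ h) _.
  rewrite le_eqVlt; apply/orP; left; apply/eqP; apply: eq_integral => x _.
  symmetry; have [] := @cvg_limn_einf_sup _ (fun n => (F n x)%:E) (G x)%:E => //.
  by apply: cvg_EFin; [exact: nearW|exact: cF].
rewrite limn_einf_lim; apply: lime_le; first exact: is_cvg_einfs.
apply: nearW => n; apply: le_trans (hC n); apply: ereal_inf_lbound.
by exists n => /=.
Qed.

End NonnegativeMeasurable.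

(** * Iterated integrals, convolution and Plancherel *)

Section Convolution.
Context {R : realType}.
Implicit Types (a b f g : R3 R -> R[i]) (x y xi eta : R3 R).
Notation T3 := (measurableTypeR R * measurableTypeR R * measurableTypeR R)%type.

Definition nint (F : R3 R -> R) : \bar R := (\int[mu3]_x (F x)%:E)%E.
Definition nint2 (F : R3 R -> R3 R -> R) : \bar R :=
  (\int[mu3]_x \int[mu3]_y (F x y)%:E)%E.

Lemma nnm_enorm : nnm (fun x : T3 => enorm x).
Proof. by split; [exact: (measurable_enorm measurable_id3)|move=> x; exact: enorm_ge0]. Qed.

Lemma nint_ge0 F : (forall x, 0 <= F x) -> (0 <= nint F)%E.
Proof. by move=> h; apply: integral_ge0 => x _; rewrite lee_fin. Qed.

Lemma nintZ (c : R) F : 0 <= c -> nnm (F : T3 -> R) -> nint (fun x => c * F x) = (c%:E * nint F)%E.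
Proof.
move=> c0 [mF F0]; rewrite /nint; under eq_integral do rewrite EFinM.
rewrite ge0_integralZl//; first exact/measurable_EFinP.
by move=> x _; rewrite lee_fin.
Qed.

Lemma nintD F G : nnm (F : T3 -> R) -> nnm (G : T3 -> R) ->
  nint (fun x => F x + G x) = (nint F + nint G)%E.
Proof.
move=> [mF F0] [mG G0]; rewrite /nint; under eq_integral do rewrite EFinD.
rewrite ge0_integralD//; try exact/measurable_EFinP; by move=> x _; rewrite lee_fin.
Qed.

Lemma le_nint F G : nnm (F : T3 -> R) -> nnm (G : T3 -> R) -> (forall x, F x <= G x) ->
  (nint F <= nint G)%E.
Proof.
move=> [mF F0] [mG G0] FG.
by apply: ge0_le_integral => //; try exact/measurable_EFinP; move=> x _; rewrite lee_fin.
Qed.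

Lemma le_nint_ae F G : nnm (F : T3 -> R) -> nnm (G : T3 -> R) ->
  {ae mu3, forall x, F x <= G x} -> (nint F <= nint G)%E.
Proof.
move=> [mF F0] [mG G0] FG; apply: ae_ge0_le_integral => //; try exact/measurable_EFinP.
- by move=> x _; rewrite lee_fin.
- by move=> x _; rewrite lee_fin.
- by apply: filterS FG => x h _; rewrite lee_fin.
Qed.

Lemma eq_nint_ae F G : nnm (F : T3 -> R) -> nnm (G : T3 -> R) ->
  {ae mu3, forall x, F x = G x} -> nint F = nint G.
Proof.
move=> nF nG FG; apply/eqP; rewrite eq_le; apply/andP; split; apply: le_nint_ae => //;
  by apply: filterS FG => x ->.
Qed.

Lemma nint_integrable F : nnm (F : T3 -> R) -> (nint F < +oo)%E ->
  mu3.-integrable [set: T3] (EFin \o F).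
Proof.
move=> [mF F0] h; apply/integrableP; split; first exact/measurable_EFinP.
by under eq_integral do rewrite /= ger0_norm//.
Qed.

Lemma integrable_nint F : (forall x, 0 <= F x) -> mu3.-integrable [set: T3] (EFin \o F) ->
  (nint F < +oo)%E.
Proof. by move=> F0 h; rewrite /nint -EFin_Rintegral// ltry. Qed.

Lemma nint_fin F : nnm (F : T3 -> R) -> (nint F < +oo)%E -> nint F = (\int[mu3]_x F x)%:E.
Proof. by move=> nF h; rewrite EFin_Rintegral//; exact: nint_integrable. Qed.

Lemma measurable_sub3 : measurable_fun [set: T3 * T3] (fun z : T3 * T3 => z.1 - z.2 : T3).
Proof. by apply: measurable_R3B; [exact: measurable_fst|exact: measurable_snd]. Qed.

Lemma nint_inner (F : R3 R -> R3 R -> R) : nnm (fun z : T3 * T3 => F z.1 z.2) ->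
  measurable_fun [set: T3] (fun x => \int[mu3]_y (F x y)%:E)%E.
Proof.
move=> [mF _]; apply: (@measurable_integral2 _ _ T3 T3 _ mu3 (fun z => (F z.1 z.2)%:E)).
exact/measurable_EFinP.
Qed.

Lemma nint2C (F : R3 R -> R3 R -> R) : nnm (fun z : T3 * T3 => F z.1 z.2) ->
  nint2 F = nint2 (fun x y => F y x).
Proof.
move=> [mF F0]; rewrite /nint2.
have mE : measurable_fun [set: T3 * T3] (fun z : T3 * T3 => (F z.1 z.2)%:E) by exact/measurable_EFinP.
have E0 (z : T3 * T3) : (0 <= (F z.1 z.2)%:E)%E by rewrite lee_fin.
by rewrite -(@fubini_tonelli1 _ _ T3 T3 _ mu3 mu3 _ mE E0) (@fubini_tonelli2 _ _ T3 T3 _ mu3 mu3 _ mE E0).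
Qed.

Lemma nnm_sec (F : R3 R -> R3 R -> R) x : nnm (fun z : T3 * T3 => F z.1 z.2) -> nnm (F x : T3 -> R).
Proof.
move=> nF; apply: (nnm_comp (h := fun y : T3 => (x : T3, y)) nF).
exact: measurable_pair1'.
Qed.

Lemma le_nint2 (F G : R3 R -> R3 R -> R) : nnm (fun z : T3 * T3 => F z.1 z.2) ->
  nnm (fun z : T3 * T3 => G z.1 z.2) -> (forall x y, F x y <= G x y) -> (nint2 F <= nint2 G)%E.
Proof.
move=> nF nG FG; apply: ge0_le_integral => //.
- by move=> x _; apply: nint_ge0; have [] := nnm_sec x nF.
- exact: nint_inner.
- exact: nint_inner.
- by move=> x _; apply: le_nint => //; exact: nnm_sec.
Qed.

Lemma nint2D (F G : R3 R -> R3 R -> R) : nnm (fun z : T3 * T3 => F z.1 z.2) ->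
  nnm (fun z : T3 * T3 => G z.1 z.2) -> nint2 (fun x y => F x y + G x y) = (nint2 F + nint2 G)%E.
Proof.
move=> nF nG; rewrite /nint2 -ge0_integralD//.
- by apply: eq_integral => x _; exact: (nintD (nnm_sec x nF) (nnm_sec x nG)).
- by move=> x _; apply: nint_ge0; have [] := nnm_sec x nF.
- exact: nint_inner.
- by move=> x _; apply: nint_ge0; have [] := nnm_sec x nG.
- exact: nint_inner.
Qed.

Lemma nint2Z (c : R) (F : R3 R -> R3 R -> R) : 0 <= c -> nnm (fun z : T3 * T3 => F z.1 z.2) ->
  nint2 (fun x y => c * F x y) = (c%:E * nint2 F)%E.
Proof.
move=> c0 nF; rewrite /nint2 -ge0_integralZl//.
- by apply: eq_integral => x _; exact: (nintZ c0 (nnm_sec x nF)).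
- exact: nint_inner.
- by move=> x _; apply: nint_ge0; have [] := nnm_sec x nF.
Qed.

Lemma nint2_tensor (A B : R3 R -> R) : nnm (A : T3 -> R) -> nnm (B : T3 -> R) ->
  nint2 (fun x y => A x * B y) = (nint A * nint B)%E.
Proof.
move=> nA nB; have [mA A0] := nA; rewrite /nint2.
transitivity (\int[mu3]_x ((A x)%:E * nint B))%E.
  by apply: eq_integral => x _; exact: (nintZ (A0 x) nB).
rewrite ge0_integralZr//; first exact/measurable_EFinP.
- by move=> x _; rewrite lee_fin.
- by apply: nint_ge0; case: nB.
Qed.

Lemma nint_shift (A : R3 R -> R) (c : R3 R) : nnm (A : T3 -> R) -> nint (fun x => A (x + c)) = nint A.
Proof.
move=> [mA A0]; have [_ _ h] := rescales3_shift c.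
rewrite /nint (h (fun x => (A x)%:E)) ?mul1e//; first exact/measurable_EFinP.
Qed.

Lemma nint_opp (A : R3 R -> R) : nnm (A : T3 -> R) -> nint (fun x => A (- x)) = nint A.
Proof.
move=> [mA A0]; have [_ _ h] := @rescales3_opp R.
rewrite /nint (h (fun x => (A x)%:E)) ?mul1e//; first exact/measurable_EFinP.
Qed.

Lemma nint_reflect (A : R3 R -> R) (c : R3 R) : nnm (A : T3 -> R) -> nint (fun x => A (c - x)) = nint A.
Proof.
move=> nA; rewrite -[RHS](nint_shift c nA) -[RHS]nint_opp; last first.
  apply: (nnm_comp nA); apply: measurable_R3D; [exact: measurable_id3|exact: measurable_cst].
by congr nint; apply/funext => x; rewrite addrC.
Qed.

Lemma nnm_conv (A : R3 R -> R) : nnm (A : T3 -> R) -> nnm (fun z : T3 * T3 => A (z.1 - z.2)).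
Proof. by move=> nA; exact: (nnm_comp nA measurable_sub3). Qed.

Lemma nnm_fst (A : R3 R -> R) : nnm (A : T3 -> R) -> nnm (fun z : T3 * T3 => A z.1).
Proof. by move=> nA; exact: (nnm_comp nA measurable_fst). Qed.

Lemma nnm_snd (A : R3 R -> R) : nnm (A : T3 -> R) -> nnm (fun z : T3 * T3 => A z.2).
Proof. by move=> nA; exact: (nnm_comp nA measurable_snd). Qed.

Lemma nint2_conv1 (A C : R3 R -> R) : nnm (A : T3 -> R) -> nnm (C : T3 -> R) ->
  nint2 (fun x y => C x * A (x - y)) = (nint C * nint A)%E.
Proof.
move=> nA nC; have [mC C0] := nC; rewrite /nint2.
transitivity (\int[mu3]_x ((C x)%:E * nint A))%E.
  apply: eq_integral => x _; rewrite -(nint_reflect x nA).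
  apply: (nintZ (C0 x) (F := fun y => A (x - y))).
  exact: (@nnm_sec (fun x y => A (x - y)) x (nnm_conv nA)).
rewrite ge0_integralZr//; first exact/measurable_EFinP.
- by move=> x _; rewrite lee_fin.
- by apply: nint_ge0; case: nA.
Qed.

Lemma nint2_conv2 (A B : R3 R -> R) : nnm (A : T3 -> R) -> nnm (B : T3 -> R) ->
  nint2 (fun x y => A (x - y) * B y) = (nint A * nint B)%E.
Proof.
move=> nA nB; rewrite nint2C; last by apply: nnmM; [exact: nnm_conv|exact: nnm_snd].
have [mB B0] := nB; rewrite /nint2.
transitivity (\int[mu3]_x (nint A * (B x)%:E))%E.
  apply: eq_integral => x _; rewrite -(nint_shift (- x) nA) muleC.
  rewrite -nintZ//; last first.
    by apply: (nnm_comp nA); apply: measurable_R3D; [exact: measurable_id3|exact: measurable_cst].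
  by apply: eq_integral => y _; rewrite mulrC.
rewrite ge0_integralZl//; first exact/measurable_EFinP.
- by move=> x _; rewrite lee_fin.
- by apply: nint_ge0; case: nA.
Qed.

(** Pointwise B C <= (B^2 + C^2) / 2; each of the two resulting double integrals factors after a
    translation. *)
Lemma young_trilinear (A B C : R3 R -> R) : nnm (A : T3 -> R) -> nnm (B : T3 -> R) -> nnm (C : T3 -> R) ->
  (nint2 (fun x y => (A (x - y) * B y * C x)%R) <=
   (2^-1)%:E * (nint A * (nint (fun x => (B x ^+ 2)%R) + nint (fun x => (C x ^+ 2)%R))))%E.
Proof.
move=> nA nB nC; have [nB2 nC2] := (nnmX 2 nB, nnmX 2 nC).
have n1 : nnm (fun z : T3 * T3 => A (z.1 - z.2) * B z.2 ^+ 2) by apply: nnmM; [exact: nnm_conv|exact: nnm_snd nB2].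
have n2 : nnm (fun z : T3 * T3 => C z.1 ^+ 2 * A (z.1 - z.2)) by apply: nnmM; [exact: nnm_fst nC2|exact: nnm_conv].
apply: (@le_trans _ _ (nint2 (fun x y => 2^-1 * (A (x - y) * B y ^+ 2 + C x ^+ 2 * A (x - y))))).
  apply: le_nint2.
  - by apply: nnmM; [apply: nnmM; [exact: nnm_conv|exact: nnm_snd]|exact: nnm_fst].
  - by apply: nnmM; [exact: nnm_cst|apply: nnmD; [exact: n1|exact: n2]].
  - move=> x y; have [_ A0] := nA; have := A0 (x - y).
    move: (A (x - y)) (B y) (C x) => u v w u0; rewrite ler_pdivlMl//.
    have := mulr_ge0 u0 (sqr_ge0 (v - w)); rewrite sqrrB !mulrDr mulrN mulrnAr => h.
    by rewrite -subr_ge0; apply: le_trans h _; rewrite le_eqVlt; apply/orP; left; apply/eqP; ring.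
rewrite nint2Z//; last exact: nnmD.
rewrite nint2D// (nint2_conv2 nA nB2) (nint2_conv1 nA nC2).
rewrite [(nint (fun x => (C x ^+ 2)%R) * _)%E]muleC -ge0_muleDr//.
- by apply: nint_ge0; case: nB2.
- by apply: nint_ge0; case: nC2.
Qed.

Definition conv a b xi : R[i] := cint mu3 (fun eta => a (xi - eta) * b eta).

Lemma cmeas_conv_integrand a b : cmeas (a : T3 -> R[i]) -> cmeas (b : T3 -> R[i]) ->
  cmeas (fun z : T3 * T3 => a (z.1 - z.2) * b z.2).
Proof.
by move=> ma mb; apply: cmeasM; [exact: (cmeas_comp ma measurable_sub3)|exact: (cmeas_comp mb measurable_snd)].
Qed.

Lemma cmeas_conv a b : cmeas (a : T3 -> R[i]) -> cmeas (b : T3 -> R[i]) -> cmeas (conv a b : T3 -> R[i]).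
Proof. by move=> ma mb; exact: (cmeas_cint2 mu3 (cmeas_conv_integrand ma mb)). Qed.

Lemma cintegrable_nint a : cintegrable mu3 a -> (nint (fun x => normc (a x)) < +oo)%E.
Proof. by move=> /cintegrableP[]. Qed.

Lemma nint_cintegrable a : cmeas (a : T3 -> R[i]) -> (nint (fun x => normc (a x)) < +oo)%E ->
  cintegrable mu3 a.
Proof. by move=> ma h; apply/cintegrableP. Qed.

Lemma cintegrable_conv_integrand a b : cintegrable mu3 a -> cintegrable mu3 b ->
  cintegrable (mu3 \x mu3)%E (fun z : T3 * T3 => a (z.1 - z.2) * b z.2).
Proof.
move=> ia ib; have [ma mb] := (cintegrable_cmeas ia, cintegrable_cmeas ib).
apply: (@cintegrable_tonelli _ _ T3 T3 _ mu3 mu3); first exact: cmeas_conv_integrand.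
under eq_integral => x _ do under eq_integral => y _ do rewrite /= Normc.normcM.
rewrite -/(nint2 (fun x y => normc (a (x - y)) * normc (b y))).
rewrite (@nint2_conv2 (fun x => normc (a x)) (fun x => normc (b x)) (nnm_normc ma) (nnm_normc mb)).
rewrite lte_mul_pinfty ?cintegrable_nint//; first by apply: nint_ge0 => x; exact: normc_ge0.
rewrite ge0_fin_numE ?cintegrable_nint//; apply: nint_ge0 => x; exact: normc_ge0.
Qed.

Lemma cintegrable_conv a b : cintegrable mu3 a -> cintegrable mu3 b -> cintegrable mu3 (conv a b).
Proof.
by move=> ia ib; exact: (@cintegrable_fubini1 _ _ T3 T3 _ mu3 mu3 _ (cintegrable_conv_integrand ia ib)).
Qed.

Lemma fourier_convM a b x : cintegrable mu3 a -> cintegrable mu3 b ->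
  fourier (conv a b) x = fourier a x * fourier b x.
Proof.
move=> ia ib; have iab := cintegrable_conv_integrand ia ib.
pose F (z : T3 * T3) := expi (- dot z.1 x) * (a (z.1 - z.2) * b z.2).
have iF : cintegrable (mu3 \x mu3)%E F.
  apply: (le_cintegrable _ _ (cintegrable_normc iab)).
    apply: cmeasM; last exact: (cintegrable_cmeas iab).
    by apply: cmeas_expi; apply: measurable_funN; apply: measurable_dot; [exact: measurable_fst|exact: measurable_cst].
  by move=> z; rewrite /F Normc.normcM normc_expi mul1r.
transitivity (cint mu3 (fun xi => cint mu3 (fun eta => F (xi, eta)))).
  rewrite fourierE; have := @ae_cintegrable1 _ _ T3 T3 _ mu3 mu3 _ iab => h.
  apply: ae_eq_cint.
  - exact: (cintegrable_cmeas (fourier_integrand x (cintegrable_conv ia ib))).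
  - exact: (cintegrable_cmeas (@cintegrable_fubini1 _ _ T3 T3 _ mu3 mu3 _ iF)).
  - by apply: filterS h => xi hxi; rewrite /conv -cintZl.
rewrite (@cint_fubini _ _ T3 T3 _ mu3 mu3 _ iF).
transitivity (cint mu3 (fun eta => fourier a x * (expi (- dot eta x) * b eta))).
  apply: eq_cint => eta; have := fourier_shift (- eta) x ia; rewrite fourierE dotNl.
  move=> h; rewrite mulrA [fourier a x * _]mulrC -h mulrC -cintZl.
    by apply: eq_cint => xi; rewrite /F /=; ring.
  exact: (fourier_integrand x (rescales_cintegrable (rescales3_shift (- eta)) ia)).
by rewrite cintZl//; exact: fourier_integrand.
Qed.

Lemma inv_fourier_convM a b x : cintegrable mu3 a -> cintegrable mu3 b ->
  inv_fourier a x * inv_fourier b x = ((2 * pi) ^- 3)%:C * inv_fourier (conv a b) x.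
Proof. by move=> ia ib; rewrite !inv_fourierE fourier_convM//; ring. Qed.

Lemma nint_rescale (A : R3 R -> R) (e : R) : 0 < e -> nnm (A : T3 -> R) ->
  nint (fun x => e ^- 3 * A (e^-1 *: x)) = nint A.
Proof.
move=> e0 nA; have [mA A0] := nA.
have ei : 0 < e^-1 by rewrite invr_gt0.
have nA' : nnm (fun x : T3 => A (e^-1 *: x)).
  by apply: (nnm_comp nA); apply: measurable_R3Z; exact: measurable_id3.
rewrite nintZ ?invr_ge0 ?exprn_ge0 ?(ltW e0)//.
have [_ _ h] := rescales3_affine 0 ei.
have := h (fun x => (A x)%:E); rewrite /nint; under eq_integral do rewrite addr0.
move=> ->; last by move=> x; rewrite lee_fin.
- by rewrite muleA -EFinM exprVn invrK mulVf ?mul1e// expf_neq0// gt_eqF.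
- exact/measurable_EFinP.
Qed.

(** The damping makes |g^|^2 integrable although g is only known to be integrable. The
    multiplication formula moves the transform from g to the other factor, where it becomes an
    average against a kernel of mass (2 pi)^3; [young_trilinear] concludes. *)
Lemma plancherel_kexp g (e : R) : 0 < e -> cintegrable mu3 g ->
  (nint (fun x => (normc (fourier g x) ^+ 2 * kexp (e *: x))%R) <=
   ((2 * pi) ^+ 3)%:E * nint (fun x => (normc (g x) ^+ 2)%R))%E.
Proof.
move=> e0 ig; have mg := cintegrable_cmeas ig.
(* Its transform is the conjugate of that of [g]. *)
pose gt x := conjc (g (- x)).
have igt : cintegrable mu3 gt by exact: (rescales_cintegrable rescales3_opp (cintegrable_conj ig)).
have Fgt x : fourier gt x = conjc (fourier g x).
  by rewrite (@fourier_opp _ (fun x => conjc (g x)))// ?fourier_conj ?opprK//; exact: cintegrable_conj.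
have mF := cmeas_fourier mg.
have nk : nnm (fun x : T3 => kexp (e *: x)).
  split; last by move=> x; exact: kexp_ge0.
  have mk : measurable_fun [set: T3] (@kexp R) by apply/measurable_EFinP; exact: (measurable_int _ integrable_kexp).
  by apply: (measurableT_comp mk); apply: measurable_R3Z; exact: measurable_id3.
pose H x := fourier gt x * (kexp (e *: x))%:C.
have ik : cintegrable mu3 (fun x => (kexp (e *: x))%:C).
  have := rescales_cintegrable (rescales3_affine 0 e0) (@cintegrable_kexp R).
  by under eq_fun do rewrite addr0.
pose M := \int[mu3]_x normc (g x).
have M0 : 0 <= M by apply: Rintegral_ge0 => x _; exact: normc_ge0.
have bF x : normc (fourier g x) <= M by exact: normc_fourier.
have iH : cintegrable mu3 H.
  have := integrableZl measurableT M (cintegrable_normc ik).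
  apply: le_cintegrable.
    apply: cmeasM; last exact: (cintegrable_cmeas ik).
    by apply: cmeas_fourier; exact: (cintegrable_cmeas igt).
  by move=> x; rewrite Normc.normcM Fgt normc_conj ler_wpM2r ?normc_ge0.
pose K x := e ^- 3 * kcauchy (e^-1 *: x).
have nK : nnm (K : T3 -> R).
  apply: nnmM; first by apply: nnm_cst; rewrite invr_ge0 exprn_ge0// ltW.
  have mk : measurable_fun [set: T3] (@kcauchy R) by apply/measurable_EFinP; exact: (measurable_int _ integrable_kcauchy).
  split; last by move=> x; exact: kcauchy_ge0.
  by apply: (measurableT_comp mk); apply: measurable_R3Z; exact: measurable_id3.
have iK : nint K = ((2 * pi) ^+ 3)%:E.
  rewrite nint_rescale//; first exact: integral_kcauchy.
  split; last by move=> x; exact: kcauchy_ge0.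
  by apply/measurable_EFinP; exact: (measurable_int _ integrable_kcauchy).
have FH xi : fourier H xi = cint mu3 (fun y => gt y * (K (y + xi))%:C).
  transitivity (cint mu3 (fun x => fourier gt x * kmod e (- xi) x)).
    by apply: eq_cint => x; rewrite /H /kmod dotNl (dotC xi); ring.
  rewrite fourier_mult//; last exact: cintegrable_kmod.
  by apply: eq_cint => y; rewrite fourier_kmod// opprK.
have nng := nnm_normc mg.
have bFH xi : ((normc (fourier H xi))%:E <= \int[mu3]_y (K (xi - y) * normc (g y))%:E)%E.
  have iy : cintegrable mu3 (fun y => gt y * (K (y + xi))%:C).
    have [C hC] : exists C, forall y, normc (fourier (kmod e (- xi)) y) <= C.
      by exists (\int[mu3]_y normc (kmod e (- xi) y)) => y; apply: normc_fourier; exact: cintegrable_kmod.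
    have := integrableZl measurableT C (cintegrable_normc igt).
    apply: le_cintegrable.
      apply: cmeasM; first exact: (cintegrable_cmeas igt).
      apply: cmeasR; have [mK _] := nK; apply: (measurableT_comp mK).
      by apply: measurable_R3D; [exact: measurable_id3|exact: measurable_cst].
    move=> y; have := hC y; rewrite fourier_kmod// opprK -/(K _) => h.
    by rewrite Normc.normcM mulrC; apply: ler_wpM2r; [exact: normc_ge0|exact: h].
  rewrite FH; apply: le_trans (le_normc_cintE iy) _.
  have nKg : nnm (fun y : T3 => K (xi - y) * normc (g y)).
    apply: nnmM nng; apply: (nnm_comp nK); apply: measurable_R3B; [exact: measurable_cst|exact: measurable_id3].
  have := nint_opp nKg; rewrite /nint => <-.
  apply: ge0_le_integral => //.
  - by move=> y _; rewrite lee_fin normc_ge0.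
  - exact/measurable_EFinP/measurable_normc/(cintegrable_cmeas iy).
  - apply/measurable_EFinP; have [mKg _] := nKg.
    by apply: (measurableT_comp mKg); apply: measurable_R3N; exact: measurable_id3.
  - move=> y _; rewrite lee_fin Normc.normcM normcR ger0_norm; last by case: nK.
    by rewrite normc_conj opprK [xi + y]addrC mulrC.
have igFH : cintegrable mu3 (fun y => g y * fourier H y).
  have := integrableZl measurableT (\int[mu3]_x normc (H x)) (cintegrable_normc ig).
  apply: le_cintegrable.
    by apply: cmeasM => //; apply: cmeas_fourier; exact: (cintegrable_cmeas iH).
  by move=> y; rewrite Normc.normcM mulrC ler_wpM2r ?normc_ge0// normc_fourier.
have E1 : nint (fun x => normc (fourier g x) ^+ 2 * kexp (e *: x)) = (Re (cint mu3 (fun x => fourier g x * H x)))%:E.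
  have nF : nnm (fun x : T3 => normc (fourier g x) ^+ 2 * kexp (e *: x)).
    by apply: nnmM nk; apply: nnmX; exact: nnm_normc.
  rewrite nint_fin//; last first.
    apply: (@le_lt_trans _ _ (nint (fun x => M ^+ 2 * kexp (e *: x)))).
      apply: le_nint => //; first by apply: nnmM nk; apply: nnm_cst; exact: sqr_ge0.
      by move=> x; apply: ler_wpM2r; [exact: kexp_ge0|rewrite lerXn2r ?nnegrE ?normc_ge0].
    rewrite nintZ ?sqr_ge0// lte_mul_pinfty ?lee_fin ?sqr_ge0//.
    have := cintegrable_nint ik; congr (_ < _)%E; congr nint; apply/funext => x.
    by rewrite normcR ger0_norm// kexp_ge0.
  congr _%:E; transitivity (\int[mu3]_x Re (fourier g x * H x)); last by [].
  apply: eq_Rintegral => x _; rewrite /H Fgt mulrA [_ * (_%:C)]mulrC ReMr ReM Re_conj Im_conj sqr_normc'; ring.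
rewrite E1 fourier_mult//.
apply: (@le_trans _ _ (normc (cint mu3 (fun y => g y * fourier H y)))%:E).
  by rewrite lee_fin; apply: le_trans (Re_le_normc _); exact: ler_norm.
apply: le_trans (le_normc_cintE igFH) _.
have nKgg : nnm (fun z : T3 * T3 => K (z.1 - z.2) * normc (g z.2) * normc (g z.1)).
  by apply: nnmM; [apply: nnmM; [exact: nnm_conv|exact: (nnm_snd nng)]|exact: (nnm_fst nng)].
have nKg2 : nnm (fun z : T3 * T3 => K (z.1 - z.2) * normc (g z.2)).
  by apply: nnmM; [exact: nnm_conv|exact: (nnm_snd nng)].
apply: (@le_trans _ _ (nint2 (fun x y => K (x - y) * normc (g y) * normc (g x)))).
  apply: ge0_le_integral => //.
  - by move=> y _; rewrite lee_fin normc_ge0.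
  - exact/measurable_EFinP/measurable_normc/(cintegrable_cmeas igFH).
  - exact: (nint_inner nKgg).
  - move=> x _; rewrite Normc.normcM EFinM.
    apply: (@le_trans _ _ ((normc (g x))%:E * \int[mu3]_y (K (x - y) * normc (g y))%:E)%E).
      by apply: lee_wpmul2l => //; rewrite lee_fin normc_ge0.
    have := nintZ (normc_ge0 (g x)) (@nnm_sec (fun x y => K (x - y) * normc (g y)) x nKg2).
    rewrite /nint => <-; rewrite le_eqVlt; apply/orP; left; apply/eqP.
    by apply: eq_integral => y _; rewrite mulrC.
apply: le_trans (young_trilinear nK nng nng) _.
rewrite iK; set I := nint _; have I0 : (0 <= I)%E by apply: nint_ge0 => x; exact: sqr_ge0.
have -> : (I + I = 2%:E * I)%E by rewrite -[in LHS](mul1e I) -ge0_muleDl// -EFinD.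
by rewrite !muleA -!EFinM mulrAC mulVf// mul1r.
Qed.

Lemma nint_fatou (F : nat -> R3 R -> R) (G : R3 R -> R) (C : \bar R) :
  (forall n, nnm (F n : T3 -> R)) -> (forall x, F n x @[n --> \oo] --> G x) ->
  (forall n, (nint (F n) <= C)%E) -> (nint G <= C)%E.
Proof. exact: fatou_le. Qed.

(** Fatou's lemma removes the damping. The right-hand side may be infinite. *)
Lemma plancherel_le g : cintegrable mu3 g ->
  (nint (fun x => (normc (fourier g x) ^+ 2)%R) <=
   ((2 * pi) ^+ 3)%:E * nint (fun x => (normc (g x) ^+ 2)%R))%E.
Proof.
move=> ig; have mF := cmeas_fourier (cintegrable_cmeas ig).
have mk : measurable_fun [set: T3] (@kexp R) by apply/measurable_EFinP; exact: (measurable_int _ integrable_kexp).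
apply: (@nint_fatou (fun n x => normc (fourier g x) ^+ 2 * kexp (harmonic n *: x))).
- move=> n; apply: nnmM; first by apply: nnmX; exact: nnm_normc.
  split; last by move=> x; exact: kexp_ge0.
  by apply: (measurableT_comp mk); apply: measurable_R3Z; exact: measurable_id3.
- by move=> x; rewrite -[X in _ --> X]mulr1; apply: cvgMr; exact: kexp_cvg.
- by move=> n; exact: plancherel_kexp (harmonic_gt0' n) ig.
Qed.

End Convolution.

(** * Fourier transforms of distributions *)

Section LocallyIntegrable.
Context {R : realType}.
Implicit Types (f g : R3 R -> R[i]) (x xi : R3 R).
Notation T3 := (measurableTypeR R * measurableTypeR R * measurableTypeR R)%type.

Lemma L1loc_cmeas g : L1loc g -> cmeas (g : T3 -> R[i]).
Proof. by case. Qed.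

Lemma L1loc_le f g : cmeas (g : T3 -> R[i]) -> L1loc f ->
  (forall rho : R, exists C : R, forall x, enorm x <= rho -> normc (g x) <= C * normc (f x)) -> L1loc g.
Proof.
move=> mg lf h; apply: (L1locP mg) => rho; have [C hC] := h rho.
have i1 := integrableZl measurableT C (L1loc_bounded lf (measurable_ball3 rho) (fun x hx => hx)).
apply: (le_integrable _ _ _ i1) => //.
  apply/measurable_EFinP; apply: measurable_funM; last exact: measurable_normc.
  by apply: measurable_indic; exact: measurable_ball3.
move=> x _ /=; rewrite lee_fin indicE.
have [hx|hx] := boolP (x \in _); last by rewrite !mul0r mulr0.
rewrite !mul1r ger0_norm ?normc_ge0//; apply: le_trans (ler_norm _).
by apply: hC; rewrite inE in hx.
Qed.

Lemma L1locD f g : L1loc f -> L1loc g -> L1loc (fun x => f x + g x).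
Proof.
move=> lf lg; apply: L1locP; first by apply: cmeasD; exact: L1loc_cmeas.
move=> rho; have i1 := integrableD (@measurableT _ T3)
  (L1loc_bounded lf (measurable_ball3 rho) (fun x hx => hx))
  (L1loc_bounded lg (measurable_ball3 rho) (fun x hx => hx)).
apply: (le_integrable _ _ _ i1) => //.
  apply/measurable_EFinP; apply: measurable_funM; last first.
    by apply: measurable_normc; apply: cmeasD; exact: L1loc_cmeas.
  by apply: measurable_indic; exact: measurable_ball3.
move=> x _ /=; rewrite lee_fin -mulrDr !normrM ler_wpM2l// ger0_norm ?normc_ge0//.
by apply: le_trans (ler_norm _); exact: le_normcD.
Qed.

Lemma L1locZ c f : L1loc f -> L1loc (fun x => c * f x).
Proof.
move=> lf; apply: (L1loc_le _ lf); first by apply: cmeasM; [exact: cmeas_cst|exact: L1loc_cmeas].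
by move=> rho; exists (normc c) => x _; rewrite Normc.normcM.
Qed.

Lemma L1locM f g : L1loc f -> cmeas (g : T3 -> R[i]) ->
  (forall rho : R, exists C : R, forall x, enorm x <= rho -> normc (g x) <= C) ->
  L1loc (fun x => g x * f x).
Proof.
move=> lf mg h; apply: (L1loc_le _ lf); first by apply: cmeasM => //; exact: L1loc_cmeas.
move=> rho; have [C hC] := h rho; exists C => x hx.
by rewrite Normc.normcM ler_wpM2r ?normc_ge0//; exact: hC.
Qed.

Lemma L1loc_cintegrable g : cintegrable mu3 g -> L1loc g.
Proof.
move=> ig; apply: L1locP; first exact: (cintegrable_cmeas ig).
move=> rho; apply: (le_integrable _ _ _ (cintegrable_normc ig)) => //.
  apply/measurable_EFinP; apply: measurable_funM; last exact/measurable_normc/(cintegrable_cmeas ig).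
  by apply: measurable_indic; exact: measurable_ball3.
move=> x _ /=; rewrite lee_fin normrM ler_piMl// indicE.
by case: (_ \in _); rewrite ?normr1 ?normr0.
Qed.

Lemma L1loc0 : L1loc (fun=> 0 : R[i]).
Proof. by apply: L1loc_cintegrable; exact: cintegrable0. Qed.

Lemma L1loc_sum (I : Type) (r : seq I) (F : I -> R3 R -> R[i]) :
  (forall i, L1loc (F i)) -> L1loc (fun x => \sum_(i <- r) F i x).
Proof.
move=> h; elim: r => [|i r ih].
  by under [X in L1loc X]eq_fun do rewrite big_nil; exact: L1loc0.
by under [X in L1loc X]eq_fun do rewrite big_cons; exact: L1locD.
Qed.

Lemma L1loc_conj_opp g : L1loc g -> L1loc (fun x => conjc (g (- x))).
Proof.
move=> lg; have mo : measurable_fun [set: T3] (fun x : T3 => - x : T3).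
  by apply: measurable_R3N; exact: measurable_id3.
apply: L1locP.
  by apply: cmeas_conj; exact: (cmeas_comp (L1loc_cmeas lg) mo).
move=> rho; have h := rescales_integrable rescales3_opp (L1loc_bounded lg (measurable_ball3 rho) (fun x hx => hx)).
move: h; apply: eq_integrable => // x _ /=; rewrite normc_conj; congr (_ * _)%:E.
rewrite !indicE (_ : (- x \in _) = (x \in [set y | enorm y <= rho]))//.
by apply/idP/idP; rewrite !inE/= enormN.
Qed.

Lemma L1loc_mult_cintegrable g f : L1loc g -> cmeas (f : T3 -> R[i]) ->
  (exists C, forall x, normc (f x) <= C) -> compactly_supported f ->
  cintegrable mu3 (fun x => g x * f x).
Proof.
move=> lg mf [C hC] [rho hf].
have i1 := integrableZl measurableT C (L1loc_bounded lg (measurable_ball3 rho) (fun x hx => hx)).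
apply: (le_cintegrable _ _ i1); first by apply: cmeasM => //; exact: L1loc_cmeas.
move=> x; rewrite Normc.normcM mulrC indicE.
have [rx|rx] := leP (enorm x) rho.
  by rewrite mem_set//= mul1r ler_wpM2r ?normc_ge0.
by rewrite hf// Normc.normc0 mul0r mulr_ge0 ?(le_trans (normc_ge0 _) (hC x))// mulr_ge0 ?normc_ge0.
Qed.

Lemma L1loc_schwartz g (f : schwartz R) : L1loc g -> compactly_supported f ->
  cintegrable mu3 (fun x => g x * f x).
Proof.
move=> lg cf; have sf := schwartzP f; apply: L1loc_mult_cintegrable => //.
  exact: schwartz_cmeas.
by apply: decays_bounded; exact: schwartz_decays.
Qed.

Lemma dist_of_unique f g : L1loc f -> L1loc g ->
  (forall h : schwartz R, compactly_supported h -> dist_of f h = dist_of g h) ->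
  {ae mu3, forall x, f x = g x}.
Proof.
move=> lf lg h.
have lfg : L1loc (fun x => f x + -1 * g x) by apply: L1locD => //; exact: L1locZ.
have := du_bois_reymond lfg; have : forall k : schwartz R, compactly_supported k ->
    cint mu3 (fun x => (f x + -1 * g x) * k x) = 0.
  move=> k ck; under eq_cint do rewrite mulN1r mulrBl.
  rewrite cintB; [|exact: L1loc_schwartz|exact: L1loc_schwartz].
  by apply/eqP; rewrite subr_eq0; apply/eqP; exact: h.
by move=> /[swap] /[apply]; apply: filterS => x; rewrite mulN1r => /eqP; rewrite subr_eq0 => /eqP.
Qed.

End LocallyIntegrable.

(** * Calculus of [has_fourier] *)

Section FourierOfDistributions.
Context {R : realType}.
Implicit Types (T : dist R) (g : R3 R -> R[i]) (x xi : R3 R) (U : vdist R).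
Notation T3 := (measurableTypeR R * measurableTypeR R * measurableTypeR R)%type.

Definition fourier_sch (f : schwartz R) : schwartz R := Schwartz (fourier_schwartz (schwartzP f)).

(** Any compactly supported test function f occurs on the right-hand side, paired with the action of
    T on the transform of f. Hence [hat], a choice among all candidates, is determined up to a null
    set. *)
Lemma has_fourier_unique T g g' : has_fourier T g -> has_fourier T g' ->
  {ae mu3, forall x, g x = g' x}.
Proof.
move=> [lg hg] [lg' hg']; apply: dist_of_unique => // f cf.
by rewrite -(hg f (fourier_sch f))// (hg' f (fourier_sch f)).
Qed.

Lemma represents_unique T g g' : represents T g -> represents T g' ->
  {ae mu3, forall x, g x = g' x}.
Proof.
by move=> [lg hg] [lg' hg']; apply: dist_of_unique => // f cf; rewrite -hg// hg'.
Qed.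

Lemma hatP T : (exists g, has_fourier T g) -> has_fourier T (hat T).
Proof. by move=> [g hg]; apply: (@xgetPex _ _ [set g | has_fourier T g]); exists g. Qed.

Lemma hat_ae T g : has_fourier T g -> {ae mu3, forall x, hat T x = g x}.
Proof. by move=> hg; apply: (has_fourier_unique (hatP _) hg); exists g. Qed.

Lemma fun_of_ae T g : represents T g -> {ae mu3, forall x, fun_of T x = g x}.
Proof.
move=> hg; apply: (represents_unique _ hg).
by apply: (@xgetPex _ _ [set g | represents T g]); exists g.
Qed.

(** Unconditional thanks to the default value 0 of [hat]; the symbol of [leray] being bounded, the
    transform of a projection is therefore known for every field. *)
Lemma hat_L1loc T : L1loc (hat T).
Proof.
have [/hatP[]//|h] := pselect (exists g, has_fourier T g).
rewrite /hat xgetPN; last by move=> g hg; apply: h; exists g.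
exact: L1loc0.
Qed.

Lemma fun_of_L1loc T : L1loc (fun_of T).
Proof.
have [h|h] := pselect (exists g, represents T g).
  by have [] := @xgetPex _ (fun=> 0) [set g | represents T g] h.
rewrite /fun_of xgetPN; last by move=> g hg; apply: h; exists g.
exact: L1loc0.
Qed.

Lemma has_fourierD T T' g g' : has_fourier T g -> has_fourier T' g' ->
  has_fourier (T + T') (fun x => g x + g' x).
Proof.
move=> [lg hg] [lg' hg']; split; first exact: L1locD.
move=> f h cf hh; rewrite -[LHS]/(T h + T' h) (hg f)// (hg' f)//.
rewrite /dist_of !cintegralE -cintD; [|exact: L1loc_schwartz|exact: L1loc_schwartz].
by apply: eq_cint => x; rewrite mulrDl.
Qed.

Lemma has_fourierZ c T g : has_fourier T g -> has_fourier (c *: T) (fun x => c * g x).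
Proof.
move=> [lg hg]; split; first exact: L1locZ.
move=> f h cf hh; rewrite -[LHS]/(c * T h) (hg f)//.
rewrite /dist_of !cintegralE -cintZl; last exact: L1loc_schwartz.
by apply: eq_cint => x; rewrite mulrA.
Qed.

Lemma has_fourierN T g : has_fourier T g -> has_fourier (- T) (fun x => - g x).
Proof.
move=> /(has_fourierZ (-1)); rewrite scaleN1r.
by under [X in has_fourier _ X]eq_fun do rewrite mulN1r.
Qed.

Lemma has_fourierB T T' g g' : has_fourier T g -> has_fourier T' g' ->
  has_fourier (T - T') (fun x => g x - g' x).
Proof. by move=> h h'; exact: (has_fourierD h (has_fourierN h')). Qed.

Lemma has_fourier0 : has_fourier (0 : dist R) (fun=> 0).
Proof.
split; first exact: L1loc0.
move=> f h cf hh; rewrite /dist_of cintegralE -[LHS]/(0 : R[i]).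
by under eq_cint do rewrite mul0r; rewrite cint0.
Qed.

Lemma has_fourier_sum (I : Type) (r : seq I) (F : I -> dist R) (G : I -> R3 R -> R[i]) :
  (forall i, has_fourier (F i) (G i)) ->
  has_fourier (\sum_(i <- r) F i) (fun x => \sum_(i <- r) G i x).
Proof.
move=> h; elim: r => [|i r ih].
  by rewrite big_nil; under [X in has_fourier _ X]eq_fun do rewrite big_nil; exact: has_fourier0.
by rewrite big_cons; under [X in has_fourier _ X]eq_fun do rewrite big_cons; exact: has_fourierD.
Qed.

Lemma cmeas_coord i : cmeas (fun x : T3 => (coord3 x i)%:C).
Proof. by apply: cmeasR; exact: measurable_coord3. Qed.

Lemma L1loc_coord i g : L1loc g -> L1loc (fun x => (coord3 x i)%:C * g x).
Proof.
move=> lg; apply: L1locM => //; first exact: cmeas_coord.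
by move=> rho; exists rho => x hx; rewrite normcR; apply: le_trans (coord3_le_enorm _ _) hx.
Qed.

(** A derivative of a transform is the transform of [mulix], which keeps the support of the test
    function compact; the sign in [dderiv] cancels the one in [mulix]. *)
Lemma has_fourier_dderiv j T g : has_fourier T g ->
  has_fourier (dderiv j T) (fun x => 'i * ((coord3 x j)%:C * g x)).
Proof.
move=> [lg hg]; split; first by apply: L1locZ; exact: L1loc_coord.
move=> f h cf hh; rewrite /dderiv.
have sf := schwartzP f.
pose f' : schwartz R := Schwartz (schwartz_mulix j sf).
rewrite (hg f').
- rewrite /dist_of !cintegralE -cintN.
    apply: eq_cint => x; rewrite /f' /= /mulix; ring.
  apply: L1loc_schwartz => //.
  by have [r hr] := cf; exists r => x rx; rewrite /= /mulix hr// !mulr0.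
- by have [r hr] := cf; exists r => x rx; rewrite /= /mulix hr// !mulr0.
- move=> xi; rewrite /= -(pderiv_fourier j sf); congr (pderiv j _ xi).
  by apply/funext.
Qed.

Lemma has_fourier_laplacian T g : has_fourier T g ->
  has_fourier (laplacian T) (fun x => - (enorm x ^+ 2)%:C * g x).
Proof.
move=> hg; have := has_fourier_sum (index_enum 'I_3)
  (fun j => has_fourier_dderiv j (has_fourier_dderiv j hg)).
congr (has_fourier _ _); apply/funext => x.
rewrite sqr_enorm /dot rmorph_sum mulNr mulr_suml -sumrN; apply: eq_bigr => j _.
rewrite rmorphM /=; have := @sqrCi R[i]; rewrite expr2 => h.
transitivity ('i * 'i * ((coord3 x j)%:C * (coord3 x j)%:C * g x)); first by ring.
by rewrite h mulN1r.
Qed.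

Lemma has_fourier_inv g : L1loc g -> has_fourier (inv_fourier_dist g) g.
Proof.
move=> lg; split => // f h cf hh; rewrite /inv_fourier_dist /dist_of.
rewrite (_ : (h : R3 R -> R[i]) = fourier f); last by apply/funext.
by rewrite inv_fourierK//; exact: schwartzP.
Qed.

Lemma leray_symbol_le1 x i j : `|leray_symbol x i j| <= 2.
Proof.
rewrite /leray_symbol; have h : `|coord3 x i * coord3 x j / enorm x ^+ 2| <= 1.
  (* At the origin the quotient is 0, by the convention on inverses. *)
  have [->|e0] := eqVneq (enorm x) 0; first by rewrite expr0n invr0 mulr0 normr0.
  have ep : 0 < enorm x by rewrite lt_neqAle eq_sym e0 enorm_ge0.
  rewrite normrM normfV [`|_ ^+ 2|]ger0_norm ?sqr_ge0// ler_pdivrMr ?exprn_gt0// mul1r.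
  rewrite normrM expr2; apply: ler_pM => //; exact: coord3_le_enorm.
have h1 : `|(i == j)%:R : R| <= 1 by case: (i == j); rewrite ?normr1 ?normr0.
by apply: le_trans (ler_normB _ _) _; lra.
Qed.

Lemma measurable_leray_symbol i j : measurable_fun [set: T3] (fun x : T3 => leray_symbol x i j).
Proof.
apply: measurable_funB; first exact: measurable_cst.
apply: measurable_funM; first by apply: measurable_funM; exact: measurable_coord3.
rewrite (_ : (fun x : T3 => _) = (fun r : R => r `^ (-1)) \o (fun x : T3 => enorm x ^+ 2)); last first.
  by apply/funext => x /=; rewrite powR_inv1// sqr_ge0.
apply: (measurableT_comp (measurable_powR (-1))).
by apply: measurable_funX; exact: (measurable_enorm measurable_id3).
Qed.

Lemma L1loc_leray (G : 'I_3 -> R3 R -> R[i]) i : (forall j, L1loc (G j)) ->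
  L1loc (fun x => \sum_(j < 3) (leray_symbol x i j)%:C * G j x).
Proof.
move=> lG; apply: L1loc_sum => j; apply: L1locM => //.
  by apply: cmeasR; exact: measurable_leray_symbol.
by move=> rho; exists 2 => x _; rewrite normcR leray_symbol_le1.
Qed.

Lemma has_fourier_leray U i :
  has_fourier (leray U i) (fun x => \sum_(j < 3) (leray_symbol x i j)%:C * hat (U j) x).
Proof. by apply: has_fourier_inv; apply: L1loc_leray => j; exact: hat_L1loc. Qed.

Lemma has_fourier_cross (a : 'I_3 -> R) U (G : 'I_3 -> R3 R -> R[i]) i :
  (forall j, has_fourier (U j) (G j)) ->
  has_fourier (cross a U i) (fun x => (a (i + 1))%:C * G (i + 2) x - (a (i + 2))%:C * G (i + 1) x).
Proof. by move=> h; apply: has_fourierB; exact: has_fourierZ. Qed.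

(** A test function f and its reflected conjugate ft have conjugate transforms, so f + ft and i (f -
    ft) have real ones. That T is real on both transforms yields the equality of the imaginary and
    of the real parts of the two pairings with f. *)
Lemma has_fourier_real T g : real_valued T -> has_fourier T g ->
  {ae mu3, forall x, g (- x) = conjc (g x)}.
Proof.
move=> rT [lg hg].
have lg' := L1loc_conj_opp lg.
have : {ae mu3, forall x, g x = conjc (g (- x))}.
  apply: dist_of_unique => // f cf; have sf := schwartzP f.
  have [r hr] := cf.
  pose ft x := conjc (f (- x)).
  have sft : is_schwartz ft by exact: (schwartz_opp (schwartz_conj sf)).
  have cft : compactly_supported ft.
    by exists r => x rx; rewrite /ft hr ?enormN// conjc0.
  have [if_ ift] := (schwartz_cintegrable sf, schwartz_cintegrable sft).
  have Fft x : fourier ft x = conjc (fourier f x).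
    rewrite (@fourier_opp _ (fun x => conjc (f x)))// ?fourier_conj ?opprK//; exact: cintegrable_conj.
  pose f1 : schwartz R := Schwartz (schwartzD sf sft).
  pose f2 : schwartz R := Schwartz (schwartzZ 'i (schwartzD sf (schwartzZ (-1) sft))).
  have cf1 : compactly_supported f1.
    by have [r' hr'] := cft; exists (Num.max r r') => x; rewrite gt_max => /andP[h1 h2]; rewrite /= hr// hr'// addr0.
  have cf2 : compactly_supported f2.
    by have [r' hr'] := cft; exists (Num.max r r') => x; rewrite gt_max => /andP[h1 h2]; rewrite /= hr// hr'// mulr0 addr0 mulr0.
  have E1 : Im (dist_of g f1) = 0.
    rewrite -(hg f1 (fourier_sch f1))//; apply: rT => x.
    have e : fourier f1 x = fourier f x + fourier ft x by exact: fourierD.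
    by rewrite -[LHS]/(Im (fourier f1 x)) e Fft ImD Im_conj subrr.
  have E2 : Im (dist_of g f2) = 0.
    rewrite -(hg f2 (fourier_sch f2))//; apply: rT => x.
    have i3 : cintegrable mu3 (fun x => -1 * ft x) by exact: cintegrableZl.
    have e : fourier f2 x = 'i * (fourier f x + -1 * fourier ft x).
      by rewrite -fourierZ// -fourierD// -fourierZ//; exact: cintegrableD.
    rewrite -[LHS]/(Im (fourier f2 x)) e Fft mulN1r.
    move: (fourier f x) => z; rewrite ImM ReD ImD ReN ImN Re_conj Im_conj subrr mulr0 addr0.
    by rewrite -[Re 'i]/(0 : R) mul0r.
  have ig : cintegrable mu3 (fun x => g x * f x) by exact: L1loc_schwartz.
  have igt : cintegrable mu3 (fun x => g x * ft x) by exact: (@L1loc_schwartz _ g (Schwartz sft)).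
  have igt' : cintegrable mu3 (fun x => conjc (g (- x)) * f x) by exact: L1loc_schwartz.
  have EB : cint mu3 (fun x => g x * ft x) = conjc (cint mu3 (fun x => conjc (g (- x)) * f x)).
    rewrite -cint_conj//.
    have := rescales_cint rescales3_opp igt; rewrite mul1r => <-.
    by apply: eq_cint => x; rewrite /ft opprK conjcM conjcK.
  have D1 : dist_of g f1 = cint mu3 (fun x => g x * f x) + cint mu3 (fun x => g x * ft x).
    by rewrite /dist_of cintegralE -cintD//; apply: eq_cint => x; rewrite /= mulrDr.
  have D2 : dist_of g f2 = 'i * (cint mu3 (fun x => g x * f x) - cint mu3 (fun x => g x * ft x)).
    rewrite /dist_of cintegralE -cintB// -cintZl; last exact: (cintegrableD ig (cintegrableN igt)).
    by apply: eq_cint => x; rewrite /= mulN1r; ring.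
  rewrite D1 EB ImD Im_conj in E1.
  rewrite D2 EB ImM ReD ReN Re_conj /= mul0r add0r mul1r in E2.
  rewrite /dist_of !cintegralE; apply: complex_eq; apply/eqP; rewrite -subr_eq0; apply/eqP.
    exact: E2.
  exact: E1.
by apply: filterS => x ->; rewrite conjcK.
Qed.

Lemma has_fourier_div U (G : 'I_3 -> R3 R -> R[i]) : divergence U = 0 ->
  (forall j, has_fourier (U j) (G j)) ->
  {ae mu3, forall x, \sum_(j < 3) (coord3 x j)%:C * G j x = 0}.
Proof.
move=> dU hG.
have h1 := has_fourier_sum (index_enum 'I_3) (fun j => has_fourier_dderiv j (hG j)).
rewrite -/(divergence U) dU in h1.
have := has_fourier_unique h1 has_fourier0; apply: filterS => x.
rewrite -mulr_sumr => /eqP; rewrite mulf_eq0 => /orP[/eqP h|/eqP//].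
by have := @sqrCi R[i]; rewrite h expr2 mul0r => /eqP; rewrite eq_sym oppr_eq0 oner_eq0.
Qed.

Lemma has_fourier_rhs (nu Om : R) U i : (exists g, has_fourier (U i) g) ->
  has_fourier (nsc_rhs nu Om U i) (fun x =>
    nu%:C * (- (enorm x ^+ 2)%:C * hat (U i) x)
    - Om%:C * (\sum_(j < 3) (leray_symbol x i j)%:C * hat (cross e3 U j) x)
    - \sum_(j < 3) (leray_symbol x i j)%:C * hat (advection U j) x).
Proof.
move=> /hatP h; apply: has_fourierB; last exact: has_fourier_leray.
apply: has_fourierB; last by apply: has_fourierZ; exact: has_fourier_leray.
by apply: has_fourierZ; exact: has_fourier_laplacian.
Qed.

End FourierOfDistributions.

(** * From compactly supported to arbitrary test functions *)

Section TemperedFourier.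
Context {R : realType}.
Implicit Types (T : dist R) (f g h : R3 R -> R[i]) (x xi : R3 R).
Notation T3 := (measurableTypeR R * measurableTypeR R * measurableTypeR R)%type.

Definition unit_bump x : R[i] :=
  (box_bump 1 (fun=> -1) (fun=> 1) 0)^-1 * box_bump 1 (fun=> -1) (fun=> 1) x.

Lemma unit_bump0 : unit_bump 0 = 1.
Proof.
rewrite /unit_bump mulVf// /box_bump.
have b0 : bump1 0 (1 * 0 + - (1 * -1)) * bump1 0 (- 1 * 0 + 1 * 1) != 0 :> R.
  by rewrite !mulr0 !mul1r !add0r opprK /bump1 ltr01 expr0 invr1 mul1r mulf_neq0// gt_eqF// expR_gt0.
rewrite !coord3_0 eq_complex /= eqxx andbT; exact: (mulf_neq0 (mulf_neq0 b0 b0) b0).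
Qed.

Lemma unit_bump_schwartz : is_schwartz unit_bump.
Proof. by apply: schwartzZ; exact: box_bump_schwartz. Qed.

Lemma unit_bump_compact : compactly_supported unit_bump.
Proof.
have [r hr] := @box_bump_compact R 1 (fun=> -1) (fun=> 1) ltr01.
by exists r => x rx; rewrite /unit_bump (hr x rx) mulr0.
Qed.

(** Tends to 1 at every point, since [unit_bump] is 1 at the origin. The term [+ 0] keeps the form
    of [schwartz_affine]. *)
Definition cutoff (n : nat) x : R[i] := unit_bump (harmonic n *: x + 0).

Lemma cutoff_schwartz f n : is_schwartz f -> is_schwartz (fun x => f (harmonic n *: x + 0)).
Proof. by apply: schwartz_affine; rewrite gt_eqF// harmonic_gt0'. Qed.

Lemma cutoff_compact n h : compactly_supported (fun x => cutoff n x * h x).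
Proof.
have [r hr] := unit_bump_compact; exists (r / harmonic n) => x rx.
rewrite /cutoff hr ?mul0r// addr0 enormZ gtr0_norm ?harmonic_gt0'//.
by rewrite mulrC -ltr_pdivrMr ?harmonic_gt0'.
Qed.

(** Sequences tending to 0 in the Schwartz space, given by a class stable under derivatives and
    under multiplication by -i x_j. The first form is the error made by the cut-off; differentiating
    the cut-off produces the second, with a factor [harmonic n]. *)
Inductive vanishing : (nat -> R3 R -> R[i]) -> Prop :=
| Van_cutoff h of is_schwartz h : vanishing (fun n x => (cutoff n x - 1) * h x)
| Van_small (a : nat -> R) p h of is_schwartz p & is_schwartz h & a n @[n --> \oo] --> (0 : R) :
    vanishing (fun n x => (a n)%:C * (p (harmonic n *: x + 0) * h x))
| Van_add z w of vanishing z & vanishing w : vanishing (fun n x => z n x + w n x).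

Lemma schwartz_cutoffB1 h n : is_schwartz h -> is_schwartz (fun x => (cutoff n x - 1) * h x).
Proof.
move=> sh; rewrite (_ : (fun x => _) = fun x => cutoff n x * h x + -1 * h x).
  by apply: schwartzD; [apply: schwartzM => //; exact: cutoff_schwartz unit_bump_schwartz|exact: schwartzZ].
by apply/funext => x; rewrite mulrBl mul1r mulN1r.
Qed.

Lemma vanishing_schwartz z n : vanishing z -> is_schwartz (z n).
Proof.
elim => [h sh|a p h sp sh _|z1 z2 _ h1 _ h2]; first exact: schwartz_cutoffB1.
  by apply: schwartzZ; apply: schwartzM => //; exact: cutoff_schwartz.
exact: schwartzD.
Qed.

Lemma is_pd_cutoff j p n x : is_schwartz p ->
  is_pd j (fun x => p (harmonic n *: x + 0)) x ((harmonic n)%:C * pderiv j p (harmonic n *: x + 0)).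
Proof. by move=> sp; apply: is_pd_affine; exact: schwartz_cdiff. Qed.

Lemma vanishing_pderiv j z : vanishing z -> vanishing (fun n => pderiv j (z n)).
Proof.
elim => [h sh|a p h sp sh ca|z1 z2 v1 h1 v2 h2].
- rewrite (_ : (fun n => _) = (fun n x => (cutoff n x - 1) * pderiv j h x +
     (harmonic n)%:C * (pderiv j unit_bump (harmonic n *: x + 0) * h x))).
    apply: Van_add; first by apply: Van_cutoff; exact: is_schwartz_pderiv.
    by apply: Van_small => //; [exact: is_schwartz_pderiv unit_bump_schwartz|exact: cvg_harmonic].
  apply/funext => n; apply: pderiv_val => x.
  have h1 : is_pd j (fun x => cutoff n x - 1) x _ := is_pdD (is_pd_cutoff j n x unit_bump_schwartz) (is_pd_cst j (-1) x).
  have := is_pdM h1 (cdiff_is_pd j (schwartz_cdiff x sh)).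
  by congr (is_pd _ _ _ _); rewrite addr0 addrC mulrA.
- rewrite (_ : (fun n => _) = (fun n x => (a n)%:C * (p (harmonic n *: x + 0) * pderiv j h x) +
     (a n * harmonic n)%:C * (pderiv j p (harmonic n *: x + 0) * h x))).
    apply: Van_add; first by apply: Van_small => //; exact: is_schwartz_pderiv.
    apply: Van_small => //; first exact: is_schwartz_pderiv.
    by rewrite -[X in _ --> X](mulr0 0); apply: cvgM => //; exact: cvg_harmonic.
  apply/funext => n; apply: pderiv_val => x.
  have h1 := is_pdM (is_pd_cutoff j n x sp) (cdiff_is_pd j (schwartz_cdiff x sh)).
  have := is_pdM (is_pd_cst j (a n)%:C x) h1.
  by congr (is_pd _ _ _ _); rewrite rmorphM /=; ring.
- rewrite (_ : (fun n => _) = (fun n x => pderiv j (z1 n) x + pderiv j (z2 n) x)); first exact: Van_add.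
  apply/funext => n; apply: pderiv_val => x.
  by apply: is_pdD; apply: cdiff_is_pd; apply: schwartz_cdiff; exact: vanishing_schwartz.
Qed.

Lemma vanishing_iter_pderiv j N z : vanishing z -> vanishing (fun n => iter N (pderiv j) (z n)).
Proof. by move=> hz; elim: N => //= N ih; exact: (vanishing_pderiv j ih). Qed.

Lemma vanishing_mulix j z : vanishing z -> vanishing (fun n => mulix j (z n)).
Proof.
elim => [h sh|a p h sp sh ca|z1 z2 v1 h1 v2 h2].
- rewrite (_ : (fun n => _) = (fun n x => (cutoff n x - 1) * mulix j h x)).
    by apply: Van_cutoff; exact: schwartz_mulix.
  by apply/funext => n; apply/funext => x; rewrite /mulix; ring.
- rewrite (_ : (fun n => _) = (fun n x => (a n)%:C * (p (harmonic n *: x + 0) * mulix j h x))).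
    by apply: Van_small => //; exact: schwartz_mulix.
  by apply/funext => n; apply/funext => x; rewrite /mulix; ring.
- rewrite (_ : (fun n => _) = (fun n x => mulix j (z1 n) x + mulix j (z2 n) x)); first exact: Van_add.
  by apply/funext => n; apply/funext => x; rewrite /mulix; ring.
Qed.

Lemma cutoff_cvg x : ccvg (fun n => cutoff n x) 1.
Proof. by rewrite -unit_bump0; apply: schwartz_ccvg_line; exact: unit_bump_schwartz. Qed.

Lemma cutoff_bounded : exists2 C : R, 0 <= C & forall n x, normc (cutoff n x) <= C.
Proof.
have [C C0 hC] := decays_ge0 0 (schwartz_decays unit_bump_schwartz).
by exists C => // n x; apply: le_trans (hC (harmonic n *: x + 0)); rewrite expr0 mul1r.
Qed.

(** Convergence in L^1 alone. Since the class is stable under [pderiv] and [mulix], it yields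
    convergence of the transforms in every Schwartz seminorm. *)
Lemma vanishing_int z : vanishing z -> \int[mu3]_x normc (z n x) @[n --> \oo] --> (0 : R).
Proof.
elim => [h sh|a p h sp sh ca|z1 z2 v1 h1 v2 h2].
- have [C C0 hC] := cutoff_bounded; have ih := schwartz_cintegrable sh.
  have -> : (0 : R) = \int[mu3]_x (0 : R) by rewrite /Rintegral integral0.
  have mz n : cmeas (fun x : T3 => (cutoff n x - 1) * h x).
    by apply: schwartz_cmeas; exact: schwartz_cutoffB1.
  apply: (@Rintegral_dct _ _ _ mu3 _ _ (fun x => (C + 1) * normc (h x))).
  + by move=> n; exact: measurable_normc.
  + exact: measurable_cst.
  + apply: nearW => x; have := ccvgM (cutoff_cvg x) (ccvg_cst (h x)).
    rewrite /ccvg mul1r; apply: cvg_trans; apply: near_eq_cvg; apply: nearW => n.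
    by rewrite mulrBl mul1r.
  + have := integrableZl measurableT (C + 1) (cintegrable_normc ih).
    by apply: eq_integrable => // x _ /=; rewrite EFinM.
  + move=> n x; rewrite ger0_norm ?normc_ge0// Normc.normcM ler_wpM2r ?normc_ge0//.
    by apply: le_trans (le_normcB _ _) _; rewrite Normc.normc1 lerD2r.
- have [C C0 hC] := decays_ge0 0 (schwartz_decays sp); have ih := schwartz_cintegrable sh.
  have c0 : `|a n| * (C * \int[mu3]_x normc (h x)) @[n --> \oo] --> (0 : R).
    rewrite -[X in _ --> X](mul0r (C * \int[mu3]_x normc (h x))).
    by apply: cvgMl; exact/norm_cvg0P.
  have sz n : is_schwartz (fun x => (a n)%:C * (p (harmonic n *: x + 0) * h x)).
    by apply: schwartzZ; apply: schwartzM => //; exact: cutoff_schwartz.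
  apply: (squeeze_cvgr _ (cvg_cst 0) c0); apply: nearW => n.
  apply/andP; split; first by apply: Rintegral_ge0 => x _; exact: normc_ge0.
  have i1 : mu3.-integrable setT (EFin \o (fun x => C * normc (h x))).
    have := integrableZl measurableT C (cintegrable_normc ih).
    by apply: eq_integrable => // x _ /=; rewrite EFinM.
  rewrite -(RintegralZl _ _ (cintegrable_normc ih))// -RintegralZl//.
  apply: Rintegral_le.
  + exact: cintegrable_normc (schwartz_cintegrable (sz n)).
  + have := integrableZl measurableT (`|a n|) i1.
    by apply: eq_integrable => // x _ /=; rewrite EFinM.
  + move=> x; rewrite !Normc.normcM normcR ler_wpM2l// ler_wpM2r ?normc_ge0//.
    by apply: le_trans (hC (harmonic n *: x + 0)); rewrite expr0 mul1r.
- have c0 : \int[mu3]_x normc (z1 n x) + \int[mu3]_x normc (z2 n x) @[n --> \oo] --> (0 : R).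
    by rewrite -[X in _ --> X](addr0 0); exact: cvgD.
  apply: (squeeze_cvgr _ (cvg_cst 0) c0); apply: nearW => n.
  apply/andP; split; first by apply: Rintegral_ge0 => x _; exact: normc_ge0.
  have i1 := schwartz_cintegrable (vanishing_schwartz n v1).
  have i2 := schwartz_cintegrable (vanishing_schwartz n v2).
  have [n1 n2] := (cintegrable_normc i1, cintegrable_normc i2).
  rewrite /= -RintegralD//; apply: Rintegral_le.
  + exact: cintegrable_normc (cintegrableD i1 i2).
  + by have := integrableD measurableT n1 n2; apply: eq_integrable.
  + by move=> x; exact: le_normcD.
Qed.

Lemma vanishing_fourier z N (e : R) : vanishing z -> 0 < e ->
  \forall n \near \oo, forall xi, (1 + enorm xi) ^+ N * normc (fourier (z n) xi) <= e.
Proof.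
move=> vz e0.
pose B n := 4 ^+ N * (\int[mu3]_x normc (z n x) +
    \int[mu3]_x normc (iter N (pderiv 0) (z n) x) + \int[mu3]_x normc (iter N (pderiv 1) (z n) x) +
    \int[mu3]_x normc (iter N (pderiv 2) (z n) x)).
have cB : B n @[n --> \oo] --> (0 : R).
  have c j := vanishing_int (vanishing_iter_pderiv j N vz).
  rewrite -[X in _ --> X](mulr0 (4 ^+ N)); apply: cvgMr.
  rewrite -[X in _ --> X]addr0; apply: cvgD; last exact: (c 2).
  rewrite -[X in _ --> X]addr0; apply: cvgD; last exact: (c 1).
  by rewrite -[X in _ --> X]addr0; apply: cvgD; [exact: vanishing_int|exact: (c 0)].
move/cvgrPdist_le : cB => /(_ _ e0); apply: filterS => n; rewrite sub0r normrN => hB xi.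
apply: le_trans (fourier_decay_bound N xi (vanishing_schwartz n vz)) _.
exact: le_trans (ler_norm _) hB.
Qed.

(** A derivative of the transform is the transform of [mulix], which stays in the class. The
    induction removes the last direction of the list, the one differentiated first. *)
Lemma vanishing_pderivs_fourier z N m (e : R) : vanishing z -> 0 < e ->
  \forall n \near \oo, forall (a : seq 'I_3) xi, (size a <= m)%N ->
    (1 + enorm xi) ^+ N * normc (pderivs a (fourier (z n)) xi) <= e.
Proof.
move=> vz e0; elim: m z vz => [|m ih] z vz.
  have := vanishing_fourier N vz e0; apply: filterS => n h a xi.
  by rewrite leqn0 => /nilP ->.
have hj j := ih _ (vanishing_mulix j vz).
apply: filter_app (hj 2); apply: filter_app (hj 1); apply: filter_app (hj 0).
have := vanishing_fourier N vz e0; apply: filterS => n h h0 h1 h2 a xi.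
case/lastP: a => [//|a j]; rewrite size_rcons ltnS => sa.
rewrite /pderivs foldr_rcons pderiv_fourier; last exact: vanishing_schwartz.
by case: (I3P j) => ->; [exact: h0|exact: h1|exact: h2].
Qed.

Lemma vanishing_seminorm z N (f : nat -> schwartz R) : vanishing z ->
  (forall n, f n = fourier (z n) :> (R3 R -> R[i])) ->
  seminorm N (f n) @[n --> \oo] --> (0 : R).
Proof.
move=> vz fE; apply/cvgrPdist_le => e e0.
have := vanishing_pderivs_fourier N N vz e0; apply: filterS => n h.
rewrite sub0r normrN /seminorm fE.
set S := [set r | _].
have S0 : S ((1 + enorm (0 : R3 R)) ^+ N * normc (pderivs [::] (fourier (z n)) 0)) by exists [::], 0.
have Se : ubound S e by move=> _ [a [x [sa ->]]]; exact: h.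
rewrite ger0_norm; last first.
  by apply: le_trans (ub_le_sup _ S0); [rewrite mulr_ge0 ?baseX_ge0 ?normc_ge0|exists e].
by apply: ge_sup => //; exists ((1 + enorm (0 : R3 R)) ^+ N * normc (pderivs [::] (fourier (z n)) 0)).
Qed.

(** [has_fourier] only tests compactly supported functions of the frequency. For general f the
    inverse transform is cut off: the error tends to 0 in the Schwartz space, so that temperedness
    lets T pass to the limit, while the polynomial bound on g allows dominated convergence on the
    other side. *)
Lemma tempered_has_fourier T g M : tempered T -> has_fourier T g ->
  mu3.-integrable [set: T3] (EFin \o (fun xi => (1 + enorm xi) ^- M * normc (g xi))) ->
  forall f : schwartz R, T f = cint mu3 (fun xi => g xi * inv_fourier f xi).
Proof.
move=> [linT [N [C hC]]] [lg hg] ig f.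
pose h := inv_fourier f; have sh : is_schwartz h by exact: inv_fourier_schwartz (schwartzP f).
have schi n : is_schwartz (fun x => cutoff n x * h x).
  by apply: schwartzM => //; exact: cutoff_schwartz unit_bump_schwartz.
pose z n x := (cutoff n x - 1) * h x.
have vz : vanishing z by exact: Van_cutoff.
pose Fz n : schwartz R := Schwartz (fourier_schwartz (vanishing_schwartz n vz)).
pose Fh n : schwartz R := Schwartz (fourier_schwartz (schi n)).
have c0 : ccvg (fun n => T (Fz n)) 0.
  have cs := vanishing_seminorm N vz (fun n => erefl : Fz n = fourier (z n) :> (R3 R -> R[i])).
  apply: (@ccvg_le _ _ _ (fun n => C * seminorm N (Fz n))).
    by move=> n; rewrite subr0; exact: hC.
  by rewrite -[X in _ --> X](mulr0 C); apply: cvgMr.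
have E n : T (Fh n) = T (Fz n) + T f.
  rewrite -[T (Fz n)]mul1r; apply: linT => x /=.
  rewrite mul1r -[in RHS](fourierK (schwartzP f)) -fourierD.
  - by congr (fourier _ x); apply/funext => y; rewrite /z mulrBl mul1r subrK.
  - by apply: schwartz_cintegrable; exact: vanishing_schwartz.
  - exact: schwartz_cintegrable.
have c1 : ccvg (fun n => T (Fh n)) (T f).
  rewrite -[X in ccvg _ X]add0r; under [X in ccvg X]eq_fun do rewrite E.
  by apply: ccvgD => //; exact: ccvg_cst.
apply: (ccvg_unique c1).
have -> : (fun n => T (Fh n)) = (fun n => cint mu3 (fun xi => g xi * (cutoff n xi * h xi))).
  apply/funext => n; rewrite (hg (Schwartz (schi n)))//.
  exact: cutoff_compact.
have [D D0 hD] := decays_ge0 M (schwartz_decays sh); have [B B0 hB] := cutoff_bounded.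
apply: (@cint_dctc _ _ _ mu3 _ _ (fun xi => (B * D) * ((1 + enorm xi) ^- M * normc (g xi)))).
- move=> n; apply: cmeasM; first exact: L1loc_cmeas.
  exact: schwartz_cmeas.
- by apply: cmeasM; [exact: L1loc_cmeas|exact: schwartz_cmeas].
- apply: nearW => x; apply: ccvgM; first exact: ccvg_cst.
  by rewrite -[X in ccvg _ X]mul1r; apply: ccvgM; [exact: cutoff_cvg|exact: ccvg_cst].
- have := integrableZl measurableT (B * D) ig.
  by apply: eq_integrable => // x _ /=; rewrite EFinM.
- move=> n x; rewrite 2!Normc.normcM.
  rewrite [leRHS](_ : _ = (B * (D * (1 + enorm x) ^- M)) * normc (g x)); last by ring.
  rewrite mulrC.
  rewrite ler_wpM2r ?normc_ge0//; apply: ler_pM => //; rewrite ?normc_ge0//.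
  by rewrite ler_pdivlMr ?exprn_gt0 ?base_gt0// mulrC.
Qed.

End TemperedFourier.

(** * The Fourier transform of the advection term *)

Section SquareIntegrableInverse.
Context {R : realType}.
Implicit Types (f g a : R3 R -> R[i]) (x xi : R3 R).
Notation T3 := (measurableTypeR R * measurableTypeR R * measurableTypeR R)%type.

(** Dyadic decomposition according to 1 + |xi| rather than |xi|, so that the shells of nonnegative
    index already fill the space. *)
Definition low (n : nat) xi : R := (1 + enorm xi < 2 ^+ n)%R%:R.
Definition shell (n : nat) xi : R := (2 ^+ n <= 1 + enorm xi < 2 ^+ n.+1)%R%:R.

Lemma sum_shell N xi : \sum_(n < N) shell n xi = low N xi.
Proof.
elim: N => [|N ih].
  by rewrite big_ord0 /low expr0 ltNge lerDl enorm_ge0.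
rewrite big_ord_recr /= ih /low /shell.
have h2 : 2 ^+ N <= 2 ^+ N.+1 :> R by rewrite exprS ler_peMl ?exprn_ge0// ler1n.
case: ltP => h /=; last by rewrite add0r.
by rewrite addr0 (lt_le_trans h h2).
Qed.

Lemma nnm_bool (P : R3 R -> bool) : measurable_fun [set: T3] (P : T3 -> bool) ->
  nnm (fun x : T3 => (P x)%:R : R).
Proof.
move=> mP; split; last by move=> x; case: (P x).
rewrite (_ : (fun x => _) = (fun x : T3 => if P x then 1 else 0)); last by apply/funext => x; case: (P x).
by apply: measurable_fun_ifT => //; exact: measurable_cst.
Qed.

Lemma measurable_base : measurable_fun [set: T3] (fun x : T3 => 1 + enorm x).
Proof. by apply: measurable_funD; [exact: measurable_cst|exact: (measurable_enorm measurable_id3)]. Qed.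

Lemma nnm_low n : nnm (low n : T3 -> R).
Proof. by apply: nnm_bool; apply: measurable_fun_ltr; [exact: measurable_base|exact: measurable_cst]. Qed.

Lemma nnm_shell n : nnm (shell n : T3 -> R).
Proof.
apply: nnm_bool; apply: measurable_and.
  by apply: measurable_fun_ler; [exact: measurable_cst|exact: measurable_base].
by apply: measurable_fun_ltr; [exact: measurable_base|exact: measurable_cst].
Qed.

Lemma low_le n xi : low n xi <= 2 ^+ n ^+ 6 * (1 + enorm xi) ^- 6.
Proof.
rewrite ler_pdivlMr ?exprn_gt0 ?base_gt0// /low; case: ltP => h; last first.
  by rewrite mul0r !exprn_ge0.
by rewrite mul1r lerXn2r ?nnegrE ?exprn_ge0// ltW// base_gt0.
Qed.

Lemma low01 n xi : 0 <= low n xi <= 1.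
Proof. by rewrite /low; case: (_ < _); rewrite ?lexx ?ler01. Qed.

Lemma low_cvg xi : low n xi @[n --> \oo] --> (1 : R).
Proof.
apply: cvg_near_cst.
have [k hk] : exists k, 1 + enorm xi < 2 ^+ k.
  exists (Num.truncn (1 + enorm xi)).+1; apply: lt_le_trans (truncnS_gt _) _.
  by rewrite -natrX ler_nat ltnW// ltn_expl.
exists k => // n /= kn; rewrite /low (lt_le_trans hk)// ler_eXn2l ?ltr1n//.
Qed.

Lemma integrable_low n : (nint (low n : R3 R -> R) < +oo)%E.
Proof.
apply: (@le_lt_trans _ _ (nint (fun xi : R3 R => 2 ^+ n ^+ 6 * (1 + enorm xi) ^- 6)%R)).
  apply: le_nint; [exact: nnm_low| |exact: low_le].
  apply: nnmM; first by apply: nnm_cst; rewrite !exprn_ge0.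
  split; last by move=> x; rewrite invr_ge0 baseX_ge0.
  by apply/measurable_EFinP; exact: (measurable_int _ (@integrable_decay R)).
have nd : nnm (fun xi : T3 => (1 + enorm xi) ^- 6).
  split; last by move=> x; rewrite invr_ge0 baseX_ge0.
  by apply/measurable_EFinP; exact: (measurable_int _ (@integrable_decay R)).
rewrite nintZ ?exprn_ge0//; apply: lte_mul_pinfty; rewrite ?lee_fin ?exprn_ge0//.
by apply: integrable_nint (@integrable_decay R); have [] := nd.
Qed.

Section inverse.
Variable g : R3 R -> R[i].
Hypothesis mg : cmeas (g : T3 -> R[i]).
Hypothesis gi : (nint (fun xi => (1 + enorm xi) * normc (g xi) ^+ 2)%R < +oo)%E.

Let ng : nnm (fun x : T3 => normc (g x)) := nnm_normc mg.
Let nb : nnm (fun x : T3 => 1 + enorm x).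
Proof. by split; [exact: measurable_base|move=> x; exact: ltW (base_gt0 x)]. Qed.

Lemma nint_sqr_fin : (nint (fun xi => normc (g xi) ^+ 2)%R < +oo)%E.
Proof.
apply: le_lt_trans gi; apply: le_nint; [exact: nnmX|by apply: nnmM nb _; exact: nnmX|].
by move=> x; rewrite ler_peMl ?sqr_ge0// lerDl enorm_ge0.
Qed.

Lemma cintegrable_low n (c : R3 R -> R) : nnm (c : T3 -> R) -> (forall x, c x <= low n x) ->
  cintegrable mu3 (fun xi => (c xi)%:C * g xi).
Proof.
move=> [mc c0] cl; apply: nint_cintegrable.
  by apply: cmeasM => //; exact: cmeasR.
have n2 := nnmX 2 ng.
apply: (@le_lt_trans _ _ (nint (fun xi => low n xi + normc (g xi) ^+ 2)%R)).
  apply: le_nint; [|by apply: nnmD => //; exact: nnm_low|].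
    by apply: nnm_normc; apply: cmeasM => //; exact: cmeasR.
  move=> x; rewrite Normc.normcM normcR ger0_norm//.
  have := cl x; have := c0 x; rewrite /low; case: (_ < _) => /= h0 h1.
    by have := normc_ge0 (g x); nra.
  have -> : c x = 0 by apply/eqP; rewrite eq_le h0 h1.
  by rewrite mul0r add0r sqr_ge0.
rewrite nintD//; last exact: nnm_low.
by rewrite lte_add_pinfty ?integrable_low ?nint_sqr_fin.
Qed.

Definition trunc n xi : R[i] := (low n xi)%:C * g xi.
Definition piece n xi : R[i] := (shell n xi)%:C * g xi.

Lemma cintegrable_trunc n : cintegrable mu3 (trunc n).
Proof. by apply: (@cintegrable_low n); [exact: nnm_low|]. Qed.

Lemma cintegrable_piece n : cintegrable mu3 (piece n).
Proof.
apply: (@cintegrable_low n.+1); first exact: nnm_shell.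
by move=> x; rewrite /shell /low ler_nat; case: (1 + enorm x < 2 ^+ n.+1); rewrite ?andbF ?leq_b1.
Qed.

Lemma inv_fourier_trunc N x : inv_fourier (trunc N) x = \sum_(n < N) inv_fourier (piece n) x.
Proof.
rewrite inv_fourierE; under eq_bigr => n _ do rewrite inv_fourierE.
rewrite -mulr_sumr; congr (_ * _); rewrite fourierE.
under [RHS]eq_bigr => n _ do rewrite fourierE.
rewrite -cint_sum; last by move=> n; apply: fourier_integrand; exact: cintegrable_piece.
apply: eq_cint => xi; rewrite /trunc -sum_shell rmorph_sum mulr_suml mulr_sumr.
by apply: eq_bigr => n _.
Qed.

Let A n x : R := normc (inv_fourier (piece n) x).

Lemma cmeas_inv_fourier f : cmeas (f : T3 -> R[i]) -> cmeas (inv_fourier f : T3 -> R[i]).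
Proof.
move=> mf; rewrite (_ : inv_fourier f = fun x => ((2 * pi) ^- 3)%:C * fourier f (- x)).
  apply: cmeasM; first exact: cmeas_cst.
  by apply: (cmeas_comp (cmeas_fourier mf)); apply: measurable_R3N; exact: measurable_id3.
by apply/funext => x; rewrite inv_fourierE.
Qed.

Lemma nnm_A n : nnm (A n : T3 -> R).
Proof. by apply: nnm_normc; apply: cmeas_inv_fourier; exact: (cintegrable_cmeas (cintegrable_piece n)). Qed.

Lemma plancherel_inv_le f : cintegrable mu3 f ->
  (nint (fun x => normc (inv_fourier f x) ^+ 2)%R <=
   ((2 * pi) ^- 3)%:E * nint (fun x => normc (f x) ^+ 2)%R)%E.
Proof.
move=> if_; have p0 : 0 < (2 * pi) ^+ 3 :> R by rewrite exprn_gt0// mulr_gt0// pi_gt0.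
have nF : nnm (fun x : T3 => normc (fourier f x) ^+ 2).
  by apply: nnmX; apply: nnm_normc; apply: cmeas_fourier; exact: (cintegrable_cmeas if_).
have -> : (nint (fun x => normc (inv_fourier f x) ^+ 2)%R =
    (((2 * pi) ^- 3) ^+ 2)%:E * nint (fun x => normc (fourier f x) ^+ 2)%R)%E.
  rewrite -nintZ ?sqr_ge0// -[RHS]nint_opp; last first.
    by apply: nnmM => //; apply: nnm_cst; exact: sqr_ge0.
  congr nint; apply/funext => x; rewrite inv_fourierE Normc.normcM exprMn normcR.
  by rewrite ger0_norm// invr_ge0 ltW.
apply: (@le_trans _ _ ((((2 * pi) ^- 3) ^+ 2)%:E * (((2 * pi) ^+ 3)%:E * nint (fun x => normc (f x) ^+ 2)%R))%E).
  by apply: lee_wpmul2l; [rewrite lee_fin sqr_ge0|exact: plancherel_le].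
by rewrite muleA -EFinM expr2 -mulrA mulVf ?mulr1// gt_eqF.
Qed.

Let D x : \bar R := (\sum_(n <oo) (2 ^+ n * A n x ^+ 2)%:E)%E.

Let nD n : nnm (fun x : T3 => 2 ^+ n * A n x ^+ 2).
Proof. by apply: nnmM; [apply: nnm_cst; rewrite exprn_ge0|apply: nnmX; exact: nnm_A]. Qed.

Let mD : measurable_fun [set: T3] (D : T3 -> \bar R).
Proof.
apply: (@ge0_emeasurable_sum _ T3 _ _ _ xpredT) => [k x _ _|k _].
  by rewrite lee_fin; case: (nD k).
by apply/measurable_EFinP; case: (nD k).
Qed.

Let D0 x : (0 <= D x)%E.
Proof. by apply: nneseries_ge0 => n _ _; rewrite lee_fin; case: (nD n). Qed.

(** On the n-th shell 2^n <= 1 + |xi|. Hence Plancherel, applied to each piece, bounds the integral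
    of [D] by the weighted square integral of g. *)
Lemma integrable_D : mu3.-integrable [set: T3] (D : T3 -> \bar R).
Proof.
apply/integrableP; split => //.
under eq_integral => x _ do rewrite gee0_abs//.
rewrite integral_nneseries//; last 2 first.
- by move=> n; apply/measurable_EFinP; case: (nD n).
- by move=> n x _; rewrite lee_fin; case: (nD n).
set M := (((2 * pi) ^- 3)%:E * nint (fun xi => (1 + enorm xi) * normc (g xi) ^+ 2)%R)%E.
have p0 : 0 <= (2 * pi) ^- 3 :> R by rewrite invr_ge0 exprn_ge0// mulr_ge0// pi_ge0.
apply: (@le_lt_trans _ _ M); last by apply: lte_mul_pinfty; rewrite ?lee_fin.
apply: lime_le.
  apply: is_cvg_nneseries => n _ _; apply: integral_ge0 => x _.
  by rewrite lee_fin; case: (nD n).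
apply: nearW => N; rewrite big_mkord.
have nS n : nnm (fun xi : T3 => 2 ^+ n * shell n xi * normc (g xi) ^+ 2).
  apply: nnmM; last exact: nnmX.
  by apply: nnmM; [apply: nnm_cst; rewrite exprn_ge0|exact: nnm_shell].
apply: (@le_trans _ _ (\sum_(n < N) ((2 * pi) ^- 3)%:E *
    nint (fun xi => 2 ^+ n * shell n xi * normc (g xi) ^+ 2)%R)%E).
  apply: lee_sum => n _.
  rewrite -/(nint _) nintZ ?exprn_ge0//; last by apply: nnmX; exact: nnm_A.
  apply: (@le_trans _ _ ((2 ^+ n)%:E * (((2 * pi) ^- 3)%:E * nint (fun x => normc (piece n x) ^+ 2)%R))%E).
    by apply: lee_wpmul2l; [rewrite lee_fin exprn_ge0|apply: plancherel_inv_le; exact: cintegrable_piece].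
  rewrite muleCA lee_wpmul2l ?lee_fin// -nintZ ?exprn_ge0//; last first.
    by apply: nnmX; apply: nnm_normc; exact: (cintegrable_cmeas (cintegrable_piece n)).
  rewrite le_eqVlt; apply/orP; left; apply/eqP; congr nint; apply/funext => xi.
  rewrite /piece Normc.normcM exprMn normcR -mulrA; congr (_ * (_ * _)).
  by rewrite /shell; case: (_ && _); rewrite ?normr1 ?normr0 ?expr1n// expr0n.
rewrite -ge0_sume_distrr; last by move=> n _; apply: nint_ge0 => x; case: (nS n).
apply: lee_wpmul2l; rewrite ?lee_fin//.
have -> : (\sum_(n < N) nint (fun xi => 2 ^+ n * shell n xi * normc (g xi) ^+ 2)%R =
   nint (fun xi => \sum_(n < N) (2 ^+ n * shell n xi * normc (g xi) ^+ 2))%R)%E.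
  rewrite /nint -ge0_integral_sum//.
  - by apply: eq_integral => x _; rewrite sumEFin.
  - by move=> n; apply/measurable_EFinP; case: (nS n).
  - by move=> n x _; rewrite lee_fin; case: (nS n).
apply: le_nint.
- by apply: nnm_sum.
- by apply: nnmM nb _; exact: nnmX.
move=> x; rewrite -mulr_suml ler_wpM2r ?sqr_ge0//.
apply: (@le_trans _ _ (\sum_(n < N) (1 + enorm x) * shell n x)).
  apply: ler_sum => n _; rewrite /shell; case: andP => [[h _]|_]; last by rewrite !mulr0.
  by rewrite !mulr1.
rewrite -mulr_sumr sum_shell ler_piMr//; first exact: ltW (base_gt0 x).
by have /andP[] := low01 N x.
Qed.

Let B x : R := fine (D x).

Lemma integrable_B : mu3.-integrable [set: T3] (EFin \o B).
Proof.
apply: (le_integrable _ _ _ integrable_D) => //.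
  by apply/measurable_EFinP; exact: (measurableT_comp (fine_measurable measurableT) mD).
move=> x _ /=; rewrite /B; have := D0 x; case: (D x) => [r| |]//= r0.
by rewrite normr0 leey.
Qed.

Let G : set T3 := [set x | D x \is a fin_num].

Let mG : measurable G.
Proof. by have := emeasurable_fin_num measurableT mD; rewrite setTI. Qed.

(** Each A_n is at most half of 2^-n + 2^n A_n^2. The first terms sum to at most 2, the others to at
    most B. *)
Lemma sum_A_le x N : G x -> \sum_(n < N) A n x <= 1 + B x.
Proof.
move=> Gx.
have h1 : \sum_(n < N) (2 ^+ n * A n x ^+ 2) <= B x.
  rewrite -lee_fin /B fineK// -sumEFin -(big_mkord xpredT (fun n => (2 ^+ n * A n x ^+ 2)%:E)).
  by apply: nneseries_lim_ge => n _ _; rewrite lee_fin; case: (nD n).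
have h2 : \sum_(n < N) (2 : R) ^- n <= 2.
  have -> : \sum_(n < N) (2 : R) ^- n = 2 - 2 * 2 ^- N.
    elim: N {h1} => [|N ih]; first by rewrite big_ord0 expr0 invr1 mulr1 subrr.
    by rewrite big_ord_recr /= ih exprS invfM; field; rewrite expf_neq0// pnatr_eq0.
  by rewrite lerBlDr lerDl mulr_ge0// invr_ge0 exprn_ge0.
apply: (@le_trans _ _ (\sum_(n < N) 2^-1 * (2 ^- n + 2 ^+ n * A n x ^+ 2))).
  apply: ler_sum => n _; rewrite ler_pdivlMl//.
  have p : 0 < 2 ^+ n :> R by rewrite exprn_gt0.
  have := sqr_ge0 (1 - 2 ^+ n * A n x); rewrite -(pmulr_lge0 _ (_ : 0 < 2 ^- n)) ?invr_gt0//.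
  rewrite (_ : (1 - 2 ^+ n * A n x) ^+ 2 * 2 ^- n = 2 ^- n + 2 ^+ n * A n x ^+ 2 - 2 * A n x).
    by rewrite subr_ge0.
  by field; rewrite gt_eqF.
rewrite -mulr_sumr big_split /=.
have B0 : 0 <= B x by rewrite /B fine_ge0.
by move: h1 h2; set s := \sum_(i < N) _; set t := \sum_(i < N) _; lra.
Qed.

Lemma normc_trunc_le x N : G x -> normc (inv_fourier (trunc N) x) <= 1 + B x.
Proof.
move=> Gx; rewrite inv_fourier_trunc; apply: le_trans (normc_sum _ _ _) _.
exact: sum_A_le.
Qed.

Lemma cvg_real_pieces (q : R[i] -> R) x : (forall z, `|q z| <= normc z) -> G x ->
  cvgn (fun N => \sum_(n < N) q (inv_fourier (piece n) x)).
Proof.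
move=> hq Gx.
pose u n := q (inv_fourier (piece n) x).
have -> : (fun N => \sum_(n < N) q (inv_fourier (piece n) x)) = series u.
  by apply/funext => N; rewrite /series /= big_mkord.
apply: normed_cvg; apply: nondecreasing_is_cvgn.
  apply/nondecreasing_seqP => n; by rewrite /normed_series_of /series /= !big_mkord big_ord_recr /= lerDl.
exists (1 + B x) => _ [N _ <-]; rewrite /normed_series_of /series /= big_mkord.
apply: le_trans (sum_A_le N Gx); apply: ler_sum => n _; exact: hq.
Qed.

(** The indicator of the set where [D] is finite makes the sequence converge at every point, so that
    its limit is measurable. *)
Let w x : R[i] := limn (fun N => \1_G x * Re (inv_fourier (trunc N) x)) +i*
                  limn (fun N => \1_G x * Im (inv_fourier (trunc N) x)).

Lemma cvg_w x : ccvg (fun N => (\1_G x)%:C * inv_fourier (trunc N) x) (w x).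
Proof.
have key (q : R[i] -> R) : {morph q : z z' / z + z'} -> q 0 = 0 -> (forall z, `|q z| <= normc z) ->
    cvgn (fun N => \1_G x * q (inv_fourier (trunc N) x)).
  move=> qD q0 hq; have [Gx|Gx] := pselect (G x); last first.
    under eq_fun do rewrite indicE memNset// mul0r.
    exact: is_cvg_cst.
  under eq_fun do rewrite indicE mem_set// mul1r inv_fourier_trunc (big_morph q qD q0).
  exact: cvg_real_pieces.
apply/ccvgP; split.
  under eq_cvg do rewrite ReMr.
  by apply: (key (@Re R)); [exact: ReD|by []|exact: Re_le_normc].
under eq_cvg do rewrite ImMr.
by apply: (key (@Im R)); [exact: ImD|by []|exact: Im_le_normc].
Qed.

(** The transform g need not be integrable, so its inverse transform is built as an almost
    everywhere limit. Half a derivative beyond L^2 makes the dyadic pieces absolutely summable and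
    leaves the majorant 1 + B, integrable against any rapidly decaying function. *)
Lemma square_integrable_inverse : exists (w : R3 R -> R[i]) (B : R3 R -> R),
  [/\ cmeas (w : T3 -> R[i]), mu3.-integrable [set: T3] (EFin \o B), forall x, 0 <= B x,
    {ae mu3, forall x, ccvg (fun n => inv_fourier (trunc n) x) (w x)} &
    {ae mu3, forall x, forall n, normc (inv_fourier (trunc n) x) <= 1 + B x}].
Proof.
have aeG : {ae mu3, forall x, G x}.
  by have := integrable_ae (@measurableT _ T3) integrable_D; apply: filterS => x; apply.
exists w, B; split.
- have mt n : cmeas (fun x : T3 => (\1_G x)%:C * inv_fourier (trunc n) x).
    apply: cmeasM; first by apply: cmeasR; exact: measurable_indic.
    by apply: cmeas_inv_fourier; exact: (cintegrable_cmeas (cintegrable_trunc n)).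
  split.
    apply: (@measurable_fun_cvg _ T3 _ _ (fun n x => Re ((\1_G x)%:C * inv_fourier (trunc n) x))).
      by move=> n; case: (mt n).
    by move=> x _; have /ccvgP[] := cvg_w x.
  apply: (@measurable_fun_cvg _ T3 _ _ (fun n x => Im ((\1_G x)%:C * inv_fourier (trunc n) x))).
    by move=> n; case: (mt n).
  by move=> x _; have /ccvgP[] := cvg_w x.
- exact: integrable_B.
- by move=> x; rewrite /B fine_ge0.
- apply: filterS aeG => x Gx; have := cvg_w x.
  by apply: ccvg_eq => n; rewrite indicE mem_set// mul1r.
- by apply: filterS aeG => x Gx n; exact: normc_trunc_le.
Qed.

End inverse.

End SquareIntegrableInverse.

(** * Convolution theorem for the advection term *)

Section Advection.
Context {R : realType}.
Implicit Types (T : dist R) (f g a : R3 R -> R[i]) (x xi eta : R3 R) (U : vdist R).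
Notation T3 := (measurableTypeR R * measurableTypeR R * measurableTypeR R)%type.

Definition sqint f : Prop := cmeas (f : T3 -> R[i]) /\ (nint (fun x => normc (f x) ^+ 2)%R < +oo)%E.

(** Only the product is assumed integrable: a section of a convolution integrand may fail to be
    integrable where the outer factor c vanishes. *)
Lemma cintZr_if {d} {T' : measurableType d} (mu : {measure set T' -> \bar R}) (h : T' -> R[i]) (c : R[i]) :
  cintegrable mu (fun y => h y * c) -> cint mu (fun y => h y * c) = cint mu h * c.
Proof.
have [->|c0] := eqVneq c 0.
  by move=> _; under eq_cint do rewrite mulr0; rewrite cint0 mulr0.
move=> ih; rewrite -[LHS]mul1r -(mulVf c0) mulrAC -cintZl//; congr (_ * _).
by apply: eq_cint => y; rewrite mulrC mulfK.
Qed.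

Section trilinear.
Variables (a g f : R3 R -> R[i]).
Hypotheses (ia : cintegrable mu3 a) (sg : sqint g) (sf : sqint f).

(** The integrand of the pairing of a * g with f. Since a * g need not be integrable on its own,
    integrals are exchanged on this triple product, which [young_trilinear] controls for a in L^1
    and g, f in L^2. *)
Definition trikernel (z : T3 * T3) : R[i] := a (z.1 - z.2) * g z.2 * f z.1.

Lemma cmeas_trikernel : cmeas trikernel.
Proof.
apply: cmeasM; last exact: (cmeas_comp sf.1 measurable_fst).
exact: (cmeas_conv_integrand (cintegrable_cmeas ia) sg.1).
Qed.

Lemma cintegrable_trikernel : cintegrable (mu3 \x mu3)%E trikernel.
Proof.
apply: (@cintegrable_tonelli _ _ T3 T3 _ mu3 mu3); first exact: cmeas_trikernel.
under eq_integral => x _ do under eq_integral => y _ do rewrite /trikernel !Normc.normcM.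
rewrite -/(nint2 (fun x y => normc (a (x - y)) * normc (g y) * normc (f x))).
have na := nnm_normc (cintegrable_cmeas ia); have ng := nnm_normc sg.1; have nf := nnm_normc sf.1.
apply: (le_lt_trans (young_trilinear na ng nf)).
have p0 (h : R3 R -> R[i]) : (0 <= nint (fun x => (normc (h x) ^+ 2)%R))%E.
  by apply: nint_ge0 => x; exact: sqr_ge0.
have q0 : (0 <= nint (fun x => normc (a x)))%E by apply: nint_ge0 => x; exact: normc_ge0.
rewrite lte_mul_pinfty ?lee_fin// lte_mul_pinfty//.
  by rewrite ge0_fin_numE//; exact: cintegrable_nint.
by rewrite lte_add_pinfty ?sg.2 ?sf.2.
Qed.

Lemma trikernel_ae : {ae mu3, forall xi, cint mu3 (fun eta => trikernel (xi, eta)) = conv a g xi * f xi}.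
Proof.
have := @ae_cintegrable1 _ _ T3 T3 _ mu3 mu3 _ cintegrable_trikernel.
apply: filterS => xi hxi.
exact: (@cintZr_if _ T3 mu3 (fun eta : T3 => a (xi - eta) * g eta) (f xi) hxi).
Qed.

Lemma cintegrable_conv_mult : cintegrable mu3 (fun xi => conv a g xi * f xi).
Proof.
have ma := cintegrable_cmeas ia.
apply: (@ae_cintegrable _ _ _ mu3 _ _ _ trikernel_ae).
  by apply: cmeasM; [apply: cmeas_conv => //; exact: sg.1|exact: sf.1].
exact: (@cintegrable_fubini1 _ _ T3 T3 _ mu3 mu3 _ cintegrable_trikernel).
Qed.

Lemma cint_conv_mult : cint mu3 (fun xi => conv a g xi * f xi) = cint (mu3 \x mu3)%E trikernel.
Proof.
rewrite (@cint_fubini1 _ _ T3 T3 _ mu3 mu3 _ cintegrable_trikernel); symmetry.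
apply: ae_eq_cint trikernel_ae.
  exact: (cintegrable_cmeas (@cintegrable_fubini1 _ _ T3 T3 _ mu3 mu3 _ cintegrable_trikernel)).
exact: (cintegrable_cmeas cintegrable_conv_mult).
Qed.

End trilinear.

Lemma sqint_decays f : cmeas (f : T3 -> R[i]) -> decays f -> sqint f.
Proof.
move=> mf df; split => //; have [C hC] := decays_bounded df.
have C0 : 0 <= C by apply: le_trans (hC 0); exact: normc_ge0.
have if_ := decays_cintegrable mf df; have nf := nnm_normc mf.
apply: (@le_lt_trans _ _ (nint (fun x => C * normc (f x))%R)).
  apply: le_nint; [exact: nnmX|by apply: nnmM => //; exact: nnm_cst|].
  by move=> x; rewrite expr2 ler_wpM2r ?normc_ge0.
by rewrite nintZ// lte_mul_pinfty ?lee_fin//; exact: cintegrable_nint.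
Qed.

Lemma sqint_schwartz f : is_schwartz f -> sqint f.
Proof. by move=> sf; apply: sqint_decays; [exact: schwartz_cmeas|exact: schwartz_decays]. Qed.

Lemma sqint_le f g (C : R) : cmeas (f : T3 -> R[i]) -> sqint g ->
  (forall x, normc (f x) <= C * normc (g x)) -> sqint f.
Proof.
move=> mf [mg ig] fg; split => //.
apply: (@le_lt_trans _ _ (nint (fun x => C ^+ 2 * normc (g x) ^+ 2)%R)).
  apply: le_nint; [by apply: nnmX; exact: nnm_normc| |].
    by apply: nnmM; [apply: nnm_cst; exact: sqr_ge0|apply: nnmX; exact: nnm_normc].
  by move=> x; rewrite -exprMn lerXn2r ?nnegrE ?normc_ge0// (le_trans (normc_ge0 (f x))).
rewrite nintZ ?sqr_ge0//; last by apply: nnmX; exact: nnm_normc.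
by rewrite lte_mul_pinfty ?lee_fin ?sqr_ge0.
Qed.

Lemma cintegrable_sqint_mult f g : sqint f -> sqint g -> cintegrable mu3 (fun x => f x * g x).
Proof.
move=> [mf if_] [mg ig]; apply: nint_cintegrable; first exact: cmeasM.
have [nf ng] := (nnmX 2 (nnm_normc mf), nnmX 2 (nnm_normc mg)).
apply: (@le_lt_trans _ _ (nint (fun x => normc (f x) ^+ 2 + normc (g x) ^+ 2)%R)).
  apply: le_nint; [by apply: nnm_normc; exact: cmeasM|exact: nnmD|].
  move=> x; rewrite Normc.normcM; move: (normc (f x)) (normc (g x)) (normc_ge0 (f x)) (normc_ge0 (g x)).
  by move=> u v u0 v0; have := sqr_ge0 (u - v); rewrite !expr2; nra.
by rewrite nintD// lte_add_pinfty.
Qed.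

Lemma sqint_trunc g n : sqint g -> sqint (trunc g n).
Proof.
move=> sg; apply: (@sqint_le _ g 1) => //.
  by apply: cmeasM sg.1; apply: cmeasR; case: (@nnm_low R n).
move=> x; rewrite Normc.normcM normcR ler_wpM2r ?normc_ge0//.
by have /andP[h0 h1] := low01 n x; rewrite ger0_norm.
Qed.

Lemma normc_trunc g n x : normc (trunc g n x) <= normc (g x).
Proof.
rewrite Normc.normcM normcR ler_piMl ?normc_ge0//.
by have /andP[h0 h1] := low01 n x; rewrite ger0_norm.
Qed.

Lemma trunc_cvg g x : ccvg (fun n => trunc g n x) (g x).
Proof.
rewrite -[X in ccvg _ X]mul1r; apply: ccvgM; last exact: ccvg_cst.
by apply: ccvgR; exact: low_cvg.
Qed.

(** The indicator of a ball is square integrable, hence an admissible third factor of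
    [trikernel]. *)
Lemma L1loc_conv a g : cintegrable mu3 a -> sqint g -> L1loc (conv a g).
Proof.
move=> ia sg; apply: L1locP; first by apply: cmeas_conv sg.1; exact: (cintegrable_cmeas ia).
move=> rho; pose S : set T3 := [set y | enorm y <= rho].
have mS : measurable S by exact: measurable_ball3.
have d1 : decays (fun x => (\1_S x)%:C).
  move=> N; exists ((1 + `|rho|) ^+ N) => x; rewrite normcR indicE.
  have [hx|hx] := boolP (x \in S); last by rewrite normr0 mulr0 exprn_ge0// addr_ge0.
  rewrite normr1 mulr1 lerXn2r ?nnegrE ?(ltW (base_gt0 x)) ?addr_ge0// lerD2l.
  by rewrite inE in hx; apply: le_trans hx (ler_norm _).
have s1 : sqint (fun x => (\1_S x)%:C).
  by apply: sqint_decays d1; apply: cmeasR; exact: measurable_indic.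
have := cintegrable_normc (cintegrable_conv_mult ia sg s1).
apply: eq_integrable => // x _; congr (_%:E); rewrite Normc.normcM normcR mulrC.
by rewrite ger0_norm// indicE.
Qed.

(** The inverse transform of an integrable function is bounded, hence locally integrable. That it
    represents T is [tempered_has_fourier] followed by the multiplication formula. *)
Lemma represents_inverse T a : tempered T -> has_fourier T a -> cintegrable mu3 a ->
  represents T (inv_fourier a).
Proof.
move=> tT hT ia; have ma := cintegrable_cmeas ia; split.
  have [C hC] : exists C, forall x, normc (inv_fourier a x) <= C.
    exists (normc ((2 * pi) ^- 3)%:C * \int[mu3]_x normc (a x)) => x.
    rewrite inv_fourierE (Normc.normcM ((2 * pi) ^- 3)%:C); apply: ler_wpM2l; first exact: normc_ge0.
    exact: normc_fourier.
  apply: L1locP; first exact: cmeas_inv_fourier.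
  move=> rho; pose S : set T3 := [set y | enorm y <= rho].
  have mS : measurable S by exact: measurable_ball3.
  have C0 : 0 <= C by apply: le_trans (hC 0); exact: normc_ge0.
  have i1 := integrableZl measurableT (C * (1 + `|rho|) ^+ 6) (@integrable_decay R).
  apply: (le_integrable _ _ _ i1) => //.
    apply/measurable_EFinP; apply: measurable_funM; first exact: measurable_indic.
    by apply: measurable_normc; exact: cmeas_inv_fourier.
  move=> x _; rewrite lee_fin indicE.
  have [hx|hx] := boolP (x \in S); last by rewrite mul0r normr0.
  rewrite mul1r ger0_norm ?normc_ge0//; apply: le_trans (hC x) _.
  apply: le_trans (ler_norm _); rewrite -mulrA ler_peMr//.
  rewrite ler_pdivlMr ?exprn_gt0 ?base_gt0// mul1r lerXn2r ?nnegrE ?(ltW (base_gt0 x)) ?addr_ge0//.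
  by rewrite inE in hx; rewrite lerD2l; apply: le_trans hx (ler_norm _).
move=> f cf; have iT := @tempered_has_fourier _ T a 0 tT hT.
rewrite iT; last first.
  have := cintegrable_normc ia; apply: eq_integrable => // x _ /=.
  by rewrite expr0 invr1 mul1r.
rewrite /dist_of cintegralE inv_fourier_mult//.
exact: schwartz_cintegrable (schwartzP f).
Qed.

Section pieces.
Variables (g w : R3 R -> R[i]) (B : R3 R -> R).
Hypothesis mg : cmeas (g : T3 -> R[i]).
Hypothesis gi : (nint (fun xi => (1 + enorm xi) * normc (g xi) ^+ 2)%R < +oo)%E.
Hypothesis mw : cmeas (w : T3 -> R[i]).
Hypothesis iB : mu3.-integrable [set: T3] (EFin \o B).
Hypothesis B0 : forall x, 0 <= B x.
Hypothesis cw : {ae mu3, forall x, ccvg (fun n => inv_fourier (trunc g n) x) (w x)}.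
Hypothesis bw : {ae mu3, forall x, forall n, normc (inv_fourier (trunc g n) x) <= 1 + B x}.

Let sg : sqint g := conj mg (nint_sqr_fin mg gi).

Lemma normc_limit_le : {ae mu3, forall x, normc (w x) <= 1 + B x}.
Proof.
apply: filterS2 cw bw => x c b.
have c1 : normc (w x - inv_fourier (trunc g n) x) @[n --> \oo] --> (0 : R).
  move: c; rewrite /ccvg; apply: cvg_trans; apply: near_eq_cvg; apply: nearW => n.
  by rewrite -normcN opprB.
have c2 : normc (w x - inv_fourier (trunc g n) x) + (1 + B x) @[n --> \oo] --> 0 + (1 + B x).
  by apply: cvgD => //; exact: cvg_cst.
rewrite add0r in c2; rewrite -(cvg_lim _ c2)//; apply: limr_ge; first by apply: cvgP; exact: c2.
apply: nearW => n; apply: le_trans (_ : _ <= normc (w x - inv_fourier (trunc g n) x) + normc (inv_fourier (trunc g n) x)) _.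
  by apply: le_trans (le_normcD _ _); rewrite subrK.
by rewrite lerD2l.
Qed.

Lemma integrable_oneB f : cmeas (f : T3 -> R[i]) -> decays f ->
  mu3.-integrable [set: T3] (EFin \o (fun x => (1 + B x) * normc (f x))).
Proof.
move=> mf df; have [C C0 hC] := decays_ge0 6 df.
have [D hD] := decays_bounded df.
have i1 := integrableD (@measurableT _ T3) (integrableZl measurableT C (@integrable_decay R))
  (integrableZl measurableT D iB).
have mB : measurable_fun [set: T3] B by apply/measurable_EFinP; exact: (measurable_int _ iB).
apply: (le_integrable _ _ _ i1) => //.
  apply/measurable_EFinP; apply: measurable_funM; last exact: measurable_normc.
  by apply: measurable_funD.
move=> x _ /=; rewrite lee_fin ger0_norm; last by rewrite mulr_ge0 ?normc_ge0 ?addr_ge0.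
apply: le_trans (ler_norm _); rewrite mulrDl mul1r; apply: lerD.
  by rewrite ler_pdivlMr ?exprn_gt0 ?base_gt0// mulrC.
by rewrite mulrC ler_wpM2r.
Qed.

Lemma L1loc_limit : L1loc w.
Proof.
apply: L1locP => // rho; pose S : set T3 := [set y | enorm y <= rho].
have mS : measurable S by exact: measurable_ball3.
have d1 : decays (fun x => (\1_S x)%:C).
  move=> N; exists ((1 + `|rho|) ^+ N) => x; rewrite normcR indicE.
  have [hx|hx] := boolP (x \in S); last by rewrite normr0 mulr0 exprn_ge0// addr_ge0.
  rewrite normr1 mulr1 lerXn2r ?nnegrE ?(ltW (base_gt0 x)) ?addr_ge0// lerD2l.
  by rewrite inE in hx; apply: le_trans hx (ler_norm _).
have [m1 _] : sqint (fun x => (\1_S x)%:C).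
  by apply: sqint_decays d1; apply: cmeasR; exact: measurable_indic.
have h : cintegrable mu3 (fun x => (\1_S x)%:C * w x).
  apply: (ae_le_cintegrable _ _ (integrable_oneB m1 d1)); first exact: cmeasM.
  apply: filterS normc_limit_le => x hx.
  by rewrite Normc.normcM mulrC ler_wpM2r ?normc_ge0.
have := cintegrable_normc h; apply: eq_integrable => // x _; congr (_%:E).
by rewrite Normc.normcM normcR ger0_norm.
Qed.

(** The multiplication formula holds for each truncation of g. The limit is dominated by 1 + B in
    the space variable and by |g| times a Schwartz function in the frequency variable. *)
Lemma cint_limit_mult f : is_schwartz f ->
  cint mu3 (fun x => w x * f x) = cint mu3 (fun x => g x * inv_fourier f x).
Proof.
move=> sf; have mf := schwartz_cmeas sf.
have sh := inv_fourier_schwartz sf; have if_ := schwartz_cintegrable sf.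
have it n := cintegrable_trunc mg gi n.
have c1 : ccvg (fun n => cint mu3 (fun x => inv_fourier (trunc g n) x * f x)) (cint mu3 (fun x => w x * f x)).
  apply: (@cint_dctc_ae _ _ _ mu3 _ _ (fun x => (1 + B x) * normc (f x))).
  - by move=> n; apply: cmeasM => //; apply: cmeas_inv_fourier; exact: (cintegrable_cmeas (it n)).
  - exact: cmeasM.
  - by apply: filterS cw => x cx; apply: ccvgM => //; exact: ccvg_cst.
  - by apply: integrable_oneB => //; exact: schwartz_decays.
  - by apply: filterS bw => x bx n; rewrite Normc.normcM ler_wpM2r ?normc_ge0.
apply: (ccvg_unique c1).
under [X in ccvg X]eq_fun do rewrite (inv_fourier_mult (it _) if_).
have igh := cintegrable_sqint_mult sg (sqint_schwartz sh).
apply: (@cint_dctc _ _ _ mu3 _ _ (fun x => normc (g x * inv_fourier f x))).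
- by move=> n; apply: cmeasM; [exact: (cintegrable_cmeas (it n))|exact: schwartz_cmeas].
- by apply: cmeasM => //; exact: schwartz_cmeas.
- by apply: nearW => x; apply: ccvgM; [exact: trunc_cvg|exact: ccvg_cst].
- exact: cintegrable_normc.
- by move=> n x; rewrite Normc.normcM [leRHS]Normc.normcM ler_wpM2r ?normc_ge0 ?normc_trunc.
Qed.

(** For a truncation of g both transforms are integrable and the product is an inverse transform of
    a convolution. In the limit the left-hand side is dominated through 1 + B and the bound on the
    first factor, the right-hand side by the integrable [trikernel]. *)
Lemma product_fourier a f : cintegrable mu3 a -> is_schwartz f ->
  cintegrable mu3 (fun x => inv_fourier a x * w x * fourier f x) /\
  cint mu3 (fun x => inv_fourier a x * w x * fourier f x) =
  ((2 * pi) ^- 3)%:C * cint mu3 (fun xi => conv a g xi * f xi).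
Proof.
move=> ia sf; have ma := cintegrable_cmeas ia.
have sF := fourier_schwartz sf; have mF := schwartz_cmeas sF; have iF := schwartz_cintegrable sF.
have it n := cintegrable_trunc mg gi n.
have s2 := sqint_schwartz sf.
have mia := cmeas_inv_fourier ma.
have [C hC] : exists C, forall x, normc (inv_fourier a x) <= C.
  exists (normc ((2 * pi) ^- 3)%:C * \int[mu3]_x normc (a x)) => x.
  rewrite inv_fourierE (Normc.normcM ((2 * pi) ^- 3)%:C); apply: ler_wpM2l; first exact: normc_ge0.
  exact: normc_fourier.
have C0 : 0 <= C by apply: le_trans (hC 0); exact: normc_ge0.
have iD : mu3.-integrable [set: T3] (EFin \o (fun x => C * ((1 + B x) * normc (fourier f x)))).
  have := integrableZl measurableT C (integrable_oneB mF (schwartz_decays sF)).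
  by apply: eq_integrable => // x _ /=; rewrite EFinM.
split.
  apply: (ae_le_cintegrable _ _ iD); first by apply: cmeasM => //; exact: cmeasM.
  apply: filterS normc_limit_le => x hx; rewrite 2!(Normc.normcM) -mulrA.
  by apply: ler_pM; rewrite ?normc_ge0 ?mulr_ge0 ?normc_ge0// ler_wpM2r ?normc_ge0.
have c1 : ccvg (fun n => cint mu3 (fun x => inv_fourier a x * inv_fourier (trunc g n) x * fourier f x))
    (cint mu3 (fun x => inv_fourier a x * w x * fourier f x)).
  apply: (@cint_dctc_ae _ _ _ mu3 _ _ (fun x => C * ((1 + B x) * normc (fourier f x)))).
  - move=> n; apply: cmeasM => //; apply: cmeasM => //.
    by apply: cmeas_inv_fourier; exact: (cintegrable_cmeas (it n)).
  - by apply: cmeasM => //; exact: cmeasM.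
  - apply: filterS cw => x cx; apply: ccvgM; last exact: ccvg_cst.
    by apply: ccvgM => //; exact: ccvg_cst.
  - exact: iD.
  - apply: filterS bw => x bx n; rewrite 2!(Normc.normcM) -mulrA.
    by apply: ler_pM; rewrite ?normc_ge0 ?mulr_ge0 ?normc_ge0// ler_wpM2r ?normc_ge0.
apply: (ccvg_unique c1).
have -> : (fun n => cint mu3 (fun x => inv_fourier a x * inv_fourier (trunc g n) x * fourier f x)) =
    (fun n => ((2 * pi) ^- 3)%:C * cint (mu3 \x mu3)%E (trikernel a (trunc g n) f)).
  apply/funext => n; have iac := cintegrable_conv ia (it n).
  rewrite -(cint_conv_mult ia (sqint_trunc n sg) s2).
  transitivity (((2 * pi) ^- 3)%:C * cint mu3 (fun x => inv_fourier (conv a (trunc g n)) x * fourier f x)).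
    rewrite -cintZl.
      by apply: eq_cint => x; rewrite inv_fourier_convM// mulrA.
    have [E hE] : exists E, forall x, normc (inv_fourier (conv a (trunc g n)) x) <= E.
      exists (normc ((2 * pi) ^- 3)%:C * \int[mu3]_x normc (conv a (trunc g n) x)) => x.
      rewrite inv_fourierE (Normc.normcM ((2 * pi) ^- 3)%:C); apply: ler_wpM2l; first exact: normc_ge0.
      exact: normc_fourier.
    have := integrableZl measurableT E (cintegrable_normc iF); apply: le_cintegrable.
      by apply: cmeasM => //; apply: cmeas_inv_fourier; exact: (cintegrable_cmeas iac).
    by move=> x; rewrite Normc.normcM ler_wpM2r ?normc_ge0.
  by rewrite inv_fourier_mult// inv_fourierK.
apply: ccvgM; first exact: ccvg_cst.
rewrite (cint_conv_mult ia sg s2).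
have ik := cintegrable_trikernel ia sg s2.
apply: (@cint_dctc _ _ _ (mu3 \x mu3)%E _ _ (fun z => normc (trikernel a g f z))).
- by move=> n; exact: (cmeas_trikernel ia (sqint_trunc n sg) s2).
- exact: (cmeas_trikernel ia sg s2).
- have F := ae_filter_ringOfSetsType (mu3 \x mu3)%E.
  apply: nearW => z; apply: ccvgM; last exact: ccvg_cst.
  by apply: ccvgM; [exact: ccvg_cst|exact: trunc_cvg].
- exact: cintegrable_normc.
- move=> n z; rewrite /trikernel 2!Normc.normcM [leRHS]Normc.normcM [X in _ <= X * _]Normc.normcM.
  rewrite ler_wpM2r ?normc_ge0// ler_wpM2l ?normc_ge0//; exact: normc_trunc.
Qed.

End pieces.

Lemma inv_fourier_pderiv k f x : is_schwartz f ->
  inv_fourier (pderiv k f) x = - 'i * ((coord3 x k)%:C * inv_fourier f x).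
Proof. by move=> sf; rewrite !inv_fourierE fourier_pderiv// coord3N rmorphN /=; ring. Qed.

Definition grad_hat (G : 'I_3 -> R3 R -> R[i]) j k eta : R[i] := 'i * ((coord3 eta k)%:C * G j eta).

(** [advection] is built from chosen representatives. They agree almost everywhere with the inverse
    transform of G_k and with the limit w of [square_integrable_inverse] for the gradient, so that
    [product_fourier] applies to each summand. *)
Lemma has_fourier_advection U (G : 'I_3 -> R3 R -> R[i]) j :
  (forall k, tempered (U k)) -> (forall k, has_fourier (U k) (G k)) ->
  (forall k, cintegrable mu3 (G k)) ->
  (forall k, (nint (fun xi => (1 + enorm xi) * normc (grad_hat G j k xi) ^+ 2)%R < +oo)%E) ->
  has_fourier (advection U j) (fun xi => \sum_(k < 3) ((2 * pi) ^- 3)%:C * conv (G k) (grad_hat G j k) xi).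
Proof.
move=> tU hU iG iGr.
have mgr k : cmeas (grad_hat G j k : T3 -> R[i]).
  apply: cmeasM; first exact: cmeas_cst.
  by apply: cmeasM; [exact: cmeas_coord|exact: (cintegrable_cmeas (iG j))].
have sgr k : sqint (grad_hat G j k) by split => //; exact: (nint_sqr_fin (mgr k) (iGr k)).
split.
  by apply: L1loc_sum => k; apply: L1locZ; exact: L1loc_conv.
move=> f h cf hh; have sf := schwartzP f.
have hE : (h : R3 R -> R[i]) = fourier f by apply/funext.
have key k : exists2 w : R3 R -> R[i], represents (dderiv k (U j)) w &
    cintegrable mu3 (fun x => inv_fourier (G k) x * w x * fourier f x) /\
    cint mu3 (fun x => inv_fourier (G k) x * w x * fourier f x) =
    ((2 * pi) ^- 3)%:C * cint mu3 (fun xi => conv (G k) (grad_hat G j k) xi * f xi).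
  have [w [B [mw iB B0 cw bw]]] := square_integrable_inverse (mgr k) (iGr k).
  exists w; last exact: (product_fourier (mgr k) (iGr k) mw iB B0 cw bw (iG k) sf).
  split; first exact: (L1loc_limit mw iB B0 cw bw).
  move=> p cp; have sp := schwartzP p.
  rewrite /dist_of cintegralE (cint_limit_mult (mgr k) (iGr k) mw iB B0 cw bw sp) /dderiv.
  rewrite (@tempered_has_fourier _ (U j) (G j) 0)//; last first.
    have := cintegrable_normc (iG j); apply: eq_integrable => // x _ /=.
    by rewrite expr0 invr1 mul1r.
  rewrite -cintN.
    by apply: eq_cint => x; rewrite /= inv_fourier_pderiv// /grad_hat; ring.
  have sd := inv_fourier_schwartz (is_schwartz_pderiv k sp).
  have [C hC] := decays_bounded (schwartz_decays sd).
  have := integrableZl measurableT C (cintegrable_normc (iG j)); apply: le_cintegrable.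
    by apply: cmeasM; [exact: (cintegrable_cmeas (iG j))|exact: schwartz_cmeas].
  by move=> x; rewrite Normc.normcM mulrC ler_wpM2r ?normc_ge0//; exact: hC.
rewrite /advection /dist_of !cintegralE hE.
pose w k := sval (cid2 (key k)).
have wP k : represents (dderiv k (U j)) (w k) by rewrite /w; case: (cid2 (key k)).
have wI k : cintegrable mu3 (fun x => inv_fourier (G k) x * w k x * fourier f x) /\
    cint mu3 (fun x => inv_fourier (G k) x * w k x * fourier f x) =
    ((2 * pi) ^- 3)%:C * cint mu3 (fun xi => conv (G k) (grad_hat G j k) xi * f xi).
  by rewrite /w; case: (cid2 (key k)) => ? ? [].
transitivity (cint mu3 (fun x => \sum_(k < 3) inv_fourier (G k) x * w k x * fourier f x)).
  apply: ae_eq_cint.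
  - apply: cmeasM; last by apply: schwartz_cmeas; exact: fourier_schwartz.
    by apply: cmeas_sum => k; apply: cmeasM; apply: L1loc_cmeas; exact: fun_of_L1loc.
  - by apply: cmeas_sum => k; exact: (cintegrable_cmeas (wI k).1).
  - have e1 k := fun_of_ae (represents_inverse (tU k) (hU k) (iG k)).
    have e2 k := fun_of_ae (wP k).
    have e k : {ae mu3, forall x, fun_of (U k) x * fun_of (dderiv k (U j)) x = inv_fourier (G k) x * w k x}.
      by apply: filterS2 (e1 k) (e2 k) => x -> ->.
    apply: filterS3 (e 0) (e 1) (e 2) => x h0 h1 h2.
    by rewrite !sum3 h0 h1 h2 !mulrDl.
rewrite cint_sum; last by move=> k; exact: (wI k).1.
under eq_bigr => k _ do rewrite (wI k).2.
have s2 := sqint_schwartz sf.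
have ic k : cintegrable mu3 (fun xi => conv (G k) (grad_hat G j k) xi * f xi).
  exact: (cintegrable_conv_mult (iG k) (sgr k) s2).
under eq_bigr => k _ do rewrite -(cintZl _ (ic k)).
rewrite -cint_sum; last by move=> k; apply: cintegrableZl.
apply: eq_cint => x; rewrite mulr_suml; apply: eq_bigr => k _.
by rewrite mulrA.
Qed.

End Advection.

(** * The kernel K *)

Section SingularKernel.
Context {R : realType}.
Notation mu := (@mu1 R).
Notation T1 := (measurableTypeR R).
Notation T3 := (measurableTypeR R * measurableTypeR R * measurableTypeR R)%type.

Section line.
Variable r : R.
Hypothesis r1 : 1 < r.

(** One factor of a product majorant of the kernel: the singularity |x|^-2 is shared out as
    |x_i|^(-2/3), integrable at 0 on the line, and the exponent r > 1 ensures integrability at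
    infinity. *)
Definition linekernel (t : R) : R := if `|t| < 1 then `|t| `^ (- (2 / 3)) else `|t| `^ (- r).

Lemma nnm_linekernel : nnm (linekernel : T1 -> R).
Proof.
split; last by move=> t; rewrite /linekernel; case: ifP => _; exact: powR_ge0.
have mn : measurable_fun [set: T1] (fun t : T1 => `|t|) by exact: normr_measurable.
apply: measurable_fun_ifT.
- by apply: measurable_fun_ltr => //; exact: measurable_cst.
- exact: (measurableT_comp (measurable_powR _) mn).
- exact: (measurableT_comp (measurable_powR _) mn).
Qed.

(** Uniform in h: the integral of t^(-2/3) over ]0, 1] is 3, and that of t^(-r) from 1 to infinity
    is 1 / (r - 1). *)
Lemma linekernel_pos_le (h : R) : 0 < h < 1 ->
  (\int[mu]_t (\1_`[h, h^-1] t * linekernel t)%:E <= (3 + (r - 1)^-1)%:E)%E.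
Proof.
move=> /andP[h0 h1]; have hi : 1 < h^-1 by rewrite invf_gt1.
have m1 a : measurable_fun [set: T1] (fun t : T1 => t `^ a) by exact: measurable_powR.
have mI (a b : R) : measurable (`[a, b] : set T1) by exact: measurable_itv.
apply: (@le_trans _ _ (\int[mu]_t ((\1_`[h, 1%R] t * t `^ (- (2 / 3)))%:E + (\1_`[1%R, h^-1] t * t `^ (- r))%:E))%E).
  have [mk k0] := nnm_linekernel.
  apply: ge0_le_integral => //.
  - by move=> t _; rewrite lee_fin mulr_ge0.
  - by apply/measurable_EFinP; apply: measurable_funM => //; exact: measurable_indic.
  - by apply: emeasurable_funD; apply/measurable_EFinP; apply: measurable_funM => //; exact: measurable_indic.
  - move=> t _; rewrite -EFinD lee_fin !indicE.
    have [|_] := boolP (t \in `[h, h^-1]%classic); last first.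
      by rewrite mul0r addr_ge0// mulr_ge0// powR_ge0.
    rewrite inE /= in_itv/= => /andP[t0 t1]; rewrite mul1r /linekernel.
    have tp : 0 < t by exact: lt_le_trans t0.
    rewrite gtr0_norm//; case: ltP => ht.
      have -> : (t \in `[h, 1]%classic) = true by apply/mem_set; rewrite /= in_itv/= t0 ltW.
      by rewrite mul1r lerDl mulr_ge0// powR_ge0.
    have -> : (t \in `[1, h^-1]%classic) = true by apply/mem_set; rewrite /= in_itv/= ht t1.
    by rewrite mul1r lerDr mulr_ge0// powR_ge0.
rewrite ge0_integralD//; last 4 first.
- by move=> t _; rewrite lee_fin mulr_ge0// powR_ge0.
- by apply/measurable_EFinP; apply: measurable_funM => //; exact: measurable_indic.
- by move=> t _; rewrite lee_fin mulr_ge0// powR_ge0.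
- by apply/measurable_EFinP; apply: measurable_funM => //; exact: measurable_indic.
have E a b p : (\int[mu]_t (\1_`[a, b] t * t `^ p)%:E = \int[mu]_(t in `[a, b]) (t `^ p)%:E)%E.
  rewrite [RHS]integral_mkcond; apply: eq_integral => t _; rewrite patchE indicE.
  by case: ifP => _; rewrite ?mul1r ?mul0r.
rewrite !E integral_powR//; last by rewrite lt_eqF//; lra.
rewrite integral_powR//; last by rewrite gt_eqF.
rewrite -EFinD lee_fin !powR1; apply: lerD.
  have := powR_ge0 h (1 - 2 / 3); rewrite ler_pdivrMr; lra.
have r10 : 0 < r - 1 by rewrite subr_gt0.
have -> : (h^-1 `^ (1 - r) - 1) / (1 - r) = (1 - h^-1 `^ (1 - r)) / (r - 1).
  by move: (h^-1 `^ (1 - r)) => A; rewrite -[1 - r]opprB invrN mulrN -mulNr opprB.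
by rewrite ler_pdivrMr// mulVf ?gt_eqF// gerBl powR_ge0.
Qed.

Lemma integrable_linekernel : mu.-integrable [set: R] (EFin \o linekernel).
Proof.
have [mk k0] := nnm_linekernel.
apply/integrableP; split; first exact/measurable_EFinP.
under eq_integral do rewrite /= ger0_norm//.
rewrite even_integral; last 3 first.
- exact/measurable_EFinP.
- by move=> x; rewrite lee_fin.
- by move=> x; rewrite /linekernel normrN.
apply: lte_mul_pinfty; rewrite ?lee_fin//.
rewrite integral_mkcond.
apply: (@le_lt_trans _ _ (3 + (r - 1)^-1)%:E); last by rewrite ltry.
rewrite (_ : (fun x => _) = (fun t => (\1_`[0, +oo[ t * linekernel t)%:E)); last first.
  by apply/funext => t; rewrite patchE indicE; case: ifP => _; rewrite ?mul1r ?mul0r.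
(* The shifted index keeps the lower end of the interval strictly below 1. *)
apply: (@fatou_le _ _ T1 mu (fun n t => \1_`[harmonic n.+1, (harmonic n.+1)^-1] t * linekernel t)).
- move=> n; split; last by move=> t; rewrite mulr_ge0.
  by apply: measurable_funM => //; apply: measurable_indic; exact: measurable_itv.
- move=> t; apply: cvg_near_cst; have [t0|t0] := leP t 0.
    exists 0 => // n _ /=; have hn : 0 < harmonic n.+1 :> R by rewrite /harmonic invr_gt0.
    rewrite [in LHS]indicE memNset ?mul0r; last first.
      by rewrite /= in_itv/= => /andP[/(lt_le_trans hn)]; rewrite ltNge t0.
    have [->|tn] := eqVneq t 0; first by rewrite /linekernel normr0 ltr01 powR0 ?mulr0// oppr_eq0 mulf_neq0// invr_neq0.
    rewrite indicE memNset ?mul0r// /= in_itv/= andbT => t0'.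
    by move: tn; rewrite eq_le t0 t0'.
  exists (maxn (Num.truncn t) (Num.truncn t^-1)) => // n /=; rewrite geq_max => /andP[n1 n2].
  rewrite !indicE !mem_set//=; last 1 first.
    rewrite in_itv/= /harmonic invrK; apply/andP; split.
      rewrite -[t]invrK lef_pV2 ?posrE ?invr_gt0//; apply: ltW.
      apply: lt_le_trans (truncnS_gt _) _; rewrite ler_nat; exact: (leq_trans n2).
    apply: ltW; apply: lt_le_trans (truncnS_gt _) _; rewrite ler_nat; exact: (leq_trans n1).
  by rewrite in_itv/= ltW.
- move=> n; apply: linekernel_pos_le; rewrite /harmonic invr_gt0 ltr0n/=.
  by rewrite invf_lt1// ltr1n.
Qed.

End line.

Variable sigma : R.
Hypothesis sigma_gt : 2^-1 < sigma.

(** The square root of the weight m; [singular] below is the integrand of K. *)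
Definition sym (kap : R) (x : R3 R) : R := kap + enorm x `^ sigma.
Definition singular (kap : R) (x : R3 R) : R := enorm x ^- 2 * sym kap x ^- 2.

Lemma measurable_enorm_powR (p : R) : measurable_fun [set: T3] (fun x : T3 => enorm x `^ p).
Proof. by apply: (measurableT_comp (measurable_powR p)); exact: (measurable_enorm measurable_id3). Qed.

Lemma nnm_sym kap : 0 <= kap -> nnm (sym kap : T3 -> R).
Proof.
move=> k0; split; last by move=> x; rewrite addr_ge0// powR_ge0.
by apply: measurable_funD; [exact: measurable_cst|exact: measurable_enorm_powR].
Qed.

Lemma nnmV {d} {T : measurableType d} (F : T -> R) : nnm F -> nnm (fun x => (F x)^-1).
Proof.
move=> [mF F0]; split; last by move=> x; rewrite invr_ge0.
under eq_fun do rewrite -powR_inv1//.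
exact: (measurableT_comp (measurable_powR (-1))).
Qed.

Lemma nnm_singular kap : 0 <= kap -> nnm (singular kap : T3 -> R).
Proof.
move=> k0; apply: nnmM; first by apply: nnmV; apply: nnmX; exact: nnm_enorm.
by apply: nnmV; apply: nnmX; exact: nnm_sym.
Qed.

(** A third of the decay exponent 2 + 2 sigma of the kernel at infinity. It exceeds 1 exactly when
    sigma > 1/2. *)
Let r := 2 / 3 + 2 * sigma / 3.
Let r1 : 1 < r. Proof. by rewrite /r; move: sigma_gt; lra. Qed.

Lemma linekernel_le (x : R) (e : R) : x != 0 -> `|x| <= e ->
  e `^ (- (2 / 3)) * Num.max 1 e `^ (- (2 * sigma / 3)) <= linekernel r x.
Proof.
move=> x0 xe; have xp : 0 < `|x| by rewrite normr_gt0.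
have ep : 0 < e by exact: lt_le_trans xe.
rewrite /linekernel; case: ltP => h.
  apply: (@le_trans _ _ (e `^ (- (2 / 3)))).
    rewrite ler_piMr ?powR_ge0// powRN invf_le1 ?powR_gt0 ?lt_max ?ltr01//.
    rewrite -[leLHS](powRr0 (Num.max 1 e)) ler_powR ?le_max ?lexx//.
    by rewrite divr_ge0// mulr_ge0//; move: sigma_gt; lra.
  by rewrite !powRN lef_pV2 ?posrE ?powR_gt0// ge0_ler_powR ?nnegrE ?(ltW ep)// divr_ge0.
have e1 : 1 <= e by exact: le_trans xe.
rewrite (max_idPr e1) -powRD; last by rewrite (gt_eqF ep) implybT.
rewrite -opprD -/r !powRN lef_pV2 ?posrE ?powR_gt0// ge0_ler_powR ?nnegrE ?(ltW ep)//.
by apply: ltW; apply: lt_trans r1.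
Qed.

Lemma powR3 (e p : R) : 0 < e -> e `^ p * e `^ p * e `^ p = e `^ (3 * p).
Proof.
move=> e0; rewrite -!powRD ?(gt_eqF e0) ?implybT//; congr (_ `^ _); ring.
Qed.

(** Each |x_i| is at most |x|, so each factor is at least |x|^(-2/3) max(1, |x|)^(-2 sigma/3); the
    cube of this dominates the kernel because 1 + |x|^sigma >= max(1, |x|)^sigma. Zero coordinates
    are excluded, as [linekernel] takes the value 0 at 0. *)
Lemma singular1_le x : (forall i, coord3 x i != 0) ->
  singular 1 x <= linekernel r x.1.1 * linekernel r x.1.2 * linekernel r x.2.
Proof.
move=> x0; set e := enorm x.
have ep : 0 < e.
  by rewrite lt_neqAle enorm_ge0 andbT eq_sym enorm_eq0; apply: contra_neq (x0 0) => ->; exact: coord3_0.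
set A := e `^ (- (2 / 3)) * Num.max 1 e `^ (- (2 * sigma / 3)).
have A0 : 0 <= A by rewrite mulr_ge0 ?powR_ge0.
have hA i : A <= linekernel r (coord3 x i) by apply: linekernel_le => //; exact: coord3_le_enorm.
apply: (@le_trans _ _ (A * A * A)); last first.
  apply: ler_pM; [exact: mulr_ge0|exact: A0| |exact: (hA 2)].
  by apply: ler_pM; [exact: A0|exact: A0|exact: (hA 0)|exact: (hA 1)].
have mp : 0 < Num.max 1 e by rewrite lt_max ltr01.
have -> : A * A * A = e ^- 2 * (Num.max 1 e `^ sigma) ^- 2.
  transitivity ((e `^ (- (2 / 3)) * e `^ (- (2 / 3)) * e `^ (- (2 / 3))) *
    (Num.max 1 e `^ (- (2 * sigma / 3)) * Num.max 1 e `^ (- (2 * sigma / 3)) * Num.max 1 e `^ (- (2 * sigma / 3)))).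
    by rewrite /A; ring.
  rewrite !powR3//; congr (_ * _).
    rewrite (_ : 3 * - (2 / 3) = - 2%:R); last by field.
    by rewrite powRN powR_mulrn ?ltW.
  rewrite (_ : 3 * - (2 * sigma / 3) = - (sigma * 2%:R)); last by field.
  by rewrite powRN powRrM powR_mulrn ?powR_ge0.
rewrite /singular ler_wpM2l ?invr_ge0 ?exprn_ge0 ?enorm_ge0//.
have s0 : 0 <= sigma by move: sigma_gt; lra.
rewrite lef_pV2 ?posrE ?exprn_gt0 ?powR_gt0//; last by rewrite /sym ltr_pwDl// powR_ge0.
rewrite lerXn2r ?nnegrE ?powR_ge0 ?addr_ge0 ?powR_ge0//.
rewrite /sym -/e; case: (leP 1 e) => h; last by rewrite powR1 lerDl powR_ge0.
by rewrite lerDr.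
Qed.

Lemma singular1_fin : (nint (singular 1) < +oo)%E.
Proof.
have iL := integrable_linekernel r1.
have [mL L0] := nnm_linekernel r.
have i3 := integrable_prod3 iL iL iL L0 L0 L0.
apply: (@le_lt_trans _ _ (nint (fun x => linekernel r x.1.1 * linekernel r x.1.2 * linekernel r x.2)%R)).
  apply: le_nint_ae.
  - exact: nnm_singular.
  - split; last by move=> x; rewrite !mulr_ge0.
    by apply/measurable_EFinP; exact: (measurable_int _ i3).
  - apply: filterS3 (@ae_coord3_neq0 R 0) (@ae_coord3_neq0 R 1) (@ae_coord3_neq0 R 2) => x h0 h1 h2.
    by apply: singular1_le => i; case: (I3P i) => ->.
by apply: integrable_nint i3 => x; rewrite !mulr_ge0.
Qed.

Lemma singular_le1 kap x : 0 < kap <= 1 -> kap ^+ 2 * singular kap x <= singular 1 x.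
Proof.
move=> /andP[k0 k1]; rewrite /singular mulrCA ler_wpM2l ?invr_ge0 ?exprn_ge0 ?enorm_ge0//.
have p0 := powR_ge0 (enorm x) sigma.
have s1 : 0 < sym 1 x by rewrite /sym ltr_pwDl.
have sk : 0 < sym kap x by rewrite /sym ltr_pwDl.
rewrite ler_pdivrMr ?exprn_gt0// mulrC ler_pdivlMr ?exprn_gt0// -exprMn.
rewrite lerXn2r ?nnegrE ?mulr_ge0 ?(ltW k0) ?(ltW s1) ?(ltW sk)//.
by rewrite /sym mulrDr mulr1 lerD2l ler_piMl.
Qed.

Lemma singular_fin kap : 0 < kap <= 1 -> (nint (singular kap) < +oo)%E.
Proof.
move=> hk; have /andP[k0 k1] := hk; have nk := nnm_singular (ltW k0).
have k2 : 0 < kap ^+ 2 by rewrite exprn_gt0.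
have -> : singular kap = (fun x => kap ^- 2 * (kap ^+ 2 * singular kap x)).
  by apply/funext => x; rewrite mulrA mulVf ?mul1r// gt_eqF.
have nk2 : nnm (fun x : T3 => kap ^+ 2 * singular kap x).
  by apply: nnmM => //; apply: nnm_cst; exact: ltW.
rewrite nintZ ?invr_ge0 ?(ltW k2)//; apply: lte_mul_pinfty; rewrite ?lee_fin ?invr_ge0 ?(ltW k2)//.
apply: le_lt_trans singular1_fin; apply: le_nint => //; first exact: nnm_singular.
by move=> x; exact: singular_le1.
Qed.

(** Dominated convergence: kap^2 [singular kap] is below [singular 1] for kap <= 1, and away from
    the origin it is at most kap^2 times a quantity independent of kap. *)
Lemma singular_small (e : R) : 0 < e -> exists2 kap : R, 0 < kap <= 1 &
  kap ^+ 2 * \int[mu3]_x singular kap x <= e.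
Proof.
move=> e0.
have hh n : 0 < (harmonic n : R) <= 1.
  by rewrite /harmonic invr_gt0 ltr0n/= invf_le1// ler1n.
have i1 := nint_integrable (nnm_singular ler01) singular1_fin.
have c : \int[mu3]_x (harmonic n ^+ 2 * singular (harmonic n) x) @[n --> \oo] --> (0 : R).
  have -> : (0 : R) = \int[mu3]_x (0 : R) by rewrite /Rintegral integral0.
  have nk n : nnm (singular (harmonic n) : T3 -> R).
    by apply: nnm_singular; have /andP[/ltW] := hh n.
  apply: (@Rintegral_dct_ae _ _ _ mu3 _ _ (singular 1)) => //.
  - by move=> n; apply: measurable_funM => //; case: (nk n).
  - apply: filterS (@ae_enorm_gt0 R) => x x0.
    have c1 : harmonic n ^+ 2 * (enorm x ^- 2 * (enorm x `^ sigma) ^- 2) @[n --> \oo] --> (0 : R).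
      rewrite -[X in _ --> X](mul0r (enorm x ^- 2 * (enorm x `^ sigma) ^- 2)); apply: cvgMl.
      rewrite -[X in _ --> X](mulr0 0); under eq_cvg do rewrite expr2.
      by apply: cvgM; exact: cvg_harmonic.
    apply: (squeeze_cvgr _ (cvg_cst 0) c1); apply: nearW => n.
    have /andP[h0 h1] := hh n; rewrite mulr_ge0 ?exprn_ge0 ?(ltW h0)//=; last by case: (nk n).
    rewrite ler_wpM2l ?exprn_ge0 ?(ltW h0)// ler_wpM2l ?invr_ge0 ?exprn_ge0 ?enorm_ge0//.
    have p0 : 0 < enorm x `^ sigma by exact: powR_gt0.
    rewrite lef_pV2 ?posrE ?exprn_gt0// /sym ?addr_gt0// lerXn2r ?nnegrE ?addr_ge0 ?(ltW h0) ?(ltW p0)//.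
    by rewrite lerDr ltW.
  - apply: nearW => x n; have /andP[h0 h1] := hh n.
    rewrite ger0_norm; first exact: singular_le1.
    by rewrite mulr_ge0 ?exprn_ge0 ?(ltW h0)//; case: (nk n).
move/cvgrPdist_le : c => /(_ _ e0) [N _ /(_ N (leqnn N))] /=.
rewrite sub0r normrN => h; exists (harmonic N) => //.
rewrite -RintegralZl//; first exact: le_trans (ler_norm _) h.
have /andP[h0 h1] := hh N.
exact: (nint_integrable (nnm_singular (ltW h0)) (singular_fin (hh N))).
Qed.

End SingularKernel.

(** * Absolutely continuous functions with bounded upper derivative *)

Section AbsoluteContinuity.
Context {R : realType}.
Notation mu := (@lebesgue_measure R).

Definition interval_family (a b : R) (n : nat) (l r : 'I_n -> R) :=
  (forall i, [/\ a <= l i, l i <= r i & r i <= b]) /\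
  (forall i j, i != j -> r i <= l j \/ r j <= l i).

Definition abs_continuous (a b : R) (f : R -> R) := forall e : R, 0 < e -> exists2 d : R, 0 < d &
  forall (n : nat) (l r : 'I_n -> R), interval_family a b l r ->
    \sum_(i < n) (r i - l i) < d -> \sum_(i < n) `|f (r i) - f (l i)| < e.

Definition upper_derivative_le (f : R -> R) (t L : R) := forall e : R, 0 < e ->
  \forall h \near (0 : R)^', (f (t + h) - f t) / h <= L + e.

(* A family of disjoint intervals contained in [U] and in [`[a, x]] along which
   the variation of [f], plus [c] times their total length, is [v]. *)
Definition chain (f : R -> R) (c : R) (U : set R) (a x v : R) := exists (n : nat) (l r : 'I_n -> R),
  [/\ interval_family a x l r,
      ((\sum_(i < n) (r i - l i))%:E <= mu (U `&` `]-oo, x[))%E &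
      v = \sum_(i < n) (`|f (r i) - f (l i)| + c * (r i - l i))].

Definition add_interval (n : nat) (l : 'I_n -> R) (x : R) (i : 'I_n.+1) : R :=
  oapp l x (unlift ord0 i).

Lemma add_interval0 n (l : 'I_n -> R) x : add_interval l x ord0 = x.
Proof. by rewrite /add_interval unlift_none. Qed.

Lemma add_interval_lift n (l : 'I_n -> R) x i : add_interval l x (lift ord0 i) = l i.
Proof. by rewrite /add_interval liftK. Qed.

Lemma chain_id f c U a x y v : x <= y -> chain f c U a x v -> chain f c U a y v.
Proof.
move=> xy [n [l [r [[h1 h2] h3 h4]]]]; exists n, l, r; split => //.
  by split => // i; have [? ? rx] := h1 i; split => //; exact: le_trans rx xy.
apply: le_trans h3 _.
apply: le_outer_measure; apply: setIS => t /=; rewrite !in_itv/= => tx.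
exact: lt_le_trans tx xy.
Qed.

(** The new interval [x, y[ lies in [U] to the right of the part already measured, so that the
    length bound is inherited by additivity. *)
Lemma chain_add f c (U : set R) a x y v : measurable U -> a <= x -> x <= y ->
  `[x, y] `<=` U -> chain f c U a x v ->
  chain f c U a y (v + (`|f y - f x| + c * (y - x))).
Proof.
move=> mU ax xy xyU [n [l [r [[h1 h2] h3 ->]]]].
exists n.+1, (add_interval l x), (add_interval r y); split.
- split => [i|i j].
    case: (unliftP ord0 i) => [k ->|->].
      rewrite !add_interval_lift; have [? ? rx] := h1 k; split => //; exact: le_trans rx xy.
    by rewrite !add_interval0.
  case: (unliftP ord0 i) => [k ->|->]; case: (unliftP ord0 j) => [k' ->|->].
  + by rewrite (inj_eq (@lift_inj _ _)) !add_interval_lift; exact: h2.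
  + by move=> _; rewrite !add_interval_lift !add_interval0; left; have [_ _] := h1 k.
  + by move=> _; rewrite !add_interval_lift !add_interval0; right; have [_ _] := h1 k'.
  + by rewrite eqxx.
- rewrite big_ord_recl !add_interval0; under eq_bigr do rewrite !add_interval_lift.
  rewrite EFinD addeC.
  have e : U `&` `]-oo, y[ = (U `&` `]-oo, x[) `|` `[x, y[.
    apply/seteqP; split => t /=; rewrite !in_itv/=.
      by move=> [Ut ty]; have [tx|tx] := ltP t x; [left|right; rewrite ty].
    move=> [[Ut tx]|/andP[xt ty]]; first by split => //; exact: lt_le_trans tx xy.
    by split => //; apply: xyU; rewrite /= in_itv/= xt ltW.
  rewrite e measureU//; last 2 first.
  - exact: measurableI.
  - apply/seteqP; split => t //= [[_]]; rewrite !in_itv/= => tx /andP[xt _].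
    by move: tx; rewrite ltNge xt.
  apply: (leeD h3); rewrite -[leRHS]/(mu `[x, y[%classic) lebesgue_measure_itv/= lte_fin.
  by case: ltP => h; [rewrite EFinB|rewrite lee_fin subr_le0].
- rewrite [RHS]big_ord_recl !add_interval0; under [in RHS]eq_bigr do rewrite !add_interval_lift.
  by rewrite addrC.
Qed.

Lemma upper_derivative_leP f t L e : upper_derivative_le f t L -> 0 < e -> exists2 d : R, 0 < d &
  (forall y, t < y < t + d -> f y - f t <= (L + e) * (y - t)) /\
  (forall y, t - d < y < t -> f t - f y <= (L + e) * (t - y)).
Proof.
move=> hL e0; have /nbhs_ballP[d /= d0 hd] : nbhs (0 : R) [set h | h != 0 -> (f (t + h) - f t) / h <= L + e] := hL e e0.
exists d => //; split => y /andP[y1 y2].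
  have := hd (y - t); rewrite /ball /= sub0r normrN gtr0_norm ?subr_gt0//.
  rewrite ltrBlDl => /(_ y2); rewrite subr_eq0 gt_eqF// => /(_ isT).
  by rewrite [t + _]addrC subrK ler_pdivrMr ?subr_gt0.
have := hd (y - t); rewrite /ball /= sub0r normrN ltr0_norm ?subr_lt0// opprB.
rewrite ltrBlDr -ltrBlDl => /(_ y1); rewrite subr_eq0 lt_eqF// => /(_ isT).
by rewrite [t + _]addrC subrK ler_ndivrMr ?subr_lt0// !mulrBr; lra.
Qed.

(* Continuity induction: cover the exceptional null set by an open set [U] of
   small measure and let [S] be the set of points up to which [f] grows at most
   linearly, except for the variation over a chain inside [U]. *)
Lemma abs_continuous_growth (f : R -> R) (a b L : R) : a <= b -> abs_continuous a b f ->
  {ae mu, forall t : R, a < t < b -> upper_derivative_le f t L} ->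
  f b - f a <= L * (b - a).
Proof.
move=> ab acf good.
suff h e : 0 < e -> f b - f a <= (L + e) * (b - a) + (e + e).
  apply/ler_addgt0Pr => e e0.
  have p : 0 < 2 + (b - a) by rewrite ltr_pwDl// subr_ge0.
  have := h (e / (2 + (b - a))) (divr_gt0 e0 p).
  set q := e / _; have : q * (2 + (b - a)) = e by rewrite /q divfK// gt_eqF.
  by lra.
move=> e0; have [d1 d10 hd1] := acf e e0.
have c0 : 0 < 1 + `|L| by rewrite ltr_pwDl.
(* The first bound serves absolute continuity; the second makes |L| times the length of a chain
   inside [U] at most e. *)
pose d := Num.min d1 (e / (1 + `|L|)).
have d0 : 0 < d by rewrite lt_min d10 divr_gt0.
have dL : `|L| * d <= e.
  apply: (@le_trans _ _ (`|L| * (e / (1 + `|L|)))).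
    by rewrite ler_wpM2l// /d ge_min lexx orbT.
  rewrite mulrA ler_pdivrMr// mulrC ler_wpM2l ?(ltW e0)//.
  by rewrite lerDr.
have [N [mN N0 hN]] := good.
(* The end points are covered too, because the derivative is only controlled strictly inside the
   interval. *)
pose N' := (N `|` [set a]) `|` [set b].
have mN' : measurable N' by apply: measurableU => //; apply: measurableU.
have N'0 : mu N' = 0%E.
  have mNa : measurable (N `|` [set a]) by exact: measurableU.
  have e1 := @measureU0 _ _ _ mu _ _ mNa (measurable_set1 b) (lebesgue_measure_set1 b).
  have e2 := @measureU0 _ _ _ mu _ _ mN (measurable_set1 a) (lebesgue_measure_set1 a).
  exact: etrans e1 (etrans e2 N0).
have N'oo : (mu N' < +oo)%E by apply: (eq_ind_r (fun z => (z < +oo)%E) _ N'0); rewrite ltry.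
have [U [oU NU Ud]] := lebesgue_regularity_outer mN' N'oo d0.
have mU : measurable U by exact: open_measurable.
have muU : (mu U < d%:E)%E.
  have e1 := @measureU0 _ _ _ mu _ _ (measurableD mU mN') mN' N'0.
  rewrite setUC setDUK// in e1; exact: (eq_ind_r (fun z => (z < d%:E)%E) Ud e1).
have goodt t : a <= t -> t <= b -> ~ U t -> upper_derivative_le f t L.
  move=> at_ tb nU; apply: contrapT => nh; apply: nU; apply: NU.
  have [->|ta] := eqVneq t a; first by left; right.
  have [->|tb'] := eqVneq t b; first by right.
  left; left; apply: hN => /= /(_ _) h; apply: nh; apply: h.
  by rewrite !lt_neqAle at_ tb tb' eq_sym ta.
pose S := [set x | a <= x <= b /\ exists2 v, chain f `|L| U a x v & f x - f a <= (L + e) * (x - a) + v].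
have Sa : S a.
  split; first by rewrite lexx.
  exists 0; last by rewrite !subrr mulr0 addr0.
  exists 0%N, (fun=> 0), (fun=> 0); split; rewrite ?big_ord0//.
  by split => -[].
have hS : has_sup S by split; [exists a|exists b => x [/andP[]]].
pose s := sup S.
have as_ : a <= s by apply: ub_le_sup => //; case: hS.
have sb : s <= b by apply: ge_sup; [exists a|move=> x [/andP[]]].
have step x y : S x -> x <= y -> y <= b -> (f y - f x <= (L + e) * (y - x) \/ `[x, y] `<=` U) -> S y.
  move=> [/andP[ax xb] [v cv hv]] xy yb [h|h].
    split; first by rewrite (le_trans ax xy).
    exists v; first exact: chain_id cv.
    by have := lerD h hv; rewrite !mulrBr; lra.
  split; first by rewrite (le_trans ax xy).
  exists (v + (`|f y - f x| + `|L| * (y - x))); first exact: chain_add.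
  have h1 := ler_norm (f y - f x).
  (* Inside [U] the growth is paid for by the variation; the length term of the chain, with
     coefficient |L|, compensates for a negative slope. *)
  have h2 : 0 <= (L + e + `|L|) * (y - x).
    apply: mulr_ge0; last by rewrite subr_ge0.
    by have := ler_norm (- L); rewrite normrN; lra.
  by move: h1 h2 hv; rewrite !mulrBr !mulrDl; lra.
have Unear t : U t -> exists2 r : R, 0 < r & forall y, t - r < y < t + r -> U y.
  move=> Ut; have /nbhs_ballP[r /= r0 hr] : nbhs t U by exact: open_nbhs_nbhs.
  by exists r => // y /andP[y1 y2]; apply: hr; rewrite /ball /= ltr_norml; apply/andP; split; lra.
have local t : a <= t -> t <= b -> exists2 r : R, 0 < r &
    (forall y, t < y < t + r -> f y - f t <= (L + e) * (y - t) \/ `[t, y] `<=` U) /\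
    (forall y, t - r < y < t -> f t - f y <= (L + e) * (t - y) \/ `[y, t] `<=` U).
  move=> at_ tb; have [/Unear[r r0 hr]|nU] := pselect (U t).
    exists r => //; split => y /andP[y1 y2]; right => z /=; rewrite in_itv/= => /andP[z1 z2];
      apply: hr; apply/andP; split; lra.
  have [r r0 [h1 h2]] := upper_derivative_leP (goodt t at_ tb nU) e0.
  by exists r => //; split => y hy; left; [exact: h1|exact: h2].
have [r r0 [hr hl]] := local s as_ sb.
(* The left half of [local] brings the supremum into [S]; the right half then extends [S] beyond it
   unless it is [b]. *)
have Ss : S s.
  have [x Sx sx] := sup_adherent r0 hS.
  have xs : x <= s by apply: ub_le_sup => //; case: hS.
  have [<-//|xns] := eqVneq x s.
  have xs' : x < s by rewrite lt_neqAle xns.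
  by apply: (step x s Sx xs sb); apply: hl; rewrite sx.
have [sb'|bs] := ltP s b.
  pose y := Num.min b (s + r / 2).
  have sy : s < y by rewrite lt_min sb' ltrDl divr_gt0.
  have yb : y <= b by rewrite ge_min lexx.
  have Sy : S y.
    apply: (step s y Ss (ltW sy) yb); apply: hr; rewrite sy/=.
    by apply: le_lt_trans (_ : y <= s + r / 2) _; [rewrite ge_min lexx orbT|rewrite ltrD2l; lra].
  have : y <= s by apply: ub_le_sup => //; case: hS.
  by rewrite leNgt sy.
have sE : s = b by apply/eqP; rewrite eq_le sb bs.
rewrite sE in Ss; case: Ss => _ [v [n [l [r' [fam len ->]]]] hv].
apply: le_trans hv _; rewrite lerD2l big_split /= -mulr_sumr.
have len' : \sum_(i < n) (r' i - l i) < d.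
  rewrite -lte_fin; apply: le_lt_trans len _; apply: le_lt_trans muU.
  by apply: le_measure; rewrite ?inE//; exact: measurableI.
apply: lerD.
  by apply: ltW; apply: hd1 => //; apply: lt_le_trans len' _; rewrite ge_min lexx.
by apply: le_trans dL; rewrite ler_wpM2l// ltW.
Qed.

End AbsoluteContinuity.

(** * Weighted energies *)

Section WeightedSpaces.
Context {R : realType}.
Notation T3 := (measurableTypeR R * measurableTypeR R * measurableTypeR R)%type.
Notation field := ('I_3 -> R3 R -> R[i]).
Implicit Types (f g : field) (w : R3 R -> R).

Definition sq f (x : R3 R) : R := \sum_(j < 3) normc (f j x) ^+ 2.

Definition L2w w f : Prop := (forall j, cmeas (f j : T3 -> R[i])) /\
  (nint (fun x => w x * sq f x)%R < +oo)%E.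

Definition Nw w f : R := Num.sqrt (\int[mu3]_x (w x * sq f x)).

Definition cdot f g (x : R3 R) : R := \sum_(j < 3) Re (conjc (f j x) * g j x).

Definition pair w f g : R := \int[mu3]_x (w x * cdot f g x).

Definition addf f g : field := fun j x => f j x + g j x.
Definition subf f g : field := fun j x => f j x - g j x.
Definition scalef (c : R) f : field := fun j x => c%:C * f j x.

Lemma sq_ge0 f x : 0 <= sq f x.
Proof. by apply: sumr_ge0 => j _; exact: sqr_ge0. Qed.

Lemma nnm_sq f : (forall j, cmeas (f j : T3 -> R[i])) -> nnm (sq f : T3 -> R).
Proof. by move=> mf; apply: nnm_sum => j; apply: nnmX; exact: nnm_normc. Qed.

Lemma nnm_wsq w f : nnm (w : T3 -> R) -> (forall j, cmeas (f j : T3 -> R[i])) ->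
  nnm (fun x : T3 => w x * sq f x).
Proof. by move=> nw mf; apply: nnmM => //; exact: nnm_sq. Qed.

Lemma measurable_cdot f g : (forall j, cmeas (f j : T3 -> R[i])) -> (forall j, cmeas (g j : T3 -> R[i])) ->
  measurable_fun [set: T3] (cdot f g : T3 -> R).
Proof.
move=> mf mg; have [] : cmeas (fun x : T3 => \sum_(j < 3) conjc (f j x) * g j x).
  by apply: cmeas_sum => j; apply: cmeasM => //; exact: cmeas_conj.
by move=> h _; apply: eq_measurable_fun h => x _; rewrite Re_sum.
Qed.

Lemma cdot_le f g x (l : R) : 0 < l -> `|cdot f g x| <= 2^-1 * (l * sq f x + l^-1 * sq g x).
Proof.
move=> l0; apply: le_trans (ler_norm_sum _ _ _) _.
rewrite /sq !mulr_sumr -big_split /= mulr_sumr; apply: ler_sum => j _.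
apply: le_trans (Re_le_normc _) _; rewrite Normc.normcM normc_conj.
move: (normc (f j x)) (normc (g j x)) => u v; rewrite ler_pdivlMl//.
have li : 0 < l^-1 by rewrite invr_gt0.
have := mulr_ge0 (ltW li) (sqr_ge0 (l * u - v)).
have -> : l^-1 * (l * u - v) ^+ 2 = l * u ^+ 2 + l^-1 * v ^+ 2 - 2 * (u * v).
  by field; rewrite gt_eqF.
by rewrite subr_ge0.
Qed.

(** Recovers the Cauchy-Schwarz inequality from the weighted arithmetic-geometric inequalities,
    which pass through sums and integrals; the optimal parameter is l = I / A. *)
Lemma sqr_cauchy_schwarz (I A B : R) : 0 <= A -> 0 <= B -> 0 <= I ->
  (forall l, 0 < l -> I <= 2^-1 * (l * A + l^-1 * B)) -> I <= Num.sqrt A * Num.sqrt B.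
Proof.
move=> A0 B0 I0 h; rewrite -sqrtrM// -(ger0_norm I0) -sqrtr_sqr ler_sqrt ?mulr_ge0//.
have [I0'|In] := eqVneq I 0; first by rewrite I0' expr0n mulr_ge0.
have Ip : 0 < I by rewrite lt_neqAle eq_sym In.
have [A00|An] := eqVneq A 0.
  (* If A = 0 a large parameter forces I to be smaller than itself. *)
  have := h ((B + 1) / I) (divr_gt0 (ltr_wpDl B0 ltr01) Ip).
  rewrite A00 mulr0 add0r invf_div mulrAC => h'.
  have : I * B / (B + 1) <= I by rewrite ler_pdivrMr ?ltr_wpDl// ler_wpM2l ?lerDl.
  by move: h' Ip; set q := _ / _ => h' Ip hq; exfalso; lra.
have Ap : 0 < A by rewrite lt_neqAle eq_sym An.
have := h (I / A) (divr_gt0 Ip Ap); rewrite invf_div divfK// => h'.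
have := ler_wpM2l (ltW Ip) h'; rewrite mulrCA mulrDr (mulrA I (A / I)) (mulrCA I A) divff// mulr1.
by rewrite -expr2; move: (I ^+ 2) (A * B) => p q; lra.
Qed.

Section pairing.
Variables (w w1 w2 : R3 R -> R) (C : R).
Hypotheses (nw : nnm (w : T3 -> R)) (nw1 : nnm (w1 : T3 -> R)) (nw2 : nnm (w2 : T3 -> R)) (C0 : 0 <= C).
Hypothesis dom : forall x, w x ^+ 2 <= C ^+ 2 * (w1 x * w2 x).

Lemma wcdot_le f g x (l : R) : 0 < l ->
  `|w x * cdot f g x| <= C * (2^-1 * (l * (w1 x * sq f x) + l^-1 * (w2 x * sq g x))).
Proof.
move=> l0; have [_ w0] := nw; have [_ w10] := nw1; have [_ w20] := nw2.
rewrite normrM (ger0_norm (w0 x)).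
have hw : w x <= C * (Num.sqrt (w1 x) * Num.sqrt (w2 x)).
  rewrite -(@ler_pXn2r _ 2) ?nnegrE ?mulr_ge0 ?sqrtr_ge0//.
  by rewrite !exprMn !sqr_sqrtr.
have hc : `|cdot f g x| <= Num.sqrt (sq f x) * Num.sqrt (sq g x).
  by apply: sqr_cauchy_schwarz; rewrite ?sq_ge0// => k k0; exact: cdot_le.
apply: le_trans (ler_pM (w0 x) (normr_ge0 _) hw hc) _.
rewrite -mulrA ler_wpM2l//.
set a := Num.sqrt (w1 x); set b := Num.sqrt (w2 x); set c := Num.sqrt (sq f x); set d := Num.sqrt (sq g x).
have -> : w1 x = a ^+ 2 by rewrite sqr_sqrtr.
have -> : w2 x = b ^+ 2 by rewrite sqr_sqrtr.
have -> : sq f x = c ^+ 2 by rewrite sqr_sqrtr// sq_ge0.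
have -> : sq g x = d ^+ 2 by rewrite sqr_sqrtr// sq_ge0.
have li : 0 < l^-1 by rewrite invr_gt0.
rewrite ler_pdivlMl//; have := mulr_ge0 (ltW li) (sqr_ge0 (l * (a * c) - b * d)).
have -> : l^-1 * (l * (a * c) - b * d) ^+ 2 = l * (a ^+ 2 * c ^+ 2) + l^-1 * (b ^+ 2 * d ^+ 2) - 2 * (a * b * (c * d)).
  by field; rewrite gt_eqF.
by rewrite subr_ge0.
Qed.

Lemma L2w_integrable v f : nnm (v : T3 -> R) -> L2w v f ->
  mu3.-integrable [set: T3] (EFin \o (fun x => v x * sq f x)).
Proof. by move=> nv [mf hf]; apply: nint_integrable => //; exact: nnm_wsq. Qed.

Lemma integrable_pair f g : L2w w1 f -> L2w w2 g ->
  mu3.-integrable [set: T3] (EFin \o (fun x => w x * cdot f g x)).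
Proof.
move=> hf hg; have i1 := integrableD (@measurableT _ T3) (L2w_integrable nw1 hf) (L2w_integrable nw2 hg).
have i2 := integrableZl (@measurableT _ T3) (C * 2^-1) i1.
apply: (le_integrable _ _ _ i2) => //.
  apply/measurable_EFinP; apply: measurable_funM; first by case: nw.
  by apply: measurable_cdot; [case: hf|case: hg].
move=> x _; rewrite lee_fin; apply: le_trans (wcdot_le f g x ltr01) _.
by rewrite invr1 !mul1r mulrA; exact: ler_norm.
Qed.

(** A duality between two weighted spaces: [dom] says that w is at most C times the geometric mean
    of w1 and w2. The pointwise inequality is integrated for each l, and l is optimised only
    afterwards. *)
Lemma pair_le f g : L2w w1 f -> L2w w2 g -> `|pair w f g| <= C * (Nw w1 f * Nw w2 g).
Proof.
move=> hf hg; have [i1 i2] := (L2w_integrable nw1 hf, L2w_integrable nw2 hg).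
have ip := integrable_pair hf hg.
have h l : 0 < l -> `|pair w f g| <= C * (2^-1 * (l * (\int[mu3]_x (w1 x * sq f x)) + l^-1 * (\int[mu3]_x (w2 x * sq g x)))).
  move=> l0; have j1 : mu3.-integrable [set: T3] (EFin \o (fun x => l * (w1 x * sq f x))).
    by have := integrableZl (@measurableT _ T3) l i1; apply: eq_integrable.
  have j2 : mu3.-integrable [set: T3] (EFin \o (fun x => l^-1 * (w2 x * sq g x))).
    by have := integrableZl (@measurableT _ T3) l^-1 i2; apply: eq_integrable.
  have j3 : mu3.-integrable [set: T3] (EFin \o (fun x => l * (w1 x * sq f x) + l^-1 * (w2 x * sq g x))).
    by have := integrableD (@measurableT _ T3) j1 j2; apply: eq_integrable.
  rewrite -RintegralZl// -[X in _ + X]RintegralZl// -RintegralD// mulrA -RintegralZl//.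
  apply: le_trans (le_normr_Rintegral _ ip) _ => //.
  apply: Rintegral_le.
  - exact: (integrable_norm ip).
  - by have := integrableZl (@measurableT _ T3) (C * 2^-1) j3; apply: eq_integrable.
  - by move=> x; rewrite -mulrA; exact: wcdot_le.
have [C00|Cn] := eqVneq C 0.
  by have := h 1 ltr01; rewrite C00 !mul0r.
have Cp : 0 < C by rewrite lt_neqAle eq_sym Cn.
rewrite -ler_pdivrMl//; apply: sqr_cauchy_schwarz.
- by apply: Rintegral_ge0 => x _; have [_] := nnm_wsq nw1 hf.1.
- by apply: Rintegral_ge0 => x _; have [_] := nnm_wsq nw2 hg.1.
- by rewrite mulr_ge0// invr_ge0.
- by move=> l l0; rewrite ler_pdivrMl//; exact: h.
Qed.

Lemma pairDr f g g' : L2w w1 f -> L2w w2 g -> L2w w2 g' ->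
  pair w f (addf g g') = pair w f g + pair w f g'.
Proof.
move=> hf hg hg'; rewrite /pair -RintegralD//; [|exact: integrable_pair|exact: integrable_pair].
apply: eq_Rintegral => x _; rewrite -mulrDr /cdot -big_split /=; congr (_ * _).
by apply: eq_bigr => j _; rewrite /addf mulrDr ReD.
Qed.

Lemma pairZr f g c : L2w w1 f -> L2w w2 g -> pair w f (scalef c g) = c * pair w f g.
Proof.
move=> hf hg; rewrite /pair -RintegralZl//; last exact: integrable_pair.
apply: eq_Rintegral => x _; rewrite [RHS]mulrCA; congr (_ * _).
by rewrite /cdot mulr_sumr; apply: eq_bigr => j _; rewrite /scalef mulrCA ReMr.
Qed.

End pairing.

Lemma cdotC f g x : cdot f g x = cdot g f x.
Proof. by apply: eq_bigr => j _; rewrite !ReM !Re_conj !Im_conj; ring. Qed.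

Lemma pairC w f g : pair w f g = pair w g f.
Proof. by apply: eq_Rintegral => x _; rewrite cdotC. Qed.

Lemma cdotxx f x : cdot f f x = sq f x.
Proof. by apply: eq_bigr => j _; rewrite ReM Re_conj Im_conj sqr_normc'; ring. Qed.

Lemma pairxx w f : nnm (w : T3 -> R) -> (forall j, cmeas (f j : T3 -> R[i])) -> pair w f f = Nw w f ^+ 2.
Proof.
move=> nw mf; rewrite sqr_sqrtr; last by apply: Rintegral_ge0 => x _; have [_] := nnm_wsq nw mf.
by apply: eq_Rintegral => x _; rewrite cdotxx.
Qed.

Lemma Nw_ge0 w f : 0 <= Nw w f. Proof. exact: sqrtr_ge0. Qed.

Lemma sq_addf f g x : sq (addf f g) x = sq f x + 2 * cdot f g x + sq g x.
Proof.
rewrite /sq /cdot mulr_sumr -!big_split /=; apply: eq_bigr => j _.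
by rewrite /addf !sqr_normc' ReD ImD ReM Re_conj Im_conj; ring.
Qed.

Lemma sq_scalef c f x : sq (scalef c f) x = c ^+ 2 * sq f x.
Proof.
rewrite /sq mulr_sumr; apply: eq_bigr => j _.
by rewrite /scalef Normc.normcM exprMn normcR real_normK ?num_real.
Qed.

Lemma cmeas_addf f g j : (forall j, cmeas (f j : T3 -> R[i])) -> (forall j, cmeas (g j : T3 -> R[i])) ->
  cmeas (addf f g j : T3 -> R[i]).
Proof. by move=> mf mg; exact: cmeasD. Qed.

Lemma cmeas_scalef c f j : (forall j, cmeas (f j : T3 -> R[i])) -> cmeas (scalef c f j : T3 -> R[i]).
Proof. by move=> mf; apply: cmeasM => //; exact: cmeas_cst. Qed.

Section weighted_norm.
Variable w : R3 R -> R.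
Hypothesis nw : nnm (w : T3 -> R).

Lemma sqr_Nw f : Nw w f ^+ 2 = \int[mu3]_x (w x * sq f x).
Proof.
rewrite sqr_sqrtr//; apply: Rintegral_ge0 => x _.
by have [_ w0] := nw; rewrite mulr_ge0 ?sq_ge0.
Qed.

Lemma L2wZ c f : L2w w f -> L2w w (scalef c f).
Proof.
move=> [mf hf]; split; first by move=> j; exact: cmeas_scalef.
rewrite (_ : (fun x => _) = fun x => c ^+ 2 * (w x * sq f x)); last first.
  by apply/funext => x; rewrite sq_scalef mulrCA.
by rewrite nintZ ?sqr_ge0 ?lte_mul_pinfty ?lee_fin ?sqr_ge0//; exact: nnm_wsq.
Qed.

Lemma NwZ c f : L2w w f -> Nw w (scalef c f) = `|c| * Nw w f.
Proof.
move=> hf; rewrite -sqrtr_sqr -sqrtrM ?sqr_ge0//; congr Num.sqrt.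
rewrite -RintegralZl//; last exact: (@L2w_integrable w f nw hf).
by apply: eq_Rintegral => x _; rewrite sq_scalef mulrCA.
Qed.

Lemma L2wD f g : L2w w f -> L2w w g -> L2w w (addf f g).
Proof.
move=> hf hg; have [mf if_] := hf; have [mg ig] := hg.
split; first by move=> j; exact: cmeas_addf.
have [_ w0] := nw.
apply: (@le_lt_trans _ _ (nint (fun x => 2 * (w x * sq f x) + 2 * (w x * sq g x))%R)).
  apply: le_nint.
  - by apply: nnm_wsq => // j; exact: cmeas_addf.
  - by apply: nnmD; apply: nnmM; [exact: nnm_cst|exact: nnm_wsq|exact: nnm_cst|exact: nnm_wsq].
  - move=> x; rewrite mulrCA (mulrCA 2) -mulrDr ler_wpM2l//.
    have := @cdot_le f g x 1 ltr01; rewrite sq_addf invr1 !mul1r => h.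
    by have := ler_norm (cdot f g x); lra.
rewrite nintD; [|by apply: nnmM; [exact: nnm_cst|exact: nnm_wsq]|by apply: nnmM; [exact: nnm_cst|exact: nnm_wsq]].
by rewrite !nintZ ?lte_add_pinfty ?lte_mul_pinfty ?lee_fin//; exact: nnm_wsq.
Qed.

Let domw x : w x ^+ 2 <= 1 ^+ 2 * (w x * w x).
Proof. by rewrite expr1n mul1r expr2. Qed.

Lemma pair_same_le f g : L2w w f -> L2w w g -> `|pair w f g| <= Nw w f * Nw w g.
Proof. by move=> hf hg; have := pair_le nw nw nw ler01 domw hf hg; rewrite mul1r. Qed.

Lemma Nw_addf f g : L2w w f -> L2w w g ->
  Nw w (addf f g) ^+ 2 = Nw w f ^+ 2 + 2 * pair w f g + Nw w g ^+ 2.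
Proof.
move=> hf hg; rewrite !sqr_Nw.
have i1 := L2w_integrable nw hf; have i2 := L2w_integrable nw hg.
have ip := integrable_pair nw nw nw ler01 domw hf hg.
have ip2 : mu3.-integrable [set: T3] (EFin \o (fun x => 2 * (w x * cdot f g x))).
  by have := integrableZl (@measurableT _ T3) 2 ip; apply: eq_integrable.
have i3 : mu3.-integrable [set: T3] (EFin \o (fun x => w x * sq f x + 2 * (w x * cdot f g x))).
  by have := integrableD (@measurableT _ T3) i1 ip2; apply: eq_integrable.
rewrite /pair -RintegralZl// -RintegralD// -RintegralD//.
by apply: eq_Rintegral => x _; rewrite sq_addf; ring.
Qed.

Lemma Nw_triangle f g : L2w w f -> L2w w g -> Nw w (addf f g) <= Nw w f + Nw w g.
Proof.
move=> hf hg; rewrite -(@ler_pXn2r _ 2) ?nnegrE ?addr_ge0 ?Nw_ge0// Nw_addf// sqrrD.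
have := pair_same_le hf hg; have := ler_norm (pair w f g).
by rewrite lerD2r lerD2l -mulr_natl; lra.
Qed.

Lemma L2w_ae f g : (forall j, cmeas (g j : T3 -> R[i])) -> (forall j, {ae mu3, forall x, f j x = g j x}) ->
  L2w w f -> L2w w g /\ Nw w f = Nw w g.
Proof.
move=> mg fg [mf hf].
have e : {ae mu3, forall x, w x * sq f x = w x * sq g x}.
  by apply: filterS3 (fg 0) (fg 1) (fg 2) => x h0 h1 h2; rewrite /sq !sum3 h0 h1 h2.
have [n1 n2] := (nnm_wsq nw mf, nnm_wsq nw mg).
have E := eq_nint_ae n1 n2 e.
have lg : L2w w g by split => //; rewrite -E.
split => //; rewrite /Nw; congr Num.sqrt; apply/EFin_inj.
by rewrite -!nint_fin// -E.
Qed.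

End weighted_norm.

Lemma L2w_le (w w' : R3 R -> R) (c : R) f : nnm (w : T3 -> R) -> nnm (w' : T3 -> R) -> 0 <= c ->
  (forall x, w' x <= c ^+ 2 * w x) -> L2w w f -> L2w w' f /\ Nw w' f <= c * Nw w f.
Proof.
move=> nw nw' c0 ww [mf hf]; have [n1 n2] := (nnm_wsq nw mf, nnm_wsq nw' mf).
have nc : nnm (fun x : T3 => c ^+ 2 * (w x * sq f x)) by apply: nnmM => //; apply: nnm_cst; exact: sqr_ge0.
have le x : w' x * sq f x <= c ^+ 2 * (w x * sq f x) by rewrite mulrA ler_wpM2r ?sq_ge0.
have hcc : (nint (fun x => c ^+ 2 * (w x * sq f x))%R < +oo)%E.
  by rewrite nintZ ?sqr_ge0 ?lte_mul_pinfty ?lee_fin ?sqr_ge0.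
have hw' : L2w w' f by split => //; apply: le_lt_trans hcc; exact: le_nint.
split => //; rewrite -(@ler_pXn2r _ 2) ?nnegrE ?mulr_ge0 ?Nw_ge0// exprMn !sqr_Nw//.
rewrite -RintegralZl//; last exact: nint_integrable.
by apply: Rintegral_le => //; [exact: (nint_integrable n2 hw'.2)|exact: (nint_integrable nc hcc)].
Qed.

End WeightedSpaces.

(** * Continuity method *)

Section Bootstrap.
Context {R : realType}.

(** As long as P <= B the hypothesis improves the bound to the strictly smaller e, and continuity
    then leaves room to go on. A supremum of admissible times below t1 would be contradictory. *)
Lemma bootstrap_le (P : R -> R) (a e B : R) : e < B -> P a <= e ->
  (forall t, a <= t -> forall eta, 0 < eta -> exists2 d, 0 < d &
     forall r, a <= r -> `|r - t| < d -> `|P r - P t| <= eta) ->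
  (forall t, a <= t -> (forall r, a <= r <= t -> P r <= B) -> P t <= e) ->
  forall t, a <= t -> P t <= e.
Proof.
move=> eB Pa cP step t1 at1; rewrite leNgt; apply/negP => Pt1.
pose S := [set t | a <= t <= t1 /\ forall r, a <= r <= t -> P r <= B].
have Sa : S a.
  split; first by rewrite lexx.
  by move=> r; rewrite -eq_le => /eqP <-; apply: le_trans Pa (ltW eB).
have hS : has_sup S by split; [exists a|exists t1 => t [/andP[]]].
pose s := sup S.
have as_ : a <= s by apply: ub_le_sup => //; case: hS.
have st : s <= t1 by apply: ge_sup; [exists a|move=> x [/andP[]]].
have below r : a <= r -> r < s -> P r <= e.
  move=> ar rs; apply: step => // r' /andP[ar' r'r].
  have [t [_ ht] srt] := @sup_adherent _ S (s - r) (ltac:(by rewrite subr_gt0)) hS.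
  apply: ht; rewrite ar'/=; apply: (le_trans r'r); rewrite ltW//.
  by rewrite -/s opprB addrC subrK in srt.
(* Spent twice: once to reach s from the left, once to pass beyond it, which uses up exactly the gap
   between e and B. *)
have eta0 : 0 < (B - e) / 2 by rewrite divr_gt0// subr_gt0.
have [d d0 hd] := cP s as_ _ eta0.
have Ps : P s <= e + (B - e) / 2.
  have [sa|sa] := eqVneq s a; first by rewrite sa; lra.
  have as' : a < s by rewrite lt_neqAle eq_sym sa.
  pose r := Num.max a (s - d / 2).
  have rs : r < s by rewrite gt_max as' ltrBlDr ltrDl divr_gt0.
  have ar : a <= r by rewrite le_max lexx.
  have rd : `|r - s| < d.
    rewrite distrC gtr0_norm ?subr_gt0// ltrBlDr -ltrBlDl.
    by apply: lt_le_trans (_ : s - d / 2 <= _); [lra|rewrite le_max lexx orbT].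
  have := hd r ar rd; have := below r ar rs; have := ler_norm (- (P r - P s)); rewrite normrN.
  lra.
have near_s r : a <= r -> r < s + d -> P r <= B.
  move=> ar rd; have [rs|sr] := ltP r s; first by apply: le_trans (below r ar rs) (ltW eB).
  have rd' : `|r - s| < d by rewrite ger0_norm ?subr_ge0//; lra.
  by have := hd r ar rd'; have := ler_norm (P r - P s); lra.
have [st'|ts] := ltP s t1; last first.
  have : P t1 <= e.
    apply: step => // r /andP[ar rt]; apply: near_s => //.
    by apply: le_lt_trans rt _; apply: le_lt_trans ts _; rewrite ltrDl.
  by rewrite leNgt Pt1.
pose y := Num.min t1 (s + d / 2).
have sy : s < y by rewrite lt_min st' ltrDl divr_gt0.
have Sy : S y.
  split; first by rewrite (le_trans as_ (ltW sy))/= ge_min lexx.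
  move=> r /andP[ar ry]; apply: near_s => //; apply: le_lt_trans ry _.
  by rewrite gt_min; apply/orP; right; lra.
have : y <= s by apply: ub_le_sup => //; case: hS.
by rewrite leNgt sy.
Qed.

End Bootstrap.

(** * Time evolution of weighted energies *)

Section Energy.
Context {R : realType}.

Lemma add3_le (a b c p q r d eta e : R) : a <= p -> b <= q -> c <= r -> 0 <= eta ->
  p + q + r + eta <= e -> d + a + b + c <= d + e.
Proof. lra. Qed.

Notation T3 := (measurableTypeR R * measurableTypeR R * measurableTypeR R)%type.
Notation field := ('I_3 -> R3 R -> R[i]).

Definition bessel (s : R) (x : R3 R) : R := (1 + enorm x ^+ 2) `^ s.

Lemma bessel_base (x : R3 R) : 1 <= 1 + enorm x ^+ 2.
Proof. by rewrite lerDl sqr_ge0. Qed.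

Lemma nnm_bessel s : nnm (bessel s : T3 -> R).
Proof.
split; last by move=> x; exact: powR_ge0.
apply: (measurableT_comp (measurable_powR s)); apply: measurable_funD; first exact: measurable_cst.
by apply: measurable_funX; exact: (measurable_enorm measurable_id3).
Qed.

Lemma bessel_le s s' x : s <= s' -> bessel s x <= bessel s' x.
Proof. by move=> ss; apply: ler_powR => //; exact: bessel_base. Qed.

Lemma bessel_ge1 s x : 0 <= s -> 1 <= bessel s x.
Proof. by move=> s0; have := bessel_le x s0; rewrite /bessel powRr0. Qed.

Lemma besselM s s' x : bessel s x * bessel s' x = bessel (s + s') x.
Proof.
by rewrite /bessel powRD// (gt_eqF (lt_le_trans ltr01 (bessel_base x))) implybT.
Qed.

Variables (s : R) (V : R -> field).
Hypothesis s_gt : 2^-1 < s.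

Let bs := bessel s.
Let bm := bessel (s - 1).
Let nbs : nnm (bs : T3 -> R) := nnm_bessel s.
Let nbm : nnm (bm : T3 -> R) := nnm_bessel (s - 1).

Hypothesis V_Hs : forall t, 0 <= t -> L2w bs (V t).
Hypothesis V_cont : forall t0, 0 <= t0 -> forall e, 0 < e -> exists2 d, 0 < d &
  forall t, 0 <= t -> `|t - t0| < d -> Nw bs (subf (V t) (V t0)) <= e.
Hypothesis V_AC : forall T, 0 < T -> forall e, 0 < e -> exists2 d, 0 < d &
  forall n (l r : 'I_n -> R), interval_family 0 T l r -> \sum_(i < n) (r i - l i) < d ->
    \sum_(i < n) Nw bm (subf (V (r i)) (V (l i))) < e.

Definition has_velocity t (z : field) := L2w bm z /\ forall e, 0 < e -> exists2 d, 0 < d &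
  forall h, h != 0 -> `|h| < d ->
    Nw bm (subf (scalef h^-1 (subf (V (t + h)) (V t))) z) <= e.

Lemma addf_subf (f g : field) : addf g (subf f g) = f.
Proof. by apply/funext => j; apply/funext => x; rewrite /addf /subf addrC subrK. Qed.

Lemma subf_addf (f g : field) : subf f g = addf f (scalef (-1) g).
Proof.
by apply/funext => j; apply/funext => x; rewrite /addf /subf /scalef rmorphN /= mulN1r.
Qed.

Lemma L2w_subf w f g : nnm (w : T3 -> R) -> L2w w f -> L2w w g -> L2w w (subf f g).
Proof. by move=> nw hf hg; rewrite subf_addf; apply: L2wD => //; exact: L2wZ. Qed.

Lemma L2w_bm f : L2w bs f -> L2w bm f /\ Nw bm f <= Nw bs f.
Proof.
move=> hf; have := @L2w_le _ bs bm 1 f nbs nbm ler01; rewrite expr1n mul1r; apply => //.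
by move=> x; rewrite mul1r; apply: bessel_le; rewrite gerBl.
Qed.

Lemma Nw_dist w f g : nnm (w : T3 -> R) -> L2w w f -> L2w w g -> `|Nw w f - Nw w g| <= Nw w (subf f g).
Proof.
move=> nw hf hg; have hs := L2w_subf nw hf hg; have hs' := L2w_subf nw hg hf.
have h1 := Nw_triangle nw hg hs; rewrite addf_subf in h1.
have h2 := Nw_triangle nw hf hs'; rewrite addf_subf in h2.
have e : Nw w (subf g f) = Nw w (subf f g).
  have -> : subf g f = scalef (-1) (subf f g).
    by apply/funext => j; apply/funext => x; rewrite /subf /scalef rmorphN /= mulN1r opprB.
  by rewrite (NwZ nw)// normrN1 mul1r.
by rewrite e in h2; rewrite ler_norml; apply/andP; split; lra.
Qed.

Lemma NV_cont w c : nnm (w : T3 -> R) -> 0 <= c -> (forall x, w x <= c ^+ 2 * bs x) ->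
  forall t, 0 <= t -> forall eta, 0 < eta -> exists2 d, 0 < d &
     forall r, 0 <= r -> `|r - t| < d -> `|Nw w (V r) - Nw w (V t)| <= eta.
Proof.
move=> nw c0 wc t t0 eta eta0.
have c1 : 0 < c + 1 by rewrite ltr_wpDl.
have [d d0 hd] := V_cont t0 (divr_gt0 eta0 c1).
exists d => // r r0 rd; have [h1 h2] := (V_Hs r0, V_Hs t0).
have [g1 _] := L2w_le nbs nw c0 wc h1; have [g2 _] := L2w_le nbs nw c0 wc h2.
apply: le_trans (Nw_dist nw g1 g2) _.
have [_ g3] := L2w_le nbs nw c0 wc (L2w_subf nbs h1 h2).
apply: le_trans g3 _; apply: (@le_trans _ _ (c * (eta / (c + 1)))).
  by rewrite ler_wpM2l//; exact: hd.
by rewrite mulrA ler_pdivrMr// mulrC ler_wpM2l ?(ltW eta0)// lerDl.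
Qed.

Lemma NV_bounded T : 0 <= T -> exists2 M, 0 <= M & forall t, 0 <= t <= T -> Nw bs (V t) <= M.
Proof.
(* Frozen at its initial value for negative times, so as to be continuous on the whole line. *)
move=> T0; pose phi t := Nw bs (V (Num.max t 0)).
have cphi : continuous phi.
  move=> t; apply/cvgrPdist_le => e e0.
  have wc x : bs x <= 1 ^+ 2 * bs x by rewrite expr1n mul1r.
  have t0 : 0 <= Num.max t 0 by rewrite le_max lexx orbT.
  have [d d0 hd] := NV_cont nbs ler01 wc t0 e0.
  near=> r; rewrite distrC; apply: hd; first by rewrite le_max lexx orbT.
  apply: le_lt_trans (_ : `|r - t| < d).
    rewrite /Num.max; case: (ltP r 0) => r0; case: (ltP t 0) => t0'; rewrite ?subrr ?normr0//.
      by rewrite sub0r normrN (ger0_norm t0') distrC ger0_norm ?lerBrDr; lra.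
    by rewrite subr0 (ger0_norm r0) ger0_norm; lra.
  rewrite distrC; near: r; exact: cvgr_dist_lt.
have [c _ hc] := EVT_max T0 (continuous_subspaceT cphi).
exists (phi c); first exact: Nw_ge0.
by move=> t tT; have := hc t; rewrite in_itv/= => /(_ tT); rewrite /phi (max_idPl _)//; have /andP[] := tT.
Unshelve. all: by end_near. Qed.

Section bounded_weight.
Variables (w : R3 R -> R) (rho : R).
Hypotheses (nw : nnm (w : T3 -> R)) (rho0 : 0 <= rho) (wr : forall x, w x <= rho).

(** The exponents of the two Sobolev weights add up to 2 s - 1 >= 0, so that their product is at
    least 1. *)
Lemma bounded_dom x : w x ^+ 2 <= rho ^+ 2 * (bs x * bm x).
Proof.
have [_ w0] := nw; rewrite besselM; apply: (@le_trans _ _ (rho ^+ 2)).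
  by rewrite lerXn2r ?nnegrE.
rewrite ler_peMr ?sqr_ge0// bessel_ge1//; move: s_gt; lra.
Qed.

Lemma wpair_le f g : L2w bs f -> L2w bm g -> `|pair w f g| <= rho * (Nw bs f * Nw bm g).
Proof. exact: (pair_le nw nbs nbm rho0 bounded_dom). Qed.

Definition energy t := Nw w (V t) ^+ 2.

Lemma energyE t : 0 <= t -> energy t = pair w (V t) (V t).
Proof. by move=> t0; rewrite pairxx//; case: (V_Hs t0). Qed.

(** The increment appears linearly, so it can be measured in H^(s-1), where u is absolutely
    continuous, while the other factor stays bounded in H^s. *)
Lemma energy_diff a b : 0 <= a -> 0 <= b ->
  energy b - energy a = pair w (V b) (subf (V b) (V a)) + pair w (V a) (subf (V b) (V a)).
Proof.
move=> a0 b0; rewrite !energyE//; set dl := subf _ _.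
have [ha hb] := (V_Hs a0, V_Hs b0); have [hma _] := L2w_bm ha.
have [hd _] := L2w_bm (L2w_subf nbs hb ha : L2w bs dl).
have e1 : pair w (V b) (V b) = pair w (V b) (V a) + pair w (V b) dl.
  by rewrite -(pairDr nw nbs nbm rho0 bounded_dom hb hma hd) addf_subf.
have e2 : pair w (V a) (V b) = pair w (V a) (V a) + pair w (V a) dl.
  by rewrite -(pairDr nw nbs nbm rho0 bounded_dom ha hma hd) addf_subf.
by rewrite e1 (pairC _ (V b) (V a)) e2; ring.
Qed.

Lemma energy_abs_continuous a b : 0 <= a -> a <= b -> abs_continuous a b energy.
Proof.
move=> a0 ab e e0; have b0 := le_trans a0 ab.
have [M M0 hM] := NV_bounded b0.
have c0 : 0 < 2 * rho * M + 1 by rewrite ltr_wpDl// !mulr_ge0.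
(* Absolute continuity is available for positive horizons only, and b may be 0. *)
have b1 : 0 < b + 1 by rewrite ltr_wpDl.
have [d d0 hd] := V_AC b1 (divr_gt0 e0 c0).
exists d => // n l r [h1 h2] len.
have fam : interval_family 0 (b + 1) l r.
  split => // i; have [al lr rb] := h1 i; split => //; first exact: le_trans a0 al.
  by apply: le_trans rb _; rewrite lerDl.
have := hd n l r fam len; rewrite ltr_pdivlMr// => h.
apply: le_lt_trans h; rewrite mulr_suml; apply: ler_sum => i _.
have [al lr rb] := h1 i.
have l0 : 0 <= l i by exact: le_trans a0 al.
have r0 : 0 <= r i by exact: le_trans l0 lr.
rewrite energy_diff//; set dl := subf _ _.
have [hd' _] := L2w_bm (L2w_subf nbs (V_Hs r0) (V_Hs l0) : L2w bs dl).
apply: le_trans (ler_normD _ _) _.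
have := wpair_le (V_Hs r0) hd'; have := wpair_le (V_Hs l0) hd'.
have m1 : Nw bs (V (l i)) <= M by apply: hM; rewrite l0 (le_trans lr).
have m2 : Nw bs (V (r i)) <= M by apply: hM; rewrite r0.
have n0 := Nw_ge0 bm dl.
have q1 : rho * (Nw bs (V (l i)) * Nw bm dl) <= rho * (M * Nw bm dl) by rewrite ler_wpM2l// ler_wpM2r.
have q2 : rho * (Nw bs (V (r i)) * Nw bm dl) <= rho * (M * Nw bm dl) by rewrite ler_wpM2l// ler_wpM2r.
by move=> p1 p2; rewrite mulrDr mulr1; lra.
Qed.

(** The difference quotient is 2 <V, z> plus three errors: the increment of V, small in H^s, against
    z, and the error of the quotient, small in H^(s-1), against V at the two times. Continuity in
    H^s is what makes the first one small. *)
Lemma energy_derivative t z : 0 < t -> has_velocity t z ->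
  upper_derivative_le energy t (2 * pair w (V t) z).
Proof.
move=> t0 [hz hv] e e0.
have ht := V_Hs (ltW t0); set A := Nw bs (V t); set Z := Nw bm z.
have [A0 Z0] : 0 <= A /\ 0 <= Z by split; exact: Nw_ge0.
have c0 : 0 < rho * (Z + 2 * A + 1) + 1 by rewrite ltr_wpDl// mulr_ge0// !addr_ge0// mulr_ge0.
(* The three errors add up to at most rho (Z + 2 A + 1) eta, using |V(t + h)| <= A + 1. *)
pose eta := Num.min 1 (e / (rho * (Z + 2 * A + 1) + 1)).
have eta0 : 0 < eta by rewrite lt_min ltr01 divr_gt0.
have eta1 : eta <= 1 by rewrite ge_min lexx.
have [d1 d10 hd1] := V_cont (ltW t0) eta0.
have [d2 d20 hd2] := hv _ eta0.
have dd : 0 < Num.min t (Num.min d1 d2) by rewrite !lt_min t0 d10.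
near=> h.
have hn : h != 0 by near: h; exact: nbhs_dnbhs_neq.
have : `|h| < Num.min t (Num.min d1 d2).
  near: h; apply: dnbhs0_lt; exact: dd.
rewrite !lt_min => /and3P[h1 h2 h3].
have th0 : 0 <= t + h by have := ler_norm (- h); rewrite normrN; lra.
have hth := V_Hs th0.
set dl := subf (V (t + h)) (V t).
have hdl : L2w bs dl by exact: L2w_subf.
have [hdm _] := L2w_bm hdl.
have hdh : L2w bm (scalef h^-1 dl) by exact: L2wZ.
set r := subf (scalef h^-1 dl) z.
have hr : L2w bm r by exact: L2w_subf.
have Ndl : Nw bs dl <= eta by apply: hd1 => //; rewrite addrAC subrr add0r.
have Nr : Nw bm r <= eta by exact: hd2.
have Nth : Nw bs (V (t + h)) <= A + 1.
  have := Nw_triangle nbs ht hdl; rewrite addf_subf -/A; move: Ndl eta1; clearbody A; lra.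
have E : (energy (t + h) - energy t) / h =
    2 * pair w (V t) z + pair w dl z + pair w (V (t + h)) r + pair w (V t) r.
  rewrite (energy_diff (ltW t0) th0) -/dl mulrDl.
  rewrite [_ / h]mulrC -(pairZr nw nbs nbm rho0 bounded_dom _ hth hdm).
  rewrite [pair w (V t) dl / h]mulrC -(pairZr nw nbs nbm rho0 bounded_dom _ ht hdm).
  rewrite -(addf_subf (scalef h^-1 dl) z) -/r.
  rewrite (pairDr nw nbs nbm rho0 bounded_dom hth hz hr) (pairDr nw nbs nbm rho0 bounded_dom ht hz hr).
  have -> : pair w (V (t + h)) z = pair w (V t) z + pair w dl z.
    rewrite pairC -{1}(addf_subf (V (t + h)) (V t)) -/dl.
    have dom' x : w x ^+ 2 <= rho ^+ 2 * (bm x * bs x) by rewrite (mulrC (bm x)); exact: bounded_dom.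
    by rewrite (pairDr nw nbm nbs rho0 dom' hz ht hdl) !(pairC _ z).
  ring.
rewrite E.
have p1 := le_trans (ler_norm _) (wpair_le hdl hz).
have p2 := le_trans (ler_norm _) (wpair_le hth hr).
have p3 := le_trans (ler_norm _) (wpair_le ht hr).
have [r0 d0] := (Nw_ge0 bm r, Nw_ge0 bs dl).
have q1 : rho * (Nw bs dl * Nw bm z) <= rho * (eta * Z) by rewrite ler_wpM2l// ler_wpM2r.
have q2 : rho * (Nw bs (V (t + h)) * Nw bm r) <= rho * ((A + 1) * eta).
  by rewrite ler_wpM2l// ler_pM// Nw_ge0.
have q3 : rho * (Nw bs (V t) * Nw bm r) <= rho * (A * eta) by rewrite ler_wpM2l// ler_wpM2l.
have q4 : (rho * (Z + 2 * A + 1) + 1) * eta <= e.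
  by rewrite mulrC -ler_pdivlMr// ge_min lexx orbT.
have q5 : rho * (eta * Z) + rho * ((A + 1) * eta) + rho * (A * eta) + eta = (rho * (Z + 2 * A + 1) + 1) * eta by ring.
rewrite -q5 in q4; have hadd := add3_le _ (le_trans p1 q1) (le_trans p2 q2) (le_trans p3 q3) (ltW eta0) q4.
exact: hadd.
Unshelve. all: by end_near. Qed.

Lemma energy_growth a b L : 0 <= a -> a <= b ->
  {ae @lebesgue_measure R, forall t : R, a < t < b ->
     exists z, has_velocity t z /\ 2 * pair w (V t) z <= L} ->
  energy b - energy a <= L * (b - a).
Proof.
move=> a0 ab good; apply: abs_continuous_growth => //; first exact: energy_abs_continuous.
have F := ae_filter_ringOfSetsType (@lebesgue_measure R).
apply: filterS good => t h tab; have [z [hz hL]] := h tab.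
have t0 : 0 < t by have /andP[at_ _] := tab; exact: le_lt_trans a0 at_.
move=> e e0; have := energy_derivative t0 hz e0; apply: filterS => k hk.
by apply: le_trans hk _; rewrite lerD2r.
Qed.

End bounded_weight.

End Energy.

(** * Energy balance at a regular time *)

Section RegularTime.
Context {R : realType}.
Notation T3 := (measurableTypeR R * measurableTypeR R * measurableTypeR R)%type.
Notation field := ('I_3 -> R3 R -> R[i]).

Definition amp (v : field) x : R := Num.sqrt (sq v x).

Lemma nnm_amp v : (forall j, cmeas (v j : T3 -> R[i])) -> nnm (amp v : T3 -> R).
Proof.
move=> mv; split; last by move=> x; exact: sqrtr_ge0.
by apply: (measurableT_comp (continuous_measurable_fun (@sqrt_continuous R))); case: (nnm_sq mv).
Qed.

Lemma sqr_amp v x : amp v x ^+ 2 = sq v x.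
Proof. by rewrite sqr_sqrtr// sq_ge0. Qed.

Lemma normc_le_amp v j x : normc (v j x) <= amp v x.
Proof.
rewrite -(@ler_pXn2r _ 2) ?nnegrE ?normc_ge0 ?sqrtr_ge0// sqr_amp /sq (bigD1 j)//= lerDl.
by apply: sumr_ge0 => i _; exact: sqr_ge0.
Qed.

Lemma amgm (l a b : R) : 0 < l -> a * b <= 2^-1 * (l * a ^+ 2 + l^-1 * b ^+ 2).
Proof.
move=> l0; have li : 0 < l^-1 by rewrite invr_gt0.
rewrite ler_pdivlMl//; have := mulr_ge0 (ltW li) (sqr_ge0 (l * a - b)).
have -> : l^-1 * (l * a - b) ^+ 2 = l * a ^+ 2 + l^-1 * b ^+ 2 - 2 * (a * b).
  by field; rewrite gt_eqF.
by rewrite subr_ge0.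
Qed.

Lemma normc_sum3_le (a b : 'I_3 -> R[i]) :
  normc (\sum_(j < 3) a j * b j) <=
  Num.sqrt (\sum_(j < 3) normc (a j) ^+ 2) * Num.sqrt (\sum_(j < 3) normc (b j) ^+ 2).
Proof.
have p0 (c : 'I_3 -> R[i]) : 0 <= \sum_(j < 3) normc (c j) ^+ 2 by apply: sumr_ge0 => j _; exact: sqr_ge0.
apply: sqr_cauchy_schwarz; rewrite ?p0 ?normc_ge0// => l l0.
apply: le_trans (normc_sum _ _ _) _; rewrite !mulr_sumr -big_split /= mulr_sumr.
by apply: ler_sum => j _; rewrite Normc.normcM; exact: amgm.
Qed.

Lemma sym_le_bessel (sigma s kap : R) x : 0 < kap <= 1 -> 0 <= sigma -> sigma <= s ->
  sym sigma kap x ^+ 2 <= 4 * bessel s x.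
Proof.
move=> /andP[k0 k1] s0 ss; have b1 := bessel_base x.
have s2 : 0 <= sigma / 2 by rewrite divr_ge0.
have h : sym sigma kap x <= 2 * bessel (sigma / 2) x.
  have e1 : enorm x `^ sigma <= bessel (sigma / 2) x.
    rewrite (_ : enorm x `^ sigma = (enorm x ^+ 2) `^ (sigma / 2)).
      apply: ge0_ler_powR; rewrite ?nnegrE ?sqr_ge0//; last by rewrite lerDr.
      exact: le_trans b1.
    by rewrite -powR_mulrn ?enorm_ge0// -powRrM mulrC divfK.
  by have := bessel_ge1 x s2; rewrite /sym; lra.
apply: (@le_trans _ _ ((2 * bessel (sigma / 2) x) ^+ 2)).
  rewrite lerXn2r ?nnegrE ?mulr_ge0 ?powR_ge0//; apply: addr_ge0; [exact: ltW|exact: powR_ge0].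
rewrite exprMn expr2 -natrM ler_wpM2l// expr2 besselM -splitr; exact: bessel_le.
Qed.

Lemma sqr_enorm_bessel (x : R3 R) (s : R) : enorm x ^+ 2 * bessel s x <= bessel (s + 1) x.
Proof.
rewrite -besselM mulrC ler_wpM2l ?powR_ge0// [in leRHS]/bessel powRr1 ?lerDr//.
by apply: le_trans (bessel_base x).
Qed.

Lemma sym_gt0 (sigma kap : R) x : 0 < kap -> 0 < sym sigma kap x.
Proof. by move=> k0; rewrite /sym ltr_pwDl// powR_ge0. Qed.

(** A pointwise Cauchy-Schwarz inequality: b is divided and multiplied by |x| [sym], and the inverse
    square of this factor is the integrable kernel. *)
Lemma low_frequency_le (sigma kap l b : R) x : 0 < kap -> 0 < l -> x != 0 ->
  b <= 2^-1 * (l * singular sigma kap x + l^-1 * (enorm x * sym sigma kap x * b) ^+ 2).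
Proof.
move=> k0 l0 x0; have sp := sym_gt0 sigma x k0.
have ep : 0 < enorm x by rewrite lt_neqAle eq_sym enorm_eq0 x0 enorm_ge0.
have := @amgm l (enorm x * sym sigma kap x)^-1 (enorm x * sym sigma kap x * b) l0.
rewrite mulKf ?gt_eqF ?mulr_gt0//; first by rewrite exprVn exprMn invfM.
Qed.

(** Truncation keeps the factor 2: if either term on the right is truncated, it alone bounds the
    left-hand side. *)
Lemma min_subadditive (a b c rho : R) : 0 <= b -> 0 <= c -> 0 <= rho -> a <= 2 * (b + c) ->
  Num.min a rho <= 2 * (Num.min b rho + Num.min c rho).
Proof.
by move=> b0 c0 r0 h; rewrite ge_min; case: (leP b rho) => r1; case: (leP c rho) => r2;
  rewrite ?h//; apply/orP; right; lra.
Qed.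

Lemma inv_sqr_le (a b : R) : 0 < a -> a <= b -> b ^- 2 <= a ^- 2.
Proof.
move=> a0 ab; have b0 := lt_le_trans a0 ab.
by rewrite lef_pV2 ?posrE ?exprn_gt0// lerXn2r ?nnegrE ?(ltW a0) ?(ltW b0).
Qed.

Lemma young_sum (l d k k' p p' : R) : 0 < l ->
  2 * l * (d * k + d * k') + l^-1 * (p + p') =
  2 * (2^-1 * (l * (d * (k + k')) + l^-1 * p) + 2^-1 * (l * (d * (k' + k)) + l^-1 * p')).
Proof. by move=> l0; field; rewrite gt_eqF. Qed.

Section cutoff_weight.
Variables sigma kap rho : R.
Hypotheses (sigma_gt : 2^-1 < sigma) (sigma_le1 : sigma <= 1).
Hypotheses (hk : 0 < kap <= 1) (rho0 : 0 < rho).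

Definition symcut x := Num.min (sym sigma kap x) rho.
Definition wcut x : R := symcut x ^+ 2.

Let k0 : 0 < kap. Proof. by case/andP: hk. Qed.
Let sigma0 : 0 <= sigma. Proof. by apply: ltW; apply: lt_trans sigma_gt; rewrite invr_gt0. Qed.

Lemma cutoff_gt0 x : 0 < symcut x.
Proof. by rewrite lt_min sym_gt0. Qed.

Lemma nnm_cutoff : nnm (symcut : T3 -> R).
Proof.
split; last by move=> x; exact: ltW (cutoff_gt0 x).
by apply: measurable_minr; [case: (nnm_sym sigma (ltW k0))|exact: measurable_cst].
Qed.

Lemma nnm_wcut : nnm (wcut : T3 -> R). Proof. exact: (nnmX 2 nnm_cutoff). Qed.

Lemma wcut_le x : wcut x <= rho ^+ 2.
Proof. by rewrite lerXn2r ?nnegrE ?(ltW (cutoff_gt0 x)) ?(ltW rho0)// ge_min lexx orbT. Qed.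

(** One of the two summands of x has at least half its norm, and 2^sigma <= 2 because sigma <= 1. *)
Lemma sym_subadditive x y : sym sigma kap x <= 2 * (sym sigma kap y + sym sigma kap (x - y)).
Proof.
have h : enorm x `^ sigma <= 2 * (enorm y `^ sigma + enorm (x - y) `^ sigma).
  pose m := Num.max (enorm y) (enorm (x - y)).
  have m0 : 0 <= m by rewrite le_max enorm_ge0.
  have xm : enorm x <= 2 * m.
    have := enormD (x - y) y; rewrite subrK => /le_trans; apply.
    by rewrite mulr_natl mulr2n; apply: lerD; rewrite le_max lexx ?orbT.
  apply: (@le_trans _ _ ((2 * m) `^ sigma)).
    by rewrite ge0_ler_powR ?nnegrE ?enorm_ge0 ?mulr_ge0.
  rewrite powRM//; apply: ler_pM; rewrite ?powR_ge0//.
    by rewrite -[leRHS]powRr1// ler_powR// ler1n.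
  by rewrite /m; case: (leP (enorm y)) => _; [rewrite lerDr|rewrite lerDl]; exact: powR_ge0.
rewrite /sym addrACA mulrDr; apply: lerD; last exact: h.
by move: k0; lra.
Qed.

Lemma cutoff_subadditive x y : symcut x <= 2 * (symcut y + symcut (x - y)).
Proof.
by apply: min_subadditive; rewrite ?(ltW rho0) ?sym_subadditive// ltW// sym_gt0.
Qed.

(** Each factor decreases with the frequency. If |y| <= |z|, replacing z by y in the second factor
    increases it; otherwise y is replaced by z in the first. *)
Lemma singular_split y z : 0 < enorm y -> 0 < enorm z ->
  enorm y ^- 2 * sym sigma kap z ^- 2 <= singular sigma kap y + singular sigma kap z.
Proof.
move=> y0 z0; have [s1 s2] := (sym_gt0 sigma y k0, sym_gt0 sigma z k0).
have p (u v : R) : 0 < u -> 0 < v -> 0 <= u ^- 2 * v ^- 2.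
  by move=> u0 v0; rewrite mulr_ge0 ?invr_ge0 ?exprn_ge0 ?ltW.
have [yz|zy] := leP (enorm y) (enorm z).
  apply: (@le_trans _ _ (singular sigma kap y)); last by rewrite lerDl p.
  apply: ler_wpM2l; first by rewrite invr_ge0 exprn_ge0 ?ltW.
  apply: inv_sqr_le => //.
  by rewrite lerD2l ge0_ler_powR ?nnegrE ?enorm_ge0.
apply: (@le_trans _ _ (singular sigma kap z)); last by rewrite lerDr p.
apply: ler_wpM2r; first by rewrite invr_ge0 exprn_ge0 ?ltW.
by apply: inv_sqr_le => //; exact: ltW.
Qed.

End cutoff_weight.

Section field.
Variables (s : R) (v : field).
Hypothesis s_gt : 2^-1 < s.
Hypothesis hv : L2w (bessel (s + 1)) v.
Hypothesis v_conj : forall j x, v j (- x) = conjc (v j x).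
Hypothesis v_div : forall x, \sum_(j < 3) (coord3 x j)%:C * v j x = 0.
Hypothesis v_0 : forall j, v j 0 = 0.

Let mv : forall j, cmeas (v j : T3 -> R[i]) := hv.1.
Let nq : nnm (sq v : T3 -> R) := nnm_sq mv.
Let na : nnm (amp v : T3 -> R) := nnm_amp mv.

Let sg := Num.min s 1.
Let sg_gt : 2^-1 < sg. Proof. by rewrite /sg lt_min s_gt/= invf_lt1// ltr1n. Qed.
Let sg_le : sg <= s. Proof. by rewrite /sg ge_min lexx. Qed.
Let sg0 : 0 <= sg. Proof. by apply: ltW; apply: lt_trans sg_gt; rewrite invr_gt0. Qed.

(** Makes the velocity bounded and continuous in space. The part not covered by the kernel is at
    most 4 times the square of the H^(s+1) norm. *)
Lemma nint_amp_fin : (nint (amp v) < +oo)%E.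
Proof.
have k1 : 0 < (1 : R) <= 1 by rewrite ltr01 lexx.
have nk : nnm (singular sg 1 : T3 -> R) := nnm_singular sg ler01.
have nb : nnm (fun x : T3 => 4 * (bessel (s + 1) x * sq v x)).
  by apply: nnmM; [exact: nnm_cst|apply: nnmM => //; exact: nnm_bessel].
apply: (@le_lt_trans _ _ (nint (fun x => singular sg 1 x + 4 * (bessel (s + 1) x * sq v x))%R)).
  apply: le_nint_ae => //; first exact: nnmD.
  apply: filterS (@ae_enorm_gt0 R) => x x0.
  have xn : x != 0 by rewrite -enorm_eq0 gt_eqF.
  have := low_frequency_le sg (amp v x) ltr01 ltr01 xn; rewrite invr1 !mul1r => h.
  apply: le_trans h _.
  have [_ k0] := nk; have := k0 x.
  have : (enorm x * sym sg 1 x * amp v x) ^+ 2 <= 4 * (bessel (s + 1) x * sq v x).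
    rewrite !exprMn sqr_amp mulrA ler_wpM2r ?sq_ge0//.
    apply: le_trans (_ : enorm x ^+ 2 * (4 * bessel s x) <= _).
      by rewrite ler_wpM2l ?sqr_ge0//; apply: sym_le_bessel.
    by rewrite mulrCA ler_wpM2l//; exact: sqr_enorm_bessel.
  have : 0 <= (enorm x * sym sg 1 x * amp v x) ^+ 2 by exact: sqr_ge0.
  lra.
rewrite nintD//; apply: lte_add_pinfty; first exact: singular_fin.
rewrite nintZ//; last by apply: nnmM => //; exact: nnm_bessel.
by apply: lte_mul_pinfty; rewrite ?lee_fin//; exact: hv.2.
Qed.

Lemma cintegrable_component j : cintegrable mu3 (v j).
Proof.
apply: nint_cintegrable; first exact: mv.
apply: le_lt_trans nint_amp_fin; apply: le_nint => //; first exact: nnm_normc.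
by move=> x; exact: normc_le_amp.
Qed.

Lemma normc_grad_hat j k x : normc (grad_hat v j k x) <= enorm x * amp v x.
Proof.
rewrite /grad_hat 2!Normc.normcM normc_i mul1r normcR.
by apply: ler_pM; rewrite ?normc_ge0 ?coord3_le_enorm// normc_le_amp.
Qed.

Lemma cmeas_grad_hat j k : cmeas (grad_hat v j k : T3 -> R[i]).
Proof.
by apply: cmeasM; [exact: cmeas_cst|apply: cmeasM; [exact: cmeas_coord|exact: mv]].
Qed.

(** The weight required by [square_integrable_inverse]. Together with the |x|^2 of the gradient it
    is at most 2 (1 + |x|^2)^(3/2), and 3/2 <= s + 1. *)
Lemma nint_grad_hat j k : (nint (fun x => (1 + enorm x) * normc (grad_hat v j k x) ^+ 2)%R < +oo)%E.
Proof.
have n1 : nnm (fun x : T3 => 2 * (bessel (s + 1) x * sq v x)).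
  by apply: nnmM; [exact: nnm_cst|apply: nnmM => //; exact: nnm_bessel].
have ne := @nnm_enorm R.
apply: (@le_lt_trans _ _ (nint (fun x => 2 * (bessel (s + 1) x * sq v x))%R)).
  apply: le_nint => //.
    apply: nnmM; first by apply: nnmD; [exact: nnm_cst|exact: ne].
    by apply: nnmX; apply: nnm_normc; exact: cmeas_grad_hat.
  move=> x; have e0 := enorm_ge0 x.
  apply: (@le_trans _ _ ((1 + enorm x) * (enorm x ^+ 2 * sq v x))).
    rewrite ler_wpM2l ?addr_ge0// -sqr_amp -exprMn.
    by rewrite lerXn2r ?nnegrE ?normc_ge0 ?mulr_ge0 ?sqrtr_ge0// normc_grad_hat.
  rewrite mulrA [leRHS]mulrA ler_wpM2r ?sq_ge0//.
  apply: (@le_trans _ _ (2 * bessel 2^-1 x * enorm x ^+ 2)).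
    rewrite ler_wpM2r ?sqr_ge0//.
    have h1 : 1 <= bessel 2^-1 x by apply: bessel_ge1; rewrite invr_ge0.
    have : enorm x <= bessel 2^-1 x.
      rewrite /bessel powR12_sqrt ?(le_trans ler01 (bessel_base x))//.
      by rewrite -{1}(ger0_norm e0) -sqrtr_sqr ler_wsqrtr// lerDr.
    lra.
  rewrite -mulrA ler_wpM2l// mulrC; apply: le_trans (sqr_enorm_bessel x _) _.
  by apply: bessel_le; rewrite lerD2r ltW.
rewrite nintZ//; last by apply: nnmM => //; exact: nnm_bessel.
by apply: lte_mul_pinfty; rewrite ?lee_fin//; exact: hv.2.
Qed.

Lemma sqint_grad_hat j k : sqint (grad_hat v j k).
Proof.
by split; [exact: cmeas_grad_hat|exact: (nint_sqr_fin (cmeas_grad_hat j k) (nint_grad_hat j k))].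
Qed.

Definition adv j x := \sum_(k < 3) ((2 * pi) ^- 3)%:C * conv (v k) (grad_hat v j k) x.

Section weight.
Variables (w : R3 R -> R) (C : R).
Hypotheses (nw : nnm (w : T3 -> R)) (wC : forall x, w x <= C).

Let C0 : 0 <= C. Proof. by have [_ w0] := nw; apply: le_trans (w0 0) (wC 0). Qed.

Definition test j x := (w x)%:C * conjc (v j x).

Lemma sqint_component j : sqint (v j).
Proof.
split; first exact: mv; apply: le_lt_trans hv.2; apply: le_nint.
- by apply: nnmX; exact: nnm_normc.
- by apply: nnmM => //; exact: nnm_bessel.
- move=> x; apply: (@le_trans _ _ (sq v x)).
    by rewrite -sqr_amp lerXn2r ?nnegrE ?normc_ge0 ?sqrtr_ge0// normc_le_amp.
  rewrite ler_peMl ?sq_ge0// bessel_ge1//; move: s_gt; lra.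
Qed.

Lemma sqint_test j : sqint (test j).
Proof.
apply: (@sqint_le _ _ (v j) C); last first.
- move=> x; have [_ w0] := nw.
  by rewrite Normc.normcM normcR normc_conj ger0_norm// ler_wpM2r ?normc_ge0.
- exact: sqint_component.
- by apply: cmeasM; [apply: cmeasR; case: nw|apply: cmeas_conj; exact: mv].
Qed.

(** The double integrand of the nonlinear term tested against w v; the factor (2 pi)^-3 is kept
    outside. *)
Definition trilinear (z : T3 * T3) : R[i] :=
  \sum_(j < 3) \sum_(k < 3) trikernel (v k) (grad_hat v j k) (test j) z.

Lemma cintegrable_trilinear : cintegrable (mu3 \x mu3)%E trilinear.
Proof.
apply: cintegrable_sum => j; apply: cintegrable_sum => k.
by apply: cintegrable_trikernel; [exact: cintegrable_component|exact: sqint_grad_hat|exact: sqint_test].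
Qed.

Let adv_test x : R[i] := ((2 * pi) ^- 3)%:C * \sum_(j < 3) \sum_(k < 3) conv (v k) (grad_hat v j k) x * test j x.

Let icm j k : cintegrable mu3 (fun x => conv (v k) (grad_hat v j k) x * test j x).
Proof.
by apply: cintegrable_conv_mult; [exact: cintegrable_component|exact: sqint_grad_hat|exact: sqint_test].
Qed.

Let iat : cintegrable mu3 adv_test.
Proof. by apply: cintegrableZl; apply: cintegrable_sum => j; apply: cintegrable_sum => k. Qed.

Let adv_testE x : w x * cdot v adv x = Re (adv_test x).
Proof.
rewrite /adv_test ReMr /cdot mulr_sumr Re_sum mulr_sumr; apply: eq_bigr => j _.
rewrite -!ReMr; congr (Re _); rewrite /adv /test !mulr_sumr.
by apply: eq_bigr => k _; ring.
Qed.

Lemma integrable_pair_adv : mu3.-integrable [set: T3] (EFin \o (fun x => w x * cdot v adv x)).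
Proof. by have [h _] := iat; apply: eq_integrable h => // x _; rewrite /= adv_testE. Qed.

Lemma pair_adv : pair w v adv = (2 * pi) ^- 3 * Re (cint (mu3 \x mu3)%E trilinear).
Proof.
transitivity (Re (cint mu3 adv_test)); first by apply: eq_Rintegral => x _; exact: adv_testE.
rewrite /adv_test cintZl; last by apply: cintegrable_sum => j; apply: cintegrable_sum => k.
rewrite ReMr; congr (_ * Re _).
rewrite cint_sum; last by move=> j; apply: cintegrable_sum => k.
rewrite /trilinear cint_sum; last first.
  move=> j; apply: cintegrable_sum => k.
  by apply: cintegrable_trikernel; [exact: cintegrable_component|exact: sqint_grad_hat|exact: sqint_test].
apply: eq_bigr => j _; rewrite cint_sum// cint_sum; last first.
  by move=> k; apply: cintegrable_trikernel; [exact: cintegrable_component|exact: sqint_grad_hat|exact: sqint_test].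
apply: eq_bigr => k _; apply: cint_conv_mult; [exact: cintegrable_component|exact: sqint_grad_hat|exact: sqint_test].
Qed.

(* The divergence-free condition moves the derivative from the frequency of
   the differentiated factor to that of the test function. *)
Lemma trilinearE z : trilinear z =
  'i * (\sum_(k < 3) (coord3 z.1 k)%:C * v k (z.1 - z.2)) *
  ((w z.1)%:C * \sum_(j < 3) v j z.2 * conjc (v j z.1)).
Proof.
have e : \sum_(k < 3) (coord3 z.1 k)%:C * v k (z.1 - z.2) = \sum_(k < 3) (coord3 z.2 k)%:C * v k (z.1 - z.2).
  apply/eqP; rewrite -subr_eq0 -sumrB; apply/eqP; rewrite -[RHS](v_div (z.1 - z.2)).
  by apply: eq_bigr => k _; rewrite coord3B rmorphB /= mulrBl.
rewrite e /trilinear !mulr_sumr; apply: eq_bigr => j _.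
rewrite mulr_suml; apply: eq_bigr => k _.
by rewrite /trikernel /grad_hat /test; ring.
Qed.

(** The factor (2 pi)^-3 is bounded by 1. *)
Lemma nint_trilinear_le (L : \bar R) :
  (nint2 (fun x y => normc (trilinear (x, y))) <= L)%E ->
  (`|pair w v adv|%:E <= L)%E.
Proof.
move=> h; apply: le_trans h.
have it := cintegrable_trilinear.
apply: (@le_trans _ _ (normc (cint (mu3 \x mu3)%E trilinear))%:E).
  rewrite lee_fin pair_adv normrM -[leRHS]mul1r; apply: ler_pM => //; last exact: Re_le_normc.
  have p2 := @pi_ge2 R; have p0 : 0 < 2 * pi :> R by rewrite mulr_gt0//; exact: pi_gt0.
  rewrite normfV ger0_norm ?exprn_ge0 ?(ltW p0)// invf_le1 ?exprn_gt0//.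
  by rewrite exprn_ege1//; lra.
apply: le_trans (le_normc_cintE it) _.
have mt : measurable_fun [set: T3 * T3] (fun z : T3 * T3 => (normc (trilinear z))%:E).
  by apply/measurable_EFinP; apply: measurable_normc; exact: (cintegrable_cmeas it).
by rewrite (@fubini_tonelli1 _ _ T3 T3 _ mu3 mu3 _ mt)// => z; rewrite lee_fin normc_ge0.
Qed.

(** Cauchy-Schwarz in C^3 for each of the two sums in [trilinearE]; the derivative is carried by the
    outer frequency alone. *)
Lemma normc_trilinear z : normc (trilinear z) <=
  enorm z.1 * w z.1 * (amp v z.1 * amp v z.2 * amp v (z.1 - z.2)).
Proof.
rewrite trilinearE 3!Normc.normcM normc_i mul1r normcR; have [_ w0] := nw.
rewrite ger0_norm//.
have h1 : normc (\sum_(k < 3) (coord3 z.1 k)%:C * v k (z.1 - z.2)) <= enorm z.1 * amp v (z.1 - z.2).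
  apply: le_trans (normc_sum3_le _ _) _.
  rewrite (_ : \sum_(j < 3) _ = dot z.1 z.1)//.
  by apply: eq_bigr => j _; rewrite normcR real_normK ?num_real// expr2.
have h2 : normc (\sum_(j < 3) v j z.2 * conjc (v j z.1)) <= amp v z.2 * amp v z.1.
  apply: le_trans (normc_sum3_le _ _) _; rewrite ler_wpM2l ?sqrtr_ge0//.
  by under eq_bigr do rewrite normc_conj.
apply: le_trans (ler_pM (normc_ge0 _) _ h1 (ler_wpM2l (w0 z.1) h2)) _.
  by rewrite mulr_ge0 ?normc_ge0.
by rewrite le_eqVlt; apply/orP; left; apply/eqP; ring.
Qed.

End weight.

(** The antisymmetry behind the conservation of energy by the nonlinear term. Reality turns v(y - x)
    into the conjugate of v(x - y), and the divergence condition allows x in place of y as its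
    multiplier. *)
Lemma trilinear_swap x y : trilinear (fun=> 1) (y, x) = - conjc (trilinear (fun=> 1) (x, y)).
Proof.
rewrite !trilinearE /= !mul1r !conjcM.
have ci : conjc ('i : R[i]) = - 'i by apply: complex_eq => /=; rewrite ?oppr0.
have e : \sum_(k < 3) (coord3 y k)%:C * v k (y - x) = conjc (\sum_(k < 3) (coord3 x k)%:C * v k (x - y)).
  have -> : conjc (\sum_(k < 3) (coord3 x k)%:C * v k (x - y)) = \sum_(k < 3) (coord3 x k)%:C * v k (y - x).
    rewrite rmorph_sum /=; apply: eq_bigr => k _.
    by rewrite rmorphM /= -(opprB x y) v_conj; congr (_ * _); apply: complex_eq => /=; rewrite ?oppr0.
  apply/eqP; rewrite -subr_eq0 -sumrB; apply/eqP; rewrite -[RHS](v_div (y - x)).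
  by apply: eq_bigr => k _; rewrite coord3B rmorphB /= mulrBl.
have e' : \sum_(j < 3) v j x * conjc (v j y) = conjc (\sum_(j < 3) v j y * conjc (v j x)).
  rewrite rmorph_sum /=; apply: eq_bigr => j _.
  by rewrite rmorphM /= conjcK mulrC.
by rewrite e e' ci; ring.
Qed.

(** By the antisymmetry the double integral is minus its own conjugate, so its real part
    vanishes. *)
Lemma pair_adv0 : pair (fun=> 1) v adv = 0.
Proof.
have n1 : nnm (fun _ : T3 => 1 : R) by exact: nnm_cst.
have l1 (x : R3 R) : (fun=> 1 : R) x <= 1 by [].
have it := @cintegrable_trilinear (fun=> 1) 1 n1 l1.
rewrite (@pair_adv (fun=> 1) 1 n1 l1); set F := trilinear _ in it *.
have itc := cintegrableN (cintegrable_conj it).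
have : cint (mu3 \x mu3)%E F = - conjc (cint (mu3 \x mu3)%E F).
  rewrite -cint_conj// -cintN; last exact: cintegrable_conj.
  rewrite (@cint_fubini1 _ _ T3 T3 _ mu3 mu3 _ it) (@cint_fubini2 _ _ T3 T3 _ mu3 mu3 _ itc).
  apply: eq_cint => x; apply: eq_cint => y.
  by rewrite /F trilinear_swap.
move: (cint _ F) => c h; have : Re c = - Re c by rewrite {1}h ReN Re_conj.
by move=> /eqP; rewrite -subr_eq0 opprK -mulr2n mulrn_eq0 /= => /eqP ->; rewrite mulr0.
Qed.

Definition ns_field (nu Om : R) : field := fun i x =>
  nu%:C * (- (enorm x ^+ 2)%:C * v i x)
  - Om%:C * (\sum_(j < 3) (leray_symbol x i j)%:C *
      ((e3 (j + 1))%:C * v (j + 2) x - (e3 (j + 2))%:C * v (j + 1) x))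
  - \sum_(j < 3) (leray_symbol x i j)%:C * adv j x.

(* The Helmholtz projection is symmetric and fixes divergence-free fields. *)
Lemma cdot_leray (g : field) x :
  cdot v (fun i x => \sum_(j < 3) (leray_symbol x i j)%:C * g j x) x = cdot v g x.
Proof.
have P j : \sum_(i < 3) (leray_symbol x i j)%:C * conjc (v i x) = conjc (v j x).
  have -> : \sum_(i < 3) (leray_symbol x i j)%:C * conjc (v i x) =
      \sum_(i < 3) (i == j)%:R * conjc (v i x)
      - (coord3 x j / enorm x ^+ 2)%:C * conjc (\sum_(i < 3) (coord3 x i)%:C * v i x).
    rewrite rmorph_sum mulr_sumr -sumrB; apply: eq_bigr => i _.
    rewrite /leray_symbol rmorphB rmorphM /= conjcM.
    have -> : conjc (coord3 x i)%:C = (coord3 x i)%:C by apply: complex_eq => /=; rewrite ?oppr0.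
    rewrite !rmorphM /=; have -> : ((i == j)%:R)%:C = (i == j)%:R :> R[i] by rewrite rmorph_nat.
    by ring.
  rewrite v_div conjc0 mulr0 subr0 (bigD1 j)//= eqxx mul1r big1 ?addr0// => i /negbTE ->.
  by rewrite mul0r.
rewrite /cdot -!Re_sum; congr (Re _).
under eq_bigr do rewrite mulr_sumr.
rewrite exchange_big /=; apply: eq_bigr => j _; rewrite -(P j) mulr_suml.
by apply: eq_bigr => i _; ring.
Qed.

(** After removal of the projection, the vector product with e3 is antisymmetric, so the Coriolis
    term has no real part against v at any single frequency. It therefore vanishes for every weight,
    not just for w = 1. *)
Lemma cdot_ns nu Om x : cdot v (ns_field nu Om) x = - (nu * (enorm x ^+ 2 * sq v x)) - cdot v adv x.
Proof.
have E1 : cdot v (fun i x => \sum_(j < 3) (leray_symbol x i j)%:C *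
    ((e3 (j + 1))%:C * v (j + 2) x - (e3 (j + 2))%:C * v (j + 1) x)) x = 0.
  rewrite (@cdot_leray (fun j x => (e3 (j + 1))%:C * v (j + 2) x - (e3 (j + 2))%:C * v (j + 1) x)).
  rewrite /cdot sum3 /e3.
  have -> : (0 + 1 : 'I_3) = 1 by exact/val_inj.
  have -> : (0 + 2 : 'I_3) = 2 by exact/val_inj.
  have -> : (1 + 1 : 'I_3) = 2 by exact/val_inj.
  have -> : (1 + 2 : 'I_3) = 0 by exact/val_inj.
  have -> : (2 + 1 : 'I_3) = 0 by exact/val_inj.
  have -> : (2 + 2 : 'I_3) = 1 by exact/val_inj.
  rewrite !eqxx; have -> : ((1 : 'I_3) == 2) = false by [].
  have -> : ((0 : 'I_3) == 2) = false by [].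
  have -> : ((false%:R : R)%:C = 0 :> R[i]) by [].
  have -> : ((true%:R : R)%:C = 1 :> R[i]) by [].
  rewrite !mul0r !mul1r !sub0r !subr0 oppr0 mulr0 addr0.
  by rewrite !ReM ReN ImN !Re_conj !Im_conj; ring.
have E2 := cdot_leray adv x.
rewrite -E2 -[X in _ = _ - X]add0r -(mulr0 Om) -E1.
rewrite -(cdotxx v x) /cdot !mulr_sumr -big_split /= -!sumrN -big_split /=.
apply: eq_bigr => i _; rewrite /ns_field.
rewrite !mulrDr !ReD !mulrN !ReN.
rewrite [conjc _ * (nu%:C * _)]mulrCA ReMr mulNr mulrN ReN [conjc _ * (_%:C * v i x)]mulrCA ReMr.
rewrite [conjc _ * (Om%:C * _)]mulrCA ReMr; ring.
Qed.

Section evolution.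
Variables (nu Om : R) (z : field).
Hypothesis mz : forall j, cmeas (z j : T3 -> R[i]).
Hypothesis z_ns : forall j, {ae mu3, forall x, z j x = ns_field nu Om j x}.

Section weight.
Variables (w : R3 R -> R) (C : R).
Hypotheses (nw : nnm (w : T3 -> R)) (wC : forall x, w x <= C).

Definition dissipation := \int[mu3]_x (w x * (enorm x ^+ 2 * sq v x)).

Lemma nnm_dissipation : nnm (fun x : T3 => w x * (enorm x ^+ 2 * sq v x)).
Proof. by apply: nnmM => //; apply: nnmM => //; apply: nnmX; exact: nnm_enorm. Qed.

Lemma nint_dissipation_fin : (nint (fun x => w x * (enorm x ^+ 2 * sq v x))%R < +oo)%E.
Proof.
have C0 : 0 <= C by have [_ w0] := nw; apply: le_trans (w0 0) (wC 0).
have nb : nnm (fun x : T3 => bessel (s + 1) x * sq v x) by apply: nnmM => //; exact: nnm_bessel.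
apply: (@le_lt_trans _ _ (nint (fun x => C * (bessel (s + 1) x * sq v x))%R)).
  apply: le_nint; first exact: nnm_dissipation.
    by apply: nnmM => //; exact: nnm_cst.
  move=> x; have [_ w0] := nw; apply: ler_pM => //; first by rewrite mulr_ge0 ?sqr_ge0 ?sq_ge0.
  rewrite ler_wpM2r ?sq_ge0//; apply: le_trans (sqr_enorm_bessel x s).
  by rewrite ler_peMr ?sqr_ge0// bessel_ge1//; move: s_gt; lra.
by rewrite nintZ// lte_mul_pinfty ?lee_fin//; exact: hv.2.
Qed.

Lemma pair_velocity : pair w v z = - nu * dissipation - pair w v adv.
Proof.
have i1 : mu3.-integrable [set: T3] (EFin \o (fun x => - nu * (w x * (enorm x ^+ 2 * sq v x)))).
  have := integrableZl (@measurableT _ T3) (- nu) (nint_integrable nnm_dissipation nint_dissipation_fin).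
  by apply: eq_integrable.
have i2 := integrable_pair_adv nw wC.
have [i1' _] := (nint_integrable nnm_dissipation nint_dissipation_fin, i1).
rewrite /dissipation -RintegralZl// /pair -RintegralB// /Rintegral; congr fine.
apply: ae_eq_integral => //.
- apply/measurable_EFinP; apply: measurable_funM; first by case: nw.
  exact: measurable_cdot.
- by have := integrableB (@measurableT _ T3) i1 i2 => /measurable_int.
- apply: filterS3 (z_ns 0) (z_ns 1) (z_ns 2) => x h0 h1 h2 _; congr (_%:E).
  have -> : cdot v z x = cdot v (ns_field nu Om) x by rewrite /cdot !sum3 h0 h1 h2.
  by rewrite cdot_ns; ring.
Qed.

End weight.

Lemma pair_velocity1 : pair (fun=> 1) v z = - nu * dissipation (fun=> 1).
Proof. by rewrite (@pair_velocity (fun=> 1) 1)// ?pair_adv0 ?subr0//; exact: nnm_cst. Qed.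

End evolution.

Section cutoff.
Variables (sigma kap rho : R).
Hypotheses (sigma_gt : 2^-1 < sigma) (sigma_le1 : sigma <= 1) (sigma_le : sigma <= s).
Hypotheses (hk : 0 < kap <= 1) (rho0 : 0 < rho).

Let k0 : 0 < kap. Proof. by case/andP: hk. Qed.
Let sigma0 : 0 <= sigma. Proof. by apply: ltW; apply: lt_trans sigma_gt; rewrite invr_gt0. Qed.
Let symcut := symcut sigma kap rho.
Let wcut := wcut sigma kap rho.
Let cut0 x : 0 <= symcut x. Proof. by apply: ltW; exact: cutoff_gt0. Qed.
Let nw : nnm (wcut : T3 -> R). Proof. exact: nnm_wcut. Qed.
Let wle x : wcut x <= rho ^+ 2. Proof. exact: wcut_le. Qed.

Let wcutE x : wcut x = symcut x ^+ 2. Proof. by []. Qed.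
Let D (x : R3 R) : R := wcut x * (enorm x ^+ 2 * sq v x).
Let M (x : R3 R) : R := sym sigma kap x ^+ 2 * sq v x.
Let K (x : R3 R) : R := singular sigma kap x.

(** Of the two amplitudes, the one at y receives |y| and the cut-off symbol, which makes it a root
    of the dissipation density, and the one at z receives [sym]. The inverse of |y| [sym] at z is
    left over, and [singular_split] separates it. The frequency 0, where these inverses degenerate,
    is harmless as v vanishes there. *)
Lemma tri_young (l A : R) y z : 0 < l -> A * (symcut y * amp v y) * amp v z <=
  2^-1 * (l * (A ^+ 2 * (K y + K z)) + l^-1 * (D y * M z)).
Proof.
move=> l0; have li : 0 < l^-1 by rewrite invr_gt0.
have [_ K0] := nnm_singular sigma (ltW k0).
have R0 : 0 <= 2^-1 * (l * (A ^+ 2 * (K y + K z)) + l^-1 * (D y * M z)).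
  rewrite mulr_ge0 ?invr_ge0// addr_ge0//.
    by rewrite mulr_ge0 ?(ltW l0)// mulr_ge0 ?sqr_ge0// addr_ge0.
  rewrite mulr_ge0 ?(ltW li)// mulr_ge0//; last by rewrite mulr_ge0 ?sqr_ge0 ?sq_ge0.
  by have [_ w0] := nw; rewrite mulr_ge0// mulr_ge0 ?sqr_ge0 ?sq_ge0.
have amp0 : amp v 0 = 0.
  by rewrite /amp /sq big1 ?sqrtr0// => j _; rewrite v_0 Normc.normc0 expr0n.
have [y0|yn] := eqVneq y 0; first by move: R0; rewrite y0 amp0 !(mulr0, mul0r).
have [z0|zn] := eqVneq z 0; first by move: R0; rewrite z0 amp0 !(mulr0, mul0r).
have yp : 0 < enorm y by rewrite lt_neqAle eq_sym enorm_eq0 yn enorm_ge0.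
have zp : 0 < enorm z by rewrite lt_neqAle eq_sym enorm_eq0 zn enorm_ge0.
have sp := sym_gt0 sigma z k0.
have := @amgm l (A * (enorm y * sym sigma kap z)^-1) (symcut y * enorm y * amp v y * (sym sigma kap z * amp v z)) l0.
have -> : A * (enorm y * sym sigma kap z)^-1 * (symcut y * enorm y * amp v y * (sym sigma kap z * amp v z)) =
    A * (symcut y * amp v y) * amp v z by field; rewrite !gt_eqF.
move=> /le_trans; apply; rewrite ler_wpM2l ?invr_ge0//; apply: lerD.
  rewrite ler_wpM2l ?(ltW l0)// exprMn ler_wpM2l ?sqr_ge0// exprVn exprMn invfM.
  exact: singular_split.
rewrite ler_wpM2l ?(ltW li)// le_eqVlt; apply/orP; left; apply/eqP.
by rewrite /D /M wcutE -!sqr_amp; ring.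
Qed.

Let L (l : R) (x y : R3 R) : R := 2 * l * (D x * K y + D x * K (x - y)) + l^-1 * (D y * M (x - y) + D (x - y) * M y).

(** Of the two factors [symcut] in the weight, one stays at x to complete the dissipation density;
    the other is moved to y and x - y by subadditivity, and [tri_young] is applied with each in
    turn. *)
Lemma normc_trilinear_young (l : R) x y : 0 < l -> normc (trilinear wcut (x, y)) <= L l x y.
Proof.
move=> l0; apply: le_trans (normc_trilinear nw (x, y)) _ => /=.
set A := enorm x * (symcut x * amp v x).
have A0 : 0 <= A by rewrite /A mulr_ge0 ?enorm_ge0// mulr_ge0 ?sqrtr_ge0.
have A2 : A ^+ 2 = D x by rewrite /A /D wcutE -sqr_amp; ring.
have h1 := @tri_young l A y (x - y) l0; have h2 := @tri_young l A (x - y) y l0.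
rewrite A2 in h1 h2.
have e : enorm x * wcut x * (amp v x * amp v y * amp v (x - y)) =
    symcut x * (A * amp v y * amp v (x - y)) by rewrite /A wcutE; ring.
rewrite e; apply: (@le_trans _ _ (2 * (symcut y + symcut (x - y)) * (A * amp v y * amp v (x - y)))).
  rewrite ler_wpM2r//; last exact: cutoff_subadditive.
  by rewrite mulr_ge0 ?sqrtr_ge0// mulr_ge0 ?sqrtr_ge0.
have -> : 2 * (symcut y + symcut (x - y)) * (A * amp v y * amp v (x - y)) =
  2 * (A * (symcut y * amp v y) * amp v (x - y) + A * (symcut (x - y) * amp v (x - y)) * amp v y) by ring.
rewrite /L; move: h1 h2.
move: (A * _ * _) (A * _ * _) => a b h1 h2.
rewrite young_sum//.
by rewrite ler_wpM2l//; apply: lerD.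
Qed.

Lemma nint_sym_fin : (nint M < +oo)%E.
Proof.
apply: (@le_lt_trans _ _ (nint (fun x => 4 * (bessel (s + 1) x * sq v x))%R)).
  apply: le_nint.
  - by apply: nnmM => //; apply: nnmX; apply: nnm_sym; exact: ltW.
  - by apply: nnmM; [exact: nnm_cst|apply: nnmM => //; exact: nnm_bessel].
  - move=> x; rewrite mulrA ler_wpM2r ?sq_ge0//; apply: sym_le_bessel => //.
    by apply: le_trans sigma_le _; rewrite lerDl.
rewrite nintZ//; last by apply: nnmM => //; exact: nnm_bessel.
by rewrite lte_mul_pinfty ?lee_fin//; exact: hv.2.
Qed.

(** Each of the four terms of the pointwise bound is a tensor or convolution integral, hence the
    total dissipation times an integral of the kernel or of the weighted energy density. Equal terms
    in pairs give the constants 4 l and 2 / l. *)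
Lemma trilinear_dissipation (l : R) : 0 < l ->
  `|pair wcut v adv| <= (4 * l * \int[mu3]_x singular sigma kap x +
    2 * l^-1 * \int[mu3]_x (sym sigma kap x ^+ 2 * sq v x)) * dissipation wcut.
Proof.
move=> l0; have li : 0 < l^-1 by rewrite invr_gt0.
have nD : nnm (D : T3 -> R) := nnm_dissipation nw.
have nM : nnm (M : T3 -> R) by apply: nnmM => //; apply: nnmX; apply: nnm_sym; exact: ltW.
have nK : nnm (K : T3 -> R) := nnm_singular sigma (ltW k0).
rewrite -lee_fin; apply: (nint_trilinear_le nw wle).
have n1 : nnm (fun z : T3 * T3 => D z.1 * K z.2) by apply: nnmM; [exact: nnm_fst|exact: nnm_snd].
have n2 : nnm (fun z : T3 * T3 => D z.1 * K (z.1 - z.2)) by apply: nnmM; [exact: nnm_fst|exact: nnm_conv].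
have n3 : nnm (fun z : T3 * T3 => D z.2 * M (z.1 - z.2)) by apply: nnmM; [exact: nnm_snd|exact: nnm_conv].
have n4 : nnm (fun z : T3 * T3 => D (z.1 - z.2) * M z.2) by apply: nnmM; [exact: nnm_conv|exact: nnm_snd].
have l2 : 0 <= 2 * l by rewrite mulr_ge0// ltW.
pose F1 x y : R := D x * K y + D x * K (x - y).
pose F2 x y : R := D y * M (x - y) + D (x - y) * M y.
have m1 : nnm (fun z : T3 * T3 => F1 z.1 z.2) := nnmD n1 n2.
have m2 : nnm (fun z : T3 * T3 => F2 z.1 z.2) := nnmD n3 n4.
have m3 : nnm (fun z : T3 * T3 => 2 * l * F1 z.1 z.2) by apply: nnmM m1; exact: nnm_cst.
have m4 : nnm (fun z : T3 * T3 => l^-1 * F2 z.1 z.2) by apply: nnmM m2; apply: nnm_cst; exact: ltW.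
apply: (@le_trans _ _ (nint2 (fun x y => 2 * l * F1 x y + l^-1 * F2 x y))).
  apply: le_nint2.
  - apply: nnm_normc; exact: (cintegrable_cmeas (cintegrable_trilinear nw wle)).
  - exact: (nnmD m3 m4).
  - by move=> x y; exact: normc_trilinear_young.
rewrite (nint2D m3 m4) (nint2Z l2 m1) (nint2Z (ltW li) m2) (nint2D n1 n2) (nint2D n3 n4).
rewrite (nint2_tensor nD nK) (nint2_conv1 nK nD) (nint2_conv2 nD nM).
rewrite (_ : nint2 (fun x y => D y * M (x - y)) = nint2 (fun x y => M (x - y) * D y)); last first.
  by congr nint2; apply/funext => x; apply/funext => y; rewrite mulrC.
rewrite (nint2_conv2 nM nD).
rewrite (nint_fin nD (nint_dissipation_fin nw wle)) (nint_fin nM nint_sym_fin).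
rewrite (nint_fin nK (singular_fin sigma_gt hk : (nint K < +oo)%E)); rewrite -!EFinM -!EFinD lee_fin.
rewrite -[dissipation wcut]/(\int[mu3]_x D x).
by rewrite le_eqVlt; apply/orP; left; apply/eqP; rewrite /K /M; ring.
Qed.

End cutoff.

End field.

End RegularTime.

(** * Decay *)

Section Decay.
Context {R : realType}.
Notation T3 := (measurableTypeR R * measurableTypeR R * measurableTypeR R)%type.
Notation field := ('I_3 -> R3 R -> R[i]).
Variables (s nu Om : R) (V : R -> field).
Hypotheses (nu0 : 0 < nu) (s_gt : 2^-1 < s).
Hypothesis V_Hs : forall t, 0 <= t -> L2w (bessel s) (V t).
Hypothesis V_cont : forall t0, 0 <= t0 -> forall e, 0 < e -> exists2 d, 0 < d &
  forall t, 0 <= t -> `|t - t0| < d -> Nw (bessel s) (subf (V t) (V t0)) <= e.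
Hypothesis V_AC : forall T, 0 < T -> forall e, 0 < e -> exists2 d, 0 < d &
  forall n (l r : 'I_n -> R), interval_family 0 T l r -> \sum_(i < n) (r i - l i) < d ->
    \sum_(i < n) Nw (bessel (s - 1)) (subf (V (r i)) (V (l i))) < e.

Definition regular_at t : Prop :=
  [/\ L2w (bessel (s + 1)) (V t), (forall j x, V t j (- x) = conjc (V t j x)),
      (forall x, \sum_(j < 3) (coord3 x j)%:C * V t j x = 0), (forall j, V t j 0 = 0) &
      exists2 z, has_velocity s V t z & forall j, {ae mu3, forall x, z j x = ns_field (V t) nu Om j x}].

Hypothesis V_regular : {ae @lebesgue_measure R, forall t : R, 0 < t -> regular_at t}.

Let one : R3 R -> R := fun=> 1.
Let n1 : nnm (one : T3 -> R). Proof. exact: nnm_cst. Qed.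
Let one_le x : one x <= 1. Proof. by []. Qed.
Let nsq t : 0 <= t -> nnm (sq (V t) : T3 -> R).
Proof. by move=> t0; apply: nnm_sq; case: (V_Hs t0). Qed.

Let E t := Nw one (V t) ^+ 2.

Lemma ae_interval (P : R -> Prop) a b : 0 <= a ->
  (forall t, a < t < b -> regular_at t -> P t) ->
  {ae @lebesgue_measure R, forall t : R, a < t < b -> P t}.
Proof.
move=> a0 h; have F := ae_filter_ringOfSetsType (@lebesgue_measure R).
apply: filterS V_regular => t ht tab; apply: h => //; apply: ht.
by have /andP[at_ _] := tab; exact: le_lt_trans a0 at_.
Qed.

Lemma dissipation_ge0 (v : field) w : (forall x, 0 <= w x) -> 0 <= dissipation v w.
Proof. by move=> w0; apply: Rintegral_ge0 => x _; rewrite mulr_ge0// mulr_ge0 ?sqr_ge0 ?sq_ge0. Qed.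

Lemma L2_energy_decay (D : R) a b : 0 <= a -> a <= b ->
  (forall t, a < t < b -> regular_at t -> D <= dissipation (V t) one) ->
  E b - E a <= - (2 * nu * D) * (b - a).
Proof.
move=> a0 ab hD; apply: (energy_growth s_gt V_Hs V_cont V_AC n1 ler01 one_le) => //.
apply: ae_interval => // t tab rt; have [hv vc vd v0 [z hz zns]] := rt.
exists z; split => //; have [[mz _] _] := hz.
rewrite (pair_velocity1 s_gt hv vc vd mz zns) mulrA mulrN mulNr lerN2 ler_wpM2l ?mulr_ge0 ?(ltW nu0)//.
exact: hD.
Qed.

Lemma L2_energy_le t : 0 <= t -> E t <= E 0.
Proof.
move=> t0; have := @L2_energy_decay 0 0 t (lexx _) t0; rewrite mulr0 oppr0 mul0r subr_le0; apply.
by move=> r _ _; exact: dissipation_ge0.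
Qed.

(** Otherwise the energy would fall at a rate of at least 2 nu d, and be negative by the time (E(0)
    + 1) / (2 nu d). *)
Lemma small_dissipation d : 0 < d -> exists2 t, 0 < t & regular_at t /\ dissipation (V t) one <= d.
Proof.
move=> d0; apply: contrapT => h.
have c0 : 0 < 2 * nu * d by rewrite !mulr_gt0.
have E0 : 0 <= E 0 by exact: sqr_ge0.
have T0 : 0 <= (E 0 + 1) / (2 * nu * d) by rewrite divr_ge0 ?addr_ge0// ltW.
have hD t : 0 < t < (E 0 + 1) / (2 * nu * d) -> regular_at t -> d <= dissipation (V t) one.
  move=> /andP[t0 _] rt; rewrite leNgt; apply/negP => lt; apply: h; exists t => //; split => //.
  exact: ltW.
have := L2_energy_decay (lexx _) T0 hD; rewrite subr0 mulNr [_ * (_ / _)]mulrC divfK ?gt_eqF//.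
by have : 0 <= E ((E 0 + 1) / (2 * nu * d)); [exact: sqr_ge0|lra].
Qed.

Section weighted.
Variables (sigma kap q : R).
Hypotheses (sigma_gt : 2^-1 < sigma) (sigma_le1 : sigma <= 1) (sigma_le : sigma <= s).
Hypotheses (hk : 0 < kap <= 1) (q0 : 0 < q) (K_le : \int[mu3]_x singular sigma kap x <= q ^+ 2).

Let m x := sym sigma kap x ^+ 2.
Let k0 : 0 < kap. Proof. by case/andP: hk. Qed.
Let sigma0 : 0 <= sigma. Proof. by apply: ltW; apply: lt_trans sigma_gt; rewrite invr_gt0. Qed.
Let nm : nnm (m : T3 -> R). Proof. by apply: nnmX; apply: nnm_sym; exact: ltW. Qed.
Let m_le x : m x <= 2 ^+ 2 * bessel s x.
Proof. by rewrite expr2 -natrM; exact: sym_le_bessel. Qed.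
Let m_L2w t : 0 <= t -> L2w m (V t).
Proof. by move=> t0; have [] := L2w_le (nnm_bessel s) nm (ler0n R 2) m_le (V_Hs t0). Qed.
Let b := nu / 6.

Lemma cutoff_energy_le rho t0 t : 0 < rho -> 0 <= t0 -> t0 <= t ->
  (forall r, t0 <= r <= t -> Nw m (V r) <= b / q) ->
  Nw (wcut sigma kap rho) (V t) ^+ 2 <= Nw (wcut sigma kap rho) (V t0) ^+ 2.
Proof.
move=> r0 t00 tt hb; rewrite -subr_le0 -(mul0r (t - t0)).
have nw : nnm (wcut sigma kap rho : T3 -> R) by exact: nnm_wcut.
have wr x : wcut sigma kap rho x <= rho ^+ 2 by exact: wcut_le.
apply: (energy_growth s_gt V_Hs V_cont V_AC nw (sqr_ge0 rho) wr) => //.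
apply: ae_interval => // r rab rr; have [hv vc vd v0 [z hz zns]] := rr.
exists z; split => //; have [[mz _] _] := hz.
rewrite (pair_velocity s_gt hv vd mz zns nw wr).
have [t0r rt] := andP rab.
have D0 : 0 <= dissipation (V r) (wcut sigma kap rho).
  by apply: dissipation_ge0; case: nw.
(* Balances the two parts of the trilinear bound: the kernel contributes at most nu/2, the weighted
   energy at most 2 (nu/6)^2 / (l q^2) = 4 nu / 9. Their sum is absorbed by the viscosity. *)
pose l := nu / (8 * q ^+ 2).
have q2 : 0 < q ^+ 2 by rewrite exprn_gt0.
have l0 : 0 < l by rewrite divr_gt0// mulr_gt0.
have := trilinear_dissipation s_gt hv vd v0 sigma_gt sigma_le1 sigma_le hk r0 l0.
set K := \int[mu3]_x singular _ _ x; set M := \int[mu3]_x (sym _ _ x ^+ 2 * _).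
have KM : 4 * l * K + 2 / l * M <= nu.
  have h1 : 4 * l * K <= nu / 2.
    apply: (@le_trans _ _ (4 * l * q ^+ 2)); first by rewrite ler_wpM2l// mulr_ge0// ltW.
    rewrite le_eqVlt; apply/orP; left; apply/eqP; rewrite /l; field; exact: lt0r_neq0.
  have M_le : M <= (b / q) ^+ 2.
    rewrite (_ : M = Nw m (V r) ^+ 2); last by rewrite sqr_Nw.
    rewrite lerXn2r ?nnegrE ?Nw_ge0//; first by rewrite divr_ge0 ?ltW// /b divr_gt0.
    by apply: hb; rewrite !ltW.
  have h2 : 2 / l * M <= nu / 2.
    apply: (@le_trans _ _ (2 / l * (b / q) ^+ 2)); first by rewrite ler_wpM2l// divr_ge0// ltW.
    have -> : 2 / l * (b / q) ^+ 2 = 4 / 9 * nu.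
      by rewrite /l /b; field; rewrite !lt0r_neq0.
    by move: nu0; lra.
  by rewrite [leRHS](splitr nu); exact: lerD.
move: (pair _ _ _) (dissipation _ _) D0 => p D D0 h; have h1 := le_trans h (ler_wpM2r D0 KM).
have h2 := ler_norm (- p); rewrite normrN in h2; have := le_trans h2 h1; rewrite mulNr.
by rewrite -subr_ge0 opprK => h3; rewrite pmulr_rle0// -opprD oppr_le0.
Qed.

(** At time t the cut-off is removed by Fatou's lemma; at time t0 the cut-off weights are simply at
    most m. *)
Lemma weighted_norm_le t0 t : 0 <= t0 -> t0 <= t ->
  (forall r, t0 <= r <= t -> Nw m (V r) <= b / q) -> Nw m (V t) <= Nw m (V t0).
Proof.
move=> t00 tt hb; have t0' := le_trans t00 tt.
rewrite -(@ler_pXn2r _ 2) ?nnegrE ?Nw_ge0//.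
pose w n := wcut sigma kap n.+1%:R.
have wp n : 0 < n.+1%:R :> R by rewrite ltr0n.
have nw n : nnm (w n : T3 -> R) by exact: nnm_wcut.
have wm n x : w n x <= 1 ^+ 2 * m x.
  have c0 : 0 < symcut sigma kap n.+1%:R x by exact: cutoff_gt0.
  rewrite expr1n mul1r /w /wcut lerXn2r ?nnegrE ?(ltW (sym_gt0 _ _ k0)) ?(ltW c0)//.
  by rewrite /symcut ge_min lexx.
rewrite -lee_fin sqr_Nw// -nint_fin; last 2 first.
- exact: nnm_wsq (m_L2w t0').1.
- exact: (m_L2w t0').2.
apply: (@fatou_le _ _ T3 mu3 (fun n x => w n x * sq (V t) x)).
- by move=> n; apply: nnmM => //; exact: nsq.
- move=> x; apply: cvg_near_cst; exists (Num.truncn (sym sigma kap x)) => // n /= hn.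
  rewrite /w /wcut /symcut (min_idPl _)//; apply: ltW; apply: lt_le_trans (truncnS_gt _) _.
  by rewrite ler_nat.
- move=> n; have [lt_ _] := L2w_le nm (nw n) ler01 (wm n) (m_L2w t0').
  have [_ le0] := L2w_le nm (nw n) ler01 (wm n) (m_L2w t00).
  rewrite -/(nint _) nint_fin; [|exact: nnm_wsq lt_.1|exact: lt_.2].
  rewrite lee_fin -sqr_Nw//; apply: le_trans (cutoff_energy_le (wp n) t00 tt hb) _.
  by rewrite mul1r in le0; rewrite lerXn2r ?nnegrE ?Nw_ge0.
Qed.

Lemma weighted_norm_stays_small t0 e : 0 <= t0 -> e < b / q -> Nw m (V t0) <= e ->
  forall t, t0 <= t -> Nw m (V t) <= e.
Proof.
move=> t00 eb h0; apply: (bootstrap_le (P := fun t => Nw m (V t)) eb h0).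
  move=> t t0t eta eta0; have t0' := le_trans t00 t0t.
  have [d d0 hd] := NV_cont V_Hs V_cont nm (ler0n R 2) m_le t0' eta0.
  by exists d => // r t0r; apply: hd; exact: le_trans t00 t0r.
by move=> t t0t hb; apply: le_trans (weighted_norm_le t00 t0t hb) h0.
Qed.

(** The factor |x|^-1 is written as (|x| [sym])^-1 [sym]. With the parameter l = c / q^2 both halves
    of the Young inequality are at most c / 2. *)
Lemma chi_amp_le (c : R) t : 0 < c -> 0 <= t -> Nw m (V t) <= c / q ->
  (nint (fun x => (enorm x)^-1 * amp (V t) x)%R <= c%:E)%E.
Proof.
move=> c0 t0 hN; have nq := nsq t0.
have nk : nnm (singular sigma kap : T3 -> R) by apply: nnm_singular; exact: ltW.
have nms : nnm (fun x : T3 => m x * sq (V t) x) by exact: nnmM.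
have q2 : 0 < q ^+ 2 by rewrite exprn_gt0.
pose l := c / q ^+ 2; have l0 : 0 < l by rewrite divr_gt0.
have li : 0 <= l^-1 by rewrite invr_ge0 ltW.
apply: (@le_trans _ _ (nint (fun x => 2^-1 * l * singular sigma kap x + 2^-1 * l^-1 * (m x * sq (V t) x))%R)).
  apply: le_nint.
  - apply: nnmM; last by apply: nnm_amp; case: (V_Hs t0).
    by apply: nnmV; exact: nnm_enorm.
  - by apply: nnmD; apply: nnmM => //; apply: nnm_cst; rewrite mulr_ge0 ?invr_ge0// ltW.
  move=> x; have sp := sym_gt0 sigma x k0.
  have := @amgm R l (enorm x * sym sigma kap x)^-1 (sym sigma kap x * amp (V t) x) l0.
  have -> : (enorm x * sym sigma kap x)^-1 * (sym sigma kap x * amp (V t) x) = (enorm x)^-1 * amp (V t) x.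
    by rewrite invfM mulrA mulfVK// gt_eqF.
  by rewrite exprVn [(enorm x * _) ^+ 2]exprMn invfM exprMn sqr_amp mulrDr !mulrA.
have h2 : 0 <= 2^-1 * l by rewrite mulr_ge0 ?invr_ge0 ?ltW.
have h3 : 0 <= 2^-1 * l^-1 by apply: mulr_ge0 => //; rewrite invr_ge0.
rewrite nintD; [|by apply: nnmM => //; exact: nnm_cst|by apply: nnmM => //; exact: nnm_cst].
rewrite nintZ// nintZ// (nint_fin nk (singular_fin sigma_gt hk)) (nint_fin nms (m_L2w t0).2).
rewrite -!EFinM -EFinD lee_fin -sqr_Nw//.
have e1 : 2^-1 * l * \int[mu3]_x singular sigma kap x <= c / 2.
  apply: le_trans (ler_wpM2l h2 K_le) _.
  by rewrite le_eqVlt; apply/orP; left; apply/eqP; rewrite /l; field; exact: lt0r_neq0.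
have e2 : 2^-1 * l^-1 * Nw m (V t) ^+ 2 <= c / 2.
  apply: (@le_trans _ _ (2^-1 * l^-1 * (c / q) ^+ 2)).
    by rewrite ler_wpM2l// lerXn2r ?nnegrE ?Nw_ge0// divr_ge0 ?ltW.
  by rewrite le_eqVlt; apply/orP; left; apply/eqP; rewrite /l; field; rewrite !lt0r_neq0.
by rewrite [leRHS](splitr c); exact: lerD.
Qed.

(** For r >= 1 the left-hand side is at most r^2 because sigma <= 1. For r < 1 it is at most r
    because 2 sigma >= 1, and r <= d + r^2 / (4 d) by completing the square. *)
Lemma powR_split (d r : R) : 0 < d -> 0 <= r -> (r `^ sigma) ^+ 2 <= d + (1 + (4 * d)^-1) * r ^+ 2.
Proof.
move=> d0 r0; have r2 : 0 <= r ^+ 2 by exact: sqr_ge0.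
have di : 0 < (4 * d)^-1 by rewrite invr_gt0 mulr_gt0.
have e : (r `^ sigma) ^+ 2 = r `^ (sigma * 2) by rewrite powRrM powR_mulrn ?powR_ge0.
have s1 : 1 <= sigma * 2 by rewrite -ler_pdivrMr// mul1r ltW.
rewrite e; have [r1|r1] := leP 1 r.
  apply: (@le_trans _ _ (r `^ 2)); first by rewrite ler_powR// ler_piMl.
  rewrite powR_mulrn// mulrDl mul1r addrCA lerDl addr_ge0 ?mulr_ge0// ltW//.
have [->|rn] := eqVneq r 0; first by rewrite powR0 ?expr0n ?mulr0 ?addr0 ?ltW// gt_eqF//; lra.
have rp : 0 < r by rewrite lt_neqAle eq_sym rn.
apply: (@le_trans _ _ r).
  by rewrite -[leRHS]powRr1// ger_powR ?rp ?(ltW r1).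
rewrite mulrDl mul1r; apply: (@le_trans _ _ (d + (4 * d)^-1 * r ^+ 2)); last by rewrite lerD2l lerDr.
rewrite -subr_ge0; have -> : d + (4 * d)^-1 * r ^+ 2 - r = (4 * d)^-1 * (r - 2 * d) ^+ 2.
  by field; rewrite gt_eqF.
by rewrite mulr_ge0 ?sqr_ge0// ltW.
Qed.

Lemma weighted_norm_split d t : 0 < d -> 0 < t -> regular_at t ->
  Nw m (V t) ^+ 2 <= 2 * (kap ^+ 2 + d) * E t + 2 * (1 + (4 * d)^-1) * dissipation (V t) one.
Proof.
move=> d0 t0 [hv _ _ _ _]; have t0' := ltW t0.
have one_bessel x : one x <= 1 ^+ 2 * bessel s x.
  by rewrite expr1n mul1r bessel_ge1//; move: s_gt; lra.
have [l1 _] := L2w_le (nnm_bessel s) n1 ler01 one_bessel (V_Hs t0').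
have nd := nnm_dissipation hv n1; have fd := nint_dissipation_fin s_gt hv n1 one_le.
have i1 := L2w_integrable n1 l1.
have i2 := nint_integrable nd fd.
have j1 : mu3.-integrable [set: T3] (EFin \o (fun x => 2 * (kap ^+ 2 + d) * (one x * sq (V t) x))).
  by have := integrableZl (@measurableT _ T3) (2 * (kap ^+ 2 + d)) i1; apply: eq_integrable.
have j2 : mu3.-integrable [set: T3] (EFin \o (fun x => 2 * (1 + (4 * d)^-1) * (one x * (enorm x ^+ 2 * sq (V t) x)))).
  by have := integrableZl (@measurableT _ T3) (2 * (1 + (4 * d)^-1)) i2; apply: eq_integrable.
rewrite /E !sqr_Nw// /dissipation -RintegralZl// -[X in _ + X]RintegralZl// -RintegralD//.
apply: Rintegral_le.
- exact: (L2w_integrable nm (m_L2w t0')).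
- by have := integrableD (@measurableT _ T3) j1 j2; apply: eq_integrable.
move=> x; rewrite /one !mul1r [X in _ <= _ + X]mulrA -mulrDl ler_wpM2r ?sq_ge0//.
have h := powR_split d0 (enorm_ge0 x).
apply: (@le_trans _ _ (2 * (kap ^+ 2 + (enorm x `^ sigma) ^+ 2))).
  rewrite /m /sym; have := sqr_ge0 (kap - enorm x `^ sigma).
  by move: (enorm x `^ sigma) => p; nra.
by rewrite -mulrA -mulrDr ler_wpM2l// -addrA lerD2l.
Qed.

End weighted.

Theorem chi_amp_cvg0 (e : R) : 0 < e -> exists T : R, forall t, T <= t ->
  (nint (fun x => (enorm x)^-1 * amp (V t) x)%R <= e%:E)%E.
Proof.
move=> e0; pose sigma := Num.min s 1.
have sigma_gt : 2^-1 < sigma by rewrite lt_min s_gt/= invf_lt1// ltr1n.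
have sigma_le1 : sigma <= 1 by rewrite ge_min lexx orbT.
have sigma_le : sigma <= s by rewrite ge_min lexx.
(* Half of the threshold nu / 6, since the continuity method needs a strict inequality. *)
pose c := Num.min e (nu / 12).
have c0 : 0 < c by rewrite lt_min e0 divr_gt0.
have c2 : 0 < c ^+ 2 by rewrite exprn_gt0.
have E0 : 0 <= E 0 by exact: sqr_ge0.
(* With 8 here the energy contribution 6 a (E(0) + 1) found below is three quarters of c^2, leaving
   one quarter for the gradient. *)
pose a := c ^+ 2 / (8 * (E 0 + 1)).
have E1 : 0 < E 0 + 1 by rewrite ltr_wpDl.
have a0 : 0 < a by rewrite divr_gt0// mulr_gt0.
have [kap hk ha] := singular_small sigma_gt a0; have /andP[k0 k1] := hk.
have k2 : 0 < kap ^+ 2 by rewrite exprn_gt0.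
set K := \int[mu3]_x _ in ha.
have K0 : 0 <= K.
  by apply: Rintegral_ge0 => x _; case: (nnm_singular sigma (ltW k0)).
(* The added term makes [Q], and thus [q], positive; it costs one more [a] in the bound on kap^2
   Q. *)
pose Q := K + a / kap ^+ 2; have Q0 : 0 < Q by rewrite ltr_wpDl// divr_gt0.
pose q := Num.sqrt Q; have q0 : 0 < q by rewrite sqrtr_gt0.
have qE : q ^+ 2 = Q by rewrite sqr_sqrtr// ltW.
have K_le : K <= q ^+ 2 by rewrite qE lerDl divr_ge0// ltW.
have Qk : kap ^+ 2 * Q <= 2 * a.
  rewrite /Q mulrDr [X in _ + X]mulrC divfK ?gt_eqF//.
  by rewrite mulr_natl mulr2n lerD2r.
(* Then d Q = a, so that the constant part of [powR_split] weighs no more than the part coming from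
   kap. *)
pose d := a / Q; have d0 : 0 < d by rewrite divr_gt0.
have dE : 0 < 2 * (1 + (4 * d)^-1) * Q.
  by rewrite !mulr_gt0// addr_gt0// invr_gt0 mulr_gt0.
(* The dissipation at which the gradient contribution, multiplied by Q, is the remaining quarter of
   c^2. It depends on kap, so the time t0 is chosen last. *)
have b0 : 0 < c ^+ 2 / 4 / (2 * (1 + (4 * d)^-1) * Q) by rewrite divr_gt0// divr_gt0.
have [t0 t00 [rt0 hD]] := small_dissipation b0.
have ce : c / q < nu / 6 / q.
  rewrite ltr_pM2r ?invr_gt0//; apply: le_lt_trans (_ : nu / 12 < _).
    by rewrite ge_min lexx orbT.
  by move: nu0; lra.
have small : Nw (fun x => sym sigma kap x ^+ 2) (V t0) <= c / q.
  rewrite -(@ler_pXn2r _ 2) ?nnegrE ?Nw_ge0 ?divr_ge0 ?(ltW c0) ?(ltW q0)//.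
  rewrite expr_div_n qE ler_pdivlMr//.
  have h := weighted_norm_split sigma_gt sigma_le1 sigma_le hk d0 t00 rt0.
  apply: le_trans (ler_wpM2r (ltW Q0) h) _.
  have Et := L2_energy_le (ltW t00).
  have Et0 : 0 <= E t0 by exact: sqr_ge0.
  have x1 : 2 * (kap ^+ 2 + d) * E t0 * Q <= 3 / 4 * c ^+ 2.
    have -> : 2 * (kap ^+ 2 + d) * E t0 * Q = 2 * (kap ^+ 2 * Q + d * Q) * E t0 by ring.
    have -> : d * Q = a by rewrite divfK// gt_eqF.
    apply: (@le_trans _ _ (2 * (2 * a + a) * (E 0 + 1))).
      apply: ler_pM => //.
      - by apply: mulr_ge0 => //; apply: addr_ge0 (ltW a0); apply: mulr_ge0; apply: ltW.
      - by rewrite ler_wpM2l// lerD2r.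
      - by apply: le_trans Et _; rewrite lerDl.
    rewrite le_eqVlt; apply/orP; left; apply/eqP; rewrite /a; field; exact: lt0r_neq0.
  have x2 : 2 * (1 + (4 * d)^-1) * dissipation (V t0) one * Q <= c ^+ 2 / 4.
    by rewrite mulrAC mulrC -ler_pdivlMr.
  by rewrite mulrDl; have := lerD x1 x2; move: (c ^+ 2) => ?; lra.
exists t0 => t t0t; have t0' := le_trans (ltW t00) t0t.
apply: (@le_trans _ _ c%:E); last by rewrite lee_fin ge_min lexx.
apply: (chi_amp_le sigma_gt sigma_le hk q0 K_le c0 t0').
exact: (weighted_norm_stays_small sigma_gt sigma_le1 sigma_le hk q0 K_le (ltW t00) ce small).
Qed.

End Decay.

(** * From distributional solutions to frequency space *)

Section Solutions.
Context {R : realType}.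
Notation T3 := (measurableTypeR R * measurableTypeR R * measurableTypeR R)%type.
Notation field := ('I_3 -> R3 R -> R[i]).
Implicit Types U : vdist R.

Lemma L1loc_ae (f g : R3 R -> R[i]) : L1loc f -> cmeas (g : T3 -> R[i]) ->
  {ae mu3, forall x, f x = g x} -> L1loc g.
Proof.
move=> lf mg fg; apply: L1locP => // rho; have mS := @measurable_ball3 R rho.
have i1 := L1loc_bounded lf mS (fun x hx => hx).
have nS : nnm (\1_[set y : T3 | enorm y <= rho] : T3 -> R) by split; [exact: measurable_indic|move=> x].
have [nf ng] := (nnmM nS (nnm_normc (L1loc_cmeas lf)), nnmM nS (nnm_normc mg)).
have i2 := integrable_nint nf.2 i1.
apply: (nint_integrable ng); rewrite -(eq_nint_ae nf ng)//.
by apply: filterS fg => x ->.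
Qed.

Lemma has_fourier_ae T (f g : R3 R -> R[i]) : has_fourier T f -> cmeas (g : T3 -> R[i]) ->
  {ae mu3, forall x, f x = g x} -> has_fourier T g.
Proof.
move=> [lf hf] mg fg; have lg := L1loc_ae lf mg fg; split => // p h cp hh.
rewrite (hf p)// /dist_of !cintegralE; apply: ae_eq_cint.
- exact: (cintegrable_cmeas (L1loc_schwartz lf cp)).
- exact: (cintegrable_cmeas (L1loc_schwartz lg cp)).
- by apply: filterS fg => x ->.
Qed.

Definition hats U : field := fun j => hat (U j).

Lemma cmeas_hats U j : cmeas (hats U j : T3 -> R[i]).
Proof. by apply: L1loc_cmeas; exact: hat_L1loc. Qed.

Lemma sobolev_normE (sigma : R) U : has_L1loc_fourier U ->
  sobolev_norm sigma U = (nint (fun x => bessel sigma x * sq (hats U) x)%R `^ 2^-1)%E.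
Proof.
move=> h; rewrite /sobolev_norm asboolT//; congr (_ `^ _)%E; apply: eq_integral => x _.
by rewrite -(sqr_amp (hats U)).
Qed.

Lemma sobolev_fin (sigma : R) U : (sobolev_norm sigma U < +oo)%E ->
  [/\ has_L1loc_fourier U, L2w (bessel sigma) (hats U) &
      sobolev_norm sigma U = (Nw (bessel sigma) (hats U))%:E].
Proof.
have [h|h] := pselect (has_L1loc_fourier U); last by rewrite /sobolev_norm asboolF// ltxx.
rewrite sobolev_normE// => fin; have nb := nnm_wsq (nnm_bessel sigma) (cmeas_hats U).
have fin' : (nint (fun x => bessel sigma x * sq (hats U) x)%R < +oo)%E.
  by apply: lty_poweRy fin; rewrite invr_neq0.
split => //; first by split => // j; exact: cmeas_hats.
rewrite nint_fin// poweR_EFin powR12_sqrt//; apply: Rintegral_ge0 => x _; by case: nb.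
Qed.

Lemma sobolev_norm_ge0 (sigma : R) U : (0 <= sobolev_norm sigma U)%E.
Proof. by rewrite /sobolev_norm; case: ifP => // _; exact: poweR_ge0. Qed.

Lemma measure_opp0 (N : set T3) : measurable N -> mu3 N = 0 -> mu3 ((fun x : T3 => - x : T3) @^-1` N) = 0.
Proof.
move=> mN N0; have mo : measurable_fun [set: T3] (fun x : T3 => - x : T3).
  by apply: measurable_R3N; exact: measurable_id3.
have mN' : measurable ((fun x : T3 => - x : T3) @^-1` N).
  by rewrite -[X in measurable X]setTI; exact: mo.
have nN : nnm (\1_N : T3 -> R) by split; [exact: measurable_indic|move=> x].
have e (A : set T3) : measurable A -> nint (\1_A : T3 -> R) = mu3 A.
  by move=> mA; rewrite /nint integral_indic// setIT.
by rewrite -e// -N0 -e//; exact: (nint_opp nN).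
Qed.

(* With symmetries valid everywhere, not just almost everywhere, the double
   integrals of [trilinear] need no null sets of pairs of frequencies. *)
Lemma symmetric_representative (G : field) : (forall j, cmeas (G j : T3 -> R[i])) ->
  (forall j, {ae mu3, forall x, G j (- x) = conjc (G j x)}) ->
  {ae mu3, forall x, \sum_(j < 3) (coord3 x j)%:C * G j x = 0} ->
  exists G' : field, [/\ (forall j, cmeas (G' j : T3 -> R[i])), (forall j, {ae mu3, forall x, G j x = G' j x}),
    (forall j x, G' j (- x) = conjc (G' j x)), (forall x, \sum_(j < 3) (coord3 x j)%:C * G' j x = 0) &
    (forall j, G' j 0 = 0)].
Proof.
move=> mG cG dG.
have [N [mN N0 hN]] : {ae mu3, forall x, (forall j, G j (- x) = conjc (G j x)) /\ \sum_(j < 3) (coord3 x j)%:C * G j x = 0}.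
  apply: filterS2 dG (filterI (cG 0) (filterI (cG 1) (cG 2))) => x d [c0 [c1 c2]]; split => // j.
  by case: (I3P j) => ->.
have good x : ~ N x -> (forall j, G j (- x) = conjc (G j x)) /\ \sum_(j < 3) (coord3 x j)%:C * G j x = 0.
  by move=> Nx; apply: contrapT => h; apply: Nx; exact: hN.
have mo : measurable_fun [set: T3] (fun x : T3 => - x : T3).
  by apply: measurable_R3N; exact: measurable_id3.
pose N' : set T3 := (fun x : T3 => - x : T3) @^-1` N.
have mN' : measurable N' by rewrite -[X in measurable X]setTI; exact: mo.
have N'0 : mu3 N' = 0 by exact: measure_opp0.
(* The origin, removed in order that the representative vanishes there. *)
pose Z : set T3 := [set x | enorm x <= 0].
have mZ : measurable Z by exact: measurable_ball3.
(* Invariant under reflection, so that multiplication by its indicator preserves the conjugation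
   symmetry. *)
pose S : set T3 := ~` (N `|` N' `|` Z).
have mS : measurable S by apply: measurableC; apply: measurableU => //; exact: measurableU.
have S_ae : {ae mu3, forall x, S x}.
  have a1 : {ae mu3, forall x : T3, ~ N x} by exists N; split => // x /contrapT.
  have a2 : {ae mu3, forall x : T3, ~ N' x} by exists N'; split => // x /contrapT.
  apply: filterS3 a1 a2 (@ae_enorm_gt0 R) => x h1 h2 h3 [[//|//]|].
  by rewrite /Z /= leNgt h3.
have S_opp x : S (- x) <-> S x.
  rewrite /S /N' /Z /= opprK enormN; split=> h [[h1|h1]|h1]; apply: h.
  - by left; right.
  - by left; left.
  - by right.
  - by left; right.
  - by left; left.
  - by right.
have S_good x : S x -> (forall j, G j (- x) = conjc (G j x)) /\ \sum_(j < 3) (coord3 x j)%:C * G j x = 0.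
  by move=> Sx; apply: good => Nx; apply: Sx; left; left.
exists (fun j x => (\1_S x)%:C * G j x); split.
- by move=> j; apply: cmeasM => //; apply: cmeasR; exact: measurable_indic.
- by move=> j; apply: filterS S_ae => x Sx; rewrite indicE mem_set// mul1r.
- move=> j x; rewrite !indicE conjcM; have [/set_mem Sx|Sx] := boolP (x \in S).
    have -> : - x \in S by apply/mem_set/S_opp.
    by rewrite (S_good x Sx).1; congr (_ * _); apply: complex_eq => /=; rewrite ?oppr0.
  have -> : - x \in S = false by apply/negbTE; apply: contra Sx => /set_mem/S_opp/mem_set.
  have -> : ((false%:R : R)%:C = 0 :> R[i]) by [].
  by rewrite conjc0 !mul0r.
- move=> x; have [/set_mem Sx|Sx] := boolP (x \in S).
    rewrite -[RHS](S_good x Sx).2; apply: eq_bigr => j _.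
    by rewrite indicE mem_set// mul1r.
  by rewrite big1// => j _; rewrite indicE (negbTE Sx) mul0r mulr0.
- move=> j; rewrite indicE memNset ?mul0r// => h; apply: h; right.
  by rewrite /Z /= (_ : enorm 0 = 0)//; apply/eqP; rewrite enorm_eq0.
Qed.

Lemma ereal_small (T : Type) (F : set_system T) {FF : Filter F} (f : T -> \bar R) (e : R) : 0 < e ->
  f x @[x --> F] --> 0%E -> \forall x \near F, (f x < e%:E)%E.
Proof.
move=> e0 fc; have : (0%E < e%:E)%E by rewrite lte_fin.
move=> /open_ereal_lt_ereal h.
exact: (fc _ h).
Qed.

Section solution.
Variables (nu s Om : R) (u0 : vdist R) (u : R -> vdist R).
Hypotheses (nu_gt0 : 0 < nu) (s_gt : 2^-1 < s).
Hypotheses (u_sol : nsc_solution nu s Om u0 u).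
Hypotheses (u_cont : continuous_into (sobolev_norm s) u) (u_AC : AC_into (sobolev_norm (s - 1)) u).
Hypothesis u_L1 : L1loc_into (sobolev_norm (s + 1)) u.

Let u_fourier t : 0 <= t -> has_L1loc_fourier (u t).
Proof. by move=> t0; have [/sobolev_fin[]] := u_cont t0. Qed.

Let u_hat t j : 0 <= t -> has_fourier (u t j) (hat (u t j)).
Proof. by move=> t0; apply: hatP; have [_] := u_fourier t0 j. Qed.

(** The symmetries are asked for at positive times, where the divergence condition is available. At
    the other times [hat] itself will do. *)
Let representative t : exists v : field, [/\ (forall j, cmeas (v j : T3 -> R[i])),
  (forall j, {ae mu3, forall x, hat (u t j) x = v j x}) &
  0 < t -> [/\ (forall j x, v j (- x) = conjc (v j x)),
    (forall x, \sum_(j < 3) (coord3 x j)%:C * v j x = 0) & (forall j, v j 0 = 0)]].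
Proof.
have [t0|t0] := ltP 0 t; last first.
  by exists (hats (u t)); split => // [j|j]; [exact: cmeas_hats|exact: nearW].
have hu j := u_hat j (ltW t0).
have [v [mv ev cv dv zv]] := @symmetric_representative (hats (u t)) (cmeas_hats (u t))
  (fun j => has_fourier_real (nsc_real u_sol (ltW t0) j) (hu j))
  (has_fourier_div (nsc_div u_sol t0) hu).
by exists v.
Qed.

Let V := projT1 (choice representative).

Let VP t : [/\ (forall j, cmeas (V t j : T3 -> R[i])),
  (forall j, {ae mu3, forall x, hat (u t j) x = V t j x}) &
  0 < t -> [/\ (forall j x, V t j (- x) = conjc (V t j x)),
    (forall x, \sum_(j < 3) (coord3 x j)%:C * V t j x = 0) & (forall j, V t j 0 = 0)]].
Proof. exact: (projT2 (choice representative) t). Qed.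

Let mV t : forall j, cmeas (V t j : T3 -> R[i]). Proof. by case: (VP t). Qed.
Let eV t j : {ae mu3, forall x, hat (u t j) x = V t j x}. Proof. by case: (VP t). Qed.

Let V_L2w (sigma t : R) : (sobolev_norm sigma (u t) < +oo)%E -> L2w (bessel sigma) (V t).
Proof.
move=> /sobolev_fin[_ h _].
by have [] := L2w_ae (nnm_bessel sigma) (mV t) (eV t) h.
Qed.

Let V_Hs t : 0 <= t -> L2w (bessel s) (V t).
Proof. by move=> t0; apply: V_L2w; case: (u_cont t0). Qed.

Let mVB t t0 j : cmeas (subf (V t) (V t0) j : T3 -> R[i]).
Proof. by apply: cmeasB; exact: mV. Qed.

Let hat_sub t t0 j : 0 <= t -> 0 <= t0 ->
  {ae mu3, forall x, hats (u t - u t0) j x = subf (V t) (V t0) j x}.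
Proof.
move=> h h0; have e := hat_ae (has_fourierB (u_hat j h) (u_hat j h0)).
by apply: filterS3 e (eV t j) (eV t0 j) => x; rewrite /hats /subf => -> -> ->.
Qed.

Let V_sub (sigma : R) t t0 : 0 <= t -> 0 <= t0 -> (sobolev_norm sigma (u t - u t0)%R < +oo)%E ->
  sobolev_norm sigma (u t - u t0) = (Nw (bessel sigma) (subf (V t) (V t0)))%:E.
Proof.
move=> h h0 /sobolev_fin[_ hl ->].
by have [_ ->] := L2w_ae (nnm_bessel sigma) (mVB t t0) (fun j => hat_sub j h h0) hl.
Qed.

Let V_cont t0 : 0 <= t0 -> forall e, 0 < e -> exists2 d, 0 < d &
  forall t, 0 <= t -> `|t - t0| < d -> Nw (bessel s) (subf (V t) (V t0)) <= e.
Proof.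
move=> h0 e e0; have [_ c] := u_cont h0.
have /nbhs_ballP[d d0 hd] : nbhs t0 (fun t => 0 <= t -> (sobolev_norm s (u t - u t0)%R < e%:E)%E).
  exact: ereal_small e0 c.
exists d => // t t0' td.
have lt : (sobolev_norm s (u t - u t0)%R < e%:E)%E.
  by apply: hd => //; rewrite /ball /= distrC.
have := lt; rewrite V_sub//; last exact: lt_trans lt (ltry e).
by rewrite lte_fin => /ltW.
Qed.

Let V_AC T : 0 < T -> forall e, 0 < e -> exists2 d, 0 < d &
  forall n (l r : 'I_n -> R), interval_family 0 T l r -> \sum_(i < n) (r i - l i) < d ->
    \sum_(i < n) Nw (bessel (s - 1)) (subf (V (r i)) (V (l i))) < e.
Proof.
move=> T0 e e0; have [_ h] := u_AC; have [d d0 hd] := h T T0 e e0.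
exists d => // n l r [h1 h2] len; have lt := hd n l r h1 h2 len.
have l0 i : 0 <= l i by case: (h1 i).
have r0 i : 0 <= r i by case: (h1 i) => a b _; exact: le_trans a b.
have fin i : (sobolev_norm (s - 1) (u (r i) - u (l i))%R < +oo)%E.
  apply: le_lt_trans (lt_trans lt (ltry e)); rewrite (bigD1 i)//=; apply: leeDl.
  by apply: sume_ge0 => k _; exact: sobolev_norm_ge0.
rewrite -lte_fin -sumEFin; apply: le_lt_trans lt; apply: lee_sum => i _.
by rewrite -V_sub.
Qed.

Let has_fourier_V t j : 0 <= t -> has_fourier (u t j) (V t j).
Proof. by move=> t0; exact: has_fourier_ae (u_hat j t0) (mV t j) (eV t j). Qed.

(** Finiteness of the H^(s+1) norm at this time makes the transform of u integrable and its gradient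
    admissible, so that [advection] has the convolution [adv] as its transform. *)
Let rhs_ns_field t : 0 < t -> (sobolev_norm (s + 1) (u t) < +oo)%E ->
  forall j, {ae mu3, forall x, hat (nsc_rhs nu Om (u t) j) x = ns_field (V t) nu Om j x}.
Proof.
move=> t0 fin j; have h0 := ltW t0; have hv := V_L2w fin.
have [_ _ /(_ t0)[cv dv zv]] := VP t.
have hU k := has_fourier_V k h0.
have tU k : tempered (u t k) by have [] := u_fourier h0 k.
have eA k : {ae mu3, forall x, hat (advection (u t) k) x = adv (V t) k x}.
  apply: hat_ae; apply: has_fourier_advection => //.
  - by move=> i; exact: (cintegrable_component s_gt hv).
  - by move=> i; exact: (nint_grad_hat s_gt hv).
have eC k := hat_ae (has_fourier_cross e3 k hU).
have e1 := hat_ae (@has_fourier_rhs _ nu Om (u t) j (ex_intro _ _ (hU j))).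
have eAC : {ae mu3, forall x, (forall k, hat (advection (u t) k) x = adv (V t) k x) /\
    forall k, hat (cross e3 (u t) k) x = (e3 (k + 1))%:C * V t (k + 2) x - (e3 (k + 2))%:C * V t (k + 1) x}.
  have e k : {ae mu3, forall x, hat (advection (u t) k) x = adv (V t) k x /\
      hat (cross e3 (u t) k) x = (e3 (k + 1))%:C * V t (k + 2) x - (e3 (k + 2))%:C * V t (k + 1) x}.
    by apply: filterS2 (eA k) (eC k) => x.
  apply: filterS3 (e 0) (e 1) (e 2) => x h1 h2 h3.
  by split=> k; case: (I3P k) => ->; [case: h1|case: h2|case: h3|case: h1|case: h2|case: h3].
apply: filterS3 e1 (eV t j) eAC => x -> -> [hA hC].
rewrite /ns_field; congr (_ - _ * _ - _); apply: eq_bigr => k _; first by rewrite hC.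
by rewrite hA.
Qed.

Let V_velocity t : 0 < t -> (sobolev_norm (s + 1) (u t) < +oo)%E ->
  has_time_deriv (sobolev_norm (s - 1)) u t (nsc_rhs nu Om (u t)) ->
  has_velocity s V t (hats (nsc_rhs nu Om (u t))).
Proof.
move=> t0 fin [zfin c]; set z := nsc_rhs nu Om (u t) in zfin c *.
have h0 := ltW t0; have [hz lz _] := sobolev_fin zfin; split => // e e0.
have /nbhs_ballP[d d0 hd] : nbhs (0 : R) (fun h => h != 0 ->
    (sobolev_norm (s - 1) ((h^-1)%:C *: (u (t + h) - u t) - z)%R < e%:E)%E).
  exact: ereal_small e0 c.
(* The bound by t keeps t + h nonnegative, where u is known to have a transform. *)
exists (Num.min d t); first by rewrite lt_min d0.
move=> h hn; rewrite lt_min => /andP[hd' ht].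
have th : 0 <= t + h by have := ler_norm (- h); rewrite normrN; lra.
have lt : (sobolev_norm (s - 1) ((h^-1)%:C *: (u (t + h) - u t) - z)%R < e%:E)%E.
  by apply: hd => //; rewrite /ball /= sub0r normrN.
have [_ hl E] := sobolev_fin (lt_trans lt (ltry e)).
move: lt; rewrite E lte_fin => /ltW; apply: le_trans.
have ml j : cmeas (subf (scalef h^-1 (subf (V (t + h)) (V t))) (hats z) j : T3 -> R[i]).
  apply: cmeasB; last exact: cmeas_hats.
  by apply: cmeasM; [exact: cmeas_cst|exact: mVB].
have ez j : {ae mu3, forall x, hats ((h^-1)%:C *: (u (t + h) - u t) - z)%R j x =
    subf (scalef h^-1 (subf (V (t + h)) (V t))) (hats z) j x}.
  have hzj : has_fourier (z j) (hat (z j)) by apply: hatP; have [_] := hz j.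
  have e1 := hat_ae (has_fourierB (has_fourierZ (h^-1)%:C (has_fourierB (u_hat j th) (u_hat j h0))) hzj).
  by apply: filterS3 e1 (eV (t + h) j) (eV t j) => x; rewrite /subf /scalef /hats => -> -> ->.
by have [_ ->] := L2w_ae (nnm_bessel (s - 1)) ml ez hl.
Qed.

(** Integrability of the H^(s+1) norm over each ]0, n + 1[ makes it finite almost everywhere there,
    and countably many null sets are discarded together with that of the equation. *)
Let u_regular : {ae @lebesgue_measure R, forall t : R, 0 < t -> regular_at s nu Om V t}.
Proof.
have F := ae_filter_ringOfSetsType (@lebesgue_measure R).
have fin : {ae @lebesgue_measure R, forall t : R, 0 < t -> (sobolev_norm (s + 1) (u t) < +oo)%E}.
  have h n : {ae @lebesgue_measure R, forall t : R, t \in `]0, n.+1%:R[ -> sobolev_norm (s + 1) (u t) \is a fin_num}.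
    have [_ i] := u_L1 (ltr0Sn R n).
    have mI : measurable (`]0, n.+1%:R[ : set (measurableTypeR R)) by exact: measurable_itv.
    by have := integrable_ae mI i; apply: filterS => t ht tn; exact: ht.
  apply: filterS (ae_foralln h) => t ht t0.
  have := ht (Num.truncn t); rewrite in_itv/= t0 truncnS_gt => /(_ isT).
  by rewrite fin_numE => /andP[_]; rewrite ltey.
apply: filterS2 fin (nsc_eq u_sol) => t ft dt t0.
have [_ _ /(_ t0)[cv dv zv]] := VP t.
split => //; first exact: V_L2w (ft t0).
by exists (hats (nsc_rhs nu Om (u t))); [apply: V_velocity; auto|apply: rhs_ns_field; auto].
Qed.

Lemma chi_normE t : 0 <= t -> chi_norm (-1) (u t) = nint (fun x => (enorm x)^-1 * amp (V t) x)%R.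
Proof.
move=> t0; rewrite /chi_norm asboolT; last exact: u_fourier.
have ne := nnmV (@nnm_enorm R).
transitivity (nint (fun x => (enorm x)^-1 * amp (hats (u t)) x)%R).
  by apply: eq_integral => x _; rewrite powR_inv1 ?enorm_ge0.
apply: eq_nint_ae.
- by apply: nnmM => //; apply: nnm_amp; exact: cmeas_hats.
- by apply: nnmM => //; apply: nnm_amp; exact: mV.
- apply: filterS3 (eV t 0) (eV t 1) (eV t 2) => x h0 h1 h2.
  by rewrite /amp /sq !sum3 /hats h0 h1 h2.
Qed.

Lemma chi_norm_cvg0 : chi_norm (-1) (u t) @[t --> +oo] --> 0%E.
Proof.
have key e : 0 < e -> \forall t \near +oo, (0 <= chi_norm (-1) (u t) <= e%:E)%E.
  move=> e0; have [T hT] := chi_amp_cvg0 nu_gt0 s_gt V_Hs V_cont V_AC u_regular e0.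
  near=> t; have t0 : 0 <= t by near: t; exact: nbhs_pinfty_ge.
  rewrite chi_normE//; apply/andP; split.
    by apply: nint_ge0 => x; rewrite mulr_ge0 ?sqrtr_ge0// invr_ge0 enorm_ge0.
  by apply: hT; near: t; apply: nbhs_pinfty_ge; exact: num_real.
apply/fine_cvgP; split.
  apply: filterS (key 1 ltr01) => t /andP[h0 h1].
  by rewrite ge0_fin_numE//; apply: le_lt_trans h1 (ltry _).
apply/cvgrPdist_le => e e0; apply: filterS (key e e0) => t /andP[h0 h1] /=.
have ft : chi_norm (-1) (u t) \is a fin_num by rewrite ge0_fin_numE//; apply: le_lt_trans h1 (ltry _).
rewrite sub0r normrN ger0_norm ?fine_ge0//.
by rewrite -lee_fin fineK.
Unshelve. all: by end_near. Qed.

End solution.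

End Solutions.

Theorem theorem4 (R : realType) (nu s Om : R) (u0 : vdist R) (u : R -> vdist R)
  (nu_gt0 : 0 < nu) (s_gt : 2^-1 < s)
  (u0_Hs : (sobolev_norm s u0 < +oo)%E) (u0_div : divergence u0 = 0)
  (u_sol : nsc_solution nu s Om u0 u)
  (u_cont : continuous_into (sobolev_norm s) u)
  (u_AC : AC_into (sobolev_norm (s - 1)) u)
  (u_L1 : L1loc_into (sobolev_norm (s + 1)) u) :
  chi_norm (-1) (u t) @[t --> +oo] --> 0%E.
Proof. exact: chi_norm_cvg0 nu_gt0 s_gt u_sol u_cont u_AC u_L1. Qed.
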